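(* Let $\delta\in\mathbb{R}$, $p>1$, $k\in\mathbb{N}$ with $k\ge 2$, and $b_0>0$. Then there exist $\gamma_0=\gamma_0(\delta,p,k,b_0)>0$ and $T_0=T_0(\delta,p,k,b_0)>0$ and a constant $C>0$ independent of $T$ and $t$ such that for every $T\in(0,T_0)$ there exists an initial datum $u_{0,T}\in L^\infty(\mathbb{R},\mathbb{C})$ such that the corresponding solution $u$ of $$\partial_t u=\partial_x^2u+(1+i\delta)|u|^{p-1}u,\qquad u(\cdot,0)=u_{0,T},\qquad x\in\mathbb{R},$$ blows up in finite time exactly at time $T$ and only at the origin (i.e. $0$ is its only blow-up point). Furthermore, there exists a constant $b^*=b^*(u_{0,T})>0$ such that $$\left\|(T-t)^{\frac{1+i\delta}{p-1}}u(\cdot,t)-f_{b^*}\!\left(\frac{|\cdot|}{(T-t)^{\frac1{2k}}}\right)\right\|_{L^\infty(\mathbb{R})}\le C\,(T-t)^{\frac{\gamma_0}{2}\left(1-\frac1k\right)}\qquad\text{for all }t\in[0,T),$$ where $$f_{b^*}(y)=\left(p-1+b^*|y|^{2k}\right)^{-\frac{1+i\delta}{p-1}},$$ and $$|b^*-b_0|\le C\,T^{\frac{\gamma_0}{2}\left(1-\frac1k\right)}.$$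
   Context: For $r>0$ and $z\in\mathbb{C}$, $r^{z}=e^{z\ln r}$. For $u_0\in L^\infty(\mathbb{R},\mathbb{C})$ the equation has a unique maximal (mild) solution in $L^\infty(\mathbb{R},\mathbb{C})$; it is either global or has a finite maximal existence time $T$ with $\lim_{t\to T}\|u(\cdot,t)\|_{L^\infty(\mathbb{R})}=+\infty$, in which case one says that $u$ blows up in finite time $T$. A point $x_0\in\mathbb{R}$ is a blow-up point of $u$ if there is a sequence $(x_j,t_j)$ with $x_j\to x_0$, $t_j\to T$ and $|u(x_j,t_j)|\to\infty$ as $j\to\infty$. *)

(* Defs.v *)
From HB Require Import structures.
From mathcomp Require Import all_boot all_order all_algebra.
From mathcomp Require Import complex.
From mathcomp Require Import all_classical all_reals all_analysis.

Set Implicit Arguments.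
Unset Strict Implicit.
Unset Printing Implicit Defensive.

Import Order.TTheory GRing.Theory Num.Theory.
Import numFieldNormedType.Exports.
Import ComplexField.Normc.

Local Open Scope classical_set_scope.
Local Open Scope complex_scope.
Local Open Scope ring_scope.

Definition cexp (R : realType) (z : R[i]) : R[i] :=
  (expR (complex.Re z))%:C * (cos (complex.Im z) +i* sin (complex.Im z)).

(* Meaningful only for r > 0: the library sets ln r = 0 for r <= 0. *)
Definition cpow (R : realType) (r : R) (z : R[i]) : R[i] :=
  cexp (z * (ln r)%:C).

(* A function to R[i] is measurable, resp. integrated, componentwise. *)
Definition cmeasurable (R : realType) (d : measure_display)
    (T : measurableType d) (D : set T) (f : T -> R[i]) : Prop :=
  measurable_fun D (fun x => complex.Re (f x)) /\
  measurable_fun D (fun x => complex.Im (f x)).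

Definition cintegral (R : realType) (D : set R) (f : R -> R[i]) : R[i] :=
  (\int[lebesgue_measure]_(x in D) complex.Re (f x)) +i*
  (\int[lebesgue_measure]_(x in D) complex.Im (f x)).

Definition Linfty_norm (R : realType) (f : R -> R[i]) : \bar R :=
  Lnorm lebesgue_measure +oo%E (fun x => (normc (f x))%:E).

Definition in_Linfty (R : realType) (f : R -> R[i]) : Prop :=
  cmeasurable [set: R] f /\ (Linfty_norm f < +oo)%E.

(* Meaningful for t > 0. *)
Definition heat_kernel (R : realType) (t x : R) : R :=
  expR (- x ^+ 2 / (4 * t)) / Num.sqrt (4 * pi * t).

Definition heat_semigroup (R : realType) (t : R) (f : R -> R[i]) (x : R)
    : R[i] :=
  cintegral [set: R] (fun y => (heat_kernel t (x - y))%:C * f y).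

Definition nonlinearity (R : realType) (delta p : R) (z : R[i]) : R[i] :=
  (1 +i* delta) * ((normc z) `^ (p - 1))%:C * z.

(* [u t x] is a mild solution on [0, Tmax) in L^oo(R, C), with Tmax possibly
   +oo. The Duhamel identity is required at every x when t > 0, so that [u t]
   is the continuous representative of its class and its pointwise values make
   sense (as needed for blow-up points); [u 0] is a chosen representative of
   the datum. Continuity of t |-> u t in L^oo for t > 0 follows from the local
   boundedness in t and the Duhamel identity. *)
Definition mild_solution (R : realType) (delta p : R) (u0 : R -> R[i])
    (Tmax : \bar R) (u : R -> R -> R[i]) : Prop :=
  [/\ (0 < Tmax)%E,
      cmeasurable [set z : R * R | 0 <= z.1 /\ (z.1%:E < Tmax)%E]
        (fun z => u z.1 z.2),
      forall t1 : R, 0 <= t1 -> (t1%:E < Tmax)%E ->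
        exists M : R, forall t : R, 0 <= t <= t1 ->
          in_Linfty (u t) /\ (Linfty_norm (u t) <= M%:E)%E,
      forall x : R, u 0 x = u0 x
    & forall t x : R, 0 < t -> (t%:E < Tmax)%E ->
        u t x = heat_semigroup t u0 x +
          cintegral `]0, t[
            (fun s => heat_semigroup (t - s)
                        (fun y => nonlinearity delta p (u s y)) x)].

(* The maximal solution: every mild solution is a restriction of it. *)
Definition maximal_mild_solution (R : realType) (delta p : R) (u0 : R -> R[i])
    (Tmax : \bar R) (u : R -> R -> R[i]) : Prop :=
  mild_solution delta p u0 Tmax u /\
  forall (T' : \bar R) (v : R -> R -> R[i]), mild_solution delta p u0 T' v ->
    (T' <= Tmax)%E /\
    forall t x : R, 0 <= t -> (t%:E < T')%E -> v t x = u t x.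

Definition blows_up_at_time (R : realType) (delta p : R) (u0 : R -> R[i])
    (T : R) (u : R -> R -> R[i]) : Prop :=
  maximal_mild_solution delta p u0 T%:E u /\
  Linfty_norm (u t) @[t --> T^'-] --> +oo%E.

Definition blowup_point (R : realType) (T : R) (u : R -> R -> R[i]) (x0 : R)
    : Prop :=
  exists xs ts : R^nat,
    [/\ forall j, 0 <= ts j < T,
        xs j @[j --> \oo] --> x0,
        ts j @[j --> \oo] --> T
      & normc (u (ts j) (xs j)) @[j --> \oo] --> +oo].

Definition profile (R : realType) (delta p : R) (k : nat) (b y : R) : R[i] :=
  cpow (p - 1 + b * `|y| ^+ (2 * k)) (- ((1 +i* delta) / (p - 1)%:C)).

(* Main.v *)
(** Write u = rho^(-c) exp (i phi) with c = (1 + i delta) / (p - 1). The equation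
    becomes rho_t = rho_xx - (p - 1) + f1 and phi_t = phi_xx + f2, where f1 and
    f2 are quadratic in (rho_x / rho, phi_x). Without f1 and f2 one has the
    explicit solution rho = (p - 1) (T - t) + b0 H, phi = 0, where H is caloric
    and equal to (1 - exp (- x^2))^k at time T. For given sources, the heat
    equations are solved by Duhamel integrals from which finitely many explicit
    caloric functions are subtracted, so that the spatial jets of order 2k (for
    rho) and k - 1 (for phi) of the corrections vanish at the singular point
    (0, T). This Lyapunov-Perron choice replaces the topological argument on the
    unstable modes: it gains powers of T and of the parabolic distance to (0, T),
    so that (f1, f2) is the fixed point of a contraction in weighted sup norms
    for T small, and it gives b* = b0 exactly.

    A Taylor expansion under the heat semigroup shows that u satisfies the
    Duhamel formula up to O(h^(5/4)) on every step of length h, hence exactly;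
    maximality follows from uniqueness (Gronwall) and from the unboundedness of
    u, and the blow-up set and the profile are read off from
    rho = (p - 1) (T - t) + b0 x^(2k) + smaller terms. *)

Require Import Defs.
From HB Require Import structures.
From mathcomp Require Import all_boot all_order all_algebra.
From mathcomp Require Import complex.
From mathcomp Require Import all_classical all_reals all_analysis.
From mathcomp Require Import measurable_realfun ess_sup_inf.
From mathcomp Require Import ring lra zify.

Set Implicit Arguments.
Unset Strict Implicit.
Unset Printing Implicit Defensive.

Import Order.TTheory GRing.Theory Num.Theory.
Import numFieldNormedType.Exports.

Local Open Scope classical_set_scope.
Local Open Scope complex_scope.
Local Open Scope ring_scope.


(** * The heat kernel and Duhamel integrals *)

(** The obstacle is that [rho] vanishes at (0, T) while its source contains rho_x^2 / rho. With q
    the parabolic distance to (0, T) and w = T - t, [rho] is comparable to w + q^(2k), which no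
    power of q or of w controls alone. Sources are therefore measured by a power of q, the vanishing
    order to be preserved, times a negative power of w found by interpolating between w and q^(2k);
    the exponents are tuned so that this singularity stays integrable in time, even after one space
    derivative. Removing jets pays off because, for source times s with T - s at least 4 q^2, the
    kernel is replaced by its caloric Taylor remainder, while for later s plain size estimates
    suffice; the spare integrability becomes a power of T. A second space derivative of a Duhamel
    integral would involve the non-integrable factor 1 / (t - s). It is never formed: only one space
    derivative and Hölder moduli occur, and the equation for u is checked through increments over
    short time steps. *)

Section Integration.
Context {R : realType}.
Notation mu := (@lebesgue_measure R).
Implicit Types (F K : R -> R) (r : R).

Lemma measurable_invr d (T : measurableType d) (D : set T) (f : T -> R) :
  measurable_fun D f -> measurable_fun D (fun x => (f x)^-1).
Proof.
move=> mf.
have -> : (fun x => (f x)^-1) = (fun x => f x * ((f x ^+ 2) `^ (-1))).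
  apply/funext => x; rewrite powR_inv1 ?sqr_ge0//.
  have [->|f0] := eqVneq (f x) 0; first by rewrite invr0 mul0r.
  by rewrite expr2 invfM mulrA divff// mul1r.
apply: measurable_funM => //.
have m2 : measurable_fun D (fun x => f x ^+ 2) by exact: measurable_funX.
have m1 : measurable_fun [set: R] (fun y : R => y `^ (-1)) by exact: measurable_powR.
exact: measurableT_comp m1 m2.
Qed.

Lemma measurable_sqrtr d (T : measurableType d) (D : set T) (f : T -> R) :
  measurable_fun D f -> measurable_fun D (fun x => Num.sqrt (f x)).
Proof.
move=> mf.
have m1 : measurable_fun [set: R] (@Num.sqrt R).
  apply: nondecreasing_measurable => // x y xy; exact: ler_wsqrtr.
exact: measurableT_comp m1 mf.
Qed.

(** No integrability is assumed: positive and negative parts depend measurably on t by Tonelli, and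
    [fine] sends the possibly infinite difference to a real number. *)
Lemma measurable_Rintegral d (T : measurableType d) (F : T * R -> R) :
  measurable_fun setT F ->
  measurable_fun setT (fun t => \int[mu]_y F (t, y)).
Proof.
move=> mF; rewrite /Rintegral.
apply: (measurableT_comp (@fine_measurable R setT measurableT)).
have -> : (fun t => \int[mu]_y (F (t, y))%:E)%E =
    (fun t => \int[mu]_y (EFin \o F)^\+ (t, y) - \int[mu]_y (EFin \o F)^\- (t, y))%E.
  apply/funext => t; rewrite integralE; congr (_ - _)%E.
    by apply: eq_integral => y _; rewrite !funeposE.
  by apply: eq_integral => y _; rewrite !funenegE.
have mE : measurable_fun setT (EFin \o F) by apply/measurable_EFinP.
by apply: emeasurable_funB; apply: measurable_fun_fubini_tonelli_F => //;
  [exact: measurable_funepos | exact: measurable_funeneg].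
Qed.

Definition itg (F : R -> R) := mu.-integrable setT (EFin \o F).

Lemma itg_measurable F : itg F -> measurable_fun setT F.
Proof. by case/integrableP => /measurable_EFinP. Qed.

Lemma itg_le (F K : R -> R) : measurable_fun setT F -> itg K ->
  (forall x, `|F x| <= K x) -> itg F.
Proof.
move=> mF iK FK; apply: (le_integrable _ _ _ iK) => //.
  exact/measurable_EFinP.
move=> x _ /=; rewrite lee_fin (le_trans (FK x))//; exact: ler_norm.
Qed.

Lemma itgZ r F : itg F -> itg (fun x => r * F x).
Proof. by move=> iF; exact: (integrableZl measurableT r iF). Qed.

Lemma itgD F K : itg F -> itg K -> itg (fun x => F x + K x).
Proof. by move=> iF iK; exact: (integrableD measurableT iF iK). Qed.

Lemma itgB F K : itg F -> itg K -> itg (fun x => F x - K x).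
Proof. by move=> iF iK; exact: (integrableB measurableT iF iK). Qed.

Lemma itg_abs F : itg F -> itg (fun x => `|F x|).
Proof. exact: integrable_norm. Qed.

Lemma itg_sum I (s : seq I) (F : I -> R -> R) :
  (forall i, itg (F i)) -> itg (fun x => \sum_(i <- s) F i x).
Proof.
move=> iF; elim: s => [|i s ih].
  rewrite (_ : (fun x => _) = (fun=> 0)); first exact: integrable0.
  by apply/funext => x; rewrite big_nil.
rewrite (_ : (fun x => _) = (fun x => F i x + \sum_(i <- s) F i x)).
  exact: itgD.
by apply/funext => x; rewrite big_cons.
Qed.

Lemma IntZ r F : itg F -> \int[mu]_x (r * F x) = r * \int[mu]_x F x.
Proof. by move=> iF; rewrite RintegralZl. Qed.

Lemma IntD F K : itg F -> itg K ->
  \int[mu]_x (F x + K x) = \int[mu]_x F x + \int[mu]_x K x.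
Proof. by move=> iF iK; rewrite RintegralD. Qed.

Lemma IntB F K : itg F -> itg K ->
  \int[mu]_x (F x - K x) = \int[mu]_x F x - \int[mu]_x K x.
Proof. by move=> iF iK; rewrite RintegralB. Qed.

Lemma Int_sum I (s : seq I) (F : I -> R -> R) : (forall i, itg (F i)) ->
  \int[mu]_x (\sum_(i <- s) F i x) = \sum_(i <- s) \int[mu]_x F i x.
Proof.
move=> iF; elim: s => [|i s ih].
  rewrite big_nil; under eq_Rintegral do rewrite big_nil.
  by rewrite Rintegral_cst// mul0r.
rewrite big_cons -ih -IntD//; last exact: itg_sum.
by apply: eq_Rintegral => x _; rewrite big_cons.
Qed.

Lemma Int_le F K : itg F -> itg K -> (forall x, F x <= K x) ->
  \int[mu]_x F x <= \int[mu]_x K x.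
Proof. by move=> iF iK FK; apply: le_Rintegral => //. Qed.

Lemma Int_abs_le (F K : R -> R) : measurable_fun setT F -> itg K ->
  (forall x, `|F x| <= K x) -> `|\int[mu]_x F x| <= \int[mu]_x K x.
Proof.
move=> mF iK FK; have iF := itg_le mF iK FK.
apply: le_trans (le_normr_Rintegral _ _) _ => //.
apply: Int_le => //; apply: (itg_le _ iK); first exact: measurableT_comp.
by move=> x; rewrite normr_id.
Qed.

(** The integrable majorant [B] of the slice norms gives joint integrability; integrability of all
    slices makes the inner extended integrals finite, so that Fubini descends to real-valued
    integrals. *)
Lemma Int_Fubini (F : R * R -> R) (B : R -> R) : measurable_fun setT F ->
  (forall s, itg (fun y => F (s, y))) -> itg B ->
  (forall s, \int[mu]_y `|F (s, y)| <= B s) ->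
  (forall y, itg (fun s => F (s, y))) ->
  [/\ itg (fun s => \int[mu]_y F (s, y)), itg (fun y => \int[mu]_s F (s, y)) &
  \int[mu]_s \int[mu]_y F (s, y) = \int[mu]_y \int[mu]_s F (s, y)].
Proof.
move=> mF i1 iB FB i2.
have iF : (mu \x mu)%E.-integrable setT (EFin \o F).
  apply/integrable12ltyP; first exact/measurable_EFinP.
  have /integrableP[_] := iB; apply: le_lt_trans.
  apply: ge0_le_integral => //.
  - by move=> s _; exact: integral_ge0.
  - apply: (@measurable_fun_fubini_tonelli_F _ _ _ _ _ mu (abse \o (EFin \o F))) => //.
      by apply: measurableT_comp => //; exact/measurable_EFinP.
    by move=> z; exact: abse_ge0.
  - by apply: measurableT_comp => //; exact: (measurable_int _ iB).
  - move=> s _ /=.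
    have ia : itg (fun y => `|F (s, y)|).
      exact: itg_abs.
    have : (\int[mu]_y `|F (s, y)|%:E)%E \is a fin_num.
      exact: (integrable_fin_num _ ia).
    move=> /fineK <-; rewrite lee_fin.
    by apply: le_trans (ler_norm _); exact: FB.
have e1 s : (\int[mu]_y (EFin \o F) (s, y))%E = (\int[mu]_y F (s, y))%:E.
  by rewrite /Rintegral fineK//; apply: (integrable_fin_num _ (i1 s)).
have e2 y : (\int[mu]_s (EFin \o F) (s, y))%E = (\int[mu]_s F (s, y))%:E.
  by rewrite /Rintegral fineK//; apply: (integrable_fin_num _ (i2 y)).
have := Fubini iF.
under eq_integral do rewrite e1.
under [in X in _ = X -> _]eq_integral do rewrite e2.
have := @integrable_fubini_F _ _ _ _ _ mu mu _ iF.
rewrite /fubini_F; under eq_fun do rewrite e1.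
move=> iA EQ; split; [exact: iA| |by rewrite /Rintegral EQ].
apply/integrableP; split.
  by apply/measurable_EFinP; apply: measurable_Rintegral (F \o (fun z => (z.2, z.1))) _;
     apply: measurableT_comp => //; exact: measurable_swap.
have mE : measurable_fun setT (EFin \o F) by exact/measurable_EFinP.
have hlt := (integrable21ltyP mu mu mE).1 iF.
apply: le_lt_trans hlt; apply: ge0_le_integral => //.
- apply: measurableT_comp => //; apply/measurable_EFinP.
  apply: (@measurable_Rintegral _ _ (F \o (fun z => (z.2, z.1)))) => /=.
  by apply: measurableT_comp => //; exact: measurable_swap.
- apply: (@measurable_fun_fubini_tonelli_G _ _ _ _ _ mu (abse \o (EFin \o F))) => //.
    by apply: measurableT_comp => //; exact/measurable_EFinP.
  by move=> z; exact: abse_ge0.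
- move=> y _; apply: (@le_trans _ _ (`| \int[mu]_s (EFin \o F) (s, y) |)%E).
    by rewrite e2.
  apply: le_abse_integral => //; exact: (measurable_int _ (i2 y)).
Qed.

End Integration.

(** * The Gaussian kernel, its derivatives and the heat equation *)

Section HeatKernel.
Context {R : realType}.
Notation mu := (@lebesgue_measure R).
Implicit Types (h s x y z : R).

Lemma mvt_abs (f df : R -> R) (a b K : R) :
  (forall x, Num.min a b <= x <= Num.max a b -> is_derive x 1 f (df x)) ->
  (forall x, Num.min a b <= x <= Num.max a b -> `|df x| <= K) ->
  `|f b - f a| <= K * `|b - a|.
Proof.
wlog ab : a b / a <= b => [hw|].
  case/orP: (le_total a b) => [/hw//|ba].
  by rewrite minC maxC distrC (distrC b); exact: hw.
rewrite min_l// max_r// => fd fK.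
have [] := @MVT_segment R f df a b ab.
- by move=> x /= xab; apply: fd; move: xab; rewrite in_itv/= => /andP[/ltW -> /ltW ->].
- apply: continuous_in_subspaceT => x; rewrite inE/= in_itv/= => xab.
  apply: differentiable_continuous; apply/derivable1_diffP.
  by have [] := fd _ xab.
- move=> c; rewrite in_itv/= => cab ->.
  by rewrite normrM ler_wpM2r// fK.
Qed.

Lemma heat_gt0 h z : 0 < h -> 0 < heat_kernel h z.
Proof.
move=> h0; rewrite /heat_kernel divr_gt0 ?expR_gt0// sqrtr_gt0.
by rewrite !mulr_gt0// pi_gt0.
Qed.

Lemma heat_ge0 h z : 0 <= heat_kernel h z.
Proof. by rewrite /heat_kernel divr_ge0 ?expR_ge0// sqrtr_ge0. Qed.

Lemma heat_sym h z : heat_kernel h (- z) = heat_kernel h z.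
Proof. by rewrite /heat_kernel sqrrN. Qed.

(** The kernel is the normal density of mean x and variance 2 h; integrability and total mass one
    are inherited from there. *)
Lemma heat_normal h x y : 0 < h ->
  heat_kernel h (x - y) = normal_pdf x (Num.sqrt (2 * h)) y.
Proof.
move=> h0.
have s0 : Num.sqrt (2 * h) != 0 by rewrite gt_eqF// sqrtr_gt0 mulr_gt0.
rewrite normal_pdfE// /normal_peak /normal_fun sqr_sqrtr ?mulr_ge0 ?(ltW h0)//.
rewrite /heat_kernel mulrC; congr (_^-1 * expR _).
  by congr Num.sqrt; rewrite -mulr_natr; ring.
rewrite -[in RHS]mulr_natr -[(y - x) ^+ 2]sqrrN opprB; congr (_ / _).
by ring.
Qed.

Lemma heat_itg h x : 0 < h -> itg (fun y => heat_kernel h (x - y)).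
Proof.
move=> h0; have := integrable_normal_pdf x (Num.sqrt (2 * h)).
by apply: eq_integrable => // y _ /=; rewrite heat_normal.
Qed.

Lemma heat_Int h x : 0 < h -> \int[mu]_y heat_kernel h (x - y) = 1.
Proof.
move=> h0; have := integral_normal_pdf x (Num.sqrt (2 * h)).
rewrite /Rintegral => e; have -> // : (\int[mu]_y (heat_kernel h (x - y))%:E = 1)%E.
by rewrite -e; apply: eq_integral => y _; rewrite heat_normal.
Qed.

Lemma heat_widen h s z : 0 < h -> h <= s ->
  heat_kernel h z <= Num.sqrt (s / h) * heat_kernel s z.
Proof.
move=> h0 hs; have s0 := lt_le_trans h0 hs.
rewrite /heat_kernel mulrCA; apply: ler_pM; rewrite ?expR_ge0 ?invr_ge0 ?sqrtr_ge0//.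
  rewrite ler_expR !mulNr lerN2 ler_wpM2l ?sqr_ge0//.
  by rewrite lef_pV2 ?posrE ?mulr_gt0// ler_wpM2l.
rewrite -sqrtrV ?mulr_ge0 ?pi_ge0 ?(ltW h0)// -sqrtrV ?mulr_ge0 ?pi_ge0 ?(ltW s0)//.
rewrite -sqrtrM ?divr_ge0 ?(ltW s0) ?(ltW h0)//.
apply: ler_wsqrtr; rewrite le_eqVlt; apply/orP; left; apply/eqP.
have p0 : (pi : R) != 0 by rewrite gt_eqF// pi_gt0.
have h0' : h != 0 by rewrite gt_eqF.
have s0' : s != 0 by rewrite gt_eqF.
by move: (pi : R) p0 => pp p0; field; rewrite p0 h0' s0'.
Qed.

Lemma sqrt2_le2 : Num.sqrt 2 <= 2 :> R.
Proof.
have e : (2 : R) = Num.sqrt (2 ^+ 2) by rewrite sqrtr_sqr ger0_norm.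
by rewrite [leRHS]e; apply: ler_wsqrtr; lra.
Qed.

Lemma heat_widen2 h z : 0 < h -> heat_kernel h z <= 2 * heat_kernel (2 * h) z.
Proof.
move=> h0; apply: le_trans (@heat_widen h (2 * h) z h0 _) _.
  by move: h0; lra.
by rewrite ler_wpM2r ?heat_ge0// mulfK ?gt_eqF// sqrt2_le2.
Qed.

(** Completing the square bounds the difference of the exponents by e^2 / (4 h), so a shift by at
    most sqrt h costs a constant and a doubling of the time. *)
Lemma heat_shift h z (e : R) : 0 < h -> e ^+ 2 <= h ->
  heat_kernel h (z + e) <= 2 * expR 1 * heat_kernel (2 * h) z.
Proof.
move=> h0 eh.
have -> : heat_kernel h (z + e) =
    expR (- (z + e) ^+ 2 / (4 * h) + z ^+ 2 / (8 * h)) *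
    (expR (- z ^+ 2 / (8 * h)) / Num.sqrt (4 * pi * h)).
  rewrite mulrA -expRD /heat_kernel; congr (expR _ / _); field.
  by rewrite gt_eqF.
have H1 : expR (- (z + e) ^+ 2 / (4 * h) + z ^+ 2 / (8 * h)) <= expR 1.
  rewrite ler_expR.
  have -> : - (z + e) ^+ 2 / (4 * h) + z ^+ 2 / (8 * h) =
     (2 * e ^+ 2 - (z + 2 * e) ^+ 2) / (8 * h) by field; rewrite gt_eqF.
  rewrite ler_pdivrMr ?mulr_gt0//; have := sqr_ge0 (z + 2 * e); lra.
have H2 : expR (- z ^+ 2 / (8 * h)) / Num.sqrt (4 * pi * h) <= 2 * heat_kernel (2 * h) z.
  rewrite /heat_kernel.
  have -> : 4 * (2 * h) = 8 * h by ring.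
  have -> : 4 * pi * (2 * h) = 2 * (4 * pi * h) by ring.
  rewrite mulrCA ler_wpM2l ?expR_ge0// (@sqrtrM _ 2)//.
  set S := Num.sqrt (4 * pi * h).
  have S0 : 0 < S by rewrite sqrtr_gt0 !mulr_gt0 ?pi_gt0.
  have q0 : 0 < Num.sqrt 2 :> R by rewrite sqrtr_gt0.
  have -> : 2 / (Num.sqrt 2 * S) = (2 / Num.sqrt 2) * S^-1 by field; rewrite !gt_eqF.
  rewrite ler_peMl ?invr_ge0 ?(ltW S0)// ler_pdivlMr// mul1r; exact: sqrt2_le2.
apply: le_trans (ler_pM _ _ H1 H2) _; rewrite ?expR_ge0// ?divr_ge0 ?expR_ge0 ?sqrtr_ge0//.
by rewrite mulrCA mulrA.
Qed.

(* The n-th space derivative of the heat kernel is h^(-n/2) P_n (z / sqrt h)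
   times the kernel, with P_n a rescaled Hermite polynomial. *)
Fixpoint hpoly (n : nat) : {poly R} :=
  if n is n'.+1 then
    if n' is n''.+1 then
      (- 2^-1) *: ('X * hpoly n' + n'%:R *: hpoly n'')
    else (- 2^-1) *: 'X
  else 1.

Lemma size_hpoly n : size (hpoly n) = n.+1.
Proof.
have c0 : (- 2^-1 : R) != 0 by rewrite oppr_eq0 invr_eq0.
elim/ltn_ind: n => -[|[|n]] ih.
- by rewrite size_poly1.
- by rewrite /= size_scale// size_polyX.
- rewrite [hpoly _]/= size_scale//.
  have s1 : size ('X * hpoly n.+1) = n.+3.
    by rewrite mulrC size_mulX -?size_poly_eq0 ih.
  rewrite size_polyDl// s1 (leq_ltn_trans (size_scale_leq _ _))//.
  by rewrite ih// ltnS.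
Qed.

Definition gk (i : nat) h z := Num.sqrt h ^- i * (hpoly i).[z / Num.sqrt h] * heat_kernel h z.

Lemma gk0 h z : gk 0 h z = heat_kernel h z.
Proof. by rewrite /gk expr0 invr1 /= hornerC !mul1r. Qed.

Lemma gk1 h z : 0 < h -> gk 1 h z = - (z / (2 * h)) * heat_kernel h z.
Proof.
move=> h0; have s0 : Num.sqrt h != 0 by rewrite gt_eqF// sqrtr_gt0.
have e : h = Num.sqrt h ^+ 2 by rewrite sqr_sqrtr// ltW.
rewrite /gk; set K := heat_kernel h z.
rewrite expr1 /= hornerZ hornerX [in X in _ = - (_ / (_ * X)) * _]e.
by move: s0; move: (Num.sqrt h) => r r0; field.
Qed.

(** The three-term recurrence of the Hermite polynomials, read on the kernels; it carries the
    inductions for the derivatives in z and in h. *)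
Lemma gkSS i h z : 0 < h ->
  gk i.+2 h z = - (2 * h)^-1 * (z * gk i.+1 h z + i.+1%:R * gk i h z).
Proof.
move=> h0; have s0 : Num.sqrt h != 0 by rewrite gt_eqF// sqrtr_gt0.
have e : h = Num.sqrt h ^+ 2 by rewrite sqr_sqrtr// ltW.
rewrite /gk; set K := heat_kernel h z.
have -> : hpoly i.+2 = (- 2^-1) *: ('X * hpoly i.+1 + i.+1%:R *: hpoly i) by [].
rewrite hornerZ hornerD hornerM hornerX hornerZ !exprSr.
move: (hpoly i.+1) (hpoly i) => P Q.
have si : Num.sqrt h ^+ i != 0 by rewrite expf_neq0.
rewrite [in X in _ = - (_ * X)^-1 * _]e.
set a := P.[_]; set b := Q.[_]; clearbody a b K.
by move: s0 si; move: (Num.sqrt h ^+ i) => ri; move: (Num.sqrt h) => r s0 si; field; rewrite s0 si.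
Qed.

Lemma is_derive_heat_z h z : 0 < h ->
  is_derive z 1 (heat_kernel h) (- (z / (2 * h)) * heat_kernel h z).
Proof.
move=> h0; rewrite /heat_kernel.
apply: is_derive_eq.
rewrite ?scaler0 /GRing.scale/=; field.
by rewrite (gt_eqF h0) gt_eqF// sqrtr_gt0 !mulr_gt0 ?pi_gt0.
Qed.

Lemma is_derive_heat_h h z : 0 < h ->
  is_derive h 1 (fun h => heat_kernel h z)
    ((z ^+ 2 / (4 * h ^+ 2) - (2 * h)^-1) * heat_kernel h z).
Proof.
move=> h0; rewrite /heat_kernel.
have s0 : 0 < Num.sqrt (4 * pi * h) by rewrite sqrtr_gt0 !mulr_gt0 ?pi_gt0.
have e : 4 * pi * h = Num.sqrt (4 * pi * h) ^+ 2 by rewrite sqr_sqrtr// !mulr_ge0 ?pi_ge0 ?ltW.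
have d1 : is_derive h 1 (fun h : R => expR (- z ^+ 2 / (4 * h))) (expR (- z ^+ 2 / (4 * h)) * (z ^+ 2 / (4 * h ^+ 2))).
  have h4 : 4 * h != 0 by rewrite mulf_neq0 ?gt_eqF.
  apply: is_derive_eq.
  rewrite ?scaler0 /GRing.scale/=; field.
  by rewrite (gt_eqF h0).
have d2 : is_derive h 1 (fun h : R => (Num.sqrt (4 * pi * h))^-1) (- (2 * h)^-1 * (Num.sqrt (4 * pi * h))^-1).
  have d3 : is_derive h 1 (fun h : R => Num.sqrt (4 * pi * h)) ((2 * Num.sqrt (4 * pi * h))^-1 * (4 * pi)).
    apply: (@is_derive1_comp _ Num.sqrt (fun h => 4 * pi * h)).
      apply: is_derive1_sqrt; by rewrite !mulr_gt0 ?pi_gt0.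
    apply: is_derive_eq.
    by rewrite /GRing.scale/= mulr1.
  have n0 : Num.sqrt (4 * pi * h) != 0 by rewrite gt_eqF.
  apply: is_derive_eq.
  rewrite /GRing.scale/=.
  have -> : (2 * h)^-1 = 2 * pi / (4 * pi * h).
    have p0 : (pi : R) != 0 by rewrite gt_eqF// pi_gt0.
    by move: (pi : R) p0 => pp p0; field; rewrite p0 gt_eqF.
  set r := Num.sqrt _ in n0 e *; clearbody r; rewrite e.
  by move: (pi : R) => pp; field.
apply: is_derive_eq; rewrite /GRing.scale/=.
by field; rewrite (gt_eqF h0) (gt_eqF s0).
Qed.

Lemma gk2 h z : 0 < h ->
  gk 2 h z = (z ^+ 2 / (4 * h ^+ 2) - (2 * h)^-1) * heat_kernel h z.
Proof.
move=> h0; rewrite gkSS// gk1// gk0; move: (heat_kernel h z) => K.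
by field; rewrite gt_eqF.
Qed.

Lemma is_derive_gk_z i h z : 0 < h -> is_derive z 1 (gk i h) (gk i.+1 h z).
Proof.
move=> h0; have hn : h != 0 by rewrite gt_eqF.
elim/ltn_ind: i => -[|[|i]] ih.
- rewrite gk1//; have -> : gk 0 h = heat_kernel h by apply/funext => w; rewrite gk0.
  exact: is_derive_heat_z.
- have -> : gk 1 h = (fun z => - (z / (2 * h)) * heat_kernel h z).
    by apply/funext => w; rewrite gk1.
  have dh := is_derive_heat_z z h0.
  rewrite gk2//; apply: is_derive_eq; rewrite ?scaler0 /GRing.scale/=.
  by move: (heat_kernel h z) => K; field.
- have -> : gk i.+2 h = (fun z => - (2 * h)^-1 * (z * gk i.+1 h z + i.+1%:R * gk i h z)).
    by apply/funext => w; rewrite gkSS.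
  have d1 := ih i.+1 (ltnSn _); have d0 := ih i (ltnW (ltnSn _)).
  rewrite (gkSS i.+1)//; apply: is_derive_eq; rewrite ?scaler0 /GRing.scale/=.
  rewrite -(natr1 i.+1) -(natr1 i); move: (gk i.+2 h z) (gk i.+1 h z) => a b.
  by field.
Qed.

Lemma is_derive_gk_h i h z : 0 < h ->
  is_derive h 1 (fun h => gk i h z) (gk i.+2 h z).
Proof.
move=> h0; have hn : h != 0 by rewrite gt_eqF.
(* The recurrence holds for positive times only, so it may be substituted under the derivative in h
   only near h. *)
have near_eq (f f' : R -> R) df : (forall s, 0 < s -> f s = f' s) ->
    is_derive h 1 f' df -> is_derive h 1 f df.
  move=> ff' d; apply: near_eq_is_derive d.
  by near=> s; rewrite ff'//; near: s; exact: lt_nbhsr.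
elim/ltn_ind: i => -[|[|i]] ih.
- rewrite gk2//; have -> : (fun s => gk 0 s z) = (fun s => heat_kernel s z) by apply/funext => w; rewrite gk0.
  exact: is_derive_heat_h.
- apply: (near_eq _ (fun s => - (z / (2 * s)) * heat_kernel s z)).
    by move=> s s0; rewrite gk1.
  have dh := is_derive_heat_h z h0.
  have h2 : 2 * h != 0 by rewrite mulf_neq0.
  rewrite gkSS// gk2// gk1//; apply: is_derive_eq; rewrite ?scaler0 /GRing.scale/=.
  by move: (heat_kernel h z) => K; field.
- apply: (near_eq _ (fun s => - (2 * s)^-1 * (z * gk i.+1 s z + i.+1%:R * gk i s z))).
    by move=> s s0; rewrite gkSS.
  have d1 := ih i.+1 (ltnSn _); have d0 := ih i (ltnW (ltnSn _)).
  have h2 : 2 * h != 0 by rewrite mulf_neq0.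
  rewrite (gkSS i.+2)//; apply: is_derive_eq; rewrite ?scaler0 /GRing.scale/=.
  have := gkSS i.+1 z h0; have := gkSS i z h0.
  rewrite -(natr1 i.+2) -(natr1 i.+1) -(natr1 i).
  move: (gk i.+3 h z) (gk i.+2 h z) (gk i.+1 h z) (gk i h z) => a b c d -> ->.
  by field.
Unshelve. all: by end_near. Qed.

End HeatKernel.

(** * Gaussian bounds, moments and the semigroup law *)

Section KernelBounds.
Context {R : realType}.
Notation mu := (@lebesgue_measure R).
Implicit Types (h s x y z e : R).

Lemma horner_le (p : {poly R}) :
  exists2 C, 0 < C & forall w, `|p.[w]| <= C * (1 + `|w|) ^+ size p.
Proof.
exists (1 + \sum_(i < size p) `|p`_i|).
  by rewrite ltr_pwDl// sumr_ge0.
move=> w; rewrite horner_coef (le_trans (ler_norm_sum _ _ _))//.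
rewrite mulrDl mul1r mulr_suml ler_wpDl ?exprn_ge0 ?addr_ge0//.
apply: ler_sum => i _; rewrite normrM normrX ler_wpM2l//.
apply: (@le_trans _ _ ((1 + `|w|) ^+ i)).
  by rewrite lerXn2r ?nnegrE ?addr_ge0// lerDr.
by rewrite ler_weXn2l ?(ltnW (ltn_ord i))// lerDl.
Qed.

(** With y = w^2 / 8, first 1 + w <= 16 (1 + y); then 1 + y <= (N + 1) exp (y / (N + 1)), and the
    N-th power of this exponential is at most exp y. *)
Lemma expn_le_expR (N : nat) :
  exists2 C : R, 0 < C & forall w, 0 <= w -> (1 + w) ^+ N <= C * expR (w ^+ 2 / 8).
Proof.
exists (16 ^+ N * N.+1%:R ^+ N); first by rewrite mulr_gt0 ?exprn_gt0.
move=> w w0.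
have N0 : 0 < N.+1%:R :> R by rewrite ltr0n.
have a1 : 1 + w <= 16 * (1 + w ^+ 2 / 8) by have := sqr_ge0 (w - 1); lra.
have y0 : 0 <= w ^+ 2 / 8 by rewrite divr_ge0 ?sqr_ge0.
set y := w ^+ 2 / 8 in a1 y0 *.
apply: (@le_trans _ _ ((16 * (1 + y)) ^+ N)).
  by rewrite lerXn2r ?nnegrE ?mulr_ge0 ?addr_ge0.
rewrite exprMn -mulrA ler_wpM2l ?exprn_ge0//.
have -> : 1 + y = N.+1%:R * (N.+1%:R^-1 + y / N.+1%:R) by field; rewrite gt_eqF.
rewrite exprMn ler_wpM2l ?exprn_ge0//.
apply: (@le_trans _ _ (expR (y / N.+1%:R) ^+ N)).
  rewrite lerXn2r ?nnegrE ?expR_ge0 ?addr_ge0 ?invr_ge0 ?divr_ge0 ?sqr_ge0 ?(ltW N0)//.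
  apply: (@le_trans _ _ (1 + y / N.+1%:R)); last exact: expR_ge1Dx.
  by rewrite lerD2r invf_le1// ler1n.
rewrite -expRM_natr ler_expR -mulrA ler_piMr// mulrC ler_pdivrMr// mul1r.
by rewrite ler_nat.
Qed.

(** The Hermite polynomial and any power of |z| / sqrt h are absorbed by part of the Gaussian; what
    remains is the Gaussian of doubled time. *)
Lemma gk_le (i j : nat) : exists2 C : R, 0 < C & forall h z, 0 < h ->
  (`|z| / Num.sqrt h) ^+ j * `|gk i h z| <=
  C * Num.sqrt h ^- i * heat_kernel (2 * h) z.
Proof.
have [C1 C10 H1] := horner_le (hpoly i).
have [C2 C20 H2] := expn_le_expR (j + size (hpoly i : {poly R})).
exists (C1 * C2 * Num.sqrt 2); first by rewrite !mulr_gt0// sqrtr_gt0.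
move=> h z h0.
have s0 : 0 < Num.sqrt h by rewrite sqrtr_gt0.
pose w := `|z| / Num.sqrt h.
have w0 : 0 <= w by rewrite divr_ge0 ?sqrtr_ge0.
have e1 : expR (w ^+ 2 / 8) * heat_kernel h z = Num.sqrt 2 * heat_kernel (2 * h) z.
  rewrite /heat_kernel.
  have -> : w ^+ 2 / 8 = z ^+ 2 / (8 * h).
    by rewrite /w exprMn exprVn sqr_sqrtr ?ltW// real_normK ?num_real//; field; rewrite gt_eqF.
  have -> : 4 * pi * (2 * h) = 2 * (4 * pi * h) by ring.
  rewrite (@sqrtrM _ 2)// mulrA -expRD.
  have -> : z ^+ 2 / (8 * h) + - z ^+ 2 / (4 * h) = - z ^+ 2 / (4 * (2 * h)).
    by field; rewrite gt_eqF.
  have q0 : Num.sqrt 2 != 0 :> R by rewrite gt_eqF// sqrtr_gt0.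
  by rewrite invfM; field; rewrite q0 gt_eqF// sqrtr_gt0 !mulr_gt0 ?pi_gt0.
have K0 : 0 <= heat_kernel h z by exact: heat_ge0.
rewrite -/w /gk; move: (heat_kernel h z) K0 e1 => K K0 e1.
rewrite !normrM (ger0_norm K0) normfV normrX (ger0_norm (sqrtr_ge0 _)).
have Hw : `|(hpoly i).[z / Num.sqrt h]| <= C1 * (1 + w) ^+ size (hpoly i : {poly R}).
  by apply: le_trans (H1 _) _; rewrite normrM normfV (ger0_norm (sqrtr_ge0 _)).
have Hw2 : w ^+ j * `|(hpoly i).[z / Num.sqrt h]| <= C1 * C2 * expR (w ^+ 2 / 8).
  apply: (@le_trans _ _ ((1 + w) ^+ j * (C1 * (1 + w) ^+ size (hpoly i : {poly R})))).
    by apply: ler_pM => //; rewrite ?exprn_ge0// lerXn2r ?nnegrE ?addr_ge0// lerDr.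
  by rewrite mulrCA -exprD -mulrA ler_wpM2l ?(ltW C10)// H2.
have -> : C1 * C2 * Num.sqrt 2 * Num.sqrt h ^- i * heat_kernel (2 * h) z =
   Num.sqrt h ^- i * (C1 * C2) * (Num.sqrt 2 * heat_kernel (2 * h) z) by ring.
rewrite -e1.
have -> : w ^+ j * (Num.sqrt h ^- i * `|(hpoly i).[z / Num.sqrt h]| * K) =
  Num.sqrt h ^- i * K * (w ^+ j * `|(hpoly i).[z / Num.sqrt h]|) by ring.
have -> : Num.sqrt h ^- i * (C1 * C2) * (expR (w ^+ 2 / 8) * K) =
  Num.sqrt h ^- i * K * (C1 * C2 * expR (w ^+ 2 / 8)) by ring.
by rewrite ler_wpM2l// mulr_ge0 // invr_ge0 exprn_ge0 ?sqrtr_ge0.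
Qed.

Lemma gk_le0 (i : nat) : exists2 C : R, 0 < C & forall h z, 0 < h ->
  `|gk i h z| <= C * Num.sqrt h ^- i * heat_kernel (2 * h) z.
Proof.
by have [C C0 H] := gk_le i 0; exists C => // h z /(H h z); rewrite expr0 mul1r.
Qed.

Lemma gk_shift (i : nat) : exists2 C : R, 0 < C & forall h z e, 0 < h ->
  e ^+ 2 <= h -> `|gk i h (z + e)| <= C * Num.sqrt h ^- i * heat_kernel (4 * h) z.
Proof.
have [C C0 H] := gk_le0 i; exists (C * (2 * expR 1)).
  by rewrite !mulr_gt0 ?expR_gt0.
move=> h z e h0 eh; apply: le_trans (H _ _ h0) _.
have -> : C * (2 * expR 1) * Num.sqrt h ^- i * heat_kernel (4 * h) z =
  C * Num.sqrt h ^- i * (2 * expR 1 * heat_kernel (4 * h) z) by ring.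
rewrite ler_wpM2l ?mulr_ge0 ?(ltW C0) ?invr_ge0 ?exprn_ge0 ?sqrtr_ge0//.
have -> : 4 * h = 2 * (2 * h) by ring.
apply: heat_shift; first by rewrite mulr_gt0.
by move: eh h0; lra.
Qed.

Lemma between_shift z e x :
  Num.min z (z + e) <= x <= Num.max z (z + e) -> exists2 d, x = z + d & d ^+ 2 <= e ^+ 2.
Proof.
move=> /andP[a b]; exists (x - z); first by rewrite addrC subrK.
have [e0|e0] := leP 0 e; move: a b.
- rewrite min_l ?lerDl// max_r ?lerDl// => a b.
  by rewrite lerXn2r ?nnegrE; lra.
- rewrite min_r ?gerDl ?(ltW e0)// max_l ?gerDl ?(ltW e0)// => a b.
  rewrite -[(x - z) ^+ 2]sqrrN -[e ^+ 2]sqrrN.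
  by rewrite lerXn2r ?nnegrE; lra.
Qed.

Lemma gk_lip (i : nat) : exists2 C : R, 0 < C & forall h z e, 0 < h ->
  e ^+ 2 <= h ->
  `|gk i h (z + e) - gk i h z| <= C * Num.sqrt h ^- i.+1 * heat_kernel (4 * h) z * `|e|.
Proof.
have [C C0 H] := gk_shift i.+1; exists C => // h z e h0 eh.
have := @mvt_abs _ (gk i h) (gk i.+1 h) z (z + e)
  (C * Num.sqrt h ^- i.+1 * heat_kernel (4 * h) z).
rewrite addrAC subrr add0r; apply.
- by move=> x _; exact: is_derive_gk_z.
- move=> x /between_shift[d -> de]; apply: H => //; exact: le_trans de eh.
Qed.

Lemma gk_taylor (i : nat) : exists2 C : R, 0 < C & forall h z e, 0 < h ->
  e ^+ 2 <= h ->
  `|gk i h (z + e) - gk i h z - e * gk i.+1 h z| <=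
     C * Num.sqrt h ^- i.+2 * heat_kernel (4 * h) z * e ^+ 2.
Proof.
have [C C0 H] := gk_lip i.+1; exists C => // h z e h0 eh.
have := @mvt_abs _ (fun x => gk i h x - (x - z) * gk i.+1 h z) (fun x => gk i.+1 h x - gk i.+1 h z) z (z + e)
  (C * Num.sqrt h ^- i.+2 * heat_kernel (4 * h) z * `|e|).
rewrite subrr mul0r subr0.
have -> : z + e - z = e by ring.
have -> : gk i h (z + e) - e * gk i.+1 h z - gk i h z = gk i h (z + e) - gk i h z - e * gk i.+1 h z by ring.
have -> : forall a : R, a * e ^+ 2 = a * `|e| * `|e|.
  by move=> a; rewrite -mulrA -normrM -expr2 ger0_norm// sqr_ge0.
apply.
- move=> x _; have d := is_derive_gk_z i x h0.
  by apply: is_derive_eq; rewrite /GRing.scale/=; ring.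
- move=> x /between_shift[d -> de].
  apply: le_trans (H h z d h0 (le_trans de eh)) _.
  rewrite ler_wpM2l ?mulr_ge0 ?(ltW C0) ?heat_ge0 ?invr_ge0 ?exprn_ge0 ?sqrtr_ge0//.
  by rewrite -ler_sqr ?nnegrE// !real_normK ?num_real.
Qed.

Lemma measurable_heat d (T : measurableType d) (D : set T) (a b : T -> R) :
  measurable_fun D a -> measurable_fun D b ->
  measurable_fun D (fun t => heat_kernel (a t) (b t)).
Proof.
move=> ma mb; rewrite /heat_kernel; apply: measurable_funM.
  apply: measurableT_comp; first exact: measurable_expR.
  apply: measurable_funM.
    by apply: measurable_funN; exact: measurable_funX.
  by apply: measurable_invr; apply: measurable_funM.
apply: measurable_invr; apply: measurable_sqrtr; by apply: measurable_funM.
Qed.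

Lemma measurable_gk i d (T : measurableType d) (D : set T) (a b : T -> R) :
  measurable_fun D a -> measurable_fun D b ->
  measurable_fun D (fun t => gk i (a t) (b t)).
Proof.
move=> ma mb; rewrite /gk; have ms := measurable_sqrtr ma.
apply: measurable_funM; last exact: measurable_heat.
apply: measurable_funM.
  by apply: measurable_invr; exact: measurable_funX.
have mp : measurable_fun [set: R] (horner (hpoly i)).
  apply: continuous_measurable_fun => x; apply: differentiable_continuous.
  by apply/derivable1_diffP; exact: derivable_horner.
apply: measurableT_comp mp _; apply: measurable_funM => //.
exact: measurable_invr.
Qed.

Lemma gk_itg i h x : 0 < h -> itg (fun y => gk i h (x - y)).
Proof.
move=> h0; have [C C0 H] := gk_le0 i.
apply: (@itg_le _ _ (fun y => (C * Num.sqrt h ^- i) * heat_kernel (2 * h) (x - y))).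
- by apply: measurable_gk => //; exact: measurable_funB.
- by apply: itgZ; apply: heat_itg; rewrite mulr_gt0.
- by move=> y; exact: H.
Qed.

Lemma sqr_le_sqrt (e h : R) : 0 < e -> 0 < h -> e <= Num.sqrt h -> e ^+ 2 <= h.
Proof.
move=> e0 h0 eh; rewrite -[leRHS](sqr_sqrtr (ltW h0)).
by rewrite lerXn2r ?nnegrE ?sqrtr_ge0 ?(ltW e0).
Qed.

(** Turns a first-order expansion with quadratic error into an exact identity. It stands in for
    differentiation under the integral sign in the next results. *)
Lemma small_le (a C e0 : R) : 0 < e0 ->
  (forall e, 0 < e -> e <= e0 -> e * a <= C * e ^+ 2) -> a <= 0.
Proof.
move=> e00 H; rewrite leNgt; apply/negP => a0.
have C0 : 0 < C.
  have := H e0 e00 (lexx _); have := mulr_gt0 e00 a0 => h1 h2.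
  by have := lt_le_trans h1 h2; rewrite pmulr_lgt0 ?exprn_gt0.
pose e := Num.min e0 (a / (2 * C)).
have e0' : 0 < e by rewrite lt_min e00 divr_gt0// mulr_gt0.
have := H e e0'; rewrite ge_min lexx => /(_ isT).
rewrite expr2 mulrCA ler_pM2l//.
have : e <= a / (2 * C) by rewrite ge_min lexx orbT.
rewrite ler_pdivlMr ?mulr_gt0//; nra.
Qed.

(** The integral of [gk i] does not depend on x, so by [gk_taylor] e times the integral of the next
    derivative is O(e^2), hence that integral vanishes. *)
Lemma Int_gkS i h x : 0 < h -> \int[mu]_y gk i.+1 h (x - y) = 0.
Proof.
move=> h0; have h40 : 0 < 4 * h by rewrite mulr_gt0.
suff : exists c, forall i x, \int[mu]_y gk i h (x - y) = if i is 0%N then c else 0.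
  by case=> c ->.
exists 1 => {}i; elim: i => [|i ih] {}x.
  by rewrite -(heat_Int x h0); apply: eq_Rintegral => y _; rewrite gk0.
have [C C0 H] := gk_taylor i.
suff : `|\int[mu]_y gk i.+1 h (x - y)| <= 0 by rewrite normr_le0 => /eqP.
apply: (@small_le _ (C * Num.sqrt h ^- i.+2) (Num.sqrt h)); first by rewrite sqrtr_gt0.
move=> e e0 eh.
have eh2 : e ^+ 2 <= h.
  exact: sqr_le_sqrt.
have E : \int[mu]_y (gk i h (x + e - y) - gk i h (x - y) - e * gk i.+1 h (x - y)) =
  - (e * \int[mu]_y gk i.+1 h (x - y)).
  rewrite IntB; [|apply: itgB; exact: gk_itg|apply: itgZ; exact: gk_itg].
  rewrite IntB ?IntZ; try exact: gk_itg.
  by rewrite !ih subrr add0r.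
have := @Int_abs_le _ (fun y => gk i h (x + e - y) - gk i h (x - y) - e * gk i.+1 h (x - y))
  (fun y => (C * Num.sqrt h ^- i.+2 * e ^+ 2) * heat_kernel (4 * h) (x - y)).
rewrite E normrN normrM (gtr0_norm e0) IntZ ?heat_Int ?mulr1; last exact: heat_itg.
  apply.
  - apply: measurable_funB; last apply: measurable_funM => //.
      by apply: measurable_funB; apply: measurable_gk => //; exact: measurable_funB.
    by apply: measurable_gk => //; exact: measurable_funB.
  - by apply: itgZ; exact: heat_itg.
  - move=> y; have := H h (x - y) e h0 eh2.
    have -> : x + e - y = x - y + e by ring.
    by move=> /le_trans; apply; rewrite le_eqVlt; apply/orP; left; apply/eqP; ring.
by [].
Qed.

(** Moments are read off the derivatives of the kernel, whose integrals vanish: the first is 2 h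
    times [gk 1], the second a combination of [gk 2] and the kernel itself. *)
Lemma heat_moment1 h x : 0 < h ->
  [/\ itg (fun y => (y - x) * heat_kernel h (x - y)) &
   \int[mu]_y ((y - x) * heat_kernel h (x - y)) = 0].
Proof.
move=> h0.
have E : (fun y => (y - x) * heat_kernel h (x - y)) = (fun y => (2 * h) * gk 1 h (x - y)).
  by apply/funext => y; rewrite gk1//; field; rewrite gt_eqF.
rewrite E; split; first by apply: itgZ; exact: gk_itg.
by rewrite IntZ ?Int_gkS ?mulr0//; exact: gk_itg.
Qed.

Lemma heat_moment2 h x : 0 < h ->
  [/\ itg (fun y => (y - x) ^+ 2 * heat_kernel h (x - y)) &
   \int[mu]_y ((y - x) ^+ 2 * heat_kernel h (x - y)) = 2 * h].
Proof.
move=> h0.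
have E : (fun y => (y - x) ^+ 2 * heat_kernel h (x - y)) =
    (fun y => (4 * h ^+ 2) * gk 2 h (x - y) + (2 * h) * heat_kernel h (x - y)).
  by apply/funext => y; rewrite gk2//; field; rewrite gt_eqF.
have i1 := gk_itg 2 x h0; have i2 := heat_itg x h0.
rewrite E; split; first by apply: itgD; exact: itgZ.
by rewrite IntD ?IntZ ?Int_gkS ?heat_Int ?mulr0 ?add0r ?mulr1//; exact: itgZ.
Qed.

Lemma heat_absmoment (j : nat) : exists2 C : R, 0 < C & forall h z, 0 < h ->
  `|z| ^+ j * heat_kernel h z <= C * Num.sqrt h ^+ j * heat_kernel (2 * h) z.
Proof.
have [C C0 H] := gk_le 0 j; exists C => // h z h0.
have := H h z h0; rewrite gk0 (ger0_norm (heat_ge0 _ _)) expr0 invr1 mulr1.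
have s0 : 0 < Num.sqrt h by rewrite sqrtr_gt0.
rewrite exprMn exprVn mulrAC ler_pdivrMr ?exprn_gt0// => /le_trans; apply.
by rewrite mulrAC.
Qed.

(** Completing the square in y: the product of the two Gaussians is the convolved one times a
    Gaussian of time h s / (h + s) centred at the barycentre [c]. *)
Lemma heat_CK h s x z : 0 < h -> 0 < s ->
  [/\ itg (fun y => heat_kernel h (x - y) * heat_kernel s (y - z)) &
  \int[mu]_y (heat_kernel h (x - y) * heat_kernel s (y - z)) = heat_kernel (h + s) (x - z)].
Proof.
move=> h0 s0; have hs0 : 0 < h + s by rewrite addr_gt0.
pose r := h * s / (h + s); have r0 : 0 < r by rewrite divr_gt0 ?mulr_gt0.
pose c := (s * x + h * z) / (h + s).
have E : (fun y => heat_kernel h (x - y) * heat_kernel s (y - z)) =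
    (fun y => heat_kernel (h + s) (x - z) * heat_kernel r (c - y)).
  apply/funext => y; rewrite /heat_kernel mulrACA -expRD [in RHS]mulrACA -expRD.
  congr (expR _ * _).
    by rewrite /c /r; field; rewrite !gt_eqF.
  rewrite -!invfM -!sqrtrM ?mulr_ge0 ?pi_ge0 ?(ltW hs0) ?(ltW h0)//.
  congr (Num.sqrt _)^-1; rewrite /r; move: (pi : R) => pp; field.
  by rewrite gt_eqF.
rewrite E; split; first by apply: itgZ; exact: heat_itg.
by rewrite IntZ ?heat_Int ?mulr1//; exact: heat_itg.
Qed.

Lemma heat_gk_itg i h s x z : 0 < h -> 0 < s ->
  itg (fun y => heat_kernel h (x - y) * gk i s (y - z)).
Proof.
move=> h0 s0; have [C C0 H] := gk_le0 i.
have s20 : 0 < 2 * s by rewrite mulr_gt0.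
apply: (@itg_le _ _ (fun y => (C * Num.sqrt s ^- i) * (heat_kernel h (x - y) * heat_kernel (2 * s) (y - z)))).
- apply: measurable_funM; first by apply: measurable_heat => //; exact: measurable_funB.
  by apply: measurable_gk => //; exact: measurable_funB.
- by apply: itgZ; have [] := heat_CK x z h0 s20.
- move=> y; rewrite normrM (ger0_norm (heat_ge0 _ _)) mulrCA ler_wpM2l ?heat_ge0//.
  exact: H.
Qed.

(** Each further derivative is obtained by shifting z by e and expanding both sides to second order;
    [small_le] removes the error. *)
Lemma gk_CK i h s x z : 0 < h -> 0 < s ->
  \int[mu]_y (heat_kernel h (x - y) * gk i s (y - z)) = gk i (h + s) (x - z).
Proof.
move=> h0 s0; have hs0 : 0 < h + s by rewrite addr_gt0.
have s40 : 0 < 4 * s by rewrite mulr_gt0.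
elim: i z => [|i ih] z.
  have [_ E] := heat_CK x z h0 s0.
  by rewrite gk0 -E; apply: eq_Rintegral => y _; rewrite gk0.
have [C C0 H] := gk_taylor i.
have [i4 E4] := heat_CK x z h0 s40.
set I := \int[mu]_y _; set g := gk i.+1 _ _.
suff : `|I - g| <= 0 by rewrite normr_le0 subr_eq0 => /eqP.
pose C1 := C * Num.sqrt s ^- i.+2 * heat_kernel (h + 4 * s) (x - z).
pose C2 := C * Num.sqrt (h + s) ^- i.+2 * heat_kernel (4 * (h + s)) (x - z).
apply: (@small_le _ (C1 + C2) (Num.sqrt s)); first by rewrite sqrtr_gt0.
move=> e e0 es.
have es2 : e ^+ 2 <= s.
  exact: sqr_le_sqrt.
have eh2 : e ^+ 2 <= h + s by apply: le_trans es2 _; rewrite lerDr ltW.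
have H2 := H (h + s) (x - z) e hs0 eh2.
pose F y := heat_kernel h (x - y) * gk i s (y - (z - e)) - heat_kernel h (x - y) * gk i s (y - z) - e * (heat_kernel h (x - y) * gk i.+1 s (y - z)).
have E : \int[mu]_y F y = gk i (h + s) (x - (z - e)) - gk i (h + s) (x - z) - e * I.
  rewrite IntB; [|apply: itgB; exact: heat_gk_itg|apply: itgZ; exact: heat_gk_itg].
  by rewrite IntB ?IntZ ?ih//; exact: heat_gk_itg.
have H1 : `|\int[mu]_y F y| <= C1 * e ^+ 2.
  have -> : C1 * e ^+ 2 = \int[mu]_y (C * Num.sqrt s ^- i.+2 * e ^+ 2 * (heat_kernel h (x - y) * heat_kernel (4 * s) (y - z))).
    by rewrite IntZ// E4 /C1; ring.
  apply: Int_abs_le.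
  - apply: itg_measurable; apply: itgB; last by apply: itgZ; exact: heat_gk_itg.
    by apply: itgB; exact: heat_gk_itg.
  - exact: itgZ.
  - move=> y.
    have -> : F y = heat_kernel h (x - y) * (gk i s (y - z + e) - gk i s (y - z) - e * gk i.+1 s (y - z)).
      by rewrite /F opprB addrCA (addrC e); ring.
    rewrite normrM (ger0_norm (heat_ge0 _ _)).
    have -> : C * Num.sqrt s ^- i.+2 * e ^+ 2 * (heat_kernel h (x - y) * heat_kernel (4 * s) (y - z)) =
      heat_kernel h (x - y) * (C * Num.sqrt s ^- i.+2 * heat_kernel (4 * s) (y - z) * e ^+ 2) by ring.
    by rewrite ler_wpM2l ?heat_ge0//; exact: H.
rewrite E in H1.
have -> : e * `|I - g| = `|e * I - e * g| by rewrite -mulrBr normrM (gtr0_norm e0).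
have ez : x - (z - e) = x - z + e by ring.
rewrite ez in H1.
rewrite mulrDl; move: H1 H2; rewrite -/g -/C2.
set a := gk i _ _; set b := gk i _ _; move=> H1 H2.
have -> : e * I - e * g = (a - b - e * g) - (a - b - e * I) by ring.
by apply: le_trans (ler_normB _ _) _; rewrite addrC lerD.
Qed.

End KernelBounds.

(** * Integrable power singularities in time *)

Section SingularIntegrals.
Context {R : realType}.
Notation mu := (@lebesgue_measure R).

(** The singularity (b - s)^(- c) extended by 0 to the whole line, so that it majorizes time
    integrands without carrying a domain of integration. *)
Definition sing (a b c s : R) : R := if a < s < b then (b - s) `^ (- c) else 0.

Lemma sing_ge0 a b c s : 0 <= sing a b c s.
Proof. by rewrite /sing; case: ifP => // _; exact: powR_ge0. Qed.

Lemma singE a b c s : sing a b c s = ((fun s => (b - s) `^ (- c)) \_ `]a, b[) s.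
Proof. by rewrite /sing patchE mem_setE in_itv. Qed.

Lemma measurable_sub_powR (b c : R) (D : set R) : measurable_fun D (fun s => (b - s) `^ (- c)).
Proof.
have m1 : measurable_fun D (fun s => b - s) by exact: measurable_funB.
have m2 : measurable_fun [set: R] (fun y : R => y `^ (- c)) by exact: measurable_powR.
exact: measurableT_comp m2 m1.
Qed.

Lemma measurable_ifitv d (T : measurableType d) (a b c f : T -> R) :
  measurable_fun setT a -> measurable_fun setT b -> measurable_fun setT c ->
  measurable_fun setT f ->
  measurable_fun setT (fun t => if a t < b t < c t then f t else 0).
Proof.
move=> ma mb mc mf; apply: measurable_fun_ifT => //.
by apply: measurable_and => //; apply: measurable_fun_ltr.
Qed.


Lemma is_derive_sub_powR (b c s : R) : s < b -> c != 1 ->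
  is_derive s 1 (fun s => - ((b - s) `^ (1 - c) / (1 - c))) ((b - s) `^ (- c)).
Proof.
move=> sb c1; have bs : 0 < b - s by rewrite subr_gt0.
have c10 : 1 - c != 0 by rewrite subr_eq0 eq_sym.
have dp : is_derive (b - s) 1 (fun y : R => y `^ (1 - c)) ((1 - c) * (b - s) `^ (- c)).
  have bi : b - s \in `]0, +oo[ by rewrite in_itv/= bs.
  apply: DeriveDef; first by apply: derivable_powR; rewrite in_itv/= bs.
  rewrite -derive1E powR_derive1; last by rewrite in_itv/= bs.
  by congr (_ * _ `^ _); rewrite addrAC subrr add0r.
have dc : is_derive s 1 (fun s => (b - s) `^ (1 - c)) (- ((1 - c) * (b - s) `^ (- c))).
  have := @is_derive1_comp _ (fun y : R => y `^ (1 - c)) (fun s => b - s) s _ (- 1) dp.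
  rewrite mulrN1; apply.
  have dB : is_derive s 1 (cst b - id : R -> R) (0 - 1) by apply: is_deriveB.
  by rewrite sub0r in dB.
apply: is_derive_eq; rewrite /GRing.scale/=.
by field.
Qed.

(** The primitive is explicit on [a, b'] for b' < b; monotone convergence along b' tending to b
    gives integrability and the bound together. *)
Lemma sing_itg (a b c : R) : a <= b -> 0 <= c < 1 ->
  itg (sing a b c) /\ \int[mu]_s sing a b c s <= (b - a) `^ (1 - c) / (1 - c).
Proof.
move=> ab /andP[c0 c1].
have c10 : 0 < 1 - c by rewrite subr_gt0.
have cn : c != 1 by rewrite lt_eqF.
move: ab; rewrite le_eqVlt => /predU1P[->|ab].
  have E : sing b b c = cst 0.
    by apply/funext => s; rewrite /sing; case: ifP => // /andP[h1 /(lt_trans h1)]; rewrite ltxx.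
  split; first by rewrite E; exact: integrable0.
  by rewrite E Rintegral_cst// mul0r divr_ge0 ?powR_ge0 ?ltW.
have ba : 0 < b - a by rewrite subr_gt0.
set M := _ / (1 - c).
pose f (s : R) := ((b - s) `^ (- c))%:E.
(* The denominator starts at 2 so that [w 0] already lies strictly to the right of a. *)
pose w n : R := b - (b - a) / n.+2%:R.
have wb n : w n < b by rewrite /w ltrBlDr ltrDl divr_gt0.
have aw n : a < w n.
  rewrite /w ltrBrDr -ltrBrDl ltr_pdivrMr ?ltr0n//.
  by rewrite ltr_pMr// ltr1n.
pose F n : set R := `[a, w n]%classic.
have I n : (\int[mu]_(s in F n) f s <= M%:E)%E.
  have dF s : s < b -> is_derive s 1 (fun s => - ((b - s) `^ (1 - c) / (1 - c))) ((b - s) `^ (- c)).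
    by move=> sb; exact: is_derive_sub_powR.
  have cF s : s < b -> {for s, continuous (fun s => - ((b - s) `^ (1 - c) / (1 - c)))}.
    move=> /dF d; apply: differentiable_continuous; apply/derivable1_diffP.
    by case: d.
  rewrite (@continuous_FTC2 _ (fun s => (b - s) `^ (- c)) (fun s => - ((b - s) `^ (1 - c) / (1 - c))))//.
  - rewrite -EFinB lee_fin opprK -/M addrC gerDl oppr_le0.
    by rewrite divr_ge0 ?powR_ge0// ltW.
  - apply: continuous_in_subspaceT => s; rewrite inE/= in_itv/= => /andP[_ sw].
    have sb := le_lt_trans sw (wb n).
    have dp : derivable (fun y : R => y `^ (- c)) (b - s) 1.
      by apply: derivable_powR; rewrite in_itv/= subr_gt0 sb.
    apply: (@continuous_comp _ _ _ (fun s => b - s) (fun y : R => y `^ (- c))).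
      by apply: continuousB; [exact: cst_continuous|move=> z; exact: cvg_id].
    by apply: differentiable_continuous; apply/derivable1_diffP.
  - split.
    + move=> s; rewrite in_itv/= => /andP[_ sw].
      by have [] := dF s (lt_trans sw (wb n)).
    + by apply: cvg_at_right_filter; apply: cF; exact: lt_trans (aw n) (wb n).
    + by apply: cvg_at_left_filter; apply: cF.
  - move=> s; rewrite in_itv/= => /andP[_ sw].
    by rewrite derive1E; have /@derive_val -> := dF s (lt_trans sw (wb n)).
have U : `]a, b[%classic `<=` \bigcup_n F n.
  move=> s; rewrite /= in_itv/= => /andP[a_s sb].
  have bs : 0 < b - s by rewrite subr_gt0.
  have [n hn] : exists n, (b - a) / n.+2%:R <= b - s.
    exists (Num.trunc ((b - a) / (b - s))).
    rewrite ler_pdivrMr// mulrC -ler_pdivrMr// ltW//.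
    apply: lt_le_trans (truncnS_gt _) _.
    by rewrite ler_nat.
  exists n => //; rewrite /F/= in_itv/= (ltW a_s)/= /w.
  by rewrite lerBrDr -lerBrDl.
have mF n : measurable (F n) by exact: measurable_itv.
have mf (D : set R) : measurable_fun D f by apply/measurable_EFinP; exact: measurable_sub_powR.
have f0 s : (0 <= f s)%E by rewrite lee_fin powR_ge0.
have L : (\int[mu]_(s in \bigcup_n F n) f s <= M%:E)%E.
  have cv : (\int[mu]_(x in F i) f x)%E @[i --> \oo] --> (\int[mu]_(x in \bigcup_i F i) f x)%E.
    apply: ge0_nondecreasing_set_cvg_integral => //.
    move=> n m nm; apply/subsetPset => s; rewrite /F/= !in_itv/= => /andP[-> /=] sw.
    apply: le_trans sw _; rewrite /w lerD2l lerN2 ler_wpM2l ?(ltW ba)//.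
      by rewrite lef_pV2 ?posrE// ler_nat !ltnS.
    by move=> i; exact: mf.
  by apply: (cvge_le _ cv); exact: nearW.
have L2 : (\int[mu]_(s in `]a, b[) f s <= M%:E)%E.
  apply: le_trans L; apply: ge0_subset_integral => //.
    by apply: bigcup_measurable => n _; exact: mF.
  exact: mf.
have E : (\int[mu]_s (sing a b c s)%:E = \int[mu]_(s in `]a, b[) f s)%E.
  by rewrite [RHS]integral_mkcond; apply: eq_integral => s _; rewrite singE restrict_EFin.
have iS : itg (sing a b c).
  apply/integrableP; split.
    by apply/measurable_EFinP; apply: measurable_ifitv => //; exact: measurable_sub_powR.
  under eq_integral do rewrite /= ger0_norm ?sing_ge0//.
  by rewrite E (le_lt_trans L2)// ltry.
split => //; rewrite -lee_fin /Rintegral fineK ?E// -E.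
exact: (integrable_fin_num _ iS).
Qed.

End SingularIntegrals.

(** * Duhamel integrals and the action of the heat semigroup on them *)

Section Duhamel.
Context {R : realType}.
Notation mu := (@lebesgue_measure R).
Implicit Types (h s t x y z e M : R).

Lemma Int_eq0 (F : R -> R) : (forall x, F x = 0) -> \int[mu]_x F x = 0.
Proof.
move=> F0; have -> : F = cst 0 by apply/funext => x; rewrite F0.
by rewrite Rintegral_cst// mul0r.
Qed.

(* i-th space derivatives of the heat semigroup and of the Duhamel integral. *)
Definition Sk (i : nat) h (f : R -> R) x := \int[mu]_y (gk i h (x - y) * f y).

Definition Duh (i : nat) (f : R * R -> R) t x :=
  \int[mu]_s (if 0 < s < t then Sk i (t - s) (fun y => f (s, y)) x else 0).

Lemma Sk_itg i h (f : R -> R) x M : 0 < h -> measurable_fun setT f ->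
  (forall y, `|f y| <= M) -> itg (fun y => gk i h (x - y) * f y).
Proof.
move=> h0 mf fM.
apply: (@itg_le _ _ (fun y => M * `|gk i h (x - y)|)).
- by apply: measurable_funM => //; apply: measurable_gk => //; exact: measurable_funB.
- by apply: itgZ; apply: itg_abs; exact: gk_itg.
- by move=> y; rewrite normrM mulrC ler_wpM2r.
Qed.

Lemma Sk_le i : exists2 C, 0 < C & forall h (f : R -> R) x M, 0 < h ->
  measurable_fun setT f -> (forall y, `|f y| <= M) ->
  `|Sk i h f x| <= C * M * Num.sqrt h ^- i.
Proof.
have [C C0 H] := @gk_le0 R i; exists C => // h f x M h0 mf fM.
have M0 : 0 <= M by apply: le_trans (fM 0).
have h20 : 0 < 2 * h by rewrite mulr_gt0.
have -> : C * M * Num.sqrt h ^- i = \int[mu]_y (C * M * Num.sqrt h ^- i * heat_kernel (2 * h) (x - y)).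
  by rewrite IntZ ?heat_Int ?mulr1//; exact: heat_itg.
apply: Int_abs_le.
- by apply: itg_measurable; exact: Sk_itg h0 mf fM.
- by apply: itgZ; exact: heat_itg.
- move=> y; rewrite normrM.
  have -> : C * M * Num.sqrt h ^- i * heat_kernel (2 * h) (x - y) =
     (C * Num.sqrt h ^- i * heat_kernel (2 * h) (x - y)) * M by ring.
  by apply: ler_pM => //; exact: H.
Qed.

Lemma sqrtV_powR i h : 0 < h -> Num.sqrt h ^- i = h `^ (- (i%:R / 2)).
Proof.
move=> h0; rewrite powRN [_ / 2]mulrC powRrM powR12_sqrt ?(ltW h0)//.
by rewrite powR_mulrn// sqrtr_ge0.
Qed.

Lemma measurable_Duh i (f : R * R -> R) : measurable_fun setT f ->
  measurable_fun setT (fun z : R * R => Duh i f z.1 z.2).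
Proof.
move=> mf; rewrite /Duh.
apply: (@measurable_Rintegral _ _ _ (fun w : (R * R) * R => if 0 < w.2 < w.1.1 then
  Sk i (w.1.1 - w.2) (fun y => f (w.2, y)) w.1.2 else 0)).
have m1 : measurable_fun setT (fun w : (R * R) * R => w.1.1) by apply: measurableT_comp.
have m2 : measurable_fun setT (fun w : (R * R) * R => w.1.2) by apply: measurableT_comp.
apply: measurable_ifitv => //.
rewrite /Sk.
apply: (@measurable_Rintegral _ _ _ (fun w : ((R * R) * R) * R =>
  gk i (w.1.1.1 - w.1.2) (w.1.1.2 - w.2) * f (w.1.2, w.2))).
have n1 : measurable_fun setT (fun w : ((R * R) * R) * R => w.1.1.1).
  by apply: (measurableT_comp m1).
have n2 : measurable_fun setT (fun w : ((R * R) * R) * R => w.1.1.2).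
  by apply: (measurableT_comp m2).
have n3 : measurable_fun setT (fun w : ((R * R) * R) * R => w.1.2) by apply: measurableT_comp.
apply: measurable_funM.
  by apply: measurable_gk; exact: measurable_funB.
by apply: (measurableT_comp mf); apply: measurable_fun_pair.
Qed.

(** The Duhamel integrand at time t after a further heat flow of length h; for h = 0 it is the
    integrand of [Duh] itself. *)
Definition Duhk (i : nat) (f : R * R -> R) t h x s :=
  if 0 < s < t then Sk i (t + h - s) (fun y => f (s, y)) x else 0.

Lemma measurable_slice (f : R * R -> R) s : measurable_fun setT f ->
  measurable_fun setT (fun y => f (s, y)).
Proof.
by move=> mf; apply: (measurableT_comp mf); apply: measurable_fun_pair.
Qed.

Lemma measurable_Duhk i (f : R * R -> R) t h : measurable_fun setT f ->
  measurable_fun setT (fun z : R * R => Duhk i f t h z.1 z.2).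
Proof.
move=> mf; rewrite /Duhk /Sk; apply: measurable_ifitv => //.
apply: (@measurable_Rintegral _ _ _ (fun w : (R * R) * R =>
  gk i (t + h - w.1.2) (w.1.1 - w.2) * f (w.1.2, w.2))).
have m1 : measurable_fun setT (fun w : (R * R) * R => w.1.1) by apply: measurableT_comp.
have m2 : measurable_fun setT (fun w : (R * R) * R => w.1.2) by apply: measurableT_comp.
apply: measurable_funM.
  by apply: measurable_gk; exact: measurable_funB.
by apply: (measurableT_comp mf); apply: measurable_fun_pair.
Qed.

Lemma Duhk_le i : (i <= 1)%N -> exists2 C, 0 < C &
  forall (f : R * R -> R) t h M, measurable_fun setT f -> 0 <= h -> 0 <= M ->
  (forall s y, 0 < s < t -> `|f (s, y)| <= M) ->
  forall x s, `|Duhk i f t h x s| <= C * M * sing 0 t (i%:R / 2) s.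
Proof.
move=> i1; have [C C0 H] := Sk_le i; exists C => // f t h M mf h0 M0 fM x s.
rewrite /Duhk /sing; case: ifPn => [st|_]; last by rewrite normr0 mulr0.
have ts : 0 < t - s by case/andP: st => _ st; rewrite subr_gt0.
have tsh : 0 < t + h - s by rewrite addrAC ltr_wpDr.
apply: le_trans (H _ _ _ M tsh (measurable_slice s mf) (fun y => fM s y st)) _.
rewrite ler_wpM2l ?mulr_ge0 ?(ltW C0)// sqrtV_powR// -[leRHS]sqrtV_powR//.
rewrite -sqrtV_powR//.
rewrite lef_pV2 ?posrE ?exprn_gt0 ?sqrtr_gt0//.
rewrite lerXn2r ?nnegrE ?sqrtr_ge0//; apply: ler_wsqrtr.
by rewrite addrAC lerDl.
Qed.

(** The kernel of the i-th derivative has size (t - s)^(- i / 2), which is integrable in s for i =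
    0, 1 only; this limits the whole development to one space derivative of Duhamel integrals. *)
Lemma half_lt1 i : (i <= 1)%N -> 0 <= (i%:R / 2 : R) < 1.
Proof. by case: i => [|[|]]// _; lra. Qed.

Lemma Duhk_itg i (f : R * R -> R) t h M x : (i <= 1)%N -> 0 < t -> measurable_fun setT f ->
  0 <= h -> 0 <= M ->
  (forall s y, 0 < s < t -> `|f (s, y)| <= M) -> itg (Duhk i f t h x).
Proof.
move=> i1 t0 mf h0 M0 fM; have [C C0 H] := Duhk_le i1.
apply: (itg_le _ (itgZ (C * M) (sing_itg (ltW t0) (half_lt1 i1)).1)).
  exact: (measurable_slice x (measurable_Duhk i t h mf)).
by move=> s; exact: H.
Qed.

Lemma Sk_CK i h s (f : R -> R) x M : 0 < h -> 0 < s -> measurable_fun setT f ->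
  (forall y, `|f y| <= M) ->
  \int[mu]_z (heat_kernel h (x - z) * Sk i s f z) = Sk i (h + s) f x.
Proof.
move=> h0 s0 mf fM; have [C C0 H] := @gk_le0 R i.
have s20 : 0 < 2 * s by rewrite mulr_gt0.
pose K (w : R * R) := heat_kernel h (x - w.1) * (gk i s (w.1 - w.2) * f w.2).
have mK : measurable_fun setT K.
  have m1 : measurable_fun setT (fun w : R * R => w.1) by exact: measurable_fst.
  have m2 : measurable_fun setT (fun w : R * R => w.2) by exact: measurable_snd.
  apply: measurable_funM.
    by apply: measurable_heat; [exact: measurable_cst|apply: measurable_funB].
  apply: measurable_funM; last exact: measurableT_comp mf m2.
  by apply: measurable_gk; [exact: measurable_cst|apply: measurable_funB].
have iK1 z : itg (fun y => K (z, y)).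
  exact: (itgZ (heat_kernel h (x - z)) (Sk_itg i z s0 mf fM)).
have KE y : (fun z => K (z, y)) = (fun z => f y * (heat_kernel h (x - z) * gk i s (z - y))).
  by apply/funext => z; rewrite /K/=; ring.
have iK2 y : itg (fun z => K (z, y)).
  by rewrite KE; apply: itgZ; exact: heat_gk_itg.
have KB z : \int[mu]_y `|K (z, y)| <= C * Num.sqrt s ^- i * M * heat_kernel h (x - z).
  have -> : C * Num.sqrt s ^- i * M * heat_kernel h (x - z) =
      \int[mu]_y (C * Num.sqrt s ^- i * M * heat_kernel h (x - z) * heat_kernel (2 * s) (z - y)).
    by rewrite IntZ ?heat_Int ?mulr1//; exact: heat_itg.
  apply: Int_le; [exact: itg_abs|by apply: itgZ; exact: heat_itg|] => y.
  rewrite /K/= normrM (normrM (gk i s _)) (ger0_norm (heat_ge0 _ _)).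
  have -> : C / Num.sqrt s ^+ i * M * heat_kernel h (x - z) * heat_kernel (2 * s) (z - y) =
    heat_kernel h (x - z) * (C / Num.sqrt s ^+ i * heat_kernel (2 * s) (z - y) * M) by ring.
  rewrite ler_wpM2l ?heat_ge0//.
  by apply: ler_pM; [exact: normr_ge0|exact: normr_ge0|exact: H|exact: fM].
have [_ _ EQ] := Int_Fubini mK iK1 (itgZ _ (heat_itg x h0)) KB iK2.
have -> : \int[mu]_z (heat_kernel h (x - z) * Sk i s f z) = \int[mu]_z \int[mu]_y K (z, y).
  apply: eq_Rintegral => z _; rewrite /K /= IntZ; first by [].
  exact: Sk_itg s0 mf fM.
rewrite EQ; apply: eq_Rintegral => y _.
rewrite KE IntZ; last exact: heat_gk_itg.
by rewrite gk_CK// mulrC.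
Qed.

(** Fubini in (s, z), with the time singularity as the integrable majorant of the slices, reduces
    the claim to Chapman-Kolmogorov at fixed s. *)
Lemma Duh_semigroup i (f : R * R -> R) t h M x : (i <= 1)%N -> 0 < t -> 0 < h ->
  measurable_fun setT f -> 0 <= M ->
  (forall s y, 0 < s < t -> `|f (s, y)| <= M) ->
  \int[mu]_z (heat_kernel h (x - z) * Duh i f t z) = \int[mu]_s Duhk i f t h x s.
Proof.
move=> i1 t0 h0 mf M0 fM; have [C C0 H] := Duhk_le i1.
have DE z : Duh i f t z = \int[mu]_s Duhk i f t 0 z s.
  by apply: eq_Rintegral => s _; rewrite /Duhk addr0.
have mh : measurable_fun setT (fun z => heat_kernel h (x - z)).
  by apply: measurable_heat => //; exact: measurable_funB.
have iS := (sing_itg (ltW t0) (half_lt1 i1)).1.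
pose F (w : R * R) := heat_kernel h (x - w.2) * Duhk i f t 0 w.2 w.1.
have mF : measurable_fun setT F.
  have m2 : measurable_fun setT (fun w : R * R => w.2) by exact: measurable_snd.
  apply: measurable_funM; first exact: (measurableT_comp mh m2).
  apply: (measurableT_comp (measurable_Duhk i t 0 mf) (_ : measurable_fun setT (fun w : R * R => (w.2, w.1)))).
  exact: measurable_swap.
have Fle s z : `|F (s, z)| <= C * M * sing 0 t (i%:R / 2) s * heat_kernel h (x - z).
  rewrite /F/= normrM (ger0_norm (heat_ge0 _ _)) mulrC ler_wpM2r ?heat_ge0//.
  exact: H.
have iF1 s : itg (fun z => F (s, z)).
  apply: (itg_le _ (itgZ (C * M * sing 0 t (i%:R / 2) s) (heat_itg x h0))) => [|z]; last exact: Fle.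
  exact: measurable_slice mF.
have iF2 z : itg (fun s => F (s, z)).
  exact: (itgZ (heat_kernel h (x - z)) (Duhk_itg z i1 t0 mf (lexx 0) M0 fM)).
have FB s : \int[mu]_z `|F (s, z)| <= C * M * sing 0 t (i%:R / 2) s.
  have -> : C * M * sing 0 t (i%:R / 2) s = \int[mu]_z (C * M * sing 0 t (i%:R / 2) s * heat_kernel h (x - z)).
    by rewrite IntZ ?heat_Int ?mulr1//; exact: heat_itg.
  by apply: Int_le => //; [exact: itg_abs|apply: itgZ; exact: heat_itg].
have [A _ EQ] := Int_Fubini mF iF1 (itgZ (C * M) iS) FB iF2.
have -> : \int[mu]_z (heat_kernel h (x - z) * Duh i f t z) = \int[mu]_z \int[mu]_s F (s, z).
  apply: eq_Rintegral => z _; rewrite /F/= IntZ; first by rewrite DE.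
  exact: (Duhk_itg z i1 t0 mf (lexx 0) M0 fM).
rewrite -EQ; apply: eq_Rintegral => s _.
rewrite /F/= /Duhk; case: ifPn => [st|_]; last first.
  by apply: Int_eq0 => z; rewrite mulr0.
have ts : 0 < t - s by case/andP: st => _ st; rewrite subr_gt0.
rewrite addr0 (Sk_CK i x h0 ts (measurable_slice s mf) (fun y => fM s y st)).
have e : h + (t - s) = t + h - s by ring.
by rewrite e.
Qed.

End Duhamel.

(** * Short time increments and moduli of continuity of the kernels *)

Section DuhamelRegularity.
Context {R : realType}.
Notation mu := (@lebesgue_measure R).
Implicit Types (h s t x y z e M : R).

Lemma DuhE i (f : R * R -> R) t x : Duh i f t x = \int[mu]_s Duhk i f t 0 x s.
Proof. by apply: eq_Rintegral => s _; rewrite /Duhk addr0. Qed.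

Lemma Duh_le i : (i <= 1)%N -> exists2 C, 0 < C &
  forall (f : R * R -> R) t M x, 0 < t -> measurable_fun setT f -> 0 <= M ->
  (forall s y, 0 < s < t -> `|f (s, y)| <= M) ->
  `|Duh i f t x| <= C * M * t `^ (1 - i%:R / 2).
Proof.
move=> i1; have [C C0 H] := @Duhk_le R i i1.
have hi : 0 <= (i%:R / 2 : R) < 1 by exact: half_lt1.
exists (C / (1 - i%:R / 2)).
  by rewrite divr_gt0// subr_gt0; case/andP: hi.
move=> f t M x t0 mf M0 fM; rewrite DuhE.
have [iS S] := sing_itg (ltW t0) hi.
apply: (@le_trans _ _ (\int[mu]_s (C * M * sing 0 t (i%:R / 2) s))).
  apply: Int_abs_le; [|exact: itgZ|by move=> s; exact: H].
  exact: (measurable_slice x (measurable_Duhk i t 0 mf)).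
rewrite IntZ//.
have -> : C / (1 - i%:R / 2) * M * t `^ (1 - i%:R / 2) = C * M * (t `^ (1 - i%:R / 2) / (1 - i%:R / 2)) by ring.
rewrite ler_wpM2l ?mulr_ge0 ?(ltW C0)//.
by rewrite subr0 in S.
Qed.

(** The part of the integrand at time t + h that comes from sources on [t, t + h[. *)
Definition Duht i (f : R * R -> R) t h x s :=
  if 0 < s < t + h then (if s < t then 0 else Sk i (t + h - s) (fun y => f (s, y)) x) else 0.

Lemma Duht_itg i (f : R * R -> R) t h M x : (i <= 1)%N -> 0 < t -> 0 < h ->
  measurable_fun setT f -> 0 <= M ->
  (forall s y, 0 < s < t + h -> `|f (s, y)| <= M) -> itg (Duht i f t h x).
Proof.
move=> i1 t0 h0 mf M0 fM; have th0 := addr_gt0 t0 h0.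
have E : Duht i f t h x = (fun s => Duhk i f (t + h) 0 x s - Duhk i f t h x s).
  apply/funext => s; rewrite /Duht /Duhk addr0.
  case: (ltP 0 s) => s0 //=; last by rewrite subr0.
  case: (ltP s t) => st.
    by rewrite (lt_trans st) ?ltrDl// subrr.
  by case: ifP; rewrite subr0.
rewrite E; apply: itgB; first exact: (Duhk_itg x i1 th0 mf (lexx 0) M0 fM).
apply: (Duhk_itg x i1 t0 mf (ltW h0) M0) => s y /andP[s0 st].
by apply: fM; rewrite s0 (lt_trans st)// ltrDl.
Qed.

(** The flow property: past sources are transported by the heat semigroup, new ones are added. Time
    regularity and the step expansions rest on it. *)
Lemma Duh_step i (f : R * R -> R) t h M x : (i <= 1)%N -> 0 < t -> 0 < h ->
  measurable_fun setT f -> 0 <= M ->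
  (forall s y, 0 < s < t + h -> `|f (s, y)| <= M) ->
  Duh i f (t + h) x = \int[mu]_z (heat_kernel h (x - z) * Duh i f t z) +
    \int[mu]_s Duht i f t h x s.
Proof.
move=> i1 t0 h0 mf M0 fM; have th0 := addr_gt0 t0 h0.
have fM' s y : 0 < s < t -> `|f (s, y)| <= M.
  by move=> /andP[s0 st]; apply: fM; rewrite s0 (lt_trans st)// ltrDl.
rewrite (Duh_semigroup x i1 t0 h0 mf M0 fM') DuhE -IntD.
- apply: eq_Rintegral => s _; rewrite /Duht /Duhk addr0.
  case: (ltP 0 s) => s0 /=; last by rewrite addr0.
  case: (ltP s t) => st.
    by rewrite (lt_trans st) ?ltrDl// addr0.
  by rewrite add0r.
- exact: (Duhk_itg x i1 t0 mf (ltW h0) M0 fM').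
- exact: Duht_itg M0 fM.
Qed.

Lemma Duht_le i : (i <= 1)%N -> exists2 C, 0 < C &
  forall (f : R * R -> R) t h M x, 0 < t -> 0 < h -> measurable_fun setT f -> 0 <= M ->
  (forall s y, 0 < s < t + h -> `|f (s, y)| <= M) ->
  `|\int[mu]_s Duht i f t h x s| <= C * M * (2 * h) `^ (1 - i%:R / 2).
Proof.
move=> i1; have [C C0 H] := @Sk_le R i.
have hi : 0 <= (i%:R / 2 : R) < 1 by exact: half_lt1.
exists (C / (1 - i%:R / 2)).
  by rewrite divr_gt0// subr_gt0; case/andP: hi.
move=> f t h M x t0 h0 mf M0 fM.
(* The window is enlarged to ]t - h, t + h[ because [sing] lives on an open interval and s = t must
   be covered; hence 2 h in the bound. *)
have ab : t - h <= t + h by rewrite lerD2l ltW// gtrN.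
have [iS S] := sing_itg ab hi.
apply: (@le_trans _ _ (\int[mu]_s (C * M * sing (t - h) (t + h) (i%:R / 2) s))).
  apply: Int_abs_le; [|exact: itgZ|] => [|s].
    by apply: itg_measurable; exact: Duht_itg i1 t0 h0 mf M0 fM.
  rewrite /Duht; case: ifPn => [/andP[s0 sth]|_]; last first.
    by rewrite normr0 !mulr_ge0 ?(ltW C0)// sing_ge0.
  case: ltP => ts; first by rewrite normr0 !mulr_ge0 ?(ltW C0)// sing_ge0.
  have hs : 0 < t + h - s by rewrite subr_gt0.
  rewrite /sing sth (lt_le_trans _ ts) ?ltrBlDr ?ltrDl//=.
  rewrite -sqrtV_powR//; apply: H => //; first exact: measurable_slice.
  by move=> y; apply: fM; rewrite s0.
rewrite IntZ//.
have -> : C / (1 - i%:R / 2) * M * (2 * h) `^ (1 - i%:R / 2) = C * M * ((2 * h) `^ (1 - i%:R / 2) / (1 - i%:R / 2)) by ring.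
rewrite ler_wpM2l ?mulr_ge0 ?(ltW C0)//.
have e : t + h - (t - h) = 2 * h by ring.
by rewrite e in S.
Qed.

(** With a = (y - x)^2 and r = h, a fractional moment of the Gaussian is bounded by its mass and its
    second moment. *)
Lemma quarter_le (a r : R) : 0 <= a -> 0 < r -> a `^ 4^-1 <= r `^ 4^-1 * (1 + a / r).
Proof.
move=> a0 r0; have ar : 0 <= a / r by rewrite divr_ge0// ltW.
have -> : a = r * (a / r) by rewrite mulrCA divff ?mulr1// gt_eqF.
rewrite powRM ?(ltW r0)// [r * _ / r]mulrC mulKf ?gt_eqF//.
rewrite ler_wpM2l ?powR_ge0//.
have [h1|h1] := leP (a / r) 1.
  apply: (@le_trans _ _ 1); last by rewrite lerDl.
  apply: (@le_trans _ _ (1 `^ 4^-1)); last by rewrite powR1.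
  by apply: ge0_ler_powR; rewrite ?nnegrE ?invr_ge0.
apply: (@le_trans _ _ (a / r)); last by rewrite lerDr.
rewrite -[leRHS](powRr1 ar); apply: ler_powR; first exact: ltW.
by rewrite invf_le1//; lra.
Qed.

Lemma heat_itg_bounded h x (f : R -> R) M : 0 < h -> measurable_fun setT f ->
  (forall y, `|f y| <= M) -> itg (fun y => heat_kernel h (x - y) * f y).
Proof.
move=> h0 mf fM; have := Sk_itg 0 x h0 mf fM.
by rewrite (_ : (fun y => _) = (fun y => heat_kernel h (x - y) * f y))//; apply/funext => y; rewrite gk0.
Qed.

(** By [quarter_le] the oscillation integrates to K h^(1/4) times 1 + 2 h / h, where 2 h is the
    second moment; this is the factor 3. *)
Lemma heat_holder h x (f : R -> R) M a K L : 0 < h -> measurable_fun setT f ->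
  (forall y, `|f y| <= M) -> 0 <= K ->
  (forall y, `|f y - a| <= K * ((y - x) ^+ 2) `^ 4^-1 + L) ->
  `|\int[mu]_y (heat_kernel h (x - y) * f y) - a| <= 3 * K * h `^ 4^-1 + L.
Proof.
move=> h0 mf fM K0 fK.
have iG := heat_itg x h0; have iF := heat_itg_bounded x h0 mf fM.
have [i2 E2] := heat_moment2 x h0.
have -> : a = \int[mu]_y (a * heat_kernel h (x - y)).
  by rewrite IntZ// heat_Int// mulr1.
rewrite -IntB//; last exact: itgZ.
set r := h `^ 4^-1.
have iB : itg (fun y => (K * r + L) * heat_kernel h (x - y) + K * r / h * ((y - x) ^+ 2 * heat_kernel h (x - y))).
  by apply: itgD; exact: itgZ.
have -> : 3 * K * r + L = \int[mu]_y ((K * r + L) * heat_kernel h (x - y) + K * r / h * ((y - x) ^+ 2 * heat_kernel h (x - y))).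
  rewrite IntD; [|exact: itgZ|exact: itgZ].
  by rewrite !IntZ// heat_Int// E2; field; rewrite gt_eqF.
apply: Int_abs_le => //.
  by apply: itg_measurable; apply: itgB => //; exact: itgZ.
move=> y.
have -> : heat_kernel h (x - y) * f y - a * heat_kernel h (x - y) = (f y - a) * heat_kernel h (x - y) by ring.
rewrite normrM (ger0_norm (heat_ge0 _ _)).
have -> : (K * r + L) * heat_kernel h (x - y) + K * r / h * ((y - x) ^+ 2 * heat_kernel h (x - y)) =
  (K * (r * (1 + (y - x) ^+ 2 / h)) + L) * heat_kernel h (x - y) by field; rewrite gt_eqF.
rewrite ler_wpM2r ?heat_ge0//; apply: le_trans (fK y) _.
by rewrite lerD2r ler_wpM2l// quarter_le// sqr_ge0.
Qed.

(** The source is frozen at (t, x): space oscillation costs 3 K h^(1/4) by [heat_holder], time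
    oscillation K h^(1/4), over an interval of length h. *)
Lemma Duht_holder (f : R * R -> R) t h M x K : 0 < t -> 0 < h -> measurable_fun setT f ->
  0 <= M -> (forall s y, 0 < s < t + h -> `|f (s, y)| <= M) -> 0 <= K ->
  (forall s y, t <= s < t + h -> `|f (s, y) - f (t, x)| <= K * ((y - x) ^+ 2) `^ 4^-1 + K * h `^ 4^-1) ->
  `|\int[mu]_s Duht 0 f t h x s - h * f (t, x)| <= 4 * K * h `^ 4^-1 * h.
Proof.
move=> t0 h0 mf M0 fM K0 fK.
pose I s : R := if t <= s < t + h then 1 else 0.
have IE : I = \1_(`[t, t + h[%classic).
  by apply/funext => s; rewrite /I indicE mem_setE in_itv/=; case: (_ && _).
have iI : itg I by rewrite IE; exact: integrable_indic_itv.
have II : \int[mu]_s I s = h.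
  have mE : mu `[t, t + h[%classic = h%:E.
    rewrite lebesgue_measure_itv/= lte_fin ltrDl h0 -EFinB; congr EFin; ring.
  by rewrite IE /Rintegral integral_indic//= setIT mE.
have iT := Duht_itg x (isT : (0 <= 1)%N) t0 h0 mf M0 fM.
have -> : h * f (t, x) = \int[mu]_s (f (t, x) * I s) by rewrite IntZ// II mulrC.
rewrite -IntB//; last exact: itgZ.
have -> : 4 * K * h `^ 4^-1 * h = \int[mu]_s (4 * K * h `^ 4^-1 * I s) by rewrite IntZ// II.
apply: Int_abs_le; [|exact: itgZ|].
  by apply: itg_measurable; apply: itgB => //; exact: itgZ.
move=> s; rewrite /Duht /I.
have [ts|ts] := leP t s; last first.
  by rewrite (_ : (if 0 < s < t + h then 0 else 0) = 0) ?mulr0 ?subrr ?normr0//; case: ifP.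
have s0 := lt_le_trans t0 ts.
rewrite s0 /=; case: ltP => sth; last by rewrite !mulr0 subrr normr0.
have hs : 0 < t + h - s by rewrite subr_gt0.
rewrite !mulr1.
have -> : Sk 0 (t + h - s) (fun y => f (s, y)) x = \int[mu]_y (heat_kernel (t + h - s) (x - y) * f (s, y)).
  by apply: eq_Rintegral => y _; rewrite gk0.
apply: le_trans (@heat_holder (t + h - s) x (fun y => f (s, y)) M (f (t, x)) K (K * h `^ 4^-1) hs _ _ K0 _) _.
- exact: measurable_slice.
- by move=> y; apply: fM; rewrite s0.
- by move=> y; apply: fK; rewrite ts.
have le1 : (t + h - s) `^ 4^-1 <= h `^ 4^-1.
  apply: ge0_ler_powR; rewrite ?nnegrE ?invr_ge0 ?(ltW hs) ?(ltW h0)//.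
  by rewrite addrAC gerDr subr_le0.
have : 3 * K * (t + h - s) `^ 4^-1 <= 3 * K * h `^ 4^-1 by rewrite ler_wpM2l ?mulr_ge0.
by lra.
Qed.

Lemma powR_ratio (a h p : R) : 0 <= a -> 0 < h -> (a / h) `^ p = a `^ p * h `^ (- p).
Proof.
move=> a0 h0; rewrite powRM ?invr_ge0 ?(ltW h0)//.
by rewrite -powR_inv1 ?(ltW h0)// -powRrM mulN1r.
Qed.

Lemma le_powR1 (a p q : R) : 0 <= a <= 1 -> 0 < q -> q <= p -> a `^ p <= a `^ q.
Proof.
move=> /andP[a0 a1] q0 qp; move: a0; rewrite le_eqVlt => /predU1P[<-|a0].
  by rewrite !powR0// gt_eqF// (lt_le_trans q0).
by apply: ger_powR => //; rewrite a0.
Qed.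

Lemma gk_abs_Int i : exists2 C, 0 < C & forall h x, 0 < h ->
  \int[mu]_y `|gk i h (x - y)| <= C * Num.sqrt h ^- i.
Proof.
have [C C0 H] := @gk_le0 R i; exists C => // h x h0.
have h20 : 0 < 2 * h by rewrite mulr_gt0.
have -> : C * Num.sqrt h ^- i = \int[mu]_y (C * Num.sqrt h ^- i * heat_kernel (2 * h) (x - y)).
  by rewrite IntZ ?heat_Int ?mulr1//; exact: heat_itg.
apply: Int_le; [by apply: itg_abs; exact: gk_itg|by apply: itgZ; exact: heat_itg|].
by move=> y; exact: H.
Qed.

(** For e^2 <= h this is Taylor, otherwise each term is bounded separately. The exponent 3/4 is
    below 1, so that (t - s)^(- 3/4) is integrable, and above 1/2, so that the remainder is o(e). *)
Lemma gk0_mod : exists2 C, 0 < C & forall h x e, 0 < h ->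
  itg (fun y => gk 0 h (x + e - y) - gk 0 h (x - y) - e * gk 1 h (x - y)) /\
  \int[mu]_y `|gk 0 h (x + e - y) - gk 0 h (x - y) - e * gk 1 h (x - y)| <=
  C * (e ^+ 2 / h) `^ (3 / 4).
Proof.
have [C1 C10 H1] := @gk_taylor R 0; have [C2 C20 H2] := gk_abs_Int 1.
exists (C1 + 2 + C2) => [|h x e h0]; first by rewrite !addr_gt0.
have r0 : 0 <= e ^+ 2 / h by rewrite divr_ge0 ?sqr_ge0 ?ltW.
have h40 : 0 < 4 * h by rewrite mulr_gt0.
have i0 w := @gk_itg R 0 h w h0; have i1 w := @gk_itg R 1 h w h0.
set F := fun y => _ - _ - _.
have iF : itg F by apply: itgB; [exact: itgB|exact: itgZ].
split => //.
set r := e ^+ 2 / h in r0 *.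
have [eh|eh] := leP (e ^+ 2) h.
  have r1 : r <= 1 by rewrite ler_pdivrMr// mul1r.
  apply: (@le_trans _ _ (C1 * r)).
    have -> : C1 * r = \int[mu]_y (C1 * r * heat_kernel (4 * h) (x - y)).
      by rewrite IntZ ?heat_Int ?mulr1//; exact: heat_itg.
    apply: Int_le; [exact: itg_abs|by apply: itgZ; exact: heat_itg|] => y.
    have e1 : x + e - y = x - y + e by ring.
    rewrite /F e1; apply: le_trans (H1 h (x - y) e h0 eh) _.
    rewrite sqr_sqrtr ?(ltW h0)// /r le_eqVlt; apply/orP; left; apply/eqP.
    by ring.
  apply: (@le_trans _ _ (C1 * r `^ (3 / 4))).
    rewrite ler_wpM2l ?(ltW C10)// -[leLHS](powRr1 r0).
    by apply: le_powR1; rewrite ?r0 ?r1//; lra.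
  by rewrite ler_wpM2r ?powR_ge0//; lra.
have r1 : 1 <= r by rewrite ler_pdivlMr// mul1r ltW.
apply: (@le_trans _ _ (2 + C2 * r `^ 2^-1)).
  apply: (@le_trans _ _ (\int[mu]_y (gk 0 h (x + e - y) + gk 0 h (x - y) + `|e| * `|gk 1 h (x - y)|))).
    apply: Int_le; [exact: itg_abs|by apply: itgD; [exact: itgD|apply: itgZ; exact: itg_abs]|].
    move=> y; rewrite /F; apply: le_trans (ler_normB _ _) _.
    rewrite normrM lerD2r; apply: le_trans (ler_normB _ _) _.
    by rewrite !gk0 !ger0_norm ?heat_ge0.
  have iabs : itg (fun y => `|e| * `|gk 1 h (x - y)|) by apply: itgZ; exact: itg_abs.
  rewrite IntD//; last exact: itgD.
  rewrite IntD// IntZ; last exact: itg_abs.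
  have I0 w : \int[mu]_y gk 0 h (w - y) = 1.
    by rewrite -(heat_Int w h0); apply: eq_Rintegral => y _; rewrite gk0.
  rewrite !I0 lerD2l; apply: le_trans (ler_wpM2l (normr_ge0 e) (H2 h x h0)) _.
  rewrite powR12_sqrt// /r sqrtrM ?sqr_ge0// sqrtr_sqr expr1 sqrtrV ?(ltW h0)//.
  by rewrite mulrCA.
have p1 : 1 <= r `^ (3 / 4).
  rewrite -{1}(powRr0 r); apply: ler_powR => //; lra.
have p2 : r `^ 2^-1 <= r `^ (3 / 4) by apply: ler_powR => //; lra.
have h1 := ler_wpM2l (ltW C20) p2; have h2 := mulr_ge0 (ltW C10) (powR_ge0 r (3 / 4)).
have -> : (C1 + 2 + C2) * r `^ (3 / 4) = C1 * r `^ (3 / 4) + 2 * r `^ (3 / 4) + C2 * r `^ (3 / 4) by ring.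
by move: h1 h2 p1; lra.
Qed.

(** The same interpolation for one more derivative: the powers 1/2 and 1/4 of h add up to the same
    integrable singularity of order 3/4. *)
Lemma gk1_mod : exists2 C, 0 < C & forall h x e, 0 < h ->
  itg (fun y => gk 1 h (x + e - y) - gk 1 h (x - y)) /\
  \int[mu]_y `|gk 1 h (x + e - y) - gk 1 h (x - y)| <=
  C * h `^ (- 2^-1) * (e ^+ 2 / h) `^ 4^-1.
Proof.
have [C1 C10 H1] := @gk_lip R 1; have [C2 C20 H2] := gk_abs_Int 1.
exists (C1 + 2 * C2) => [|h x e h0]; first by rewrite addr_gt0// mulr_gt0.
have r0 : 0 <= e ^+ 2 / h by rewrite divr_ge0 ?sqr_ge0 ?ltW.
have h40 : 0 < 4 * h by rewrite mulr_gt0.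
have i1 w := @gk_itg R 1 h w h0.
set F := fun y => _ - _.
have iF : itg F by exact: itgB.
have hE : h `^ (- 2^-1) = (Num.sqrt h)^-1 by rewrite powRN powR12_sqrt ?ltW.
split => //.
set r := e ^+ 2 / h in r0 *.
have [eh|eh] := leP (e ^+ 2) h.
  have r1 : r <= 1 by rewrite ler_pdivrMr// mul1r.
  apply: (@le_trans _ _ (C1 * h `^ (- 2^-1) * r `^ 2^-1)).
    have -> : C1 * h `^ (- 2^-1) * r `^ 2^-1 = \int[mu]_y (C1 * h `^ (- 2^-1) * r `^ 2^-1 * heat_kernel (4 * h) (x - y)).
      by rewrite IntZ ?heat_Int ?mulr1//; exact: heat_itg.
    apply: Int_le; [exact: itg_abs|by apply: itgZ; exact: heat_itg|] => y.
    have e1 : x + e - y = x - y + e by ring.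
    rewrite /F e1; apply: le_trans (H1 h (x - y) e h0 eh) _.
    rewrite hE powR12_sqrt// /r sqrtrM ?sqr_ge0// sqrtr_sqr sqrtrV ?(ltW h0)//.
    rewrite le_eqVlt; apply/orP; left; apply/eqP.
    by rewrite expr2 invfM; ring.
  apply: (@le_trans _ _ (C1 * h `^ (- 2^-1) * r `^ 4^-1)).
    rewrite ler_wpM2l ?mulr_ge0 ?powR_ge0 ?(ltW C10)//.
    by apply: le_powR1; rewrite ?r0 ?r1//; lra.
  by rewrite ler_wpM2r ?powR_ge0// ler_wpM2r ?powR_ge0//; lra.
have r1 : 1 <= r by rewrite ler_pdivlMr// mul1r ltW.
apply: (@le_trans _ _ (2 * C2 * h `^ (- 2^-1))).
  apply: (@le_trans _ _ (\int[mu]_y (`|gk 1 h (x + e - y)| + `|gk 1 h (x - y)|))).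
    apply: Int_le; [exact: itg_abs|by apply: itgD; exact: itg_abs|].
    by move=> y; exact: ler_normB.
  rewrite IntD; [|exact: itg_abs|exact: itg_abs].
  have := H2 h x h0; have := H2 h (x + e) h0; rewrite hE expr1; lra.
have p1 : 1 <= r `^ 4^-1.
  rewrite -{1}(powRr0 r); apply: ler_powR => //; rewrite invr_ge0; lra.
apply: (@le_trans _ _ ((C1 + 2 * C2) * h `^ (- 2^-1))).
  by rewrite ler_wpM2r ?powR_ge0//; lra.
by rewrite ler_peMr// mulr_ge0 ?powR_ge0 ?addr_ge0 ?mulr_ge0 ?(ltW C10) ?(ltW C20).
Qed.

End DuhamelRegularity.
Ltac nonneg := repeat match goal with
  | |- is_true (_ <= _ ^+ _) => apply: exprn_ge0
  | |- is_true (_ <= (_ * _)%R) => apply: mulr_ge0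
  | |- is_true (_ <= (_ + _)%R) => apply: addr_ge0
  | |- is_true (_ <= _ ^-1) => rewrite invr_ge0
  | |- is_true (_ <= _ `^ _) => apply: powR_ge0
  | |- is_true (_ <= Num.sqrt _) => apply: sqrtr_ge0
  | |- is_true (_ <= expR _) => apply: expR_ge0
  | |- is_true (_ <= `| _ |) => apply: normr_ge0
  | |- is_true (_ <= _%:R) => apply: ler0n
  | |- _ => first [assumption | apply: heat_ge0 | apply: ltW; assumption | by []]
  end.

(** * Hölder estimates in space for Duhamel integrals *)

Section DuhamelHolder.
Context {R : realType}.
Notation mu := (@lebesgue_measure R).
Implicit Types (h s t x y z e M : R).

Lemma Int_mul_le (F f : R -> R) M : itg F -> measurable_fun setT f ->
  (forall y, `|f y| <= M) -> `|\int[mu]_y (F y * f y)| <= M * \int[mu]_y `|F y|.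
Proof.
move=> iF mf fM; rewrite -IntZ; last exact: itg_abs.
apply: Int_abs_le.
- by apply: measurable_funM => //; exact: itg_measurable.
- by apply: itgZ; exact: itg_abs.
- by move=> y; rewrite normrM mulrC ler_wpM2r.
Qed.

(** The right side is of order |e|^(3/2), so [Duh 1] is the space derivative of [Duh 0] and the
    integral is of class C^(1,1/2), without any continuity of the source. *)
Lemma Duh_mod0 : exists2 C, 0 < C & forall (f : R * R -> R) t M x e, 0 < t ->
  measurable_fun setT f -> 0 <= M -> (forall s y, 0 < s < t -> `|f (s, y)| <= M) ->
  `|Duh 0 f t (x + e) - Duh 0 f t x - e * Duh 1 f t x| <=
  C * M * t `^ 4^-1 * (e ^+ 2) `^ (3 / 4).
Proof.
have [C C0 H] := @gk0_mod R; exists (4 * C) => [|f t M x e t0 mf M0 fM].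
  by rewrite mulr_gt0.
have c01 : 0 <= (3 / 4 : R) < 1 by lra.
have [iS S] := sing_itg (ltW t0) c01.
have i0 w := Duhk_itg w (isT : (0 <= 1)%N) t0 mf (lexx 0) M0 fM.
have i1 w := Duhk_itg w (isT : (1 <= 1)%N) t0 mf (lexx 0) M0 fM.
rewrite !DuhE -IntB// -IntZ// -IntB; [|exact: itgB|exact: itgZ].
apply: (@le_trans _ _ (\int[mu]_s (C * M * (e ^+ 2) `^ (3 / 4) * sing 0 t (3 / 4) s))).
  apply: Int_abs_le; [|exact: itgZ|] => [|s].
    by apply: itg_measurable; apply: itgB; [exact: itgB|exact: itgZ].
  rewrite /Duhk /sing addr0; case: ifPn => [st|_]; last by rewrite (mulr0 e) !subr0 normr0 (mulr0 (C * M * _)).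
  have ts : 0 < t - s by case/andP: st => _ st; rewrite subr_gt0.
  have mfs := measurable_slice s mf.
  have fMs y : `|f (s, y)| <= M by exact: fM.
  have j i w := Sk_itg i w ts mfs fMs.
  have [iF F] := H (t - s) x e ts.
  rewrite /Sk -IntB// -IntZ// -IntB; [|exact: itgB|exact: itgZ].
  rewrite (_ : \int[mu]_x0 _ = \int[mu]_y ((gk 0 (t - s) (x + e - y) - gk 0 (t - s) (x - y) - e * gk 1 (t - s) (x - y)) * f (s, y))); last first.
    by apply: eq_Rintegral => y _; ring.
  apply: le_trans (Int_mul_le iF mfs fMs) _.
  have -> : C * M * (e ^+ 2) `^ (3 / 4) * (t - s) `^ (- (3 / 4)) = M * (C * ((e ^+ 2) / (t - s)) `^ (3 / 4)).
    by rewrite powR_ratio ?sqr_ge0//; ring.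
  by rewrite ler_wpM2l.
rewrite IntZ//.
have e1 : 1 - 3 / 4 = 4^-1 :> R by field.
rewrite e1 subr0 invrK in S.
have -> : 4 * C * M * t `^ 4^-1 * (e ^+ 2) `^ (3 / 4) = C * M * (e ^+ 2) `^ (3 / 4) * (t `^ 4^-1 * 4) by ring.
by rewrite ler_wpM2l ?mulr_ge0 ?powR_ge0 ?(ltW C0).
Qed.

Lemma Duh_mod1 : exists2 C, 0 < C & forall (f : R * R -> R) t M x e, 0 < t ->
  measurable_fun setT f -> 0 <= M -> (forall s y, 0 < s < t -> `|f (s, y)| <= M) ->
  `|Duh 1 f t (x + e) - Duh 1 f t x| <= C * M * t `^ 4^-1 * (e ^+ 2) `^ 4^-1.
Proof.
have [C C0 H] := @gk1_mod R; exists (4 * C) => [|f t M x e t0 mf M0 fM].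
  by rewrite mulr_gt0.
have c01 : 0 <= (3 / 4 : R) < 1 by lra.
have [iS S] := sing_itg (ltW t0) c01.
have i1 w := Duhk_itg w (isT : (1 <= 1)%N) t0 mf (lexx 0) M0 fM.
rewrite !DuhE -IntB//.
apply: (@le_trans _ _ (\int[mu]_s (C * M * (e ^+ 2) `^ 4^-1 * sing 0 t (3 / 4) s))).
  apply: Int_abs_le; [|exact: itgZ|] => [|s].
    by apply: itg_measurable; exact: itgB.
  rewrite /Duhk /sing addr0; case: ifPn => [st|_]; last by rewrite subr0 normr0 (mulr0 (C * M * _)).
  have ts : 0 < t - s by case/andP: st => _ st; rewrite subr_gt0.
  have mfs := measurable_slice s mf.
  have fMs y : `|f (s, y)| <= M by exact: fM.
  have j i w := Sk_itg i w ts mfs fMs.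
  have [iF F] := H (t - s) x e ts.
  rewrite /Sk -IntB//.
  rewrite (_ : \int[mu]_x0 _ = \int[mu]_y ((gk 1 (t - s) (x + e - y) - gk 1 (t - s) (x - y)) * f (s, y))); last first.
    by apply: eq_Rintegral => y _; ring.
  apply: le_trans (Int_mul_le iF mfs fMs) _.
  have -> : C * M * (e ^+ 2) `^ 4^-1 * (t - s) `^ (- (3 / 4)) = M * (C * (t - s) `^ (- 2^-1) * ((e ^+ 2) / (t - s)) `^ 4^-1).
    rewrite powR_ratio ?sqr_ge0//.
    have -> : - (3 / 4) = - 2^-1 + - 4^-1 :> R by field.
    by rewrite powRD; [ring|rewrite (gt_eqF ts) implybT].
  by rewrite ler_wpM2l.
rewrite IntZ//.
have e1 : 1 - 3 / 4 = 4^-1 :> R by field.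
rewrite e1 subr0 invrK in S.
have -> : 4 * C * M * t `^ 4^-1 * (e ^+ 2) `^ 4^-1 = C * M * (e ^+ 2) `^ 4^-1 * (t `^ 4^-1 * 4) by ring.
by rewrite ler_wpM2l ?mulr_ge0 ?powR_ge0 ?(ltW C0).
Qed.

End DuhamelHolder.

Section CaloricTaylor.
Context {R : realType}.

(* Backward time: [w] plays the role of the remaining time T - t, so a caloric
   family satisfies d/dw F_i = - F_{i+2}; the jet of F vanishes at (0, 0). *)
Lemma caloric_taylor (F : nat -> R -> R -> R) (m : nat) (X w r l B : R) :
  0 <= B -> 0 <= l -> 0 <= r -> l * r <= 1 -> 0 <= X <= r -> 0 <= w <= r ^+ 2 ->
  (forall (i : nat) (x v : R), `|x| <= X -> 0 <= v <= w -> is_derive x 1 (fun x => F i x v) (F i.+1 x v)) ->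
  (forall (i : nat) (x v : R), `|x| <= X -> 0 <= v <= w -> is_derive v 1 (fun v => F i x v) (- F i.+2 x v)) ->
  (forall i, (i <= m)%N -> F i 0 0 = 0) ->
  (forall x v : R, `|x| <= X -> 0 <= v <= w -> `|F m.+1 x v| <= B * l ^+ m.+1) ->
  (forall x v : R, `|x| <= X -> 0 <= v <= w -> `|F m.+2 x v| <= B * l ^+ m.+2) ->
  forall (i : nat) (x v : R), (i <= m.+1)%N -> `|x| <= X -> 0 <= v <= w ->
  `|F i x v| <= 2 ^+ (m.+1 - i) * B * l ^+ i * (l * r) ^+ (m.+1 - i).
Proof.
move=> B0 l0 r0 lr1 /andP[X0 Xr] /andP[w0 wr] dx dw jet b1 b2 i x v im xX vw.
have lr0 : 0 <= l * r by rewrite mulr_ge0.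
have [j ej] : {j | j = (m.+1 - i)%N} by exists (m.+1 - i)%N.
rewrite -ej; elim/ltn_ind: j i ej im x v xX vw => j ih i ej im x v xX vw.
have z0 : `|0 : R| <= X by rewrite normr0.
case: j ih ej => [|j] ih ej.
  have -> : i = m.+1 by move: ej im; clear; lia.
  by rewrite !expr0 mul1r mulr1; exact: b1.
have iltm : (i <= m)%N by move: ej; clear; lia.
have xr : `|x| <= r by exact: le_trans Xr.
have /andP[v0 vw'] := vw.
have vr : v <= r ^+ 2 by exact: le_trans wr.
have s2 : `|F i 0 v - F i 0 0| <= 2 ^+ j * B * l ^+ i * (l * r) ^+ j.+1.
  have H := @mvt_abs R (fun v => F i 0 v) (fun v => - F i.+2 0 v) 0 v.
  have vb y : Num.min 0 v <= y <= Num.max 0 v -> 0 <= y <= w.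
    by rewrite min_l// max_r// => /andP[-> /le_trans]; apply.
  case: j ih ej => [|j] ih ej.
    (* Here the time derivative has order m + 2, one above the range of the induction; this is where
       the separate hypothesis on that order enters. *)
    have em : i = m by move: ej iltm; clear; lia.
    apply: (@le_trans _ _ (B * l ^+ m.+2 * `|v - 0|)).
      by apply: H => y /vb yw; [exact: dw|rewrite normrN em; exact: b2].
    rewrite subr0 (ger0_norm v0) em expr0 mul1r expr1.
    apply: (@le_trans _ _ (B * l ^+ m.+2 * r ^+ 2)).
      by rewrite ler_wpM2l//; nonneg.
    have -> : B * l ^+ m.+2 * r ^+ 2 = B * l ^+ m * (l * r) * (l * r) by rewrite !exprSr; ring.
    by rewrite ler_piMr//; nonneg.
  apply: (@le_trans _ _ (2 ^+ j * B * l ^+ i.+2 * (l * r) ^+ j * `|v - 0|)).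
    apply: H => y /vb yw; [exact: dw|rewrite normrN].
    by apply: (ih j) => //; move: ej; clear; lia.
  rewrite subr0 (ger0_norm v0).
  apply: (@le_trans _ _ (2 ^+ j * B * l ^+ i.+2 * (l * r) ^+ j * r ^+ 2)).
    by rewrite ler_wpM2l//; nonneg.
  have -> : 2 ^+ j * B * l ^+ i.+2 * (l * r) ^+ j * r ^+ 2 = 2 ^+ j * (B * l ^+ i * (l * r) ^+ j.+2).
    by rewrite !exprSr; ring.
  have -> : 2 ^+ j.+1 * B * l ^+ i * (l * r) ^+ j.+2 = 2 * (2 ^+ j * (B * l ^+ i * (l * r) ^+ j.+2)) by rewrite exprS; ring.
  by rewrite ler_peMl ?ler1n//; nonneg.
pose K1 := 2 ^+ j * B * l ^+ i.+1 * (l * r) ^+ j.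
have s1 : `|F i x v - F i 0 v| <= K1 * r.
  have H := @mvt_abs R (fun x => F i x v) (fun x => F i.+1 x v) 0 x K1.
  have K10 : 0 <= K1 by rewrite /K1; nonneg.
  apply: le_trans (_ : K1 * `|x| <= _); last by rewrite ler_wpM2l.
  rewrite -[x in leRHS]subr0; apply: H => y yx.
    apply: dx => //; move: yx xX.
    by have [xx|xx] := leP 0 x; rewrite ?min_l ?max_r ?min_r ?max_l ?(ltW xx)// => /andP[y1 y2];
      rewrite !ler_norml; lra.
  have yX : `|y| <= X.
    move: yx xX.
    by have [xx|xx] := leP 0 x; rewrite ?min_l ?max_r ?min_r ?max_l ?(ltW xx)// => /andP[y1 y2];
      rewrite !ler_norml; lra.
  by apply: (ih j (ltnSn _)) => //; move: ej; clear; lia.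
have -> : F i x v = (F i x v - F i 0 v) + (F i 0 v - F i 0 0) by rewrite (jet i iltm); ring.
apply: le_trans (ler_normD _ _) _; apply: le_trans (lerD s1 s2) _.
rewrite /K1 !exprSr le_eqVlt; apply/orP; left; apply/eqP; ring.
Qed.

End CaloricTaylor.

(** * The Lyapunov-Perron operator *)

Section CaloricBasis.
Context {R : realType}.
Implicit Types (h s t x y z w : R).

Definition hmat (m : nat) : 'M[R]_m.+1 := \matrix_(i, l) gk i 1 (- (l : nat)%:R).

(** A left kernel vector gives a combination of Hermite polynomials of degree at most m with the m +
    1 roots 0, -1, ..., -m, hence zero; since [hpoly i] has exact degree i, its coefficients
    vanish. *)
Lemma hmat_unit m : hmat m \in unitmx.
Proof.
rewrite -row_free_unit; apply: inj_row_free => v vA.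
pose P : {poly R} := \sum_(i < m.+1) v 0 i *: hpoly i.
have rt (l : 'I_m.+1) : root P (- (l : nat)%:R).
  have := congr1 (fun M : 'rV[R]_m.+1 => M 0 l) vA; rewrite !mxE.
  move=> e; apply/rootP; rewrite /P horner_sum.
  have e2 : (\sum_(i < m.+1) (v 0 i *: hpoly i).[- (l : nat)%:R]) * heat_kernel 1 (- (l : nat)%:R) = 0.
    rewrite mulr_suml -[RHS]e; apply: eq_bigr => i _.
    have -> : hmat m i l = gk i 1 (- (l : nat)%:R) by rewrite mxE.
    rewrite /gk sqrtr1 expr1n invr1 mul1r hornerZ -mulrA.
    set a := - _; clearbody a; rewrite ?mulr1; by [].
  by move/eqP: e2; rewrite mulf_eq0 (gt_eqF (heat_gt0 _ ltr01)) orbF => /eqP.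
have sP : (size P <= m.+1)%N.
  apply: (leq_trans (size_sum _ _ _)); apply/bigmax_leqP => i _.
  by rewrite (leq_trans (size_scale_leq _ _))// size_hpoly.
have P0 : P = 0.
  apply/eqP; apply/negPn/negP => Pn.
  pose rs := [seq - (l%:R) : R | l <- iota 0 m.+1].
  have /(max_poly_roots Pn) : all (root P) rs.
    apply/allP => z /mapP[l]; rewrite mem_iota add0n => /andP[_ lm] ->.
    exact: (rt (Ordinal lm)).
  have urs : uniq rs.
    rewrite map_inj_uniq ?iota_uniq// => i j /oppr_inj /eqP.
    by rewrite eqr_nat => /eqP.
  by move=> /(_ urs); rewrite size_map size_iota ltnNge sP.
(* Coefficients are eliminated from the top degree downwards: the leading coefficient of [hpoly i]
   is met by no lower polynomial. *)
have cf (n : nat) : (n <= m.+1)%N -> forall i : 'I_m.+1, (m.+1 - n <= i)%N -> v 0 i = 0.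
  elim: n => [|n ih] nm i ni.
    by move: (ltn_ord i) ni; rewrite subn0 ltnNge => /negP h /h.
  have nm' := ltnW nm.
  have [/ih -> //|lt] := leqP (m.+1 - n) i.
  have := congr1 (fun p : {poly R} => p`_i) P0; rewrite coef0 coef_sum.
  rewrite (bigD1 i)//= big1 ?addr0 => [|j ji].
    rewrite coefZ => /eqP; rewrite mulf_eq0 => /orP[/eqP//|].
    have -> : (hpoly i : {poly R})`_i = lead_coef (hpoly i).
      by rewrite lead_coefE size_hpoly.
    by rewrite lead_coef_eq0 -size_poly_eq0 size_hpoly.
  have [ij|ij] := ltnP i j; first by rewrite ih ?scale0r ?coef0//; lia.
  rewrite coefZ nth_default ?mulr0// size_hpoly.
  by rewrite ltn_neqAle ij andbT (inj_eq val_inj).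
by apply/rowP => i; rewrite (cf m.+1)// ?mxE// subnn.
Qed.

(* [EE m j i] is the i-th space derivative of a caloric function of (x, w),
   w = T - t, whose jet up to order m at (0, 0) is that of x^j / j!. *)
Definition EE (m j i : nat) x w : R :=
  \sum_(l < m.+1) invmx (hmat m) l (inord j) * gk i (1 - w) (x - (l : nat)%:R).

Lemma EE_jet m i j : (i <= m)%N -> (j <= m)%N -> EE m j i 0 0 = (i == j)%:R.
Proof.
move=> im jm; rewrite /EE subr0.
have := congr1 (fun M : 'M[R]_m.+1 => M (inord i) (inord j)) (mulmxV (hmat_unit m)).
rewrite !mxE -val_eqE/= !inordK// => <-.
by apply: eq_bigr => l _; rewrite !mxE inordK// sub0r mulrC.
Qed.

Lemma EE_dx m j i x w : w < 1 -> is_derive x 1 (fun x => EE m j i x w) (EE m j i.+1 x w).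
Proof.
move=> w1; rewrite /EE; have h0 : 0 < 1 - w by rewrite subr_gt0.
have -> : (fun x => \sum_(l < m.+1) invmx (hmat m) l (inord j) * gk i (1 - w) (x - (l : nat)%:R)) =
  \sum_(l < m.+1) (fun x => invmx (hmat m) l (inord j) * gk i (1 - w) (x - (l : nat)%:R)).
  by apply/funext => z; rewrite fct_sumE.
apply: is_derive_sum => l.
have d := is_derive_gk_z i (x - (l : nat)%:R) h0.
have d2 : is_derive x 1 (fun x => gk i (1 - w) (x - (l : nat)%:R)) (gk i.+1 (1 - w) (x - (l : nat)%:R)).
  have dB : is_derive x 1 (id - cst (l : nat)%:R : R -> R) (1 - 0) by apply: is_deriveB.
  rewrite subr0 in dB; have := @is_derive1_comp R (gk i (1 - w)) (fun x => x - (l : nat)%:R) x _ _ d dB.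
  by rewrite mulr1.
exact: is_deriveZ.
Qed.

Lemma EE_dw m j i x w : w < 1 -> is_derive w 1 (fun w => EE m j i x w) (- EE m j i.+2 x w).
Proof.
move=> w1; rewrite /EE; have h0 : 0 < 1 - w by rewrite subr_gt0.
have -> : (fun w => \sum_(l < m.+1) invmx (hmat m) l (inord j) * gk i (1 - w) (x - (l : nat)%:R)) =
  \sum_(l < m.+1) (fun w => invmx (hmat m) l (inord j) * gk i (1 - w) (x - (l : nat)%:R)).
  by apply/funext => z; rewrite fct_sumE.
rewrite -sumrN; apply: is_derive_sum => l.
have d := is_derive_gk_h i (x - (l : nat)%:R) h0.
have d2 : is_derive w 1 (fun w => gk i (1 - w) (x - (l : nat)%:R)) (- gk i.+2 (1 - w) (x - (l : nat)%:R)).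
  have dB : is_derive w 1 (cst 1 - id : R -> R) (0 - 1) by apply: is_deriveB.
  rewrite sub0r in dB; have := @is_derive1_comp R (fun h => gk i h (x - (l : nat)%:R)) (fun w => 1 - w) w _ _ d dB.
  by rewrite mulrN1.
by rewrite -mulrN; exact: is_deriveZ.
Qed.

Lemma gk_le_cst i (h0 : R) : 0 < h0 -> exists2 C : R, 0 < C & forall h z, h0 <= h <= 1 -> `|gk i h z| <= C.
Proof.
move=> h00; have [C C0 H] := @gk_le0 R i.
have p4 : 0 < 4 * pi :> R by rewrite mulr_gt0 ?pi_gt0.
have s0 : 0 < Num.sqrt h0 by rewrite sqrtr_gt0.
have s4 : 0 < Num.sqrt (4 * pi * (2 * h0)) by rewrite sqrtr_gt0 !mulr_gt0 ?pi_gt0.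
exists (C * Num.sqrt h0 ^- i * (Num.sqrt (4 * pi * (2 * h0)))^-1).
  by rewrite !mulr_gt0 ?invr_gt0 ?exprn_gt0.
move=> h z /andP[h1 h2]; have hp : 0 < h by apply: lt_le_trans h1.
have sh0 : 0 < Num.sqrt h by rewrite sqrtr_gt0.
apply: le_trans (H h z hp) _; apply: ler_pM; [by nonneg|by nonneg| |].
  rewrite ler_wpM2l ?(ltW C0)// lef_pV2 ?posrE ?exprn_gt0//.
  by rewrite lerXn2r ?nnegrE ?sqrtr_ge0//; exact: ler_wsqrtr.
have s4h : 0 < Num.sqrt (4 * pi * (2 * h)) by rewrite sqrtr_gt0 !mulr_gt0 ?pi_gt0.
rewrite /heat_kernel -[leRHS]mul1r; apply: ler_pM; rewrite ?expR_ge0 ?invr_ge0 ?(ltW s4h)//.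
  rewrite -[leRHS]expR0 ler_expR mulNr oppr_le0 divr_ge0 ?sqr_ge0//.
  by rewrite !mulr_ge0 ?ltW.
rewrite lef_pV2 ?posrE//; apply: ler_wsqrtr.
by rewrite ler_pM2l// ler_pM2l.
Qed.

Lemma EE_bounded m (n : nat) : exists2 C : R, 0 < C &
  forall j i x w, (j <= m)%N -> (i <= n)%N -> 0 <= w <= 2^-1 -> `|EE m j i x w| <= C.
Proof.
elim: n => [|n [C C0 H]].
  have h0 : 0 < 2^-1 :> R by rewrite invr_gt0.
  have [C C0 H] := gk_le_cst 0 h0.
  exists (1 + \sum_(l < m.+1) \sum_(j < m.+1) `|invmx (hmat m) l j| * C).
    by rewrite ltr_pwDl// sumr_ge0// => l _; rewrite sumr_ge0// => j _; rewrite mulr_ge0// ltW.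
  move=> j [|//] x w jm _ w12; apply: le_trans (ler_norm_sum _ _ _) _.
  rewrite ler_wpDl//; apply: ler_sum => l _; rewrite normrM (bigD1 (inord j))//=.
  rewrite ler_wpDr//; first by rewrite sumr_ge0// => k _; rewrite mulr_ge0// ltW.
  by rewrite ler_wpM2l//; apply: H; move: w12; lra.
have h0 : 0 < 2^-1 :> R by rewrite invr_gt0.
have [C1 C10 H1] := gk_le_cst n.+1 h0.
exists (C + \sum_(l < m.+1) \sum_(j < m.+1) `|invmx (hmat m) l j| * C1).
  by rewrite ltr_pwDl// sumr_ge0// => l _; rewrite sumr_ge0// => j _; rewrite mulr_ge0// ltW.
move=> j i x w jm; rewrite leq_eqVlt => /predU1P[->|]; last first.
  rewrite ltnS => iN w12; apply: le_trans (H j i x w jm iN w12) _; rewrite lerDl.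
  by rewrite sumr_ge0// => l _; rewrite sumr_ge0// => k _; rewrite mulr_ge0// ltW.
move=> w12; apply: le_trans (ler_norm_sum _ _ _) _.
rewrite ler_wpDl ?(ltW C0)//; apply: ler_sum => l _; rewrite normrM (bigD1 (inord j))//=.
rewrite ler_wpDr//; first by rewrite sumr_ge0// => k _; rewrite mulr_ge0// ltW.
by rewrite ler_wpM2l//; apply: H1; move: w12; lra.
Qed.

(* Parabolic distance to the singular point, truncated at 1. *)
Definition qd x w : R := Num.min (`|x| + Num.sqrt w) 1.

Lemma qd_ge0 x w : 0 <= qd x w.
Proof. by rewrite /qd le_min addr_ge0 ?sqrtr_ge0//=. Qed.

Lemma qd_le1 x w : qd x w <= 1. Proof. by rewrite /qd ge_min lexx orbT. Qed.

Lemma qd_gt0 x w : 0 < w -> 0 < qd x w.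
Proof. by move=> w0; rewrite /qd lt_min ltr01 andbT ltr_wpDl// sqrtr_gt0. Qed.

Lemma sqrt_le_qd x w : 0 <= w <= 1 -> Num.sqrt w <= qd x w.
Proof.
move=> /andP[w0 w1]; rewrite /qd le_min lerDr normr_ge0/=.
by rewrite -[leRHS]sqrtr1; exact: ler_wsqrtr.
Qed.

Lemma le_qd2 x w : 0 <= w <= 1 -> w <= qd x w ^+ 2.
Proof.
move=> w01; have /andP[w0 w1] := w01; rewrite -[leLHS](sqr_sqrtr w0).
by rewrite lerXn2r ?nnegrE ?sqrtr_ge0 ?qd_ge0// sqrt_le_qd.
Qed.

Lemma qd0 w : 0 <= w <= 1 -> qd 0 w = Num.sqrt w.
Proof.
move=> /andP[w0 w1]; rewrite /qd normr0 add0r min_l//.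
by rewrite -[leRHS]sqrtr1; exact: ler_wsqrtr.
Qed.

(** For j > 0 the jet of order j - 1 of [EE m j] vanishes, so [caloric_taylor] with length scale 1
    yields the power of the distance; where the distance is truncated, boundedness suffices. *)
Lemma EE_le m : exists2 C : R, 0 < C & forall j i x w, (j <= m)%N -> (i <= 1)%N ->
  0 <= w <= 2^-1 -> `|EE m j i x w| <= C * qd x w ^+ (j - i).
Proof.
have [C C0 H] := EE_bounded m m.+2.
exists (2 ^+ m.+1 * C); first by rewrite mulr_gt0 ?exprn_gt0.
move=> j i x w jm i1 w12; have /andP[w0 w2] := w12.
have q0 := qd_ge0 x w.
have [big|small] := leP 1 (`|x| + Num.sqrt w).
  rewrite /qd min_r// expr1n mulr1; apply: le_trans (H j i x w jm _ w12) _.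
    by rewrite (leq_trans i1).
  by rewrite ler_peMl ?(ltW C0)// exprn_ege1// ler1n.
case: j jm => [|j] jm.
  rewrite sub0n expr0 mulr1; apply: le_trans (H 0%N i x w jm _ w12) _.
    by rewrite (leq_trans i1).
  by rewrite ler_peMl ?(ltW C0)// exprn_ege1// ler1n.
have qE : qd x w = `|x| + Num.sqrt w by rewrite /qd min_l// ltW.
rewrite qE.
have w1 v : 0 <= v <= w -> v < 1 by move=> /andP[_ vw]; apply: le_lt_trans vw _; lra.
have r0 : 0 <= `|x| + Num.sqrt w by rewrite addr_ge0 ?sqrtr_ge0.
have wr : 0 <= w <= (`|x| + Num.sqrt w) ^+ 2.
  by rewrite w0 -[w in leLHS](sqr_sqrtr w0) lerXn2r ?nnegrE ?sqrtr_ge0// lerDr.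
have vw v : 0 <= v <= w -> 0 <= v <= 2^-1 by move=> /andP[-> /le_trans]; apply.
have := @caloric_taylor R (EE m j.+1) j `|x| w (`|x| + Num.sqrt w) 1 C (ltW C0) ler01 r0.
rewrite mul1r (ltW small) normr_ge0 lerDl sqrtr_ge0 => /(_ isT isT wr).
move=> /(_ (fun i y v _ vv => EE_dx m j.+1 i y (w1 v vv))).
move=> /(_ (fun i y v _ vv => EE_dw m j.+1 i y (w1 v vv))).
have jet k : (k <= j)%N -> EE m j.+1 k 0 0 = 0.
  move=> kj; rewrite EE_jet//; first by rewrite ltn_eqF.
  by rewrite (leq_trans kj)// ltnW.
move=> /(_ jet); rewrite !expr1n mulr1.
have b1 y v : `|y| <= `|x| -> 0 <= v <= w -> `|EE m j.+1 j.+1 y v| <= C.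
  by move=> _ /vw; apply: H => //; move: jm; clear; lia.
have b2 y v : `|y| <= `|x| -> 0 <= v <= w -> `|EE m j.+1 j.+2 y v| <= C.
  by move=> _ /vw; apply: H => //; move: jm; clear; lia.
move=> /(_ b1 b2 i x w (leq_trans i1 _) (lexx _)); rewrite w0 lexx => /(_ isT isT).
rewrite expr1n mulr1 => /le_trans; apply.
rewrite ler_wpM2r ?exprn_ge0// ler_wpM2r ?(ltW C0)//.
by rewrite ler_weXn2l ?ler1n//; lia.
Qed.

End CaloricBasis.

(** * Weighted kernels and the caloric Taylor remainder of the heat kernel *)

Section LyapunovPerron.
Context {R : realType}.
Notation mu := (@lebesgue_measure R).
Implicit Types (h s t x y z w e M T A sg v : R).

(* [Duh j f T 0] is the j-th derivative at the singular point (0, T) of the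
   Duhamel integral; subtracting the caloric functions [EE m j] makes the jet
   up to order m vanish there. *)
Definition LP (m : nat) T (i : nat) (f : R * R -> R) t x :=
  Duh i f t x - \sum_(j < m.+1) Duh j f T 0 * EE m j i x (T - t).

Lemma exprD_le (u v : R) (a : nat) : 0 <= u -> 0 <= v -> (u + v) ^+ a <= 2 ^+ a * (u ^+ a + v ^+ a).
Proof.
move=> u0 v0.
wlog uv : u v u0 v0 / u <= v => [hw|].
  case/orP: (le_total u v) => [/hw//|/hw h]; first exact.
  by rewrite addrC (addrC (u ^+ a)); exact: h.
apply: (@le_trans _ _ ((2 * v) ^+ a)).
  by rewrite lerXn2r ?nnegrE ?addr_ge0 ?mulr_ge0//; lra.
by rewrite exprMn ler_wpM2l ?exprn_ge0// lerDr exprn_ge0.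
Qed.

Lemma qd_shift x y w : qd y w <= qd x w + `|x - y|.
Proof.
rewrite {2}/qd; case: (leP (`|x| + Num.sqrt w) 1) => _.
  rewrite /qd ge_min; apply/orP; left.
  have : `|y| <= `|x| + `|x - y|.
    by rewrite -{1}(subKr x y); exact: ler_normB.
  by lra.
by apply: le_trans (qd_le1 _ _) _; rewrite lerDl.
Qed.

(** The weight is moved from y to x: the distances differ by at most |x - y|, whose powers the
    Gaussian turns into powers of sqrt h, and sqrt h <= 2 sqrt w is at most twice the distance at
    x. *)
Lemma qd_gk_le (i a : nat) : exists2 C : R, 0 < C & forall h w x y, 0 < h -> h <= 4 * w -> w <= 1 ->
  qd y w ^+ a * `|gk i h (x - y)| <= C * Num.sqrt h ^- i * qd x w ^+ a * heat_kernel (2 * h) (x - y).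
Proof.
have [C1 C10 H1] := @gk_le R i a; have [C2 C20 H2] := @gk_le0 R i.
exists (2 ^+ a * (C2 + C1 * 2 ^+ a)).
  by rewrite mulr_gt0 ?exprn_gt0// addr_gt0// mulr_gt0 ?exprn_gt0.
move=> h w x y h0 hw w1.
have w0 : 0 <= w <= 1 by rewrite w1 andbT -(pmulr_rge0 _ (_ : 0 < 4))// (le_trans _ hw)// ltW.
have qx := qd_ge0 x w.
have s0 : 0 < Num.sqrt h by rewrite sqrtr_gt0.
have sq : Num.sqrt h <= 2 * qd x w.
  apply: (@le_trans _ _ (2 * Num.sqrt w)); last by rewrite ler_wpM2l// sqrt_le_qd.
  have e2 : 2 = Num.sqrt 4 :> R.
    have -> : 4 = 2 ^+ 2 :> R by ring.
    by rewrite sqrtr_sqr ger0_norm.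
  by rewrite e2 -sqrtrM//; exact: ler_wsqrtr.
apply: (@le_trans _ _ (2 ^+ a * (qd x w ^+ a + `|x - y| ^+ a) * `|gk i h (x - y)|)).
  rewrite ler_wpM2r//; apply: le_trans (exprD_le a qx (normr_ge0 (x - y))).
  by rewrite lerXn2r ?nnegrE ?qd_ge0 ?addr_ge0// qd_shift.
set K := heat_kernel _ _; set g := gk _ _ _; set S := _ ^- i.
have b1 : qd x w ^+ a * `|g| <= C2 * S * qd x w ^+ a * K.
  have -> : C2 * S * qd x w ^+ a * K = qd x w ^+ a * (C2 * S * K) by ring.
  by rewrite ler_wpM2l ?exprn_ge0//; exact: H2.
have b2 : `|x - y| ^+ a * `|g| <= C1 * 2 ^+ a * S * qd x w ^+ a * K.
  have -> : `|x - y| ^+ a = Num.sqrt h ^+ a * (`|x - y| / Num.sqrt h) ^+ a.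
    by rewrite -exprMn mulrCA divff ?mulr1// gt_eqF.
  rewrite -(mulrA (Num.sqrt h ^+ a)); apply: (@le_trans _ _ (Num.sqrt h ^+ a * (C1 * S * K))).
    by rewrite ler_wpM2l ?exprn_ge0 ?(ltW s0)//; exact: H1.
  have -> : C1 * 2 ^+ a * S * qd x w ^+ a * K = (2 * qd x w) ^+ a * (C1 * S * K).
    by rewrite exprMn; ring.
  rewrite ler_wpM2r//; first by rewrite /S /K; nonneg.
  by rewrite lerXn2r ?nnegrE ?mulr_ge0 ?(ltW s0).
have -> : 2 ^+ a * (qd x w ^+ a + `|x - y| ^+ a) * `|g| = 2 ^+ a * (qd x w ^+ a * `|g| + `|x - y| ^+ a * `|g|) by ring.
have -> : 2 ^+ a * (C2 + C1 * 2 ^+ a) * S * qd x w ^+ a * K = 2 ^+ a * (C2 * S * qd x w ^+ a * K + C1 * 2 ^+ a * S * qd x w ^+ a * K) by ring.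
by rewrite ler_wpM2l ?exprn_ge0// lerD.
Qed.

Definition wbound (a : nat) (b T A : R) (f : R * R -> R) :=
  forall s y, 0 < s < T -> `|f (s, y)| <= A * qd y (T - s) ^+ a * (T - s) `^ (- b).

Lemma Sk_wbound (i a : nat) : exists2 C : R, 0 < C & forall b T A f h s x,
  0 < T <= 2^-1 -> 0 <= A -> measurable_fun setT f -> wbound a b T A f -> 0 < s < T ->
  0 < h <= T - s ->
  `|Sk i h (fun y => f (s, y)) x| <= C * A * Num.sqrt h ^- i * qd x (T - s) ^+ a * (T - s) `^ (- b).
Proof.
have [C C0 H] := qd_gk_le i a; exists C => // b T A f h s x /andP[T0 T1] A0 mf fw sT /andP[h0 hs].
have /andP[s0 s1] := sT.
have w0 : 0 < T - s by rewrite subr_gt0.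
have w1 : T - s <= 1 by lra.
have hw : h <= 4 * (T - s) by lra.
have h20 : 0 < 2 * h by rewrite mulr_gt0.
set B := (T - s) `^ (- b).
have -> : C * A * Num.sqrt h ^- i * qd x (T - s) ^+ a * B =
  \int[mu]_y (C * A * Num.sqrt h ^- i * qd x (T - s) ^+ a * B * heat_kernel (2 * h) (x - y)).
  by rewrite IntZ ?heat_Int ?mulr1//; exact: heat_itg.
have mfs := measurable_slice s mf.
apply: Int_abs_le.
- by apply: measurable_funM => //; apply: measurable_gk => //; exact: measurable_funB.
- by apply: itgZ; exact: heat_itg.
- move=> y; rewrite normrM; apply: le_trans (ler_wpM2l (normr_ge0 _) (fw s y sT)) _.
  have -> : C * A * Num.sqrt h ^- i * qd x (T - s) ^+ a * B * heat_kernel (2 * h) (x - y) =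
    (C * Num.sqrt h ^- i * qd x (T - s) ^+ a * heat_kernel (2 * h) (x - y)) * (A * B) by ring.
  have -> : `|gk i h (x - y)| * (A * qd y (T - s) ^+ a * B) = (qd y (T - s) ^+ a * `|gk i h (x - y)|) * (A * B) by ring.
  rewrite ler_wpM2r ?mulr_ge0 ?powR_ge0//; exact: H.
Qed.

(** The integrand in s of the jet coefficient [Duh j f T 0]. *)
Definition Duhc j (f : R * R -> R) T s := if 0 < s < T then Sk j (T - s) (fun y => f (s, y)) 0 else 0.

Lemma ex2_uniform (P : nat -> R -> Prop) n :
  (forall j, exists2 C, 0 < C & P j C) ->
  (forall j C C', P j C -> C <= C' -> P j C') ->
  exists2 C, 0 < C & forall j, (j <= n)%N -> P j C.
Proof.
move=> ex mono; elim: n => [|n [C C0 H]].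
  by have [C C0 H] := ex 0%N; exists C => // j; rewrite leqn0 => /eqP ->.
have [C' C'0 H'] := ex n.+1.
exists (C + C') => [|j]; first exact: addr_gt0.
rewrite leq_eqVlt => /predU1P[->|/H h]; first by apply: mono H' _; rewrite lerDr ltW.
by apply: mono h _; rewrite lerDl ltW.
Qed.

(** At x = 0 the distance is sqrt (T - s), so the weight of order m compensates the kernel
    singularity of order j. The condition j <= m is repeated inside because [ex2_uniform] asks for a
    statement at every j. *)
Lemma Duhc_le m : exists2 C : R, 0 < C & forall j, (j <= m)%N -> (j <= m)%N -> forall b T A f s,
  0 < T <= 2^-1 -> 0 <= A -> measurable_fun setT f -> wbound m b T A f ->
  `|Duhc j f T s| <= C * A * Num.sqrt (T - s) ^+ (m - j) * sing 0 T b s.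
Proof.
apply: ex2_uniform => [j|j C C' H CC' jm b T A f s T01 A0 mf fw]; last first.
  apply: le_trans (H jm b T A f s T01 A0 mf fw) _.
  rewrite ler_wpM2r ?sing_ge0// ler_wpM2r ?exprn_ge0 ?sqrtr_ge0//.
  exact: ler_wpM2r.
have [C C0 H] := Sk_wbound j m; exists C => // jm b T A f s T01 A0 mf fw.
rewrite /Duhc /sing; case: ifPn => sT; last by rewrite normr0 mulr0.
have /andP[s0 s1] := sT; have /andP[T0 T1] := T01.
have w0 : 0 < T - s by rewrite subr_gt0.
have r0 : 0 < Num.sqrt (T - s) by rewrite sqrtr_gt0.
apply: le_trans (H b T A f (T - s) s 0 T01 A0 mf fw sT _) _; first by rewrite w0 lexx.
rewrite qd0; last by rewrite (ltW w0)/=; lra.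
rewrite ler_wpM2r ?powR_ge0// -mulrA ler_wpM2l//; first by nonneg.
have -> : Num.sqrt (T - s) ^+ m = Num.sqrt (T - s) ^+ (m - j) * Num.sqrt (T - s) ^+ j.
  by rewrite -exprD subnK.
by rewrite mulrCA mulVf ?mulr1// expf_neq0// gt_eqF.
Qed.

Lemma gk_near n : exists2 C : R, 0 < C & forall sg v x y, 0 < sg -> 0 <= v <= sg / 2 ->
  x ^+ 2 <= sg / 2 -> `|gk n (sg - v) (x - y)| <= C * Num.sqrt sg ^- n * heat_kernel (4 * sg) y.
Proof.
have [C C0 H] := @gk_shift R n; exists (C * 2 ^+ n * 2).
  by rewrite !mulr_gt0 ?exprn_gt0.
move=> sg v x y sg0 /andP[v0 v1] xs.
have h0 : 0 < sg - v by lra.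
have h2 : sg / 2 <= sg - v by lra.
have := H (sg - v) (- y) x h0 (le_trans xs h2).
rewrite [- y + x]addrC heat_sym => /le_trans; apply.
have r0 : 0 < Num.sqrt sg by rewrite sqrtr_gt0.
have rh0 : 0 < Num.sqrt (sg - v) by rewrite sqrtr_gt0.
have rh : Num.sqrt sg <= 2 * Num.sqrt (sg - v).
  have e2 : 2 = Num.sqrt (2 ^+ 2) :> R by rewrite sqrtr_sqr ger0_norm.
  by rewrite e2 -sqrtrM ?sqr_ge0//; apply: ler_wsqrtr; rewrite expr2; lra.
have -> : C * 2 ^+ n * 2 * Num.sqrt sg ^- n * heat_kernel (4 * sg) y =
  (C * (2 ^+ n * Num.sqrt sg ^- n)) * (2 * heat_kernel (4 * sg) y) by ring.
apply: ler_pM; [by nonneg|by nonneg| |].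
  rewrite ler_wpM2l ?(ltW C0)// ler_pdivlMr ?exprn_gt0// mulrC ler_pdivrMr ?exprn_gt0//.
  by rewrite -exprMn lerXn2r ?nnegrE//; nonneg.
have h40 : 0 < 4 * (sg - v) by rewrite mulr_gt0.
apply: le_trans (@heat_widen R (4 * (sg - v)) (4 * sg) y h40 _) _; first by lra.
rewrite ler_wpM2r ?heat_ge0//; apply: (@le_trans _ _ (Num.sqrt 2)); last exact: sqrt2_le2.
apply: ler_wsqrtr; rewrite ler_pdivrMr//; lra.
Qed.

(** The kernel of [LP] at fixed source point: sg is the time from the source to T, v the remaining
    time at the observation point, and the heat kernel is diminished by its caloric Taylor
    polynomial at (x, v) = (0, 0). *)
Definition Rem m sg y i x v :=
  gk i (sg - v) (x - y) - \sum_(j < m.+1) gk j sg (0 - y) * EE m j i x v.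

Lemma Rem_top m n : (n <= m.+2)%N -> (m < n)%N -> exists2 C : R, 0 < C & forall sg y x v, 0 < sg <= 2^-1 ->
  0 <= v <= sg / 2 -> x ^+ 2 <= sg / 2 ->
  `|Rem m sg y n x v| <= C * heat_kernel (4 * sg) y * (Num.sqrt sg)^-1 ^+ n.
Proof.
move=> n2 nm; have [C C0 H] := gk_near n; have [E E0 HE] := @EE_bounded R m m.+2.
have [G G0 HG] : exists2 G, 0 < G & forall j, (j <= m)%N -> forall sg z, 0 < sg ->
    `|gk j sg z| <= G * Num.sqrt sg ^- j * heat_kernel (2 * sg) z.
  apply: ex2_uniform => [j|j D D' HD DD' sg z sg0].
    by have [D D0 HD] := @gk_le0 R j; exists D.
  apply: le_trans (HD sg z sg0) _; rewrite ler_wpM2r ?heat_ge0// ler_wpM2r//; nonneg.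
exists (C + m.+1%:R * (G * 2 * E)); first by rewrite ltr_pwDl// !mulr_ge0 ?ler0n ?ltW.
move=> sg y x v /andP[sg0 sg1] vs xs; rewrite /Rem.
have r0 : 0 < Num.sqrt sg by rewrite sqrtr_gt0.
have r1 : Num.sqrt sg <= 1 by rewrite -[leRHS]sqrtr1; apply: ler_wsqrtr; lra.
set K := heat_kernel (4 * sg) y; have K0 : 0 <= K by exact: heat_ge0.
apply: le_trans (ler_normB _ _) _.
rewrite !mulrDl; apply: lerD.
  by rewrite -[leRHS]mulrA [K * _]mulrC mulrA exprVn; exact: H.
apply: le_trans (ler_norm_sum _ _ _) _.
have -> : m.+1%:R * (G * 2 * E) * K * (Num.sqrt sg)^-1 ^+ n = \sum_(j < m.+1) (G * 2 * E * K * (Num.sqrt sg)^-1 ^+ n).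
  by rewrite sumr_const card_ord -mulr_natl; ring.
apply: ler_sum => j _; rewrite normrM sub0r.
have jm : (j <= m)%N by rewrite -ltnS.
have b1 := HG j jm sg (- y) sg0; rewrite heat_sym in b1.
have vv : 0 <= v <= 2^-1 by case/andP: vs => -> h /=; apply: le_trans h _; lra.
have b2 := HE j n x v jm n2 vv.
apply: le_trans (ler_pM (normr_ge0 _) (normr_ge0 _) b1 b2) _.
have sg20 : 0 < 2 * sg by lra.
have kk : heat_kernel (2 * sg) y <= 2 * K.
  have := heat_widen2 y sg20; have -> : 2 * (2 * sg) = 4 * sg by ring.
  exact.
have pw : Num.sqrt sg ^- j <= (Num.sqrt sg)^-1 ^+ n.
  rewrite -exprVn; apply: ler_weXn2l; first by rewrite invf_ge1.
  by move: jm nm; clear; lia.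
have -> : G * 2 * E * K * (Num.sqrt sg)^-1 ^+ n = G * (Num.sqrt sg)^-1 ^+ n * (2 * K) * E by ring.
rewrite ler_wpM2r ?(ltW E0)//; apply: ler_pM => //; [by nonneg|by exact: heat_ge0|].
by rewrite ler_wpM2l ?(ltW G0).
Qed.

End LyapunovPerron.

(** * Gain from the vanishing jet for sources far from the singular point *)

Section LyapunovPerronKernel.
Context {R : realType}.
Notation mu := (@lebesgue_measure R).
Implicit Types (h s t x y z w e M T A sg v : R).

Lemma Rem_dx m sg y i x v : 0 < sg <= 2^-1 -> 0 <= v <= sg / 2 ->
  is_derive x 1 (fun x => Rem m sg y i x v) (Rem m sg y i.+1 x v).
Proof.
move=> /andP[sg0 sg1] /andP[v0 v1]; rewrite /Rem.
have h0 : 0 < sg - v by lra.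
have dB : is_derive x 1 (id - cst y : R -> R) (1 - 0) by apply: is_deriveB.
rewrite subr0 in dB.
have d1 : is_derive x 1 (fun x => gk i (sg - v) (x - y)) (gk i.+1 (sg - v) (x - y)).
  have := @is_derive1_comp R (gk i (sg - v)) (fun x => x - y) x _ _ (is_derive_gk_z i (x - y) h0) dB.
  by rewrite mulr1.
apply: is_deriveB.
have -> : (fun x => \sum_(j < m.+1) gk j sg (0 - y) * EE m j i x v) =
  \sum_(j < m.+1) (fun x => gk j sg (0 - y) * EE m j i x v).
  by apply/funext => z; rewrite fct_sumE.
apply: is_derive_sum => j; apply: is_deriveZ; apply: EE_dx; lra.
Qed.

Lemma Rem_dv m sg y i x v : 0 < sg <= 2^-1 -> 0 <= v <= sg / 2 ->
  is_derive v 1 (fun v => Rem m sg y i x v) (- Rem m sg y i.+2 x v).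
Proof.
move=> /andP[sg0 sg1] /andP[v0 v1]; rewrite /Rem.
have h0 : 0 < sg - v by lra.
have dB : is_derive v 1 (cst sg - id : R -> R) (0 - 1) by apply: is_deriveB.
rewrite sub0r in dB.
have d1 : is_derive v 1 (fun v => gk i (sg - v) (x - y)) (- gk i.+2 (sg - v) (x - y)).
  have := @is_derive1_comp R (fun h => gk i h (x - y)) (fun v => sg - v) v _ _ (is_derive_gk_h i (x - y) h0) dB.
  by rewrite mulrN1.
rewrite opprD; apply: is_deriveB.
rewrite -sumrN.
have -> : (fun v => \sum_(j < m.+1) gk j sg (0 - y) * EE m j i x v) =
  \sum_(j < m.+1) (fun v => gk j sg (0 - y) * EE m j i x v).
  by apply/funext => z; rewrite fct_sumE.
apply: is_derive_sum => j; rewrite -mulrN; apply: is_deriveZ; apply: EE_dw; lra.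
Qed.

Lemma Rem_jet m sg y i : (i <= m)%N -> Rem m sg y i 0 0 = 0.
Proof.
move=> im; rewrite /Rem subr0 (bigD1 (Ordinal (im : (i < m.+1)%N)))//= EE_jet// eqxx mulr1.
rewrite big1 ?addr0 ?subrr// => j; rewrite -val_eqE/= => ji.
by rewrite EE_jet// ?(eq_sym i) ?(negbTE ji) ?mulr0// -ltnS.
Qed.

(** [caloric_taylor] at length scale sqrt sg: the jet vanishes by [Rem_jet], orders m + 1 and m + 2
    are bounded by [Rem_top], and 4 q^2 <= sg keeps the whole parabolic segment in their range. *)
Lemma Rem_le m : exists2 C : R, 0 < C & forall i sg y x w, (i <= 1)%N -> 0 < sg <= 2^-1 ->
  0 <= w -> 4 * qd x w ^+ 2 <= sg ->
  `|Rem m sg y i x w| <= C * heat_kernel (4 * sg) y * (Num.sqrt sg)^-1 ^+ i *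
     ((Num.sqrt sg)^-1 * qd x w) ^+ (m.+1 - i).
Proof.
have [C1 C10 H1] := @Rem_top R m m.+1 (leqnSn _) (ltnSn _).
have [C2 C20 H2] := @Rem_top R m m.+2 (leqnn _) (ltnW (ltnSn _)).
exists (2 ^+ m.+1 * (C1 + C2)); first by rewrite mulr_gt0 ?exprn_gt0 ?addr_gt0.
move=> i sg y x w i1 sg01 w0 qs; have /andP[sg0 sg1] := sg01.
have q0 := qd_ge0 x w.
have q1 : qd x w < 1.
  rewrite ltNge; apply/negP => q1; have : 1 <= qd x w ^+ 2 by rewrite expr_ge1.
  lra.
have qE : qd x w = `|x| + Num.sqrt w.
  by move: q1; rewrite /qd; case: (leP _ 1) => // _; rewrite ltxx.
set r := qd x w in q0 q1 qE qs *; set K := heat_kernel (4 * sg) y.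
have K0 : 0 <= K by exact: heat_ge0.
set S := Num.sqrt sg; have S0 : 0 < S by rewrite sqrtr_gt0.
have S1 : 0 <= S^-1 by rewrite invr_ge0 ltW.
have xr : 0 <= `|x| <= r by rewrite normr_ge0 qE lerDl sqrtr_ge0.
have wr : 0 <= w <= r ^+ 2.
  rewrite w0 -[leLHS](sqr_sqrtr w0) lerXn2r ?nnegrE ?sqrtr_ge0//.
  by rewrite qE lerDr.
have xs z : `|z| <= `|x| -> z ^+ 2 <= sg / 2.
  move=> zx; apply: (@le_trans _ _ (r ^+ 2)); last by lra.
  by rewrite -real_normK ?num_real// lerXn2r ?nnegrE// (le_trans zx)//; case/andP: xr.
have vs v : 0 <= v <= w -> 0 <= v <= sg / 2.
  case/andP => -> vw /=; apply: le_trans vw _; case/andP: wr => _ wr.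
  by apply: le_trans wr _; lra.
have lr : S^-1 * r <= 1.
  rewrite mulrC ler_pdivrMr// mul1r.
  rewrite -(@ler_pXn2r _ 2)// ?nnegrE ?(ltW S0)// sqr_sqrtr ?(ltW sg0)//; have := sqr_ge0 r; lra.
have B0 : 0 <= (C1 + C2) * K by nonneg.
have CK (c : R) (n : nat) a : 0 <= c -> c <= C1 + C2 -> a <= c * K * S^-1 ^+ n -> a <= (C1 + C2) * K * S^-1 ^+ n.
  move=> c0 cC /le_trans; apply; rewrite ler_wpM2r ?exprn_ge0// ler_wpM2r//.
have c1 : C1 <= C1 + C2 by rewrite lerDl ltW.
have c2 : C2 <= C1 + C2 by rewrite lerDr ltW.
have b1 z v : `|z| <= `|x| -> 0 <= v <= w -> `|Rem m sg y m.+1 z v| <= (C1 + C2) * K * S^-1 ^+ m.+1.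
  by move=> zx vw; apply: (CK C1 m.+1 _ (ltW C10) c1); apply: H1 => //; [exact: vs|exact: xs].
have b2 z v : `|z| <= `|x| -> 0 <= v <= w -> `|Rem m sg y m.+2 z v| <= (C1 + C2) * K * S^-1 ^+ m.+2.
  by move=> zx vw; apply: (CK C2 m.+2 _ (ltW C20) c2); apply: H2 => //; [exact: vs|exact: xs].
have dx j z v : `|z| <= `|x| -> 0 <= v <= w -> is_derive z 1 (fun x => Rem m sg y j x v) (Rem m sg y j.+1 z v).
  by move=> _ vw; apply: Rem_dx => //; exact: vs.
have dv j z v : `|z| <= `|x| -> 0 <= v <= w -> is_derive v 1 (fun v => Rem m sg y j z v) (- Rem m sg y j.+2 z v).
  by move=> _ vw; apply: Rem_dv => //; exact: vs.
have im : (i <= m.+1)%N by rewrite (leq_trans i1).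
have ww : 0 <= w <= w by rewrite w0 lexx.
have := caloric_taylor B0 S1 q0 lr xr wr dx dv (fun j => @Rem_jet m sg y j) b1 b2 im (lexx _) ww.
move=> /le_trans; apply.
rewrite ler_wpM2r ?exprn_ge0 ?mulr_ge0// ler_wpM2r ?exprn_ge0//.
have -> : 2 ^+ m.+1 * (C1 + C2) * K = 2 ^+ m.+1 * ((C1 + C2) * K) by rewrite mulrA.
by rewrite ler_wpM2r// ler_weXn2l ?ler1n// leq_subr.
Qed.

Definition LPk (m : nat) T (i : nat) (f : R * R -> R) t x s :=
  Duhk i f t 0 x s - \sum_(j < m.+1) Duhc j f T s * EE m j i x (T - t).

Lemma wbound_bounded a b T A f s : 0 <= A -> wbound a b T A f -> 0 < s < T ->
  forall y, `|f (s, y)| <= A * (T - s) `^ (- b).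
Proof.
move=> A0 fw sT y; apply: le_trans (fw s y sT) _.
rewrite ler_wpM2r ?powR_ge0// -[leRHS]mulr1 ler_wpM2l//.
by rewrite exprn_ile1 ?qd_ge0 ?qd_le1.
Qed.

(** The integrand is the integral of the source against [Rem]. Its weight integrates to (T - s)^(m /
    2) because the Gaussian is centred at 0, so one factor (T - s)^(- 1/2) is all that remains of
    the kernel. *)
Lemma LPk_near m : exists2 C : R, 0 < C & forall i b T A f t x s, (i <= 1)%N ->
  0 < T <= 2^-1 -> 0 <= A -> measurable_fun setT f -> wbound m b T A f ->
  t < T -> 0 < s < T -> 4 * qd x (T - t) ^+ 2 <= T - s ->
  `|LPk m T i f t x s| <= C * A * qd x (T - t) ^+ (m.+1 - i) *
     (Num.sqrt (T - s))^-1 * (T - s) `^ (- b).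
Proof.
have [C1 C10 H1] := Rem_le m; have [C2 C20 H2] := @qd_gk_le R 0 m.
exists (C1 * C2); first exact: mulr_gt0.
move=> i b T A f t x s i1 T01 A0 mf fw tT sT qs.
have /andP[T0 T1] := T01; have /andP[s0 s1] := sT.
have w0 : 0 < T - t by rewrite subr_gt0.
have sg0 : 0 < T - s by rewrite subr_gt0.
have sg01 : 0 < T - s <= 2^-1 by rewrite sg0/=; lra.
(* Here t may be negative; if T - t > 1 the distance is truncated to 1 and 4 <= T - s contradicts T
   <= 1/2. *)
have wq : T - t <= qd x (T - t) ^+ 2.
  have [w1|w1] := leP (T - t) 1; first by apply: le_qd2; rewrite (ltW w0).
  have q1 : qd x (T - t) = 1.
    rewrite /qd min_r//; apply: (@le_trans _ _ (Num.sqrt (T - t))); last by rewrite lerDr.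
    by rewrite -[leLHS]sqrtr1; apply: ler_wsqrtr; rewrite ltW.
  by move: qs; rewrite q1 expr1n; lra.
have st : s < t by lra.
have h0 : 0 < t - s by rewrite subr_gt0.
have mfs := measurable_slice s mf.
have fb := wbound_bounded A0 fw sT.
set S := Num.sqrt (T - s); have S0 : 0 < S by rewrite sqrtr_gt0.
set q := qd x (T - t); have q0 : 0 <= q by exact: qd_ge0.
have eJ : LPk m T i f t x s = \int[mu]_y (Rem m (T - s) y i x (T - t) * f (s, y)).
  rewrite /LPk /Duhk /Duhc s0 st addr0 s1 /= /Rem.
  have i0 := Sk_itg i x h0 mfs fb.
  have ij (j : 'I_m.+1) := Sk_itg j 0 sg0 mfs fb.
  have ij2 (j : 'I_m.+1) : itg (fun y => EE m j i x (T - t) * (gk j (T - s) (0 - y) * f (s, y))).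
    by apply: itgZ; exact: ij.
  have -> : (fun y => (gk i (T - s - (T - t)) (x - y) - \sum_(j < m.+1) gk j (T - s) (0 - y) * EE m j i x (T - t)) * f (s, y)) =
    (fun y => gk i (t - s) (x - y) * f (s, y) - \sum_(j < m.+1) EE m j i x (T - t) * (gk j (T - s) (0 - y) * f (s, y))).
    apply/funext => y; rewrite mulrBl; congr (_ - _).
      by congr (gk i _ _ * _); ring.
    by rewrite mulr_suml; apply: eq_bigr => j _; ring.
  rewrite IntB//; last exact: itg_sum.
  rewrite Int_sum//; congr (_ - _); apply: eq_bigr => j _.
  by rewrite (IntZ _ (ij j)); exact: mulrC.
rewrite eJ.
set P := C1 * S^-1 ^+ i * (S^-1 * q) ^+ (m.+1 - i).
have P0 : 0 <= P by rewrite /P; nonneg.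
have h8 : 0 < 2 * (4 * (T - s)) by rewrite !mulr_gt0.
have -> : C1 * C2 * A * q ^+ (m.+1 - i) * S^-1 * (T - s) `^ (- b) =
  \int[mu]_y (P * (A * (T - s) `^ (- b)) * (C2 * S ^+ m) * heat_kernel (2 * (4 * (T - s))) (0 - y)).
  rewrite IntZ ?heat_Int//; last exact: heat_itg.
  have -> : P = C1 * q ^+ (m.+1 - i) * S^-1 ^+ m.+1.
    rewrite /P exprMn mulrA; have -> : S^-1 ^+ m.+1 = S^-1 ^+ i * S^-1 ^+ (m.+1 - i).
      by rewrite -exprD subnKC// (leq_trans i1).
    by ring.
  rewrite exprS; have e : S^-1 ^+ m * S ^+ m = 1.
    by rewrite -exprMn mulVf ?gt_eqF// expr1n.
  transitivity (C1 * C2 * A * q ^+ (m.+1 - i) * S^-1 * (T - s) `^ (- b) * (S^-1 ^+ m * S ^+ m)).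
    by rewrite e mulr1.
  by ring.
have mR : measurable_fun setT (fun y => Rem m (T - s) y i x (T - t)).
  rewrite /Rem; apply: measurable_funB.
    by apply: measurable_gk => //; exact: measurable_funB.
  apply: measurable_sum => j; apply: measurable_funM => //.
  by apply: measurable_gk => //; exact: measurable_funB.
apply: Int_abs_le.
- by apply: measurable_funM.
- by apply: itgZ; exact: heat_itg.
- move=> y; rewrite normrM.
  have b1 := H1 i (T - s) y x (T - t) i1 sg01 (ltW w0) qs.
  have b2 := fw s y sT.
  have sg41 : 0 < 4 * (T - s) by rewrite mulr_gt0.
  have b3 := H2 (4 * (T - s)) (T - s) 0 y sg41 (lexx _) _.
  rewrite gk0 ger0_norm ?heat_ge0// expr0 invr1 mulr1 qd0 in b3; last by rewrite (ltW sg0)/=; lra.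
  have b4 := b3 ltac:(lra).
  apply: le_trans (ler_pM (normr_ge0 _) (normr_ge0 _) b1 b2) _.
  rewrite -/S -/q; rewrite [0 - y]sub0r in b4 *; rewrite !heat_sym in b4 *.
  set K := heat_kernel _ _ in b4 *; set K' := heat_kernel (2 * _) _ in b4 *.
  set B := _ `^ _; have B0 : 0 <= B by exact: powR_ge0.
  have -> : C1 * K * S^-1 ^+ i * (S^-1 * q) ^+ (m.+1 - i) * (A * qd y (T - s) ^+ m * B) =
    P * (A * B) * (qd y (T - s) ^+ m * K) by rewrite /P; ring.
  have -> : P * (A * B) * (C2 * S ^+ m) * K' = P * (A * B) * (C2 * S ^+ m * K') by ring.
  by rewrite ler_wpM2l//; nonneg.
Qed.

End LyapunovPerronKernel.

(** * Pointwise bounds for the corrected Duhamel integrand *)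

Section LyapunovPerronBounds.
Context {R : realType}.
Notation mu := (@lebesgue_measure R).
Implicit Types (h s t x y z w e M T A sg v b om : R).

Lemma powRDp (a u v : R) : 0 < a -> a `^ (u + v) = a `^ u * a `^ v.
Proof. by move=> a0; rewrite powRD// (gt_eqF a0) implybT. Qed.

Lemma powR_anti (a c u : R) : 0 < a -> a <= c -> 0 <= u -> c `^ (- u) <= a `^ (- u).
Proof.
move=> a0 ac u0; rewrite !powRN lef_pV2 ?posrE ?powR_gt0//; last exact: lt_le_trans ac.
by apply: ge0_ler_powR; rewrite ?nnegrE ?(ltW a0)// (le_trans (ltW a0)).
Qed.

Lemma powR_mono (a c u : R) : 0 <= a -> a <= c -> 0 <= u -> a `^ u <= c `^ u.
Proof. by move=> a0 ac u0; apply: ge0_ler_powR => //; rewrite nnegrE// (le_trans a0). Qed.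

Lemma sqr_powR (a u : R) : 0 <= a -> (a ^+ 2) `^ u = a `^ (2 * u).
Proof. by move=> a0; rewrite powRrM -powR_mulrn. Qed.

Lemma powR_le_self (a u : R) : 1 <= a -> u <= 1 -> a `^ u <= a.
Proof.
move=> a1 u1; have a0 : 0 <= a by exact: le_trans a1.
by rewrite -[leRHS](powRr1 a0); apply: ler_powR.
Qed.

Lemma powR_2q (q u : R) : 0 <= q -> u <= 1 -> (2 * q) `^ u <= 2 * q `^ u.
Proof.
move=> q0 u1; rewrite powRM// ler_wpM2r ?powR_ge0//.
by apply: powR_le_self => //; rewrite ler1n.
Qed.

Lemma sqrtV_powR1 (a : R) : 0 < a -> (Num.sqrt a)^-1 = a `^ (- 2^-1).
Proof. by move=> a0; rewrite powRN powR12_sqrt// ltW. Qed.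

(** Applied with sg = T - s: in the regime where the source is close to T, the distance at the
    source time is at most three times the one at the observation time. *)
Lemma qd_triple x w sg : 0 <= sg -> sg <= 4 * qd x w ^+ 2 -> qd x sg <= 3 * qd x w.
Proof.
move=> sg0 sq; have q0 := qd_ge0 x w.
have s2 : Num.sqrt sg <= 2 * qd x w.
  rewrite -(@ler_pXn2r _ 2)// ?nnegrE ?sqrtr_ge0 ?mulr_ge0// sqr_sqrtr// exprMn.
  by apply: le_trans sq _; rewrite expr2; lra.
have [q1|q1] := leP 1 (`|x| + Num.sqrt w).
  by apply: le_trans (qd_le1 _ _) _; rewrite /qd min_r//; lra.
rewrite {1}/qd ge_min; apply/orP; left.
have qE : qd x w = `|x| + Num.sqrt w by rewrite /qd min_l// ltW.
have := sqrtr_ge0 w; move: s2; rewrite qE; lra.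
Qed.

Lemma eqle (a c : R) : a = c -> a <= c.
Proof. by move=> ->. Qed.

Lemma wpM_le (a c u : R) : a <= c -> 0 <= u -> a * u <= c * u.
Proof. by move=> ac u0; rewrite ler_wpM2r. Qed.

(** When T - s < 4 q^2 there is nothing to cancel: the Duhamel term and the subtracted caloric sum
    already have the right size separately. *)
Lemma far_part1 m : exists2 C : R, 0 < C & forall i, (i <= 1)%N -> forall b T A f t x s,
  0 < T <= 2^-1 -> 0 <= A -> measurable_fun setT f -> wbound m b T A f ->
  0 < s < t -> t < T -> T - s < 4 * qd x (T - t) ^+ 2 ->
  `|Duhk i f t 0 x s| <= C * A * qd x (T - t) ^+ m * Num.sqrt (t - s) ^- i * (T - s) `^ (- b).
Proof.
apply: ex2_uniform => [i|i C C' H CC' b T A f t x s T01 A0 mf fw st tT far]; last first.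
  apply: le_trans (H b T A f t x s T01 A0 mf fw st tT far) _.
  have q0 := qd_ge0 x (T - t).
  do 4 (apply: wpM_le; last by nonneg).
  exact: CC'.
have [C C0 H] := @Sk_wbound R i m; exists (C * 3 ^+ m); first by rewrite mulr_gt0 ?exprn_gt0.
move=> b T A f t x s T01 A0 mf fw st tT far.
have /andP[s0 s1] := st; have /andP[T0 T1] := T01.
have sT : 0 < s < T by rewrite s0 (lt_trans s1).
rewrite /Duhk st addr0.
have hs : 0 < t - s <= T - s by rewrite subr_gt0 s1/= lerD2r ltW.
apply: le_trans (H b T A f (t - s) s x T01 A0 mf fw sT hs) _.
apply: wpM_le; last exact: powR_ge0.
have -> : C * 3 ^+ m * A * qd x (T - t) ^+ m / Num.sqrt (t - s) ^+ i =
  C * A / Num.sqrt (t - s) ^+ i * (3 * qd x (T - t)) ^+ m by rewrite exprMn; ring.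
rewrite ler_wpM2l//; first by nonneg.
rewrite lerXn2r ?nnegrE ?qd_ge0 ?mulr_ge0 ?qd_ge0//.
apply: qd_triple; last exact: ltW.
by rewrite subr_ge0 ltW//; case/andP: sT.
Qed.

(** The j-th coefficient carries (T - s)^((m - j) / 2) <= (2 q)^(m - j) and the j-th caloric
    function q^(j - i); the product has order m - i whatever j. *)
Lemma far_part2 m : (0 < m)%N -> exists2 C : R, 0 < C & forall i b T A f t x s, (i <= 1)%N ->
  0 < T <= 2^-1 -> 0 <= A -> measurable_fun setT f -> wbound m b T A f ->
  0 < s < T -> 0 <= t < T -> T - s < 4 * qd x (T - t) ^+ 2 ->
  `|\sum_(j < m.+1) Duhc j f T s * EE m j i x (T - t)| <=
     C * A * qd x (T - t) ^+ (m - i) * (T - s) `^ (- b).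
Proof.
move=> m0; have [C1 C10 H1] := @Duhc_le R m; have [C2 C20 H2] := @EE_le R m.
exists (m.+1%:R * (C1 * C2 * 2 ^+ m)).
  by rewrite !mulr_gt0 ?exprn_gt0.
move=> i b T A f t x s i1 T01 A0 mf fw sT /andP[t0 tT] far.
have /andP[s0 s1] := sT; have /andP[T0 T1] := T01.
set q := qd x (T - t); have q0 : 0 <= q by exact: qd_ge0.
set B := _ `^ _; have B0 : 0 <= B by exact: powR_ge0.
have w12 : 0 <= T - t <= 2^-1 by lra.
set S := Num.sqrt (T - s); have S0 : 0 <= S by exact: sqrtr_ge0.
have Sq : S <= 2 * q.
  rewrite -(@ler_pXn2r _ 2)// ?nnegrE ?mulr_ge0// sqr_sqrtr; last by lra.
  rewrite exprMn; apply: le_trans (ltW far) _; rewrite -/q expr2; lra.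
apply: le_trans (ler_norm_sum _ _ _) _.
have -> : m.+1%:R * (C1 * C2 * 2 ^+ m) * A * q ^+ (m - i) * B = \sum_(j < m.+1) (C1 * C2 * 2 ^+ m * A * q ^+ (m - i) * B).
  by rewrite sumr_const card_ord -mulr_natl; ring.
apply: ler_sum => j _; rewrite normrM; have jm : (j <= m)%N by rewrite -ltnS.
have b1 := H1 j jm jm b T A f s T01 A0 mf fw; have b2 := H2 j i x (T - t) jm i1 w12.
apply: le_trans (ler_pM (normr_ge0 _) (normr_ge0 _) b1 b2) _.
have -> : sing 0 T b s = B by rewrite /sing sT.
rewrite -/S -/q.
have e1 : S ^+ (m - j) <= 2 ^+ m * q ^+ (m - j).
  apply: (@le_trans _ _ ((2 * q) ^+ (m - j))); first by rewrite lerXn2r ?nnegrE ?mulr_ge0.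
  by rewrite exprMn ler_wpM2r ?exprn_ge0// ler_weXn2l ?ler1n// leq_subr.
have e2 : q ^+ (m - j) * q ^+ (j - i) <= q ^+ (m - i).
  rewrite -exprD; apply: ler_wiXn2l; rewrite ?qd_ge0 ?qd_le1//.
  by move: jm; clear; lia.
apply: (@le_trans _ _ (C1 * A * (2 ^+ m * q ^+ (m - j)) * B * (C2 * q ^+ (j - i)))).
  apply: wpM_le; last by nonneg. 
  apply: wpM_le => //.
  by rewrite ler_wpM2l//; nonneg.
have -> : C1 * A * (2 ^+ m * q ^+ (m - j)) * B * (C2 * q ^+ (j - i)) = C1 * C2 * 2 ^+ m * A * B * (q ^+ (m - j) * q ^+ (j - i)) by ring.
have -> : C1 * C2 * 2 ^+ m * A * q ^+ (m - i) * B = C1 * C2 * 2 ^+ m * A * B * q ^+ (m - i) by ring.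
by rewrite ler_wpM2l//; nonneg.
Qed.

Lemma LPk_out m T i f t x s : t < T -> ~~ (0 < s < T) -> LPk m T i f t x s = 0.
Proof.
move=> tT sT; rewrite /LPk /Duhk; case: ifPn => [/andP[s0 s1]|_].
  by move: sT; rewrite s0 (lt_trans s1 tT).
by rewrite big1 ?subr0// => j _; rewrite /Duhc (negbTE sT) mul0r.
Qed.

(** The exponent (1 + b) / 2 lies halfway between b and 1. Half of the spare integrability is
    exchanged for q^(1 - b), by comparing T - s with 4 q^2 in either regime; the other half is left
    to produce a power of T. *)
Lemma LPk0_le m : (0 < m)%N -> exists2 C : R, 0 < C & forall b T A f t x s,
  0 < b < 1 -> 0 < T <= 2^-1 -> 0 <= A -> measurable_fun setT f -> wbound m b T A f ->
  0 <= t < T ->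
  `|LPk m T 0 f t x s| <= C * A * qd x (T - t) ^+ m * qd x (T - t) `^ (1 - b) * sing 0 T ((1 + b) / 2) s.
Proof.
move=> m0; have [C1 C10 H1] := far_part1 m; have [C2 C20 H2] := far_part2 m0.
have [C3 C30 H3] := @LPk_near R m.
exists (2 * (C1 + C2) + C3); first by rewrite addr_gt0 ?mulr_gt0 ?addr_gt0.
move=> b T A f t x s /andP[b0 b1] T01 A0 mf fw tT; have /andP[t0 t1] := tT.
have /andP[T0 T1] := T01.
have q0 : 0 <= qd x (T - t) by exact: qd_ge0.
rewrite /sing; case: ifPn => sT; last by rewrite LPk_out// normr0 mulr0.
have /andP[s0 s1] := sT.
have sg0 : 0 < T - s by rewrite subr_gt0.
have qp : 0 < qd x (T - t) by apply: qd_gt0; rewrite subr_gt0.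
have k1 : 0 <= (1 - b) / 2 by lra.
have eb : (T - s) `^ (- b) = (T - s) `^ ((1 - b) / 2) * (T - s) `^ (- ((1 + b) / 2)).
  by rewrite -powRDp//; congr (_ `^ _); lra.
have [near|far] := leP (4 * qd x (T - t) ^+ 2) (T - s).
  have h := H3 0%N b T A f t x s isT T01 A0 mf fw t1 sT near.
  rewrite subn0 sqrtV_powR1// in h; apply: le_trans h _.
  set q := qd x (T - t) in q0 qp near *.
  apply: (@le_trans _ _ (C3 * A * q ^+ m * q `^ (1 - b) * (T - s) `^ (- ((1 + b) / 2)))); last first.
    do 4 (apply: wpM_le; last by nonneg); by rewrite lerDr mulr_ge0 ?addr_ge0 ?ltW.
  have -> : C3 * A * q ^+ m.+1 * (T - s) `^ (- 2^-1) * (T - s) `^ (- b) =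
     C3 * A * q ^+ m * (q * ((T - s) `^ (- 2^-1) * (T - s) `^ (- b))) by rewrite exprS; ring.
  rewrite -[leRHS]mulrA ler_wpM2l//; first by nonneg.
  have -> : (T - s) `^ (- 2^-1) * (T - s) `^ (- b) = (T - s) `^ (- (b / 2)) * (T - s) `^ (- ((1 + b) / 2)).
    by rewrite -!powRDp//; congr (_ `^ _); lra.
  rewrite mulrA; apply: wpM_le; last exact: powR_ge0.
  have -> : q `^ (1 - b) = q * q `^ (- b) by rewrite powRDp// powRr1.
  rewrite ler_wpM2l//; apply: (@le_trans _ _ ((q ^+ 2) `^ (- (b / 2)))).
    apply: powR_anti; first by rewrite exprn_gt0.
      by apply: le_trans near; rewrite ler_peMl ?sqr_ge0// ler1n.
    by lra.
  rewrite sqr_powR//; apply: eqle; congr (_ `^ _); lra.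
rewrite /LPk; apply: le_trans (ler_normB _ _) _.
have p2 : `|\sum_(j < m.+1) Duhc j f T s * EE m j 0 x (T - t)| <=
     C2 * A * qd x (T - t) ^+ m * (T - s) `^ (- b).
  by have := H2 0%N b T A f t x s isT T01 A0 mf fw sT tT far; rewrite subn0.
have p1 : `|Duhk 0 f t 0 x s| <= C1 * A * qd x (T - t) ^+ m * (T - s) `^ (- b).
  have [st|st] := ltP s t.
    have st' : 0 < s < t by rewrite s0.
    by have := H1 0%N isT b T A f t x s T01 A0 mf fw st' t1 far; rewrite expr0 invr1 mulr1.
  by rewrite /Duhk s0 ltNge st/= normr0; nonneg.
apply: le_trans (lerD p1 p2) _.
set q := qd x (T - t) in q0 qp far *.
have -> : C1 * A * q ^+ m * (T - s) `^ (- b) + C2 * A * q ^+ m * (T - s) `^ (- b) =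
  (C1 + C2) * A * q ^+ m * (T - s) `^ ((1 - b) / 2) * (T - s) `^ (- ((1 + b) / 2)) by rewrite eb; ring.
apply: wpM_le; last exact: powR_ge0.
have -> : (2 * (C1 + C2) + C3) * A * q ^+ m * q `^ (1 - b) =
  (C1 + C2) * A * q ^+ m * (2 * q `^ (1 - b)) + C3 * A * q ^+ m * q `^ (1 - b) by ring.
rewrite ler_wpDr//; first by nonneg.
rewrite ler_wpM2l//; first by nonneg.
apply: le_trans (powR_2q q0 _); last by lra.
apply: (@le_trans _ _ (((2 * q) ^+ 2) `^ ((1 - b) / 2))).
  apply: powR_mono => //; first exact: ltW.
  by rewrite exprMn; apply: le_trans (ltW far) _; rewrite expr2; lra.
by rewrite sqr_powR ?mulr_ge0//; apply: eqle; congr (_ `^ _); lra.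
Qed.

(** A derivative costs 1/2 in the time exponent; extracting (T - t)^(- om) brings it back below 1 as
    soon as b - om < 1/2. The singularity sits at s = t for the Duhamel term and at s = T for the
    jet. *)
Lemma LPk1_le m : (0 < m)%N -> exists2 C : R, 0 < C & forall b om T A f t x s,
  0 <= om <= b -> om <= 2^-1 -> 0 < T <= 2^-1 -> 0 <= A -> measurable_fun setT f -> wbound m b T A f ->
  0 <= t < T ->
  `|LPk m T 1 f t x s| <= C * A * qd x (T - t) ^+ m * (T - t) `^ (- om) *
     (sing 0 t (2^-1 + b - om) s + sing 0 T (2^-1 + b - om) s).
Proof.
move=> m0; have [C1 C10 H1] := far_part1 m; have [C2 C20 H2] := far_part2 m0.
have [C3 C30 H3] := @LPk_near R m.
exists (C1 + 2 * C2 + C3); first by rewrite !addr_gt0 ?mulr_gt0.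
move=> b om T A f t x s /andP[om0 omb] om1 T01 A0 mf fw tT; have /andP[t0 t1] := tT.
have /andP[T0 T1] := T01.
have q0 : 0 <= qd x (T - t) by exact: qd_ge0.
have [sT|sT] := boolP (0 < s < T); last first.
  by rewrite LPk_out// normr0; apply: mulr_ge0; [nonneg|rewrite addr_ge0 ?sing_ge0].
have /andP[s0 s1] := sT.
have sg0 : 0 < T - s by rewrite subr_gt0.
have w0 : 0 < T - t by rewrite subr_gt0.
have qp : 0 < qd x (T - t) by apply: qd_gt0.
have wq : T - t <= qd x (T - t) ^+ 2 by apply: le_qd2; rewrite (ltW w0)/=; lra.
set c := 2^-1 + b - om.
set Q := A * qd x (T - t) ^+ m * (T - t) `^ (- om); have Q0 : 0 <= Q by rewrite /Q; nonneg.
have eT : sing 0 T c s = (T - s) `^ (- c) by rewrite /sing sT.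
have sg1 := sing_ge0 0 t c s; have sg2 := sing_ge0 0 T c s.
have -> : (C1 + 2 * C2 + C3) * A * qd x (T - t) ^+ m * (T - t) `^ (- om) * (sing 0 t c s + sing 0 T c s) =
  C1 * Q * sing 0 t c s + 2 * C2 * Q * sing 0 T c s + C3 * Q * sing 0 T c s +
  (C1 * Q * sing 0 T c s + 2 * C2 * Q * sing 0 t c s + C3 * Q * sing 0 t c s) by rewrite /Q; ring.
rewrite ler_wpDr//; first by nonneg.
have [near|far] := leP (4 * qd x (T - t) ^+ 2) (T - s).
  rewrite ler_wpDl//; first by nonneg.
  have h := H3 1%N b T A f t x s isT T01 A0 mf fw t1 sT near.
  rewrite subn1/= sqrtV_powR1// in h; apply: le_trans h _.
  have -> : C3 * A * qd x (T - t) ^+ m * (T - s) `^ (- 2^-1) * (T - s) `^ (- b) =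
    C3 * A * qd x (T - t) ^+ m * (T - s) `^ (- om) * sing 0 T c s.
    rewrite eT -!mulrA; do 3 congr (_ * _); rewrite -!powRDp//; congr (_ `^ _); rewrite /c; lra.
  apply: wpM_le => //; rewrite /Q !mulrA ler_wpM2l//; first by nonneg.
  apply: powR_anti => //; apply: le_trans wq _; apply: le_trans near.
  by rewrite ler_peMl ?sqr_ge0// ler1n.
rewrite ler_wpDr//; first by nonneg.
rewrite /LPk; apply: le_trans (ler_normB _ _) _; apply: lerD.
  have [st|st] := ltP s t; last first.
    by rewrite /Duhk s0 ltNge st/= normr0; nonneg.
  have st' : 0 < s < t by rewrite s0.
  have ts0 : 0 < t - s by rewrite subr_gt0.
  apply: le_trans (H1 1%N isT b T A f t x s T01 A0 mf fw st' t1 far) _.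
  have -> : sing 0 t c s = (t - s) `^ (- 2^-1) * (t - s) `^ (- (b - om)).
    by rewrite /sing st' -powRDp//; congr (_ `^ _); rewrite /c; lra.
  rewrite expr1 sqrtV_powR1//.
  have -> : (T - s) `^ (- b) = (T - s) `^ (- om) * (T - s) `^ (- (b - om)).
    by rewrite -powRDp//; congr (_ `^ _); lra.
  have -> : C1 * Q * ((t - s) `^ (- 2^-1) * (t - s) `^ (- (b - om))) =
    C1 * A * qd x (T - t) ^+ m * (t - s) `^ (- 2^-1) * ((T - t) `^ (- om) * (t - s) `^ (- (b - om))).
    by rewrite /Q; ring.
  rewrite ler_wpM2l//; first by nonneg.
  apply: ler_pM; [by nonneg|by nonneg| |].
    by apply: powR_anti => //; lra.
  by apply: powR_anti => //; lra.
apply: le_trans (H2 1%N b T A f t x s isT T01 A0 mf fw sT tT far) _.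
set q := qd x (T - t) in q0 qp far wq Q Q0 *.
have -> : 2 * C2 * Q * sing 0 T c s = C2 * A * q ^+ (m - 1) * (2 * (q * (T - t) `^ (- om)) * sing 0 T c s).
  have -> : Q = A * (q ^+ (m - 1) * q) * (T - t) `^ (- om) by rewrite -exprSr subn1 prednK.
  by ring.
rewrite ler_wpM2l//; first by nonneg.
have -> : (T - s) `^ (- b) = (T - s) `^ (2^-1 - om) * sing 0 T c s.
  by rewrite eT -powRDp//; congr (_ `^ _); rewrite /c; lra.
apply: wpM_le => //.
apply: (@le_trans _ _ (((2 * q) ^+ 2) `^ (2^-1 - om))).
  apply: powR_mono; [exact: ltW| |by lra].
  by rewrite exprMn; apply: le_trans (ltW far) _; rewrite expr2; lra.
rewrite sqr_powR ?mulr_ge0//.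
apply: le_trans (powR_2q q0 _) _; first by lra.
rewrite ler_wpM2l//.
have -> : q `^ (2 * (2^-1 - om)) = q * q `^ (2 * - om).
  by rewrite -{2}(powRr1 q0) -powRDp//; congr (_ `^ _); lra.
rewrite ler_wpM2l// -sqr_powR//.
exact: powR_anti.
Qed.

End LyapunovPerronBounds.

(** * Integrated bounds and linearity of the corrected Duhamel operator *)

Section LyapunovPerronLinear.
Context {R : realType}.
Notation mu := (@lebesgue_measure R).
Implicit Types (h s t x y z w e M T A sg v b om : R).

Lemma measurable_Duhc j f T : measurable_fun setT f -> measurable_fun setT (Duhc j f T : R -> R).
Proof.
move=> mf.
have e : Duhc j f T = (fun z : R * R => Duhk j f T 0 z.1 z.2) \o (fun s : R => (0 : R, s)).
  by apply/funext => s; rewrite /= /Duhc /Duhk addr0.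
by rewrite e; apply: measurableT_comp; [exact: measurable_Duhk|exact: measurable_pair1].
Qed.

Lemma Duhc_itg m : exists2 C : R, 0 < C & forall j b T A f,
  (j <= m)%N -> 0 <= b < 1 -> 0 < T <= 2^-1 -> 0 <= A -> measurable_fun setT f -> wbound m b T A f ->
  itg (Duhc j f T) /\ `|Duh j f T 0| <= C * A * (T `^ (1 - b) / (1 - b)).
Proof.
have [C C0 H] := @Duhc_le R m; exists C => // j b T A f jm b01 T01 A0 mf fw.
have /andP[T0 T1] := T01.
have [i1 i2] := sing_itg (ltW T0) b01.
have mD := measurable_Duhc j T mf.
have le s : `|Duhc j f T s| <= C * A * sing 0 T b s.
  have := H j jm jm b T A f s T01 A0 mf fw.
  rewrite /sing; case: ifPn => [/andP[s0 s1]|_]; last by rewrite !mulr0.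
  move=> /le_trans; apply; apply: wpM_le; last exact: powR_ge0.
  rewrite -[leRHS]mulr1 ler_wpM2l ?mulr_ge0 ?(ltW C0)//.
  rewrite exprn_ile1 ?sqrtr_ge0// -[leRHS]sqrtr1; apply: ler_wsqrtr; lra.
have iCA : itg (fun s => C * A * sing 0 T b s) by apply: itgZ.
split; first exact: itg_le mD iCA le.
have -> : Duh j f T 0 = \int[mu]_s Duhc j f T s by [].
apply: le_trans (Int_abs_le mD iCA le) _.
rewrite (IntZ _ i1) ler_wpM2l ?mulr_ge0 ?(ltW C0)//.
by rewrite subr0 in i2.
Qed.

Lemma LPE m b T A f t x i : (i <= 1)%N -> 0 <= b < 1 -> 0 < T <= 2^-1 -> 0 <= A -> 0 <= t < T ->
  measurable_fun setT f -> wbound m b T A f ->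
  itg (LPk m T i f t x) /\ LP m T i f t x = \int[mu]_s LPk m T i f t x s.
Proof.
move=> i1 b01 T01 A0 /andP[t0 tT] mf fw; have /andP[T0 T1] := T01; have /andP[b0 b1] := b01.
have [C C0 H] := Duhc_itg m.
have i2 : itg (fun s => \sum_(j < m.+1) Duhc j f T s * EE m j i x (T - t)).
  apply: itg_sum => j; have jm : (j <= m)%N by rewrite -ltnS.
  have [h _] := H j b T A f jm b01 T01 A0 mf fw.
  have -> : (fun s => Duhc j f T s * EE m j i x (T - t)) = (fun s => EE m j i x (T - t) * Duhc j f T s).
    by apply/funext => s; rewrite mulrC.
  exact: itgZ.
have i3 : itg (Duhk i f t 0 x).
  move: t0; rewrite le_eqVlt => /predU1P[t0|t0].
    have -> : Duhk i f t 0 x = cst 0.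
      apply/funext => s; rewrite /Duhk; case: ifPn => // /andP[h1 h2]; move: (lt_trans h1 h2).
      by rewrite t0 ltxx.
    exact: integrable0.
  have w0 : 0 < T - t by rewrite subr_gt0.
  apply: (@Duhk_itg R i f t 0 (A * (T - t) `^ (- b)) x i1 t0 mf (lexx _)); first by nonneg.
  move=> s y /andP[s0 st]; have sT : 0 < s < T by rewrite s0 (lt_trans st).
  apply: le_trans (wbound_bounded A0 fw sT y) _; rewrite ler_wpM2l//.
  by apply: powR_anti => //; lra.
split; first exact: itgB.
rewrite /LP /LPk IntB// DuhE; congr (_ - _).
rewrite Int_sum => [|j]; last first.
  have jm : (j <= m)%N by rewrite -ltnS.
  have [h _] := H j b T A f jm b01 T01 A0 mf fw.
  have -> : (fun s => Duhc j f T s * EE m j i x (T - t)) = (fun s => EE m j i x (T - t) * Duhc j f T s).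
    by apply/funext => s; rewrite mulrC.
  exact: itgZ.
apply: eq_bigr => j _; have jm : (j <= m)%N by rewrite -ltnS.
have [h _] := H j b T A f jm b01 T01 A0 mf fw.
rewrite mulrC -(IntZ _ h); congr Rintegral; apply/funext => s; exact: mulrC.
Qed.

Lemma LP0_le m : (0 < m)%N -> exists2 C : R, 0 < C & forall b T A f t x,
  0 < b < 1 -> 0 < T <= 2^-1 -> 0 <= A -> measurable_fun setT f -> wbound m b T A f ->
  0 <= t < T ->
  `|LP m T 0 f t x| <= C * A * (T `^ ((1 - b) / 2) / ((1 - b) / 2)) * qd x (T - t) ^+ m * qd x (T - t) `^ (1 - b).
Proof.
move=> m0; have [C C0 H] := @LPk0_le R m m0; exists C => // b T A f t x b01 T01 A0 mf fw tT.
have /andP[b0 b1] := b01; have /andP[T0 T1] := T01.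
have c01 : 0 <= (1 + b) / 2 < 1 by lra.
have [i1 i2] := sing_itg (ltW T0) c01.
have b01' : 0 <= b < 1 by rewrite ltW.
have [mk ->] := @LPE m b T A f t x 0 isT b01' T01 A0 tT mf fw.
have q0 := qd_ge0 x (T - t).
set P := C * A * qd x (T - t) ^+ m * qd x (T - t) `^ (1 - b).
have P0 : 0 <= P by rewrite /P; nonneg.
have iP : itg (fun s => P * sing 0 T ((1 + b) / 2) s) by exact: itgZ.
apply: le_trans (Int_abs_le (itg_measurable mk) iP (fun s => H b T A f t x s b01 T01 A0 mf fw tT)) _.
rewrite (IntZ _ i1).
have -> : C * A * (T `^ ((1 - b) / 2) / ((1 - b) / 2)) * qd x (T - t) ^+ m * qd x (T - t) `^ (1 - b) =
  P * (T `^ ((1 - b) / 2) / ((1 - b) / 2)) by rewrite /P; ring.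
rewrite ler_wpM2l//; move: i2; rewrite subr0.
by have -> : 1 - (1 + b) / 2 = (1 - b) / 2 by lra.
Qed.

Lemma LP1_le m : (0 < m)%N -> exists2 C : R, 0 < C & forall b om T A f t x,
  0 < b < 1 -> 0 <= om <= b -> om <= 2^-1 -> b - om < 2^-1 ->
  0 < T <= 2^-1 -> 0 <= A -> measurable_fun setT f -> wbound m b T A f ->
  0 <= t < T ->
  `|LP m T 1 f t x| <= C * A * (T `^ (2^-1 - b + om) / (2^-1 - b + om)) * qd x (T - t) ^+ m * (T - t) `^ (- om).
Proof.
move=> m0; have [C C0 H] := @LPk1_le R m m0; exists (C * 2); first by rewrite mulr_gt0.
move=> b om T A f t x b01 omb om1 bom T01 A0 mf fw tT.
have /andP[b0 b1] := b01; have /andP[T0 T1] := T01; have /andP[t0 t1] := tT.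
set c := 2^-1 + b - om.
have c01 : 0 <= c < 1 by rewrite /c; move: omb; lra.
have [i1 i2] := sing_itg (ltW T0) c01.
have [i3 i4] := sing_itg t0 c01.
have b01' : 0 <= b < 1 by rewrite ltW.
have [mk ->] := @LPE m b T A f t x 1 isT b01' T01 A0 tT mf fw.
have q0 := qd_ge0 x (T - t).
set P := C * A * qd x (T - t) ^+ m * (T - t) `^ (- om).
have P0 : 0 <= P by rewrite /P; nonneg.
have i5 : itg (fun s => sing 0 t c s + sing 0 T c s) by exact: itgD.
have iP : itg (fun s => P * (sing 0 t c s + sing 0 T c s)) by exact: itgZ.
apply: le_trans (Int_abs_le (itg_measurable mk) iP (fun s => H b om T A f t x s omb om1 T01 A0 mf fw tT)) _.
rewrite (IntZ _ i5) (IntD i3 i1).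
have -> : C * 2 * A * (T `^ (2^-1 - b + om) / (2^-1 - b + om)) * qd x (T - t) ^+ m * (T - t) `^ (- om) =
  P * (2 * (T `^ (2^-1 - b + om) / (2^-1 - b + om))) by rewrite /P; ring.
rewrite ler_wpM2l// mulr2n mulrDl !mul1r.
have e : 1 - c = 2^-1 - b + om by rewrite /c; lra.
rewrite e subr0 in i2; rewrite e subr0 in i4.
have d0 : 0 < 2^-1 - b + om by move: omb; lra.
apply: lerD; last exact: i2.
apply: le_trans i4 _.
rewrite ler_wpM2r ?invr_ge0 ?(ltW d0)//; apply: powR_mono => //; exact: ltW.
Qed.

Lemma measurable_EE m j i d (S : measurableType d) (a c : S -> R) :
  measurable_fun setT a -> measurable_fun setT c ->
  measurable_fun setT (fun z : S => EE m j i (a z) (c z)).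
Proof.
move=> ma mc; apply: measurable_sum => l; apply: measurable_funM => //.
by apply: measurable_gk; apply: measurable_funB.
Qed.

Lemma measurable_LP m T i f : measurable_fun setT f ->
  measurable_fun setT (fun z : R * R => LP m T i f z.1 z.2).
Proof.
move=> mf; apply: measurable_funB; first exact: measurable_Duh.
apply: measurable_sum => j; apply: measurable_funM => //.
by apply: measurable_EE => //; apply: measurable_funB.
Qed.

Lemma SkB i h x (f g : R -> R) M : 0 < h -> measurable_fun setT f -> measurable_fun setT g ->
  (forall y, `|f y| <= M) -> (forall y, `|g y| <= M) ->
  Sk i h (fun y => f y - g y) x = Sk i h f x - Sk i h g x.
Proof.
move=> h0 mf mg fM gM; rewrite /Sk -IntB; [|exact: Sk_itg fM|exact: Sk_itg gM].
by congr Rintegral; apply/funext => y; rewrite mulrBr.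
Qed.

Lemma LPB m b T A f g t x i : (i <= 1)%N -> 0 <= b < 1 -> 0 < T <= 2^-1 -> 0 <= A -> 0 <= t < T ->
  measurable_fun setT f -> measurable_fun setT g -> wbound m b T A f -> wbound m b T A g ->
  LP m T i (fun z : R * R => f z - g z) t x = LP m T i f t x - LP m T i g t x.
Proof.
move=> i1 b01 T01 A0 tT mf mg fw gw; have /andP[t0 t1] := tT.
have [i2 ->] := LPE x i1 b01 T01 A0 tT mf fw.
have [i3 ->] := LPE x i1 b01 T01 A0 tT mg gw.
have mfg : measurable_fun setT (fun z : R * R => f z - g z) by exact: measurable_funB.
have fgw : wbound m b T (2 * A) (fun z : R * R => f z - g z).
  move=> s y sT; apply: le_trans (ler_normB _ _) _; apply: le_trans (lerD (fw s y sT) (gw s y sT)) _.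
  by apply: eqle; ring.
have A20 : 0 <= 2 * A by rewrite mulr_ge0.
have [i4 ->] := LPE x i1 b01 T01 A20 tT mfg fgw.
rewrite -(IntB i2 i3); congr Rintegral; apply/funext => s.
have [sT|sT] := boolP (0 < s < T); last by rewrite !LPk_out// subr0.
have /andP[s0 s1] := sT; have w0 : 0 < T - s by rewrite subr_gt0.
have fb := wbound_bounded A0 fw sT; have gb := wbound_bounded A0 gw sT.
have mfs := measurable_slice s mf; have mgs := measurable_slice s mg.
have eD : Duhk i (fun z : R * R => f z - g z) t 0 x s = Duhk i f t 0 x s - Duhk i g t 0 x s.
  rewrite /Duhk; case: ifP => [/andP[_ st]|_]; last by rewrite subr0.
  by rewrite addr0 (SkB _ _ _ mfs mgs fb gb)// subr_gt0.
have eC j : Duhc j (fun z : R * R => f z - g z) T s = Duhc j f T s - Duhc j g T s.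
  by rewrite /Duhc sT (SkB _ _ w0 mfs mgs fb gb).
rewrite /LPk eD.
have -> : \sum_(j < m.+1) Duhc j (fun z : R * R => f z - g z) T s * EE m j i x (T - t) =
    \sum_(j < m.+1) Duhc j f T s * EE m j i x (T - t) - \sum_(j < m.+1) Duhc j g T s * EE m j i x (T - t).
  by rewrite -sumrB; apply: eq_bigr => j _; rewrite eC mulrBl.
by ring.
Qed.

End LyapunovPerronLinear.

(** * Approximate solution and fixed point *)

Section CaloricProfile.
Context {R : realType}.
Implicit Types (h s t x y z w : R).

Lemma gk_odd_0 j h : 0 < h -> gk j.*2.+1 h 0 = 0 :> R.
Proof.
move=> h0; elim: j => [|j ih]; first by rewrite gk1// mul0r oppr0 mul0r.
by rewrite doubleS gkSS// ih mulr0 mul0r addr0 mulr0.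
Qed.

Lemma gk_even_0 j : exists c : R, forall h, 0 < h -> gk j.*2 h 0 = c * h ^- j * heat_kernel h 0.
Proof.
elim: j => [|j [c H]]; first by exists 1 => h h0; rewrite gk0 expr0 invr1 !mul1r.
exists (- 2^-1 * j.*2.+1%:R * c) => h h0.
rewrite doubleS gkSS// mul0r add0r H// exprS.
have h1 : h != 0 by rewrite gt_eqF.
have hj : h ^+ j != 0 by rewrite expf_neq0.
set K := heat_kernel _ _; clearbody K; move: (j.*2.+1%:R : R) => a.
by move: hj; move: (h ^+ j) => u hj; field; rewrite h1 hj.
Qed.

(** The k-th finite difference annihilates degrees below k. The sum is the value at 1 of the
    operator X d/dX applied j times to (1 - X)^k, which keeps a zero of order k - j there. *)
Lemma alternating_sum (k j : nat) : (j < k)%N ->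
  \sum_(l < k.+1) 'C(k, l)%:R * (-1) ^+ l * l%:R ^+ j = 0 :> R.
Proof.
pose Q (j : nat) : {poly R} := \sum_(l < k.+1) ('C(k, l)%:R * (-1) ^+ l * l%:R ^+ j) *: 'X^l.
have Q0 : Q 0%N = (1 - 'X) ^+ k.
  rewrite exprBn; apply: eq_bigr => l _; rewrite expr0 mulr1 expr1n mulr1.
  rewrite mulrC -scalerA scaler_nat -[in LHS]signr_odd -[in RHS]signr_odd.
  by case: odd; rewrite ?expr0 ?expr1 ?scale1r ?scaleN1r ?mul1r ?mulN1r ?mulNrn.
have QS i : Q i.+1 = 'X * (Q i)^`().
  rewrite /Q raddf_sum mulr_sumr; apply: eq_bigr => -[[|l] lk] _ /=.
    by rewrite exprS mul0r mulr0 scale0r derivZ expr0 derivC scaler0 mulr0.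
  by rewrite derivZ derivXn succnK -scalerAr mulrnAr -exprS -(scaler_nat l.+1 'X^(l.+1)) scalerA (exprSr _ i) mulrA.
have div i : (i <= k)%N -> exists W, Q i = (1 - 'X) ^+ (k - i) * W.
  elim: i => [|i ih] ik; first by exists 1; rewrite Q0 subn0 mulr1.
  have [W e] := ih (ltnW ik); have [n en] : {n | n = (k - i.+1)%N} by exists (k - i.+1)%N.
  have en' : (k - i = n.+1)%N by move: ik en; clear; lia.
  rewrite QS e en' -en derivM deriv_exp /= derivB derivX derivC.
  exists ('X * ((0 - 1) *+ n.+1 * W + (1 - 'X) * W^`())).
  by rewrite exprS -(mulr_natr ((0 - 1) * _) n.+1) -(mulr_natr (0 - 1) n.+1); ring.
move=> jk; have [W e] := div j (ltnW jk).
have := congr1 (fun p : {poly R} => p.[1]) e; rewrite /Q horner_sum hornerM horner_exp.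
rewrite !(hornerD, hornerN, hornerC, hornerX) subrr expr0n subn_eq0 leqNgt jk mul0r => E; rewrite -[RHS]E.
by apply: eq_bigr => l _; rewrite hornerZ hornerXn expr1n mulr1.
Qed.

(* i-th space derivative of the solution of the backward heat equation equal to
   (1 - exp (- x^2))^k at w = 0: this bounded datum is x^2k to leading order at
   0, and expanding the power gives an explicit sum of Gaussians. *)
Definition Hc (k i : nat) x w : R := (i == 0)%:R +
  \sum_(l < k) 'C(k, l.+1)%:R * (-1) ^+ l.+1 * Num.sqrt (pi / l.+1%:R) *
    gk i ((4 * l.+1%:R)^-1 - w) x.

(** The powers of exp (- x^2) in the binomial expansion are heat kernels at time 1 / (4 (l + 1)),
    which fixes the coefficients and times in [Hc]. *)
Lemma gauss_heat (l : nat) x :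
  Num.sqrt (pi / l.+1%:R) * heat_kernel (4 * l.+1%:R)^-1 x = expR (- x ^+ 2) ^+ l.+1.
Proof.
rewrite /heat_kernel -expRM_natl.
have l0 : (l.+1%:R : R) != 0 by rewrite pnatr_eq0.
have -> : 4 * pi * (4 * l.+1%:R)^-1 = pi / l.+1%:R :> R.
  by move: l0; move: (l.+1%:R : R) => u u0; field.
have -> : - x ^+ 2 / (4 * (4 * l.+1%:R)^-1) = l.+1%:R * - x ^+ 2.
  by move: l0; move: (l.+1%:R : R) => u u0; field.
by rewrite mulrC mulfVK// gt_eqF// sqrtr_gt0 divr_gt0 ?pi_gt0.
Qed.

Lemma Hc0E k x : Hc k 0 x 0 = (1 - expR (- x ^+ 2)) ^+ k.
Proof.
rewrite exprBn big_ord_recl/= expr1n expr0 bin0 !mulr1 mulr1n /Hc; congr (_ + _).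
apply: eq_bigr => l _; rewrite subr0 gk0 -mulrA gauss_heat expr1n mulr1 /bump leq0n add1n.
by rewrite -mulrA mulr_natl.
Qed.

(** Odd derivatives vanish by parity; an even derivative of order 2 j is a multiple of the
    alternating sum of order j, which vanishes for 0 < j < k. Order 0 is the value (1 - 1)^k. *)
Lemma Hc_jet k i : (i < 2 * k)%N -> Hc k i 0 0 = 0.
Proof.
move=> ik.
have h0 (l : nat) : 0 < (4 * l.+1%:R)^-1 :> R by rewrite invr_gt0 mulr_gt0.
have [j [e|e]] : exists j, i = j.*2 \/ i = j.*2.+1.
  exists i./2; have := odd_double_half i; case: (odd i) => /= e; [right|left]; by rewrite -{1}e.
- case: j e => [|j] e.
    rewrite e Hc0E expr0n/= oppr0 expR0 subrr expr0n.
    by case: k ik {e} => //; rewrite muln0.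
  have [c H] := gk_even_0 j.+1; rewrite e /Hc add0r.
  have A : (j.+1 < k)%N by move: ik; rewrite e; clear; lia.
  have := alternating_sum A; rewrite big_ord_recl expr0n/= mulr0 add0r => S0.
  transitivity (c * 4 ^+ j.+1 * \sum_(l < k) 'C(k, bump 0 l)%:R * (-1) ^+ (bump 0 l) * (bump 0 l)%:R ^+ j.+1); last by rewrite S0 mulr0.
  rewrite mulr_sumr; apply: eq_bigr => l _; rewrite subr0 H// /bump leq0n add1n.
  have := gauss_heat l 0; rewrite expr0n/= oppr0 expR0 expr1n => g.
  rewrite exprVn invrK exprMn.
  set K := heat_kernel _ _ in g *; set r := Num.sqrt _ in g *.
  transitivity ('C(k, l.+1)%:R * (-1) ^+ l.+1 * (r * K) * (c * (4 ^+ j.+1 * l.+1%:R ^+ j.+1))); first by ring.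
  by rewrite g; ring.
- rewrite e /Hc/= add0r big1// => l _; by rewrite subr0 gk_odd_0// mulr0.
Qed.

(** 1 / (8 k) is half of the smallest heat time 1 / (4 k) in [Hc], so all times stay away from 0;
    the same number later bounds T. *)
Lemma Hc_h k (l : 'I_k) w : (0 < k)%N -> 0 <= w -> w <= (8 * k%:R)^-1 ->
  (8 * k%:R)^-1 <= (4 * l.+1%:R)^-1 - w <= 1.
Proof.
move=> k0 w0 w1; have kp : 0 < k%:R :> R by rewrite ltr0n.
have lp : 1 <= l.+1%:R :> R by rewrite ler1n.
have lk : l.+1%:R <= k%:R :> R by rewrite ler_nat.
have a1 : (4 * k%:R)^-1 <= (4 * l.+1%:R)^-1 :> R.
  by rewrite lef_pV2 ?posrE ?mulr_gt0 ?ltr0n// ler_pM2l.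
have a2 : (4 * k%:R)^-1 = 2 * (8 * k%:R)^-1 :> R by field; rewrite gt_eqF.
have a3 : (4 * l.+1%:R)^-1 <= 1 :> R by rewrite invf_le1 ?mulr_gt0 ?ltr0n//; lra.
move: a1 a2 a3 w0 w1; move: (4 * k%:R)^-1 (8 * k%:R)^-1 (4 * l.+1%:R)^-1 => u v z ? ? ? ? ?.
by apply/andP; split; lra.
Qed.

Lemma Hc_dx k i x w : (0 < k)%N -> 0 <= w <= (8 * k%:R)^-1 -> is_derive x 1 (fun x => Hc k i x w) (Hc k i.+1 x w).
Proof.
move=> k0 /andP[w0 w1]; rewrite /Hc.
have kp : 0 < k%:R :> R by rewrite ltr0n.
apply: is_deriveD.
have -> : (fun x => \sum_(l < k) 'C(k, l.+1)%:R * (-1) ^+ l.+1 * Num.sqrt (pi / l.+1%:R) * gk i ((4 * l.+1%:R)^-1 - w) x) =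
  \sum_(l < k) (fun x => 'C(k, l.+1)%:R * (-1) ^+ l.+1 * Num.sqrt (pi / l.+1%:R) * gk i ((4 * l.+1%:R)^-1 - w) x).
  by apply/funext => z; rewrite fct_sumE.
apply: is_derive_sum => l; apply: is_deriveZ; apply: is_derive_gk_z.
have /andP[h _] := Hc_h l k0 w0 w1; apply: lt_le_trans h; by rewrite invr_gt0 mulr_gt0.
Qed.

Lemma Hc_dw k i x w : (0 < k)%N -> 0 <= w <= (8 * k%:R)^-1 -> is_derive w 1 (fun w => Hc k i x w) (- Hc k i.+2 x w).
Proof.
move=> k0 /andP[w0 w1]; rewrite /Hc.
have kp : 0 < k%:R :> R by rewrite ltr0n.
rewrite opprD; apply: is_deriveD; first by rewrite oppr0; exact: is_derive_cst.
have -> : (fun w => \sum_(l < k) 'C(k, l.+1)%:R * (-1) ^+ l.+1 * Num.sqrt (pi / l.+1%:R) * gk i ((4 * l.+1%:R)^-1 - w) x) =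
  \sum_(l < k) (fun w => 'C(k, l.+1)%:R * (-1) ^+ l.+1 * Num.sqrt (pi / l.+1%:R) * gk i ((4 * l.+1%:R)^-1 - w) x).
  by apply/funext => z; rewrite fct_sumE.
rewrite -sumrN; apply: is_derive_sum => l; rewrite -mulrN; apply: is_deriveZ.
have h0 : 0 < (4 * l.+1%:R)^-1 - w.
  by have /andP[h _] := Hc_h l k0 w0 w1; apply: lt_le_trans h; rewrite invr_gt0 mulr_gt0.
have dB : is_derive w 1 (cst (4 * l.+1%:R)^-1 - id : R -> R) (0 - 1) by apply: is_deriveB.
rewrite sub0r in dB; have := @is_derive1_comp R (fun h => gk i h x) (fun w => (4 * l.+1%:R)^-1 - w) w _ _ (is_derive_gk_h i x h0) dB.
by rewrite mulrN1.
Qed.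

Lemma Hc_bounded k (n : nat) : (0 < k)%N -> exists2 C : R, 0 < C & forall i, (i <= n)%N -> forall x w,
  0 <= w <= (8 * k%:R)^-1 -> `|Hc k i x w| <= C.
Proof.
move=> k0; have kp : 0 < k%:R :> R by rewrite ltr0n.
have h0 : 0 < (8 * k%:R)^-1 :> R by rewrite invr_gt0 mulr_gt0.
apply: ex2_uniform => [i|i C C' H CC' x w w1]; last exact: le_trans (H x w w1) CC'.
have [C C0 H] := @gk_le_cst R i _ h0.
exists (1 + \sum_(l < k) `|'C(k, l.+1)%:R * (-1) ^+ l.+1 * Num.sqrt (pi / l.+1%:R)| * C).
  by rewrite ltr_pwDl// sumr_ge0// => l _; rewrite mulr_ge0// ltW.
move=> x w /andP[w0 w1]; apply: le_trans (ler_normD _ _) _; apply: lerD.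
  by case: (i == 0)%N; rewrite ?normr1 ?normr0.
apply: le_trans (ler_norm_sum _ _ _) _; apply: ler_sum => l _.
by rewrite normrM ler_wpM2l//; apply: H; exact: Hc_h.
Qed.

(** [caloric_taylor] with vanishing jet of order 2 k - 1 and length scale 1. *)
Lemma Hc_le k : (0 < k)%N -> exists2 C : R, 0 < C & forall i x w, (i <= 2)%N -> (i <= 2 * k)%N ->
  0 <= w <= (8 * k%:R)^-1 -> `|Hc k i x w| <= C * qd x w ^+ (2 * k - i).
Proof.
move=> k0; have [C C0 H] := Hc_bounded (2 * k).+1 k0.
exists (2 ^+ (2 * k) * C); first by rewrite mulr_gt0 ?exprn_gt0.
move=> i x w i2 ik w12; have /andP[w0 w2] := w12.
have q0 := qd_ge0 x w.
have [big|small] := leP 1 (`|x| + Num.sqrt w).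
  rewrite /qd min_r// expr1n mulr1; apply: le_trans (H i (leqW ik) x w w12) _.
  by rewrite ler_peMl ?(ltW C0)// exprn_ege1// ler1n.
have qE : qd x w = `|x| + Num.sqrt w by rewrite /qd min_l// ltW.
rewrite qE.
have r0 : 0 <= `|x| + Num.sqrt w by rewrite addr_ge0 ?sqrtr_ge0.
have wr : 0 <= w <= (`|x| + Num.sqrt w) ^+ 2.
  by rewrite w0 -[w in leLHS](sqr_sqrtr w0) lerXn2r ?nnegrE ?sqrtr_ge0// lerDr.
have vw v : 0 <= v <= w -> 0 <= v <= (8 * k%:R)^-1 by move=> /andP[-> /le_trans]; apply.
have k2 : (2 * k = (2 * k).-1.+1)%N by move: k0; clear; lia.
have jet j : (j <= (2 * k).-1)%N -> Hc k j 0 0 = 0 by move=> jk; apply: Hc_jet; rewrite k2.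
have dx (j : nat) (y v : R) : `|y| <= `|x| -> 0 <= v <= w -> is_derive y 1 (fun x => Hc k j x v) (Hc k j.+1 y v).
  by move=> _ vv; apply: Hc_dx => //; exact: vw.
have dw (j : nat) (y v : R) : `|y| <= `|x| -> 0 <= v <= w -> is_derive v 1 (fun v => Hc k j y v) (- Hc k j.+2 y v).
  by move=> _ vv; apply: Hc_dw => //; exact: vw.
have xr : 0 <= `|x| <= `|x| + Num.sqrt w by rewrite normr_ge0 lerDl sqrtr_ge0.
have b1 (y v : R) : `|y| <= `|x| -> 0 <= v <= w -> `|Hc k (2 * k).-1.+1 y v| <= C * 1 ^+ (2 * k).-1.+1.
  by move=> _ /vw vv; rewrite expr1n mulr1; apply: H => //; rewrite -k2 leqnSn.
have b2 (y v : R) : `|y| <= `|x| -> 0 <= v <= w -> `|Hc k (2 * k).-1.+2 y v| <= C * 1 ^+ (2 * k).-1.+2.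
  by move=> _ /vw vv; rewrite expr1n mulr1; apply: H => //; rewrite -k2.
have l1 : 1 * (`|x| + Num.sqrt w) <= 1 by rewrite mul1r ltW.
have ww : 0 <= w <= w by rewrite w0 lexx.
have ik' : (i <= (2 * k).-1.+1)%N by rewrite -k2.
have := caloric_taylor (ltW C0) ler01 r0 l1 xr wr dx dw jet b1 b2 ik' (lexx _) ww.
rewrite -k2 expr1n mulr1 mul1r => /le_trans; apply.
rewrite ler_wpM2r ?exprn_ge0// ler_wpM2r ?(ltW C0)//.
by rewrite ler_weXn2l ?ler1n// leq_subr.
Qed.

Lemma qd_mono x v w : v <= w -> qd x v <= qd x w.
Proof.
move=> vw; have h : `|x| + Num.sqrt v <= `|x| + Num.sqrt w by rewrite lerD2l; exact: ler_wsqrtr.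
rewrite /qd le_min !ge_min lexx orbT andbT; apply/orP; left; exact: h.
Qed.

(** The time derivative is a second space derivative: two powers of the distance are traded for one
    power of w. *)
Lemma Hc_time k : (0 < k)%N -> exists2 C : R, 0 < C & forall x w,
  0 <= w <= (8 * k%:R)^-1 -> `|Hc k 0 x w - Hc k 0 x 0| <= C * w * qd x w ^+ (2 * k - 2).
Proof.
move=> k0; have [C C0 H] := Hc_le k0; exists C => // x w /andP[w0 w1].
have d v : Num.min 0 w <= v <= Num.max 0 w -> is_derive v 1 (fun w => Hc k 0 x w) (- Hc k 2 x v).
  rewrite min_l// max_r// => /andP[v0 v1]; apply: Hc_dw => //; by rewrite v0 (le_trans v1).
have b v : Num.min 0 w <= v <= Num.max 0 w -> `|- Hc k 2 x v| <= C * qd x w ^+ (2 * k - 2).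
  rewrite min_l// max_r// normrN => /andP[v0 v1].
  apply: le_trans (H 2 x v _ _ _) _ => //.
  - by move: k0; clear; lia.
  - by rewrite v0 (le_trans v1).
  - by rewrite ler_wpM2l ?(ltW C0)// lerXn2r ?nnegrE ?qd_ge0// qd_mono.
have := mvt_abs d b; rewrite subr0 (ger0_norm w0) => /le_trans; apply.
by rewrite mulrAC.
Qed.

Lemma one_expR_ge (y : R) : 0 <= y -> y / (1 + y) <= 1 - expR (- y).
Proof.
move=> y0; have y1 : 0 < 1 + y by rewrite ltr_pwDl.
have h : expR (- y) <= (1 + y)^-1.
  by rewrite expRN lef_pV2 ?posrE ?expR_gt0// expR_ge1Dx.
have -> : y / (1 + y) = 1 - (1 + y)^-1 by field; rewrite gt_eqF.
lra.
Qed.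

Lemma one_expR_le (y : R) : 1 - expR (- y) <= y.
Proof. have := expR_ge1Dx (- y); lra. Qed.

(** 1 - exp (- m^2) >= m^2 / (1 + m^2) >= m^2 / 2 for m = min (|x|, 1), raised to the power k. *)
Lemma Hc0_ge k x : 2 ^- k * Num.min `|x| 1 ^+ (2 * k) <= Hc k 0 x 0.
Proof.
rewrite Hc0E exprM -exprVn -exprMn; set m := Num.min _ _.
have m0 : 0 <= m by rewrite le_min normr_ge0/=.
have m1 : m <= 1 by rewrite ge_min lexx orbT.
rewrite lerXn2r ?nnegrE ?mulr_ge0 ?sqr_ge0 ?invr_ge0//.
  by rewrite subr_ge0 -[leRHS]expR0 ler_expR oppr_le0 sqr_ge0.
have mx : m ^+ 2 <= x ^+ 2.
  by rewrite -[leRHS]real_normK ?num_real// lerXn2r ?nnegrE// ge_min lexx.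
apply: (@le_trans _ _ (1 - expR (- m ^+ 2))); last first.
  by rewrite lerD2l lerN2 ler_expR lerN2.
apply: le_trans (one_expR_ge (sqr_ge0 m)); rewrite mulrC ler_wpM2l ?sqr_ge0//.
have m2 : m ^+ 2 <= 1 by rewrite exprn_ile1.
have m20 := sqr_ge0 m.
rewrite lef_pV2 ?posrE; lra.
Qed.

End CaloricProfile.

(** * Interpolation between the parabolic weights *)

Section Weights.
Context {R : realType}.
Implicit Types (x w c C : R).

(* With q the parabolic distance and w = T - t, the sources [f1], [f2] will be
   O(q^2k w^-nu) and O(q^(k-1) w^-ze); the space derivatives of the solution
   involve w^-om and w^-chi. These values make [GG_weight] and [exponents] true. *)
Definition nu (k : nat) : R := (1 + 3 / k%:R) / 4.
Definition ze (k : nat) : R := (1 + k%:R^-1) / 2.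
Definition om (k : nat) : R := k%:R^-1 / 2.
Definition chi (k : nat) : R := nu k / 2.

Lemma invk_bounds k : (2 <= k)%N -> 0 < (k%:R^-1 : R) <= 2^-1.
Proof.
move=> k2; rewrite invr_gt0 ltr0n (ltn_trans _ k2)//= lef_pV2 ?posrE ?ltr0n ?ler_nat//.
exact: ltn_trans k2.
Qed.

Definition DD (k : nat) x w : R := w + qd x w ^+ (2 * k).

(* Size of the logarithmic space derivative of the solution. *)
Definition GG (k : nat) x w : R :=
  (qd x w ^+ (2 * k - 1) + qd x w ^+ (2 * k) * w `^ (- om k)) / DD k x w +
  qd x w ^+ (k - 1) * w `^ (- chi k).

Lemma DD_gt0 k x w : 0 < w -> 0 < DD k x w.
Proof. by move=> w0; rewrite /DD ltr_pwDl// exprn_ge0// qd_ge0. Qed.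

Lemma GG_ge0 k x w : 0 < w -> 0 <= GG k x w.
Proof.
move=> w0; have q0 := qd_ge0 x w; have D0 := DD_gt0 k x w0.
by rewrite /GG addr_ge0 ?mulr_ge0 ?addr_ge0 ?exprn_ge0 ?powR_ge0 ?invr_ge0 ?(ltW D0)// mulr_ge0 ?exprn_ge0 ?powR_ge0.
Qed.

(** A weighted geometric mean: [DD] dominates both q^(2k) and w, hence (q^(2k))^th w^(1 - th), and
    th is fixed by the power n of q that is wanted. *)
Lemma DD_interp k (n : nat) (th : R) x w : 0 < w -> 0 <= th <= 1 -> 2 * k%:R * th = n%:R ->
  qd x w ^+ n * w `^ (1 - th) <= DD k x w.
Proof.
move=> w0 /andP[th0 th1] en; have q0 := qd_ge0 x w; have D0 := DD_gt0 k x w0.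
have -> : qd x w ^+ n = (qd x w ^+ (2 * k)) `^ th.
  by rewrite -!powR_mulrn// -powRrM natrM en.
have -> : DD k x w = DD k x w `^ th * DD k x w `^ (1 - th).
  by rewrite -powRDp// addrC subrK powRr1// ltW.
apply: ler_pM; rewrite ?powR_ge0//; apply: powR_mono => //.
- by rewrite exprn_ge0.
- by rewrite lerDr ltW.
- exact: ltW.
- by rewrite lerDl exprn_ge0.
- by rewrite subr_ge0.
Qed.

Lemma DD_interp2 k (n : nat) (th : R) x w : 0 < w -> 0 <= th <= 1 -> 4 * k%:R * th = n%:R ->
  qd x w ^+ n * w `^ (2 * (1 - th)) <= DD k x w ^+ 2.
Proof.
move=> w0 /andP[th0 th1] en; have q0 := qd_ge0 x w; have D0 := DD_gt0 k x w0.
have -> : qd x w ^+ n = (qd x w ^+ (2 * k)) `^ (2 * th).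
  by rewrite -!powR_mulrn// -powRrM natrM -en; congr (_ `^ _); ring.
have -> : DD k x w ^+ 2 = DD k x w `^ (2 * th) * DD k x w `^ (2 * (1 - th)).
  by rewrite -powRDp// -mulrDr addrC subrK mulr1 powR_mulrn// ltW.
apply: ler_pM; rewrite ?powR_ge0//; apply: powR_mono => //.
- by rewrite exprn_ge0.
- by rewrite lerDr ltW.
- by rewrite mulr_ge0.
- exact: ltW.
- by rewrite lerDl exprn_ge0.
- by rewrite mulr_ge0// subr_ge0.
Qed.

Lemma sqr3_le (a b c : R) : (a + b + c) ^+ 2 <= 3 * (a ^+ 2 + b ^+ 2 + c ^+ 2).
Proof. have := sqr_ge0 (a - b); have := sqr_ge0 (a - c); have := sqr_ge0 (b - c); lra. Qed.

Lemma powR_weaken (a u v : R) : 0 < a <= 1 -> u <= v -> a `^ (- u) <= a `^ (- v).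
Proof. by move=> a01 uv; apply: ger_powR => //; rewrite lerN2. Qed.

(** [N1] will have size D G^2 and [N2] size G^2, so this says that the weights reproduce themselves
    under the nonlinearity. Each of the three terms of [GG] is squared and treated alone; 12 = 3 (1
    + 1 + 2) and 9 = 3 (1 + 1 + 1). *)
Lemma GG_weight k x w : (2 <= k)%N -> 0 < w <= 1 ->
  DD k x w * GG k x w ^+ 2 <= 12 * qd x w ^+ (2 * k) * w `^ (- nu k) /\
  GG k x w ^+ 2 <= 9 * qd x w ^+ (k - 1) * w `^ (- ze k).
Proof.
move=> k2 w01; have /andP[w0 w1] := w01; have q0 := qd_ge0 x w; have D0 := DD_gt0 k x w0.
have q1 := qd_le1 x w; have /andP[e0 e1] := invk_bounds k2.
have kn0 : k%:R != 0 :> R by rewrite pnatr_eq0; move: k2; clear; case: k.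
have wq : w <= qd x w ^+ 2 by apply: le_qd2; rewrite (ltW w0).
have I1 : qd x w ^+ (2 * k - 2) <= DD k x w * w `^ (- k%:R^-1).
  rewrite powRN ler_pdivlMr ?powR_gt0//.
  have := @DD_interp k (2 * k - 2) (1 - k%:R^-1) x w w0; rewrite subKr; apply; first lra.
  by rewrite natrB ?natrM; [field|move: k2; clear; lia].
(* The power 3 k - 1 is what remains of q^(4k - 2), the square of the first term, once q^(k - 1) is
   kept for the target; the exponent of w left over is exactly [ze k]. *)
have I2 : qd x w ^+ (3 * k - 1) <= DD k x w ^+ 2 * w `^ (- ze k).
  rewrite powRN ler_pdivlMr ?powR_gt0//.
  have := @DD_interp2 k (3 * k - 1) ((3 - k%:R^-1) / 4) x w w0.
  have -> : 2 * (1 - (3 - k%:R^-1) / 4) = ze k by rewrite /ze; lra.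
  apply; first lra.
  by rewrite natrB ?natrM; [field|move: k2; clear; lia].
(* Likewise for the second term, whose square is q^(4k) w^(- 1/k): the powers (1 - 1/k) / 2 and 1/k
   of 1 / w add up to [ze k]. *)
have I3 : qd x w ^+ (3 * k + 1) <= DD k x w ^+ 2 * w `^ (- ((1 - k%:R^-1) / 2)).
  rewrite powRN ler_pdivlMr ?powR_gt0//.
  have := @DD_interp2 k (3 * k + 1) ((3 + k%:R^-1) / 4) x w w0.
  have -> : 2 * (1 - (3 + k%:R^-1) / 4) = (1 - k%:R^-1) / 2 :> R by move: (k%:R^-1 : R) => i; field.
  apply; first lra.
  by rewrite natrD natrM; field.
have D1 : DD k x w <= 2 * qd x w ^+ 2.
  have : qd x w ^+ (2 * k) <= qd x w ^+ 2 by rewrite ler_wiXn2l//; move: k2; clear; lia.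
  by rewrite /DD; lra.
have G3 := sqr3_le (qd x w ^+ (2 * k - 1) / DD k x w) (qd x w ^+ (2 * k) * w `^ (- om k) / DD k x w) (qd x w ^+ (k - 1) * w `^ (- chi k)).
have GE : GG k x w = qd x w ^+ (2 * k - 1) / DD k x w + qd x w ^+ (2 * k) * w `^ (- om k) / DD k x w + qd x w ^+ (k - 1) * w `^ (- chi k) by rewrite /GG mulrDl.
rewrite -GE !exprMn !exprVn -!exprM in G3.
have eo : (w `^ (- om k)) ^+ 2 = w `^ (- k%:R^-1).
  by rewrite -powR_mulrn ?powR_ge0// -powRrM; congr (_ `^ _); rewrite /om; lra.
have ec : (w `^ (- chi k)) ^+ 2 = w `^ (- nu k).
  by rewrite -powR_mulrn ?powR_ge0// -powRrM; congr (_ `^ _); rewrite /chi; lra.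
rewrite eo ec in G3.
have x1 : ((2 * k - 1) * 2 = (2 * k - 2) + 2 * k)%N by move: k2; clear; lia.
have x2 : ((2 * k - 1) * 2 = (3 * k - 1) + (k - 1))%N by move: k2; clear; lia.
have x3 : (2 * k * 2 = 2 * k + 2 * k)%N by move: k2; clear; lia.
have x4 : (2 * k * 2 = (3 * k + 1) + (k - 1))%N by move: k2; clear; lia.
have x5 : (2 + (k - 1) * 2 = 2 * k)%N by move: k2; clear; lia.
have x6 : ((k - 1) * 2 = (k - 1) + (k - 1))%N by move: k2; clear; lia.
set q := qd x w in q0 q1 wq I1 I2 I3 D1 G3 *; set D := DD k x w in D0 I1 I2 I3 D1 G3 *.
set G := GG k x w in G3 *.
have D20 : 0 < D ^+ 2 by rewrite exprn_gt0.
have en : w `^ (- k%:R^-1) <= w `^ (- nu k) by apply: powR_weaken => //; rewrite /nu; lra.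
have nz : w `^ (- nu k) <= w `^ (- ze k) by apply: powR_weaken => //; rewrite /nu /ze; lra.
have qk n : 0 <= q ^+ n by rewrite exprn_ge0.
have pw u : 0 <= w `^ u by exact: powR_ge0.
split.
  have t1 : D * (q ^+ ((2 * k - 1) * 2) / D ^+ 2) <= q ^+ (2 * k) * w `^ (- nu k).
    have -> : D * (q ^+ ((2 * k - 1) * 2) / D ^+ 2) = q ^+ (2 * k) * (q ^+ (2 * k - 2) / D).
      by rewrite x1 exprD; field; rewrite gt_eqF.
    rewrite ler_wpM2l// ler_pdivrMr// mulrC; apply: le_trans I1 _.
    by rewrite ler_wpM2l// ltW.
  have t2 : D * (q ^+ (2 * k * 2) * w `^ (- k%:R^-1) / D ^+ 2) <= q ^+ (2 * k) * w `^ (- nu k).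
    have -> : D * (q ^+ (2 * k * 2) * w `^ (- k%:R^-1) / D ^+ 2) = q ^+ (2 * k) * (q ^+ (2 * k) / D * w `^ (- k%:R^-1)).
      by rewrite x3 exprD; field; rewrite gt_eqF.
    rewrite ler_wpM2l//; apply: le_trans en; rewrite ler_piMl// ler_pdivrMr// mul1r.
    by rewrite /D /DD lerDr ltW.
  have t3 : D * (q ^+ ((k - 1) * 2) * w `^ (- nu k)) <= 2 * (q ^+ (2 * k) * w `^ (- nu k)).
    rewrite mulrA [leRHS]mulrA; apply: wpM_le => //.
    by rewrite -x5 exprD mulrA; apply: wpM_le.
  apply: le_trans (ler_wpM2l (ltW D0) G3) _.
  have -> : D * (3 * (q ^+ ((2 * k - 1) * 2) / D ^+ 2 + q ^+ (2 * k * 2) * w `^ (- k%:R^-1) / D ^+ 2 + q ^+ ((k - 1) * 2) * w `^ (- nu k))) =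
    3 * (D * (q ^+ ((2 * k - 1) * 2) / D ^+ 2) + D * (q ^+ (2 * k * 2) * w `^ (- k%:R^-1) / D ^+ 2) + D * (q ^+ ((k - 1) * 2) * w `^ (- nu k))) by ring.
  by rewrite -mulrA; lra.
have t1 : q ^+ ((2 * k - 1) * 2) / D ^+ 2 <= q ^+ (k - 1) * w `^ (- ze k).
  rewrite x2 exprD ler_pdivrMr// [leLHS]mulrC -mulrA ler_wpM2l//.
  by rewrite mulrC.
have t2 : q ^+ (2 * k * 2) * w `^ (- k%:R^-1) / D ^+ 2 <= q ^+ (k - 1) * w `^ (- ze k).
  have -> : w `^ (- ze k) = w `^ (- ((1 - k%:R^-1) / 2)) * w `^ (- k%:R^-1).
    by rewrite -powRDp//; congr (_ `^ _); rewrite /ze; lra.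
  rewrite x4 exprD ler_pdivrMr//.
  have -> : q ^+ (3 * k + 1) * q ^+ (k - 1) * w `^ (- k%:R^-1) = q ^+ (k - 1) * w `^ (- k%:R^-1) * q ^+ (3 * k + 1) by ring.
  have -> : q ^+ (k - 1) * (w `^ (- ((1 - k%:R^-1) / 2)) * w `^ (- k%:R^-1)) * D ^+ 2 =
    q ^+ (k - 1) * w `^ (- k%:R^-1) * (D ^+ 2 * w `^ (- ((1 - k%:R^-1) / 2))) by ring.
  by rewrite ler_wpM2l// mulr_ge0.
have t3 : q ^+ ((k - 1) * 2) * w `^ (- nu k) <= q ^+ (k - 1) * w `^ (- ze k).
  apply: ler_pM => //; rewrite x6 exprD ler_piMl//.
  by rewrite exprn_ile1.
by apply: le_trans G3 _; rewrite -mulrA; lra.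
Qed.

End Weights.

(** * Size and Lipschitz estimates of the quadratic sources *)

Section Nonlinear.
Context {R : realType}.
Implicit Types (x w c C g s r u e D G M : R).

Definition quad (a1 a2 a3 : R) g s := a1 * g ^+ 2 + a2 * (g * s) + a3 * s ^+ 2.

Lemma quad_lip a1 a2 a3 : exists2 A : R, 0 < A & forall g s g' s' M e,
  `|g| <= M -> `|s| <= M -> `|g'| <= M -> `|s'| <= M -> `|g - g'| <= e -> `|s - s'| <= e ->
  `|quad a1 a2 a3 g s - quad a1 a2 a3 g' s'| <= A * e * M.
Proof.
exists (1 + 2 * (`|a1| + `|a2| + `|a3|)); first by rewrite ltr_pwDl// mulr_ge0// !addr_ge0.
move=> g s g' s' M e gM sM gM' sM' ge se.
have e0 : 0 <= e by exact: le_trans ge.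
have M0 : 0 <= M by exact: le_trans gM.
have pr (a b a' b' : R) : `|a| <= M -> `|b| <= M -> `|a'| <= M -> `|b'| <= M -> `|a - a'| <= e -> `|b - b'| <= e ->
    `|a * b - a' * b'| <= 2 * (e * M).
  move=> aM bM aM' bM' ae be.
  have -> : a * b - a' * b' = (a - a') * b + a' * (b - b') by ring.
  apply: le_trans (ler_normD _ _) _; rewrite !normrM mulr2n mulrDl !mul1r; apply: lerD.
    exact: ler_pM.
  by rewrite mulrC; exact: ler_pM.
have -> : quad a1 a2 a3 g s - quad a1 a2 a3 g' s' =
  a1 * (g * g - g' * g') + a2 * (g * s - g' * s') + a3 * (s * s - s' * s') by rewrite /quad; ring.
apply: le_trans (ler_normD _ _) _.
have h1 : `|a1 * (g * g - g' * g')| <= `|a1| * (2 * (e * M)) by rewrite normrM ler_wpM2l// pr.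
have h2 : `|a2 * (g * s - g' * s')| <= `|a2| * (2 * (e * M)) by rewrite normrM ler_wpM2l// pr.
have h3 : `|a3 * (s * s - s' * s')| <= `|a3| * (2 * (e * M)) by rewrite normrM ler_wpM2l// pr.
apply: le_trans (lerD (le_trans (ler_normD _ _) (lerD h1 h2)) h3) _.
have -> : (1 + 2 * (`|a1| + `|a2| + `|a3|)) * e * M = e * M +
  (`|a1| * (2 * (e * M)) + `|a2| * (2 * (e * M)) + `|a3| * (2 * (e * M))) by ring.
by rewrite lerDr mulr_ge0.
Qed.

(* Real and imaginary parts of the square of the gradient in the equations
   satisfied by r and phi when u = r^-c e^(i phi), c = (1 + i de)/(p - 1);
   here g = r_x / r and s = phi_x. *)
Definition ReZ (al de : R) g s := quad (al ^+ 2 - al ^+ 2 * de ^+ 2 + al) (2 * al * de) (-1) g s.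
Definition ImZ (al de : R) g s := quad (2 * al ^+ 2 * de + al * de) (- 2 * al) 0 g s.

Definition N1 (p de : R) r u s := - (p - 1) * r * ReZ (p - 1)^-1 de (u / r) s.
Definition N2 (p de : R) r u s := ImZ (p - 1)^-1 de (u / r) s - de * ReZ (p - 1)^-1 de (u / r) s.

(** The estimates are homogeneous: D is the size of r, G that of u / r and s, and e a relative
    distance between two states. The lower bound r >= c0 D makes the quotient u / r Lipschitz in
    these units. *)
Lemma nonlin_le (p de c0 C0 : R) : 0 < c0 -> 0 < C0 -> exists2 K : R, 0 < K &
  forall D G e r r' u u' s s', 0 < D -> 0 <= G -> 0 <= e ->
  c0 * D <= r <= C0 * D -> c0 * D <= r' <= C0 * D -> `|u| <= C0 * (D * G) -> `|u'| <= C0 * (D * G) ->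
  `|s| <= C0 * G -> `|s'| <= C0 * G -> `|r - r'| <= e * D -> `|u - u'| <= e * (D * G) -> `|s - s'| <= e * G ->
  [/\ `|N1 p de r u s| <= K * (D * G ^+ 2), `|N2 p de r u s| <= K * G ^+ 2,
   `|N1 p de r u s - N1 p de r' u' s'| <= K * e * (D * G ^+ 2) &
   `|N2 p de r u s - N2 p de r' u' s'| <= K * e * G ^+ 2].
Proof.
move=> c00 C00.
have [A A0 HA] := quad_lip ((p - 1)^-1 ^+ 2 - (p - 1)^-1 ^+ 2 * de ^+ 2 + (p - 1)^-1) (2 * (p - 1)^-1 * de) (-1).
have [B B0 HB] := quad_lip (2 * (p - 1)^-1 ^+ 2 * de + (p - 1)^-1 * de) (- 2 * (p - 1)^-1) 0.
pose m := C0 + C0 / c0; pose l := 1 + c0^-1 + C0 / c0 ^+ 2.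
have m0 : 0 < m by rewrite /m addr_gt0 ?divr_gt0.
have l0 : 0 < l by rewrite /l !addr_gt0 ?divr_gt0 ?exprn_gt0 ?invr_gt0.
pose k1 := (B + `|de| * A) * (m ^+ 2 + l * m).
pose k2 := `|p - 1| * (C0 * A * (m ^+ 2 + l * m) + A * m ^+ 2).
have k10 : 0 < k1.
  rewrite /k1; apply: mulr_gt0; first by rewrite ltr_wpDr// mulr_ge0// ltW.
  by rewrite addr_gt0 ?exprn_gt0 ?mulr_gt0.
have k20 : 0 <= k2 by rewrite /k2; nonneg.
exists (k1 + k2); first by rewrite ltr_wpDr.
move=> D G e r r' u u' s s' D0 G0 e0 /andP[r1 r2] /andP[r1' r2'] uG uG' sG sG' re ue se.
have cD : 0 < c0 * D by rewrite mulr_gt0.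
have r0 : 0 < r by exact: lt_le_trans r1.
have r0' : 0 < r' by exact: lt_le_trans r1'.
have gb (v q : R) : `|v| <= C0 * (D * G) -> c0 * D <= q -> `|v / q| <= C0 / c0 * G.
  move=> vG qD; have q0 : 0 < q by exact: lt_le_trans qD.
  rewrite normrM normfV (ger0_norm (ltW q0)) ler_pdivrMr//; apply: le_trans vG _.
  have -> : C0 * (D * G) = C0 / c0 * G * (c0 * D) by field; rewrite gt_eqF.
  by rewrite ler_wpM2l//; nonneg.
have mG : C0 / c0 * G <= m * G by apply: wpM_le => //; rewrite /m lerDr ltW.
have mG2 : C0 * G <= m * G by apply: wpM_le => //; rewrite /m lerDl divr_ge0 ?ltW.
have g1 := le_trans (gb u r uG r1) mG; have g2 := le_trans (gb u' r' uG' r1') mG.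
have s1 := le_trans sG mG2; have s2 := le_trans sG' mG2.
have lg : `|u / r - u' / r'| <= l * (e * G).
  have -> : u / r - u' / r' = (u - u') / r + (u' / r') * ((r' - r) / r).
    by field; rewrite !gt_eqF.
  apply: le_trans (ler_normD _ _) _.
  have -> : l * (e * G) = c0^-1 * (e * G) + C0 / c0 * G * (e / c0) + e * G by rewrite /l; field; rewrite gt_eqF.
  rewrite ler_wpDr ?mulr_ge0//; apply: lerD.
    rewrite normrM normfV (ger0_norm (ltW r0)) ler_pdivrMr//; apply: le_trans ue _.
    have -> : e * (D * G) = c0^-1 * (e * G) * (c0 * D) by field; rewrite gt_eqF.
    by rewrite ler_wpM2l//; nonneg.
  rewrite normrM; apply: ler_pM => //; first by exact: gb.
  rewrite normrM normfV (ger0_norm (ltW r0)) distrC ler_pdivrMr//; apply: le_trans re _.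
  have -> : e * D = e / c0 * (c0 * D) by field; rewrite gt_eqF.
  by rewrite ler_wpM2l//; nonneg.
have ls : `|s - s'| <= l * (e * G).
  apply: le_trans se _; rewrite ler_peMl ?mulr_ge0//.
  by rewrite /l -addrA lerDl addr_ge0 ?invr_ge0 ?divr_ge0 ?exprn_ge0 ?ltW.
have z0 : `|0 : R| <= m * G by rewrite normr0 mulr_ge0// ltW.
have a0 a : `|a - 0| = `|a| :> R by rewrite subr0.
have q00 a b c : quad a b c 0 0 = 0 by rewrite /quad; ring.
(* The size bound is the Lipschitz bound against the zero argument, where the quadratic form
   vanishes, with the distance taken equal to the size. *)
have bA : `|ReZ (p - 1)^-1 de (u / r) s| <= A * m ^+ 2 * G ^+ 2.
  have := HA (u / r) s 0 0 (m * G) (m * G) g1 s1 z0 z0.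
  rewrite q00 !a0 => /(_ g1 s1) /le_trans; apply; apply: eqle; ring.
have bA' : `|ReZ (p - 1)^-1 de (u' / r') s'| <= A * m ^+ 2 * G ^+ 2.
  have := HA (u' / r') s' 0 0 (m * G) (m * G) g2 s2 z0 z0.
  rewrite q00 !a0 => /(_ g2 s2) /le_trans; apply; apply: eqle; ring.
have bB : `|ImZ (p - 1)^-1 de (u / r) s| <= B * m ^+ 2 * G ^+ 2.
  have := HB (u / r) s 0 0 (m * G) (m * G) g1 s1 z0 z0.
  rewrite q00 !a0 => /(_ g1 s1) /le_trans; apply; apply: eqle; ring.
have dA : `|ReZ (p - 1)^-1 de (u / r) s - ReZ (p - 1)^-1 de (u' / r') s'| <= A * (l * m) * (e * G ^+ 2).
  apply: le_trans (HA _ _ _ _ _ _ g1 s1 g2 s2 lg ls) _; apply: eqle; ring.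
have dB : `|ImZ (p - 1)^-1 de (u / r) s - ImZ (p - 1)^-1 de (u' / r') s'| <= B * (l * m) * (e * G ^+ 2).
  apply: le_trans (HB _ _ _ _ _ _ g1 s1 g2 s2 lg ls) _; apply: eqle; ring.
have G20 : 0 <= G ^+ 2 by exact: sqr_ge0.
rewrite /N1 /N2; move: bA bA' bB dA dB.
set X := ReZ _ _ _ _; set X' := ReZ _ _ (u' / r') _; set Y := ImZ _ _ _ _; set Y' := ImZ _ _ (u' / r') _.
move=> bA bA' bB dA dB.
have b2 : `|Y - de * X| <= (B + `|de| * A) * m ^+ 2 * G ^+ 2.
  apply: le_trans (ler_normB _ _) _; rewrite normrM.
  have -> : (B + `|de| * A) * m ^+ 2 * G ^+ 2 = B * m ^+ 2 * G ^+ 2 + `|de| * (A * m ^+ 2 * G ^+ 2) by ring.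
  by apply: lerD => //; rewrite ler_wpM2l.
have d2 : `|Y - de * X - (Y' - de * X')| <= (B + `|de| * A) * (l * m) * (e * G ^+ 2).
  have -> : Y - de * X - (Y' - de * X') = (Y - Y') - de * (X - X') by ring.
  apply: le_trans (ler_normB _ _) _; rewrite normrM.
  have -> : (B + `|de| * A) * (l * m) * (e * G ^+ 2) = B * (l * m) * (e * G ^+ 2) + `|de| * (A * (l * m) * (e * G ^+ 2)) by ring.
  by apply: lerD => //; rewrite ler_wpM2l.
have rn : `|r| <= C0 * D by rewrite ger0_norm ?(ltW r0).
have b1 : `|- (p - 1) * r * X| <= `|p - 1| * (C0 * A * m ^+ 2) * (D * G ^+ 2).
  rewrite normrM normrM normrN.
  have -> : `|p - 1| * (C0 * A * m ^+ 2) * (D * G ^+ 2) = `|p - 1| * (C0 * D) * (A * m ^+ 2 * G ^+ 2) by ring.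
  by apply: ler_pM => //; rewrite ler_wpM2l.
have d1 : `|- (p - 1) * r * X - - (p - 1) * r' * X'| <= `|p - 1| * (C0 * A * (l * m) + A * m ^+ 2) * (e * (D * G ^+ 2)).
  have -> : - (p - 1) * r * X - - (p - 1) * r' * X' = - (p - 1) * (r * (X - X') + (r - r') * X') by ring.
  rewrite normrM normrN -[leRHS]mulrA ler_wpM2l//.
  apply: le_trans (ler_normD _ _) _; rewrite [leRHS]mulrDl normrM (normrM (r - r')); apply: lerD.
    have -> : C0 * A * (l * m) * (e * (D * G ^+ 2)) = C0 * D * (A * (l * m) * (e * G ^+ 2)) by ring.
    exact: ler_pM.
  have -> : A * m ^+ 2 * (e * (D * G ^+ 2)) = e * D * (A * m ^+ 2 * G ^+ 2) by ring.
  exact: ler_pM.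
have DG : 0 <= D * G ^+ 2 by rewrite mulr_ge0// ltW.
split.
- apply: le_trans b1 _; apply: wpM_le => //; rewrite ler_wpDl ?(ltW k10)// /k2 ler_wpM2l//.
  by rewrite mulrDr -addrA lerDl; nonneg.
- apply: le_trans b2 _; apply: wpM_le => //; rewrite ler_wpDr// /k1 ler_wpM2l//; first by nonneg.
  by rewrite lerDl; nonneg.
- apply: le_trans d1 _; rewrite -[leRHS]mulrA; apply: wpM_le; first last. by nonneg.
  rewrite ler_wpDl ?(ltW k10)// /k2 ler_wpM2l// lerD2r ler_wpM2l//; first by nonneg.
  by rewrite lerDr; nonneg.
- apply: le_trans d2 _; rewrite -[leRHS]mulrA; apply: wpM_le; first last. by nonneg.
  rewrite ler_wpDr// /k1 ler_wpM2l//; first by nonneg.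
  by rewrite lerDr; nonneg.
Qed.

End Nonlinear.

(** * Two-sided bounds for the approximate solution plus correction *)

Section Ansatz.
Context {R : realType}.
Implicit Types (x w c C s t T A : R).

(** A common lower bound for the four powers of T gained by the corrected Duhamel integrals and
    their derivatives. *)
Definition et (k : nat) : R := (1 - k%:R^-1) / 8.

Lemma exponents k : (2 <= k)%N ->
  [/\ 0 < (nu k : R) < 1, 0 <= (om k : R) <= nu k, om k <= 2^-1 :> R & nu k - om k < 2^-1 :> R] /\
  [/\ 0 < (ze k : R) < 1, 0 <= (chi k : R) <= ze k, chi k <= 2^-1 :> R & ze k - chi k < 2^-1 :> R] /\
  [/\ 0 < et k :> R, et k <= (1 - nu k) / 2 :> R, et k <= 2^-1 - nu k + om k :> R,
      et k <= (1 - ze k) / 2 :> R & et k <= 2^-1 - ze k + chi k :> R].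
Proof.
move=> k2; have /andP[e0 e1] := @invk_bounds R k k2.
rewrite /chi /nu /ze /om /et; move: e0 e1; move: (k%:R^-1 : R) => e e0 e1.
by do !split; lra.
Qed.

Lemma powR_div_le (T u v : R) : 0 < T <= 1 -> 0 < v -> v <= u -> T `^ u / u <= v^-1 * T `^ v.
Proof.
move=> /andP[T0 T1] v0 vu; rewrite mulrC; apply: ler_pM; rewrite ?powR_ge0 ?invr_ge0//.
- by apply: ltW; apply: lt_le_trans vu.
- by rewrite lef_pV2 ?posrE// (lt_le_trans v0).
- by apply: ger_powR => //; rewrite T0.
Qed.

Lemma small_powR (v e : R) : 0 < v -> 0 < e -> exists2 T0 : R, 0 < T0 & forall T, 0 < T < T0 -> T `^ v <= e.
Proof.
move=> v0 e0; exists (e `^ v^-1); first by rewrite powR_gt0.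
move=> T /andP[T0 T1]; rewrite -[leRHS](powRr1 (ltW e0)) -(mulVf (lt0r_neq0 v0)) powRrM.
by apply: powR_mono; rewrite ltW.
Qed.

Lemma LP_bounds k : (2 <= k)%N -> exists2 C : R, 0 < C & forall T A f1 f2 t x,
  0 < T <= 2^-1 -> 0 <= A -> measurable_fun setT f1 -> measurable_fun setT f2 ->
  wbound (2 * k) (nu k) T A f1 -> wbound (k - 1) (ze k) T A f2 -> 0 <= t < T ->
  [/\ `|LP (2 * k) T 0 f1 t x| <= C * A * T `^ et k * (qd x (T - t) ^+ (2 * k) * qd x (T - t) `^ (1 - nu k)),
   `|LP (2 * k) T 1 f1 t x| <= C * A * T `^ et k * (qd x (T - t) ^+ (2 * k) * (T - t) `^ (- om k)),
   `|LP (k - 1) T 0 f2 t x| <= C * A * T `^ et k * (qd x (T - t) ^+ (k - 1) * qd x (T - t) `^ (1 - ze k)) &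
   `|LP (k - 1) T 1 f2 t x| <= C * A * T `^ et k * (qd x (T - t) ^+ (k - 1) * (T - t) `^ (- chi k))].
Proof.
move=> k2; have [[n1 n2 n3 n4] [[z1 z2 z3 z4] [e0 e1 e2 e3 e4]]] := exponents k2.
have k0 : (0 < 2 * k)%N by move: k2; clear; lia.
have k1 : (0 < k - 1)%N by move: k2; clear; lia.
have [C1 C10 H1] := @LP0_le R _ k0; have [C2 C20 H2] := @LP1_le R _ k0.
have [C3 C30 H3] := @LP0_le R _ k1; have [C4 C40 H4] := @LP1_le R _ k1.
exists ((C1 + C2 + C3 + C4) / et k); first by rewrite divr_gt0 ?addr_gt0.
move=> T A f1 f2 t x T01 A0 m1 m2 w1 w2 tT.
have T01' : 0 < T <= 1 by move: T01; lra.
have q0 := qd_ge0 x (T - t).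
have gen (c u X Y : R) : 0 < c -> c <= C1 + C2 + C3 + C4 -> et k <= u -> 0 <= X -> 0 <= Y ->
   c * A * (T `^ u / u) * X * Y <= (C1 + C2 + C3 + C4) / et k * A * T `^ et k * (X * Y).
  move=> c0 cC eu X0 Y0; rewrite -[leLHS]mulrA; apply: wpM_le; last exact: mulr_ge0.
  have -> : (C1 + C2 + C3 + C4) / et k * A * T `^ et k = (C1 + C2 + C3 + C4) * A * ((et k)^-1 * T `^ et k) by ring.
  apply: ler_pM; [by nonneg| | |exact: powR_div_le].
    by rewrite mulr_ge0 ?powR_ge0 ?invr_ge0// (le_trans (ltW e0)).
  by apply: wpM_le.
split.
- apply: le_trans (H1 _ _ _ _ _ x n1 T01 A0 m1 w1 tT) _; apply: gen => //; [|by nonneg|by nonneg].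
  by rewrite -!addrA lerDl !addr_ge0 ?ltW.
- apply: le_trans (H2 _ _ _ _ _ _ x n1 n2 n3 n4 T01 A0 m1 w1 tT) _; apply: gen => //; [|by nonneg|by nonneg].
  by rewrite -!addrA addrCA lerDl !addr_ge0 ?ltW.
- apply: le_trans (H3 _ _ _ _ _ x z1 T01 A0 m2 w2 tT) _; apply: gen => //; [|by nonneg|by nonneg].
  by rewrite -addrA addrCA lerDl !addr_ge0 ?ltW.
- apply: le_trans (H4 _ _ _ _ _ _ x z1 z2 z3 z4 T01 A0 m2 w2 tT) _; apply: gen => //; [|by nonneg|by nonneg].
  by rewrite lerDr !addr_ge0 ?ltW.
Qed.

Context (p b0 : R) (k : nat) (p1 : 1 < p) (b00 : 0 < b0) (k2 : (2 <= k)%N).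

Definition base (i : nat) x w : R := (i == 0)%:R * ((p - 1) * w) + b0 * Hc k i x w.

(** At w = 0 the lower bound is [Hc0_ge]. The time variation of [Hc] has size w q^(2k - 2), which by
    interpolation is at most w^(1 - 1/k) D and is absorbed for small w. *)
Lemma base_le : exists c C T0 : R, [/\ 0 < c, 0 < C, 0 < T0 & forall x w, 0 < w < T0 ->
  c * DD k x w <= base 0 x w <= C * DD k x w /\ `|base 1 x w| <= C * qd x w ^+ (2 * k - 1)].
Proof.
have k0 : (0 < k)%N by move: k2; case: k.
have kp : 0 < k%:R :> R by rewrite ltr0n.
have [C C0 H] := @Hc_le R k k0; have [C' C0' H'] := @Hc_time R k k0.
have /andP[e0 e1] := @invk_bounds R k k2.
(* 2^(- 3k) collects 2^(- k) from [Hc0_ge] and 2^(- 2k) from splitting the distance into its x and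
   sqrt w parts. *)
pose c1 := Num.min (p - 1) (b0 * 2 ^- (3 * k)).
have c10 : 0 < c1 by rewrite lt_min subr_gt0 p1 mulr_gt0// invr_gt0 exprn_gt0.
pose C2 := b0 * 2 ^- k + b0 * C'.
have C20 : 0 < C2 by rewrite addr_gt0 ?mulr_gt0 ?invr_gt0 ?exprn_gt0.
have v0 : 0 < 1 - k%:R^-1 :> R by lra.
have [T1 T10 HT] := small_powR v0 (divr_gt0 c10 (mulr_gt0 (ltr0n R 2) C20)).
exists (c1 / 2), ((p - 1) + b0 * C), (Num.min T1 (Num.min (8 * k%:R)^-1 1)).
split.
- by rewrite divr_gt0.
- by rewrite addr_gt0 ?subr_gt0 ?mulr_gt0.
- by rewrite !lt_min T10 invr_gt0 mulr_gt0/=.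
move=> x w /andP[w0]; rewrite !lt_min => /and3P[wT wk w1].
have w01 : 0 <= w <= (8 * k%:R)^-1 by rewrite !ltW.
have q0 := qd_ge0 x w; have q1 := qd_le1 x w; have D0 := DD_gt0 k x w0.
have kk1 : (1 <= 2 * k)%N by move: k0; clear; lia.
have bpC n : b0 * C * qd x w ^+ n <= (p - 1 + b0 * C) * qd x w ^+ n.
  by apply: wpM_le; rewrite ?exprn_ge0// lerDr subr_ge0 ltW.
have b1 : `|base 1 x w| <= (p - 1 + b0 * C) * qd x w ^+ (2 * k - 1).
  rewrite /base mul0r add0r normrM (ger0_norm (ltW b00)); apply: le_trans (bpC _).
  by rewrite -mulrA ler_wpM2l ?(ltW b00)//; exact: H.
split => //.
have Q0 : 0 <= qd x w ^+ (2 * k) by rewrite exprn_ge0.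
rewrite /base mul1r; apply/andP; split; last first.
  have h := H 0%N x w isT (leq0n _) w01; rewrite subn0 in h.
  have h2 : b0 * Hc k 0 x w <= b0 * (C * qd x w ^+ (2 * k)).
    by rewrite ler_wpM2l ?(ltW b00)//; apply: le_trans (ler_norm _) h.
  apply: le_trans (lerD (lexx _) h2) _.
  have -> : (p - 1 + b0 * C) * DD k x w = (p - 1) * w + b0 * (C * qd x w ^+ (2 * k)) + (b0 * C * w + (p - 1) * qd x w ^+ (2 * k)) by rewrite /DD; ring.
  by rewrite lerDl addr_ge0 ?mulr_ge0 ?(ltW b00) ?(ltW C0) ?(ltW w0)// subr_ge0 ltW.
set m := Num.min `|x| 1.
have m0 : 0 <= m by rewrite le_min normr_ge0/=.
have h1 := @Hc0_ge R k x; rewrite -/m in h1.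
have /ler_normlP[h2 _] := H' x w w01.
have qm : qd x w <= m + Num.sqrt w.
  rewrite /m; case: (leP `|x| 1) => _; first by rewrite /qd ge_min lexx.
  by apply: le_trans q1 _; rewrite lerDl sqrtr_ge0.
have s2 : Num.sqrt w ^+ (2 * k) = w ^+ k by rewrite exprM sqr_sqrtr// ltW.
have h3 : qd x w ^+ (2 * k) <= 2 ^+ (2 * k) * (m ^+ (2 * k) + w ^+ k).
  rewrite -s2; apply: le_trans (exprD_le _ m0 (sqrtr_ge0 w)).
  by rewrite lerXn2r ?nnegrE ?addr_ge0 ?sqrtr_ge0.
have wk1 : w ^+ k <= w * w.
  rewrite -expr2; apply: ler_wiXn2l; rewrite ?ltW//.
have W := HT w; rewrite w0 wT in W; have {}W := W isT.
set z := w `^ (1 - k%:R^-1) in W.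
have z0 : 0 < z by exact: powR_gt0.
have wz : w <= z.
  rewrite -[leLHS](powRr1 (ltW w0)); apply: ger_powR; [by rewrite w0 ltW|lra].
have I1 : w * qd x w ^+ (2 * k - 2) <= z * DD k x w.
  have := @DD_interp R k (2 * k - 2) (1 - k%:R^-1) x w w0; rewrite subKr => /(_ _ _) h.
  have -> : w * qd x w ^+ (2 * k - 2) = z * (qd x w ^+ (2 * k - 2) * w `^ k%:R^-1).
    rewrite mulrCA /z -powRDp// subrK powRr1 ?(ltW w0)//; exact: mulrC.
  rewrite ler_wpM2l ?(ltW z0)//; apply: h; first by lra.
  by rewrite natrB ?natrM; [field; rewrite gt_eqF|move: k2; clear; lia].
have I2 : w ^+ k <= z * DD k x w.
  apply: le_trans wk1 _; apply: ler_pM; rewrite ?(ltW w0)// /DD lerDl//.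
have lo : (p - 1) * w + b0 * (2 ^- k * m ^+ (2 * k) - C' * w * qd x w ^+ (2 * k - 2)) <= (p - 1) * w + b0 * Hc k 0 x w.
  by rewrite lerD2l ler_wpM2l ?(ltW b00)//; lra.
apply: le_trans lo.
have e3 : 2 ^- (3 * k) * 2 ^+ (2 * k) = 2 ^- k :> R.
  have -> : (3 * k = k + 2 * k)%N by clear; lia.
  by rewrite exprD invfM mulfVK// expf_neq0// pnatr_eq0.
have h4 : b0 * 2 ^- (3 * k) * qd x w ^+ (2 * k) <= b0 * 2 ^- k * m ^+ (2 * k) + b0 * 2 ^- k * w ^+ k.
  apply: le_trans (ler_wpM2l _ h3) _; first by rewrite mulr_ge0 ?(ltW b00)// invr_ge0 exprn_ge0.
  by apply: eqle; rewrite -e3; ring.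
have cD : c1 * DD k x w <= (p - 1) * w + b0 * 2 ^- (3 * k) * qd x w ^+ (2 * k).
  rewrite /DD mulrDr; apply: lerD; apply: wpM_le; rewrite ?(ltW w0) ?exprn_ge0// /c1 ge_min lexx ?orbT//.
have zD : C2 * z * DD k x w <= c1 / 2 * DD k x w.
  apply: wpM_le; last exact: ltW.
  have -> : c1 / 2 = C2 * (c1 / (2 * C2)) by field; rewrite gt_eqF.
  by rewrite ler_wpM2l ?(ltW C20).
have J1 : b0 * 2 ^- k * w ^+ k <= b0 * 2 ^- k * (z * DD k x w).
  by rewrite ler_wpM2l// mulr_ge0 ?(ltW b00)// invr_ge0 exprn_ge0.
have J2 : b0 * C' * (w * qd x w ^+ (2 * k - 2)) <= b0 * C' * (z * DD k x w).
  by rewrite ler_wpM2l// mulr_ge0 ?(ltW b00)// ltW.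
have E : C2 * z * DD k x w = b0 * 2 ^- k * (z * DD k x w) + b0 * C' * (z * DD k x w) by rewrite /C2; ring.
rewrite E in zD.
have -> : b0 * (2 ^- k * m ^+ (2 * k) - C' * w * qd x w ^+ (2 * k - 2)) =
  b0 * 2 ^- k * m ^+ (2 * k) - b0 * C' * (w * qd x w ^+ (2 * k - 2)) by ring.
move: zD cD h4 J1 J2.
move: (b0 * 2 ^- k * w ^+ k) (b0 * 2 ^- k * (z * DD k x w)) (b0 * C' * (z * DD k x w)) (b0 * C' * (w * qd x w ^+ (2 * k - 2))) (b0 * 2 ^- k * m ^+ (2 * k)) (b0 * 2 ^- (3 * k) * qd x w ^+ (2 * k)) => a1 a2 a3 a4 a5 a6.
lra.
Qed.

(* rho_t = rho_xx - (p - 1) + f1 and phi_t = phi_xx + f2; the index i counts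
   space derivatives. *)
Definition rho T i (f : R * R -> R) t x := base i x (T - t) + LP (2 * k) T i f t x.
Definition phi T i (f : R * R -> R) t x := LP (k - 1) T i f t x.

Lemma DD_ge_q x w : 0 < w -> qd x w ^+ (2 * k) <= DD k x w.
Proof. by move=> w0; rewrite /DD lerDr ltW. Qed.

Lemma qpow_le1 x w (u : R) : 0 <= u -> qd x w `^ u <= 1.
Proof. by move=> u0; apply: le_trans (powR_mono (qd_ge0 x w) (qd_le1 x w) u0) _; rewrite powR1. Qed.

Lemma GG_ge1 x w : 0 < w -> qd x w ^+ (2 * k - 1) + qd x w ^+ (2 * k) * w `^ (- om k) <= DD k x w * GG k x w.
Proof.
move=> w0; have D0 := DD_gt0 k x w0; rewrite /GG mulrDr mulrCA divff ?mulr1 ?gt_eqF// lerDl.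
by rewrite !mulr_ge0 ?powR_ge0 ?exprn_ge0 ?qd_ge0// ltW.
Qed.

Lemma GG_ge2 x w : 0 < w -> qd x w ^+ (k - 1) * w `^ (- chi k) <= GG k x w.
Proof.
move=> w0; have D0 := DD_gt0 k x w0; rewrite /GG lerDr.
by rewrite divr_ge0 ?(ltW D0)// addr_ge0 ?mulr_ge0 ?powR_ge0 ?exprn_ge0 ?qd_ge0.
Qed.

(** [c0] and [C0] are produced before [A], and only the threshold on T depends on [A]: the radius of
    the ball of sources can later be chosen from nonlinear constants built on [c0] and [C0], without
    circularity. *)
Lemma ansatz_le : exists c0 C0 : R, [/\ 0 < c0, 0 < C0 & forall A, 0 <= A ->
  exists2 T0 : R, 0 < T0 & forall T f1 f2 t x, 0 < T < T0 ->
  measurable_fun setT f1 -> measurable_fun setT f2 ->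
  wbound (2 * k) (nu k) T A f1 -> wbound (k - 1) (ze k) T A f2 -> 0 <= t < T ->
  [/\ c0 * DD k x (T - t) <= rho T 0 f1 t x <= C0 * DD k x (T - t),
    `|rho T 1 f1 t x| <= C0 * (DD k x (T - t) * GG k x (T - t)) &
    `|phi T 1 f2 t x| <= C0 * GG k x (T - t)]].
Proof.
have [c [C [T1 [c0 C0 T10 HB]]]] := base_le; have [L L0 HL] := LP_bounds k2.
have [_ [_ [e0 _ _ _ _]]] := @exponents k k2.
have [n01 _] := @exponents k k2; case: n01 => /andP[n0 n1] _ _ _.
exists (c / 2), (C + c + 1); split; [by rewrite divr_gt0|by rewrite !addr_gt0|].
move=> A A0.
pose ee := Num.min (c / 2) 1 / (L * (A + 1)).
have ee0 : 0 < ee by rewrite divr_gt0// ?lt_min ?divr_gt0//= mulr_gt0// ltr_wpDl.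
have [T2 T20 HT] := small_powR e0 ee0.
exists (Num.min T1 (Num.min T2 2^-1)); first by rewrite !lt_min T10 T20/= invr_gt0.
move=> T f1 f2 t x /andP[T0]; rewrite !lt_min => /and3P[TT1 TT2 T12] m1 m2 w1 w2 tT.
have T01 : 0 < T <= 2^-1 by rewrite T0 ltW.
have /andP[t0 t1] := tT.
have w0 : 0 < T - t by rewrite subr_gt0.
have wT : 0 < T - t < T1 by rewrite w0/= (le_lt_trans _ TT1)// gerBl.
have [/andP[h1 h2] h3] := HB x (T - t) wT.
have [l1 l2 l3 l4] := HL T A f1 f2 t x T01 A0 m1 m2 w1 w2 tT.
have q0 := qd_ge0 x (T - t); have D0 := DD_gt0 k x w0; have G0 := GG_ge0 k x w0.
have g1 := @GG_ge1 x _ w0; have g2 := @GG_ge2 x _ w0; have dq := @DD_ge_q x _ w0.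
have T00 : 0 < T < T2 by rewrite T0.
have s1 : L * A * T `^ et k <= Num.min (c / 2) 1.
  apply: (@le_trans _ _ (L * (A + 1) * ee)).
    apply: ler_pM; rewrite ?powR_ge0 ?mulr_ge0 ?(ltW L0)//; last exact: HT.
    by rewrite ler_wpM2l ?(ltW L0)// lerDl.
  by rewrite /ee mulrC divfK// gt_eqF// mulr_gt0// ltr_wpDl.
have sc : L * A * T `^ et k <= c / 2 by apply: le_trans s1 _; rewrite ge_min lexx.
have s11 : L * A * T `^ et k <= 1 by apply: le_trans s1 _; rewrite ge_min lexx orbT.
have s0 : 0 <= L * A * T `^ et k by nonneg.
set E := L * A * T `^ et k in l1 l2 l3 l4 s1 sc s11 s0.
set D := DD k x (T - t) in h1 h2 D0 g1 dq *; set G := GG k x (T - t) in G0 g1 g2 *.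
set q := qd x (T - t) in h3 l1 l2 l3 l4 q0 g1 g2 dq.
have om0 : 0 <= q ^+ (2 * k) * (T - t) `^ (- om k) by nonneg.
have q10 : 0 <= q ^+ (2 * k - 1) by nonneg.
split.
- have a1 : `|LP (2 * k) T 0 f1 t x| <= c / 2 * D.
    apply: le_trans l1 _; apply: ler_pM => //; first by nonneg.
    apply: le_trans dq; rewrite ler_piMr ?exprn_ge0//; apply: qpow_le1; lra.
  have /ler_normlP[a2 a3] := a1.
  by rewrite /rho -/D; apply/andP; split; move: a2 a3 h1 h2; nra.
- rewrite /rho; apply: le_trans (ler_normD _ _) _.
  have a1 : `|LP (2 * k) T 1 f1 t x| <= D * G.
    apply: le_trans l2 _; apply: le_trans (ler_piMl om0 s11) _; apply: le_trans g1.
    by rewrite lerDr.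
  have a2 : `|base 1 x (T - t)| <= C * (D * G).
    apply: le_trans h3 _; rewrite ler_wpM2l ?(ltW C0)//; apply: le_trans g1.
    by rewrite lerDl.
  apply: le_trans (lerD a2 a1) _.
  have -> : (C + c + 1) * (D * G) = C * (D * G) + D * G + c * (D * G) by ring.
  by rewrite lerDl; nonneg.
- rewrite /phi; apply: le_trans l4 _.
  have ch0 : 0 <= q ^+ (k - 1) * (T - t) `^ (- chi k) by nonneg.
  apply: le_trans (ler_piMl ch0 s11) _; apply: le_trans g2 _.
  by rewrite ler_peMl// lerDr addr_ge0 ?ltW.
Qed.

Lemma ansatz_diff : exists2 C : R, 0 < C & forall T A B f1 f2 g1 g2 t x, 0 < T <= 2^-1 ->
  measurable_fun setT f1 -> measurable_fun setT f2 -> measurable_fun setT g1 -> measurable_fun setT g2 ->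
  0 <= A -> 0 <= B ->
  wbound (2 * k) (nu k) T B f1 -> wbound (k - 1) (ze k) T B f2 ->
  wbound (2 * k) (nu k) T B g1 -> wbound (k - 1) (ze k) T B g2 ->
  wbound (2 * k) (nu k) T A (fun z : R * R => f1 z - g1 z) ->
  wbound (k - 1) (ze k) T A (fun z : R * R => f2 z - g2 z) -> 0 <= t < T ->
  [/\ `|rho T 0 f1 t x - rho T 0 g1 t x| <= C * A * T `^ et k * DD k x (T - t),
    `|rho T 1 f1 t x - rho T 1 g1 t x| <= C * A * T `^ et k * (DD k x (T - t) * GG k x (T - t)) &
    `|phi T 1 f2 t x - phi T 1 g2 t x| <= C * A * T `^ et k * GG k x (T - t)].
Proof.
have [L L0 HL] := LP_bounds k2; exists L => //.
move=> T A B f1 f2 g1 g2 t x T01 mf1 mf2 mg1 mg2 A0 B0 wf1 wf2 wg1 wg2 w1 w2 tT.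
have [[/andP[n0 n1] n2 n3 n4] [[/andP[z0 z1] z2 z3 z4] _]] := @exponents k k2.
have n01 : 0 <= (nu k : R) < 1 by rewrite ltW.
have z01 : 0 <= (ze k : R) < 1 by rewrite ltW.
have m1 : measurable_fun setT (fun z : R * R => f1 z - g1 z) by exact: measurable_funB.
have m2 : measurable_fun setT (fun z : R * R => f2 z - g2 z) by exact: measurable_funB.
have [l1 l2 l3 l4] := HL T A _ _ t x T01 A0 m1 m2 w1 w2 tT.
have /andP[t0 t1] := tT.
have w0 : 0 < T - t by rewrite subr_gt0.
have q0 := qd_ge0 x (T - t); have D0 := DD_gt0 k x w0; have G0 := GG_ge0 k x w0.
have gg1 := @GG_ge1 x _ w0; have gg2 := @GG_ge2 x _ w0; have dq := @DD_ge_q x _ w0.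
rewrite (@LPB R _ _ _ _ _ _ _ x 0 isT n01 T01 B0 tT mf1 mg1 wf1 wg1) in l1.
rewrite (@LPB R _ _ _ _ _ _ _ x 1 isT n01 T01 B0 tT mf1 mg1 wf1 wg1) in l2.
rewrite (@LPB R _ _ _ _ _ _ _ x 1 isT z01 T01 B0 tT mf2 mg2 wf2 wg2) in l4.
have E0 : 0 <= L * A * T `^ et k by nonneg.
have cancel (a b c : R) : a + b - (a + c) = b - c by ring.
have eR i : rho T i f1 t x - rho T i g1 t x = LP (2 * k) T i f1 t x - LP (2 * k) T i g1 t x by exact: cancel.
rewrite (eR 0%N) (eR 1%N) {eR cancel} /phi; split.
- apply: le_trans l1 _; rewrite ler_wpM2l//; apply: le_trans dq.
  rewrite ler_piMr ?exprn_ge0//; apply: qpow_le1; lra.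
- apply: le_trans l2 _; rewrite ler_wpM2l//; apply: le_trans gg1.
  by rewrite lerDr exprn_ge0.
- by apply: le_trans l4 _; rewrite ler_wpM2l.
Qed.

End Ansatz.

(** * Contraction and fixed point for the pair of sources *)

Section FixedPoint.
Context {R : realType}.
Implicit Types (x w c C s t T A : R).

Lemma geometric_limit (u : nat -> R) M : 0 <= M -> (forall n, `|u n.+1 - u n| <= M * 2^-1 ^+ n) ->
  exists2 l : R, u n @[n --> \oo] --> l & forall n, `|l - u n| <= 2 * M * 2^-1 ^+ n.
Proof.
move=> M0 H.
have tail n m : `|u (n + m)%N - u n| <= 2 * M * 2^-1 ^+ n * (1 - 2^-1 ^+ m).
  elim: m => [|m ih]; first by rewrite addn0 subrr normr0 expr0 subrr mulr0.
  have -> : u (n + m.+1)%N - u n = (u (n + m.+1)%N - u (n + m)%N) + (u (n + m)%N - u n) by ring.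
  apply: le_trans (ler_normD _ _) _; rewrite addnS.
  apply: le_trans (lerD (H (n + m)%N) ih) _.
  by apply: eqle; rewrite exprD exprS; field.
have cvu : cvgn u.
  have : cvgn (series (telescope u)).
    apply: normed_cvg; apply: (@series_le_cvg _ _ (geometric M 2^-1)) => //.
    - by move=> n /=; exact: normr_ge0.
    - by move=> n /=; rewrite mulr_ge0 ?exprn_ge0 ?invr_ge0.
    - by apply: is_cvg_geometric_series; rewrite ger0_norm ?invr_ge0// invf_lt1// ltr1n.
  move=> cs; have -> : u = (fun n => u 0%N + series (telescope u) n).
    by apply/funext => n; exact: eq_sum_telescope.
  by apply: is_cvgD => //; exact: is_cvg_cst.
exists (limn u) => // n; apply/ler_addgt0Pr => e e0.
have := @cvgr_dist_lt _ _ _ _ _ _ _ cvu _ e0 => -[N _ /(_ (n + N)%N)] /= h.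
have {}h := h (leq_addl _ _).
have -> : limn u - u n = (limn u - u (n + N)%N) + (u (n + N)%N - u n) by ring.
rewrite [leRHS]addrC; apply: le_trans (ler_normD _ _) _; apply: lerD; first exact: ltW.
apply: le_trans (tail n N) _; rewrite ler_piMr//; first by rewrite !mulr_ge0 ?exprn_ge0 ?invr_ge0.
Qed.

Lemma measurable_Hc k i d (S : measurableType d) (a c : S -> R) :
  measurable_fun setT a -> measurable_fun setT c ->
  measurable_fun setT (fun z : S => Hc k i (a z) (c z)).
Proof.
move=> ma mc; apply: measurable_funD => //; apply: measurable_sum => l.
apply: measurable_funM => //.
by apply: measurable_gk => //; exact: measurable_funB.
Qed.

Context (p b0 de : R) (k : nat) (p1 : 1 < p) (b00 : 0 < b0) (k2 : (2 <= k)%N).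

Lemma measurable_rho T i f : measurable_fun setT f ->
  measurable_fun setT (fun z : R * R => rho p b0 k T i f z.1 z.2).
Proof.
move=> mf; apply: measurable_funD; last exact: measurable_LP.
apply: measurable_funD; first by do 2 apply: measurable_funM => //; exact: measurable_funB.
by apply: measurable_funM => //; apply: measurable_Hc => //; exact: measurable_funB.
Qed.

Lemma measurable_phi T i f : measurable_fun setT f ->
  measurable_fun setT (fun z : R * R => phi k T i f z.1 z.2).
Proof. exact: measurable_LP. Qed.

Lemma measurable_quad a1 a2 a3 (g s : R * R -> R) : measurable_fun setT g -> measurable_fun setT s ->
  measurable_fun setT (fun z => quad a1 a2 a3 (g z) (s z)).
Proof.
move=> mg ms; apply: measurable_funD; [apply: measurable_funD|]; apply: measurable_funM => //.
- exact: measurable_funX.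
- exact: measurable_funM.
- exact: measurable_funX.
Qed.

Definition src1 T f1 f2 (z : R * R) := if 0 < z.1 < T then
  N1 p de (rho p b0 k T 0 f1 z.1 z.2) (rho p b0 k T 1 f1 z.1 z.2) (phi k T 1 f2 z.1 z.2) else 0.
Definition src2 T f1 f2 (z : R * R) := if 0 < z.1 < T then
  N2 p de (rho p b0 k T 0 f1 z.1 z.2) (rho p b0 k T 1 f1 z.1 z.2) (phi k T 1 f2 z.1 z.2) else 0.

Lemma measurable_src T f1 f2 : measurable_fun setT f1 -> measurable_fun setT f2 ->
  measurable_fun setT (src1 T f1 f2) /\ measurable_fun setT (src2 T f1 f2).
Proof.
move=> m1 m2.
have mr0 := measurable_rho T 0 m1; have mr1 := measurable_rho T 1 m1; have mp := measurable_phi T 1 m2.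
have mg : measurable_fun setT (fun z : R * R => rho p b0 k T 1 f1 z.1 z.2 / rho p b0 k T 0 f1 z.1 z.2).
  by apply: measurable_funM => //; exact: measurable_invr.
split; apply: measurable_ifitv => //.
- apply: measurable_funM; last exact: measurable_quad.
  by apply: measurable_funM.
- apply: measurable_funB; first exact: measurable_quad.
  by apply: measurable_funM => //; exact: measurable_quad.
Qed.

(** The radius is A = 12 K, with 12 from [GG_weight], and the ball is preserved as soon as the
    bounds of [ansatz_le] hold; the contraction factor comes from the power of T in
    [ansatz_diff]. *)
Lemma src_le : exists c0 C0 A T0 : R, [/\ 0 < c0, 0 < C0, 0 < A, 0 < T0 <= 2^-1 &
  forall T, 0 < T < T0 ->
  (forall f1 f2, measurable_fun setT f1 -> measurable_fun setT f2 ->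
    wbound (2 * k) (nu k) T A f1 -> wbound (k - 1) (ze k) T A f2 ->
    (forall t x, 0 <= t < T -> [/\ c0 * DD k x (T - t) <= rho p b0 k T 0 f1 t x <= C0 * DD k x (T - t),
      `|rho p b0 k T 1 f1 t x| <= C0 * (DD k x (T - t) * GG k x (T - t)) &
      `|phi k T 1 f2 t x| <= C0 * GG k x (T - t)]) /\
    (wbound (2 * k) (nu k) T A (src1 T f1 f2) /\ wbound (k - 1) (ze k) T A (src2 T f1 f2))) /\
  (forall f1 f2 g1 g2 a, measurable_fun setT f1 -> measurable_fun setT f2 ->
    measurable_fun setT g1 -> measurable_fun setT g2 -> 0 <= a ->
    wbound (2 * k) (nu k) T A f1 -> wbound (k - 1) (ze k) T A f2 ->
    wbound (2 * k) (nu k) T A g1 -> wbound (k - 1) (ze k) T A g2 ->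
    wbound (2 * k) (nu k) T a (fun z : R * R => f1 z - g1 z) ->
    wbound (k - 1) (ze k) T a (fun z : R * R => f2 z - g2 z) ->
    wbound (2 * k) (nu k) T (a / 2) (fun z : R * R => src1 T f1 f2 z - src1 T g1 g2 z) /\
    wbound (k - 1) (ze k) T (a / 2) (fun z : R * R => src2 T f1 f2 z - src2 T g1 g2 z))].
Proof.
have [c0 [C0 [c00 C00 HA]]] := ansatz_le p1 b00 k2.
have [K K0 HK] := nonlin_le p de c00 C00.
have [L L0 HL] := ansatz_diff p b0 k2.
have [_ [_ [e0 _ _ _ _]]] := @exponents R k k2.
pose A := 12 * K; have A0 : 0 < A by rewrite mulr_gt0.
have [T1 T10 HT1] := HA A (ltW A0).
(* The Lipschitz constant of the source map is 12 K L T^et; this threshold makes it at most 1/2. *)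
have KL : 0 < (24 * K * L)^-1 by rewrite invr_gt0 !mulr_gt0.
have [T2 T20 HT2] := small_powR e0 KL.
exists c0, C0, A, (Num.min T1 (Num.min T2 2^-1)); split => //.
  by rewrite !lt_min T10 T20 !ge_min lexx !orbT invr_gt0/= ltr0n.
move=> T /andP[T0]; rewrite !lt_min => /and3P[TT1 TT2 T12].
have T01 : 0 < T <= 2^-1 by rewrite T0 ltW.
have T00 : 0 < T < T1 by rewrite T0.
have TT : 0 < T < T2 by rewrite T0.
have h2 := HT2 T TT.
have wt s : 0 < s < T -> 0 < T - s <= 1 by move: T12; lra.
split=> [f1 f2 m1 m2 w1 w2|f1 f2 g1 g2 a mf1 mf2 mg1 mg2 a0 wf1 wf2 wg1 wg2 wd1 wd2].
  have H t x tT := HT1 T f1 f2 t x T00 m1 m2 w1 w2 tT; split => //.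
  have H2 s x : 0 < s < T -> `|src1 T f1 f2 (s, x)| <= K * (DD k x (T - s) * GG k x (T - s) ^+ 2) /\
      `|src2 T f1 f2 (s, x)| <= K * GG k x (T - s) ^+ 2.
    move=> sT; have /andP[ws0 ws1] := wt s sT; rewrite /src1 /src2 /= sT.
    have sT' : 0 <= s < T by case/andP: sT => s0 ->; rewrite ltW.
    have [r u ph] := H s x sT'.
    have z0 : `|0 : R| <= 0 by rewrite normr0.
    have zd (a M : R) : `|a - a| <= 0 * M by rewrite subrr normr0 mul0r.
    by have [n1 n2 _ _] := HK _ _ _ _ _ _ _ _ _ (DD_gt0 k x ws0) (GG_ge0 k x ws0) (lexx 0) r r u u ph ph (zd _ _) (zd _ _) (zd _ _).
  split=> s x sT; have [g1 g2] := GG_weight x k2 (wt s sT); have [s1 s2] := H2 s x sT.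
  - apply: le_trans s1 _; apply: le_trans (ler_wpM2l (ltW K0) g1) _.
    by apply: eqle; rewrite /A; ring.
  - apply: le_trans s2 _; apply: le_trans (ler_wpM2l (ltW K0) g2) _.
    have q0 := qd_ge0 x (T - s); rewrite !mulrA; apply: wpM_le; last exact: powR_ge0.
    apply: wpM_le; last exact: exprn_ge0.
    by rewrite /A; move: K0; lra.
have HF t x tT := HT1 T f1 f2 t x T00 mf1 mf2 wf1 wf2 tT.
have HG t x tT := HT1 T g1 g2 t x T00 mg1 mg2 wg1 wg2 tT.
have H2 s x : 0 < s < T -> `|src1 T f1 f2 (s, x) - src1 T g1 g2 (s, x)| <= K * (L * a * T `^ et k) * (DD k x (T - s) * GG k x (T - s) ^+ 2) /\
      `|src2 T f1 f2 (s, x) - src2 T g1 g2 (s, x)| <= K * (L * a * T `^ et k) * GG k x (T - s) ^+ 2.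
  move=> sT; have /andP[ws0 ws1] := wt s sT; rewrite /src1 /src2 /= sT.
  have sT' : 0 <= s < T by case/andP: sT => s0 ->; rewrite ltW.
  have [r u ph] := HF s x sT'; have [r' u' ph'] := HG s x sT'.
  have [d1 d2 d3] := HL T a A f1 f2 g1 g2 s x T01 mf1 mf2 mg1 mg2 a0 (ltW A0) wf1 wf2 wg1 wg2 wd1 wd2 sT'.
  have La : 0 <= L * a * T `^ et k by nonneg.
  by have [_ _ h3 h4] := HK (DD k x (T - s)) (GG k x (T - s)) _ _ _ _ _ _ _ (DD_gt0 k x ws0) (GG_ge0 k x ws0) La r r' u u' ph ph' d1 d2 d3.
have sm : 12 * (K * (L * a * T `^ et k)) <= a / 2.
  have -> : 12 * (K * (L * a * T `^ et k)) = a * (12 * K * L) * T `^ et k by ring.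
  have -> : a / 2 = a * (12 * K * L) * (24 * K * L)^-1 by field; rewrite !gt_eqF.
  by rewrite ler_wpM2l//; nonneg.
have La : 0 <= K * (L * a * T `^ et k) by nonneg.
split=> s x sT; have [g1' g2'] := GG_weight x k2 (wt s sT); have [s1 s2] := H2 s x sT.
- apply: le_trans s1 _; apply: le_trans (ler_wpM2l La g1') _.
  have q0 := qd_ge0 x (T - s); rewrite !mulrA; apply: wpM_le; last exact: powR_ge0.
  apply: wpM_le; last exact: exprn_ge0.
  by apply: le_trans sm; apply: eqle; ring.
- apply: le_trans s2 _; apply: le_trans (ler_wpM2l La g2') _.
  have q0 := qd_ge0 x (T - s); rewrite !mulrA; apply: wpM_le; last exact: powR_ge0.
  apply: wpM_le; last exact: exprn_ge0.
  apply: le_trans sm; apply: (@le_trans _ _ (9 * (K * (L * a * T `^ et k)))); first by apply: eqle; ring.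
  by apply: wpM_le => //; rewrite ler_nat.
Qed.

Lemma half_pow_le (a c M : R) : (forall n : nat, a <= c + M * 2^-1 ^+ n) -> a <= c.
Proof.
move=> H; apply/ler_addgt0Pr => e e0.
have cM : (fun n => M * 2^-1 ^+ n : R) @ \oo --> (M * 0 : R).
  by apply: cvgMr; apply: cvg_expr; rewrite ger0_norm ?invr_ge0// invf_lt1// ltr1n.
have := @cvgr_dist_lt _ _ _ _ _ _ _ cM _ e0 => -[N _ /(_ N)] /= h; have {}h := h (leqnn _).
rewrite mulr0 sub0r normrN in h; have h2 := ler_norm (M * 2^-1 ^+ N).
by apply: le_trans (H N) _; rewrite lerD2l; apply: le_trans h2 (ltW h).
Qed.

Definition picard T (n : nat) : (R * R -> R) * (R * R -> R) :=
  iter n (fun f => (src1 T f.1 f.2, src2 T f.1 f.2)) (cst 0, cst 0).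

(** The Picard iterates converge pointwise with geometric error in the weights, and are all 0
    outside 0 < t < T. Measurability passes to pointwise limits, and inequalities with error M 2^(-
    n) pass to the limit by [half_pow_le]. *)
Lemma fixed_point : exists c0 C0 A T0 : R, [/\ 0 < c0, 0 < C0, 0 < A, 0 < T0 <= 2^-1 &
  forall T, 0 < T < T0 -> exists f1 f2 : R * R -> R,
  [/\ measurable_fun setT f1, measurable_fun setT f2,
    wbound (2 * k) (nu k) T A f1, wbound (k - 1) (ze k) T A f2 &
    (forall t x, 0 <= t < T -> [/\ c0 * DD k x (T - t) <= rho p b0 k T 0 f1 t x <= C0 * DD k x (T - t),
      `|rho p b0 k T 1 f1 t x| <= C0 * (DD k x (T - t) * GG k x (T - t)) &
      `|phi k T 1 f2 t x| <= C0 * GG k x (T - t)]) /\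
    (forall z, f1 z = src1 T f1 f2 z /\ f2 z = src2 T f1 f2 z)]].
Proof.
have [c0 [C0 [A [T0 [c00 C00 A0 T00 H]]]]] := src_le.
exists c0, C0, A, T0; split => // T TT; have [H1 H2] := H T TT.
have P n : [/\ measurable_fun setT (picard T n).1, measurable_fun setT (picard T n).2,
    wbound (2 * k) (nu k) T A (picard T n).1 & wbound (k - 1) (ze k) T A (picard T n).2].
  elim: n => [|n [m1 m2 w1 w2]].
    split => //= s y sT; rewrite normr0.
      by have q0 := qd_ge0 y (T - s); nonneg.
    by have q0 := qd_ge0 y (T - s); nonneg.
  have [h1 h2] := measurable_src T m1 m2; have [_ [h3 h4]] := H1 _ _ m1 m2 w1 w2.
  by split.
have Dn n : wbound (2 * k) (nu k) T (A * 2^-1 ^+ n) (fun z : R * R => (picard T n.+1).1 z - (picard T n).1 z) /\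
   wbound (k - 1) (ze k) T (A * 2^-1 ^+ n) (fun z : R * R => (picard T n.+1).2 z - (picard T n).2 z).
  elim: n => [|n [h1 h2]].
    have [_ _ w1 w2] := P 1%N; rewrite expr0 mulr1.
    split=> s y sT; rewrite /= subr0; first exact: w1.
    exact: w2.
  have [m1 m2 w1 w2] := P n; have [m1' m2' w1' w2'] := P n.+1.
  have a0 : 0 <= A * 2^-1 ^+ n by nonneg.
  have := H2 _ _ _ _ _ m1' m2' m1 m2 a0 w1' w2' w1 w2 h1 h2.
  by have -> : A * 2^-1 ^+ n / 2 = A * 2^-1 ^+ n.+1 by rewrite exprSr mulrA.
have zero n (z : R * R) : ~~ (0 < z.1 < T) -> (picard T n).1 z = 0 /\ (picard T n).2 z = 0.
  by case: n => [//|n] zT; rewrite /= /src1 /src2 (negbTE zT).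
have lim1 z : exists l1 : R, exists l2 : R, [/\ (picard T n).1 z @[n --> \oo] --> l1, (picard T n).2 z @[n --> \oo] --> l2,
  (~~ (0 < z.1 < T) -> l1 = 0 /\ l2 = 0) &
  0 < z.1 < T -> forall n, `|l1 - (picard T n).1 z| <= 2 * A * 2^-1 ^+ n * qd z.2 (T - z.1) ^+ (2 * k) * (T - z.1) `^ (- nu k) /\
    `|l2 - (picard T n).2 z| <= 2 * A * 2^-1 ^+ n * qd z.2 (T - z.1) ^+ (k - 1) * (T - z.1) `^ (- ze k)].
  have [zT|zT] := boolP (0 < z.1 < T); last first.
    exists 0, 0; split => //.
    - have -> : (fun n => (picard T n).1 z) = cst 0 by apply/funext => n; case: (zero n z zT).
      exact: cvg_cst.
    - have -> : (fun n => (picard T n).2 z) = cst 0 by apply/funext => n; case: (zero n z zT).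
      exact: cvg_cst.
  have q0 := qd_ge0 z.2 (T - z.1).
  have M1 : 0 <= A * qd z.2 (T - z.1) ^+ (2 * k) * (T - z.1) `^ (- nu k) by nonneg.
  have M2 : 0 <= A * qd z.2 (T - z.1) ^+ (k - 1) * (T - z.1) `^ (- ze k) by nonneg.
  have [l1 c1 d1] : exists2 l : R, (picard T n).1 z @[n --> \oo] --> l & forall n, `|l - (picard T n).1 z| <= 2 * (A * qd z.2 (T - z.1) ^+ (2 * k) * (T - z.1) `^ (- nu k)) * 2^-1 ^+ n.
    apply: geometric_limit => // n; case: (Dn n) => h1 _.
    by case: z zT q0 M1 M2 => s y /= zT q0 M1 M2; apply: le_trans (h1 s y zT) _; apply: eqle; ring.
  have [l2 c2 d2] : exists2 l : R, (picard T n).2 z @[n --> \oo] --> l & forall n, `|l - (picard T n).2 z| <= 2 * (A * qd z.2 (T - z.1) ^+ (k - 1) * (T - z.1) `^ (- ze k)) * 2^-1 ^+ n.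
    apply: geometric_limit => // n; case: (Dn n) => _ h1.
    by case: z zT q0 M1 M2 c1 d1 => s y /= zT q0 M1 M2 c1 d1; apply: le_trans (h1 s y zT) _; apply: eqle; ring.
  exists l1, l2; split => // _ n; split.
    by apply: le_trans (d1 n) _; apply: eqle; ring.
  by apply: le_trans (d2 n) _; apply: eqle; ring.
have [f1 /choice [f2 F]] := choice lim1.
have m1 : measurable_fun setT f1.
  apply: (@measurable_fun_cvg _ _ _ _ (fun n => (picard T n).1)) => [n|z _]; first by case: (P n).
  by case: (F z).
have m2 : measurable_fun setT f2.
  apply: (@measurable_fun_cvg _ _ _ _ (fun n => (picard T n).2)) => [n|z _]; first by case: (P n).
  by case: (F z).
have D1 n : wbound (2 * k) (nu k) T (2 * A * 2^-1 ^+ n) (fun z : R * R => f1 z - (picard T n).1 z).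
  by move=> s y sT; have [_ _ _ /(_ sT n) []] := F (s, y).
have D2 n : wbound (k - 1) (ze k) T (2 * A * 2^-1 ^+ n) (fun z : R * R => f2 z - (picard T n).2 z).
  by move=> s y sT; have [_ _ _ /(_ sT n) []] := F (s, y).
have W1 : wbound (2 * k) (nu k) T A f1.
  move=> s y sT; have q0 := qd_ge0 y (T - s).
  apply: (@half_pow_le _ _ (2 * A * (qd y (T - s) ^+ (2 * k) * (T - s) `^ (- nu k)))) => n.
  have [_ _ w1 _] := P n.
  have -> : f1 (s, y) = (picard T n).1 (s, y) + (f1 (s, y) - (picard T n).1 (s, y)) by ring.
  apply: le_trans (ler_normD _ _) _; apply: lerD; first exact: w1.
  by apply: le_trans (D1 n s y sT) _; apply: eqle; ring.
have W2 : wbound (k - 1) (ze k) T A f2.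
  move=> s y sT; have q0 := qd_ge0 y (T - s).
  apply: (@half_pow_le _ _ (2 * A * (qd y (T - s) ^+ (k - 1) * (T - s) `^ (- ze k)))) => n.
  have [_ _ _ w1] := P n.
  have -> : f2 (s, y) = (picard T n).2 (s, y) + (f2 (s, y) - (picard T n).2 (s, y)) by ring.
  apply: le_trans (ler_normD _ _) _; apply: lerD; first exact: w1.
  by apply: le_trans (D2 n s y sT) _; apply: eqle; ring.
exists f1, f2; split => //; split; first by case: (H1 f1 f2 m1 m2 W1 W2).
move=> z; have [_ _ z1 z2] := F z.
have [zT|zT] := boolP (0 < z.1 < T); last first.
  by have [-> ->] := z1 zT; rewrite /src1 /src2 (negbTE zT).
have q0 := qd_ge0 z.2 (T - z.1).
have eqz (a b M : R) : (forall n : nat, `|a - b| <= 0 + M * 2^-1 ^+ n) -> a = b.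
  by move=> /half_pow_le; rewrite normr_le0 subr_eq0 => /eqP.
have dn n : `|f1 z - src1 T f1 f2 z| <= 2 * A * (qd z.2 (T - z.1) ^+ (2 * k) * (T - z.1) `^ (- nu k)) * 2^-1 ^+ n /\
  `|f2 z - src2 T f1 f2 z| <= 2 * A * (qd z.2 (T - z.1) ^+ (k - 1) * (T - z.1) `^ (- ze k)) * 2^-1 ^+ n.
  have [p1' p2' w1 w2] := P n.
  have a0 : 0 <= 2 * A * 2^-1 ^+ n by nonneg.
  have [d1 d2] := H2 _ _ _ _ _ m1 m2 p1' p2' a0 W1 W2 w1 w2 (D1 n) (D2 n).
  have [e1 e2] := z2 zT n.+1.
  have E1 : src1 T (picard T n).1 (picard T n).2 z = (picard T n.+1).1 z by [].
  have E2 : src2 T (picard T n).1 (picard T n).2 z = (picard T n.+1).2 z by [].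
  case: z zT {z1 z2} q0 e1 e2 E1 E2 => s y /= zT q0 e1 e2 E1 E2.
  have {}d1 := d1 s y zT; have {}d2 := d2 s y zT; rewrite distrC in d1; rewrite distrC in d2.
  split.
    have -> : f1 (s, y) - src1 T f1 f2 (s, y) = (f1 (s, y) - (picard T n.+1).1 (s, y)) + ((picard T n.+1).1 (s, y) - src1 T f1 f2 (s, y)) by ring.
    apply: le_trans (ler_normD _ _) _; apply: le_trans (lerD e1 d1) _.
    by apply: eqle; rewrite exprS; field.
  have -> : f2 (s, y) - src2 T f1 f2 (s, y) = (f2 (s, y) - (picard T n.+1).2 (s, y)) + ((picard T n.+1).2 (s, y) - src2 T f1 f2 (s, y)) by ring.
  apply: le_trans (ler_normD _ _) _; apply: le_trans (lerD e2 d2) _.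
  by apply: eqle; rewrite exprS; field.
split; [apply: (eqz _ _ (2 * A * (qd z.2 (T - z.1) ^+ (2 * k) * (T - z.1) `^ (- nu k))))|
  apply: (eqz _ _ (2 * A * (qd z.2 (T - z.1) ^+ (k - 1) * (T - z.1) `^ (- ze k))))] => n.
  by rewrite add0r; case: (dn n).
by rewrite add0r; case: (dn n).
Qed.

End FixedPoint.

(** * The Duhamel identity *)

Section PowerExponential.
Context {R : realType}.
Implicit Types (A B r a K m t : R).

Lemma is_derive_mulr (c : R) t : is_derive t 1 (fun t : R => t * c) c.
Proof.
have -> : (fun t : R => t * c) = c *: id by apply/funext => s; rewrite /= mulrC.
have e : c *: (1 : R) = c by rewrite /GRing.scale/= mulr1.
by rewrite -[X in is_derive _ _ _ X]e; apply: is_deriveZ.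
Qed.

Lemma is_derive_sqr2 (c : R) t : is_derive t 1 (fun t : R => t * (t * (c / 2))) (t * c).
Proof.
have := is_deriveM (@is_derive_id _ _ t 1) (is_derive_mulr (c / 2) t).
by move/is_derive_eq; apply; rewrite /GRing.scale/=; field.
Qed.

Lemma taylor2 (g g1 g2 : R -> R) K :
  (forall t, 0 <= t <= 1 -> is_derive t 1 g (g1 t)) ->
  (forall t, 0 <= t <= 1 -> is_derive t 1 g1 (g2 t)) ->
  (forall t, 0 <= t <= 1 -> `|g2 t| <= K) -> `|g 1 - g 0 - g1 0| <= K.
Proof.
move=> d0 d1 b2.
have K0 : 0 <= K by apply: le_trans (b2 0 _); rewrite ?lexx ?ler01.
have mm (t s : R) : 0 <= t -> Num.min 0 t <= s <= Num.max 0 t -> 0 <= s <= t.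
  by move=> t0; rewrite min_l// max_r.
have s1 t : 0 <= t <= 1 -> `|g1 t - g1 0| <= K.
  move=> /andP[t0 t1]; apply: (@le_trans _ _ (K * `|t - 0|)).
    apply: (@mvt_abs _ g1 g2) => s /(mm _ _ t0)/andP[s0 st]; [apply: d1|apply: b2]; by rewrite s0 (le_trans st).
  by rewrite subr0 ger0_norm// ler_piMr.
pose h := fun t : R => g t - t * g1 0.
have dh t : 0 <= t <= 1 -> is_derive t 1 h (g1 t - g1 0).
  move=> t01; apply: is_deriveB; first exact: d0.
  exact: is_derive_mulr.
have := @mvt_abs _ h _ 0 1 K; rewrite min_l// max_r// => /(_ _ dh s1).
by rewrite subr0 normr1 mulr1 /h mul1r mul0r subr0 addrAC.
Qed.

Lemma taylor3 (g g1 g2 g3 : R -> R) K :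
  (forall t, 0 <= t <= 1 -> is_derive t 1 g (g1 t)) ->
  (forall t, 0 <= t <= 1 -> is_derive t 1 g1 (g2 t)) ->
  (forall t, 0 <= t <= 1 -> is_derive t 1 g2 (g3 t)) ->
  (forall t, 0 <= t <= 1 -> `|g3 t| <= K) -> `|g 1 - g 0 - g1 0 - g2 0 / 2| <= K.
Proof.
move=> d0 d1 d2 b3.
have K0 : 0 <= K by apply: le_trans (b3 0 _); rewrite ?lexx ?ler01.
have mm (t s : R) : 0 <= t -> Num.min 0 t <= s <= Num.max 0 t -> 0 <= s <= t.
  by move=> t0; rewrite min_l// max_r.
have s2 t : 0 <= t <= 1 -> `|g2 t - g2 0| <= K.
  move=> /andP[t0 t1]; apply: (@le_trans _ _ (K * `|t - 0|)).
    apply: (@mvt_abs _ g2 g3) => s /(mm _ _ t0)/andP[s0 st]; [apply: d2|apply: b3]; by rewrite s0 (le_trans st).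
  by rewrite subr0 ger0_norm// ler_piMr.
have := @taylor2 (fun t => g t - t * (t * (g2 0 / 2))) (fun t => g1 t - t * g2 0) (fun t => g2 t - g2 0) K.
have -> : g 1 - 1 * (1 * (g2 0 / 2)) - (g 0 - 0 * (0 * (g2 0 / 2))) - (g1 0 - 0 * g2 0) = g 1 - g 0 - g1 0 - g2 0 / 2 by field.
apply => // t t01.
- by apply: is_deriveB; [exact: d0|exact: is_derive_sqr2].
- by apply: is_deriveB; [exact: d1|exact: is_derive_mulr].
Qed.

Context (al be : R) (al0 : 0 < al).

(* Real and imaginary parts of r^(- al - n - i be) e^(i a), and their linear
   combinations: a family of functions closed under differentiation. *)
Definition Qf (n : nat) A B r a := expR (- (n%:R + al) * ln r) * (A * cos (a - be * ln r) + B * sin (a - be * ln r)).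
Definition RA (n : nat) A B := - (n%:R + al) * A - be * B.
Definition RB (n : nat) A B := - (n%:R + al) * B + be * A.

Lemma Qf_shift n A B r a : 0 < r -> Qf n.+1 A B r a = r^-1 * Qf n A B r a.
Proof.
move=> r0; have -> : r^-1 = expR (- ln r) by rewrite expRN lnK// posrE.
by rewrite /Qf mulrA -expRD; congr (expR _ * _); rewrite -natr1; ring.
Qed.

Lemma Qf_le n A B r a m : 0 < m -> m <= r -> `|Qf n A B r a| <= expR (- (n%:R + al) * ln m) * (`|A| + `|B|).
Proof.
move=> m0 mr; have r0 : 0 < r by exact: lt_le_trans mr.
rewrite /Qf normrM (ger0_norm (expR_ge0 _)); apply: ler_pM; rewrite ?expR_ge0//.
  rewrite ler_expR !mulNr lerN2 ler_wpM2l//; first by rewrite addr_ge0// ltW.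
  by rewrite ler_ln ?posrE.
apply: le_trans (ler_normD _ _) _; apply: lerD; rewrite normrM ler_piMr//.
  exact: cos_max.
exact: sin_max.
Qed.

Lemma Qf_path n A B r0 dr a0 da (t : R) : 0 < r0 + t * dr ->
  is_derive t 1 (fun t => Qf n A B (r0 + t * dr) (a0 + t * da))
   (dr * Qf n.+1 (RA n A B) (RB n A B) (r0 + t * dr) (a0 + t * da) + da * Qf n B (- A) (r0 + t * dr) (a0 + t * da)).
Proof.
move=> rp; set r := r0 + t * dr; set a := a0 + t * da.
have dl (c d : R) : is_derive t 1 (fun t : R => c + t * d) d.
  rewrite -[X in is_derive _ _ _ X]add0r; apply: is_deriveD; exact: is_derive_mulr.
have dL : is_derive t 1 (fun t => ln (r0 + t * dr)) (r^-1 * dr).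
  refine (@is_derive1_comp R (@ln R) (fun t => r0 + t * dr) t _ _ (is_derive1_ln rp) (dl r0 dr)).
pose c := - (n%:R + al).
have dcL : is_derive t 1 (fun t => c * ln (r0 + t * dr)) (c * (r^-1 * dr)).
  exact: (@is_deriveZ _ _ _ (fun t => ln (r0 + t * dr)) c t 1).
have dE : is_derive t 1 (fun t => expR (c * ln (r0 + t * dr))) (expR (c * ln r) * (c * (r^-1 * dr))).
  exact: (@is_derive1_comp R expR (fun t => c * ln (r0 + t * dr)) t _ _ (is_derive_expR _) dcL).
have dbL : is_derive t 1 (fun t => be * ln (r0 + t * dr)) (be * (r^-1 * dr)).
  exact: (@is_deriveZ _ _ _ (fun t => ln (r0 + t * dr)) be t 1).
have dth : is_derive t 1 (fun t => (a0 + t * da) - be * ln (r0 + t * dr)) (da - be * (r^-1 * dr)).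
  apply: is_deriveB; exact: dl.
have dC : is_derive t 1 (fun t => cos ((a0 + t * da) - be * ln (r0 + t * dr))) (- sin (a - be * ln r) * (da - be * (r^-1 * dr))).
  exact: (@is_derive1_comp R cos (fun t => (a0 + t * da) - be * ln (r0 + t * dr)) t _ _ (is_derive_cos _) dth).
have dS : is_derive t 1 (fun t => sin ((a0 + t * da) - be * ln (r0 + t * dr))) (cos (a - be * ln r) * (da - be * (r^-1 * dr))).
  exact: (@is_derive1_comp R sin (fun t => (a0 + t * da) - be * ln (r0 + t * dr)) t _ _ (is_derive_sin _) dth).
have dAC := @is_deriveZ _ _ _ _ A t 1 _ dC; have dBS := @is_deriveZ _ _ _ _ B t 1 _ dS.
have dsum := is_deriveD dAC dBS.
have := is_deriveM dE dsum.
rewrite Qf_shift// {1}/Qf -/r -/a /Qf /RA /RB -/c.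
move/is_derive_eq; apply; rewrite /GRing.scale/= -/r -/a.
set F := (X in _ + X * _ = _); have -> : F = A * cos (a - be * ln r) + B * sin (a - be * ln r) by [].
move: (expR _) (cos _) (sin _) => E0 C0 S0.
have r0' : r != 0 by rewrite gt_eqF.
clear -r0'; clearbody c.
by field.
Qed.

(* First, second and third derivatives along the segment from (r0, a0) to
   (r0 + dr, a0 + da). *)
Definition Q1 n A B dr da r a := dr * Qf n.+1 (RA n A B) (RB n A B) r a + da * Qf n B (- A) r a.
Definition Q2 n A B dr da r a := dr * Q1 n.+1 (RA n A B) (RB n A B) dr da r a + da * Q1 n B (- A) dr da r a.
Definition Q3 n A B dr da r a := dr * Q2 n.+1 (RA n A B) (RB n A B) dr da r a + da * Q2 n B (- A) dr da r a.

Lemma lin_le (dr da x y K1 K2 : R) : `|x| <= K1 -> `|y| <= K2 -> `|dr * x + da * y| <= (`|dr| + `|da|) * (K1 + K2).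
Proof.
move=> xK yK; have K10 := le_trans (normr_ge0 _) xK; have K20 := le_trans (normr_ge0 _) yK.
apply: le_trans (ler_normD _ _) _; rewrite !normrM.
have h1 : `|dr| * `|x| <= `|dr| * K1 by rewrite ler_wpM2l.
have h2 : `|da| * `|y| <= `|da| * K2 by rewrite ler_wpM2l.
apply: le_trans (lerD h1 h2) _; rewrite mulrDl !mulrDr.
have := mulr_ge0 (normr_ge0 dr) K20; have := mulr_ge0 (normr_ge0 da) K10; lra.
Qed.

Lemma Q123_le m n A B : 0 < m -> exists2 K : R, 0 < K & forall r a dr da, m <= r ->
  [/\ `|Qf n A B r a| <= K, `|Q1 n A B dr da r a| <= K * (`|dr| + `|da|),
      `|Q2 n A B dr da r a| <= K * (`|dr| + `|da|) ^+ 2 & `|Q3 n A B dr da r a| <= K * (`|dr| + `|da|) ^+ 3].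
Proof.
move=> m0.
have b0 n' A' B' : exists2 K : R, 0 < K & forall r a, m <= r -> `|Qf n' A' B' r a| <= K.
  exists (1 + expR (- (n'%:R + al) * ln m) * (`|A'| + `|B'|)); first by rewrite ltr_pwDl// mulr_ge0 ?expR_ge0// addr_ge0.
  by move=> r a mr; apply: le_trans (Qf_le _ _ _ a m0 mr) _; rewrite lerDr.
have b1 n' A' B' : exists2 K : R, 0 < K & forall r a dr da, m <= r -> `|Q1 n' A' B' dr da r a| <= K * (`|dr| + `|da|).
  have [K1 K10 H1] := b0 n'.+1 (RA n' A' B') (RB n' A' B'); have [K2 K20 H2] := b0 n' B' (- A').
  exists (K1 + K2) => [|r a dr da mr]; first exact: addr_gt0.
  by rewrite [leRHS]mulrC; apply: lin_le; [exact: H1|exact: H2].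
have b2 n' A' B' : exists2 K : R, 0 < K & forall r a dr da, m <= r -> `|Q2 n' A' B' dr da r a| <= K * (`|dr| + `|da|) ^+ 2.
  have [K1 K10 H1] := b1 n'.+1 (RA n' A' B') (RB n' A' B'); have [K2 K20 H2] := b1 n' B' (- A').
  exists (K1 + K2) => [|r a dr da mr]; first exact: addr_gt0.
  apply: le_trans (lin_le _ _ (H1 r a dr da mr) (H2 r a dr da mr)) _.
  by apply: eqle; ring.
have b3 n' A' B' : exists2 K : R, 0 < K & forall r a dr da, m <= r -> `|Q3 n' A' B' dr da r a| <= K * (`|dr| + `|da|) ^+ 3.
  have [K1 K10 H1] := b2 n'.+1 (RA n' A' B') (RB n' A' B'); have [K2 K20 H2] := b2 n' B' (- A').
  exists (K1 + K2) => [|r a dr da mr]; first exact: addr_gt0.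
  apply: le_trans (lin_le _ _ (H1 r a dr da mr) (H2 r a dr da mr)) _.
  by apply: eqle; ring.
have [K0 K00 H0] := b0 n A B; have [K1 K10 H1] := b1 n A B; have [K2 K20 H2] := b2 n A B; have [K3 K30 H3] := b3 n A B.
exists (K0 + K1 + K2 + K3); first by rewrite !addr_gt0.
have le0 : K0 <= K0 + K1 + K2 + K3 by lra.
have le1 : K1 <= K0 + K1 + K2 + K3 by lra.
have le2 : K2 <= K0 + K1 + K2 + K3 by lra.
have le3 : K3 <= K0 + K1 + K2 + K3 by lra.
move=> r a dr da mr; have s0 : 0 <= `|dr| + `|da| by rewrite addr_ge0.
split.
- exact: le_trans (H0 r a mr) le0.
- by apply: le_trans (H1 r a dr da mr) _; apply: wpM_le.
- by apply: le_trans (H2 r a dr da mr) _; apply: wpM_le; rewrite ?exprn_ge0.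
- by apply: le_trans (H3 r a dr da mr) _; apply: wpM_le; rewrite ?exprn_ge0.
Qed.

(** The segment between two points with r >= m stays in that half-plane, where derivatives up to
    order three are bounded. Only this smooth function is expanded; u itself is never
    differentiated. *)
Lemma Qf_taylor m n A B : 0 < m -> exists2 K : R, 0 < K & forall r0 r1 a0 a1, m <= r0 -> m <= r1 ->
  [/\ `|Qf n A B r0 a0| <= K, `|Qf n A B r1 a1 - Qf n A B r0 a0| <= K * (`|r1 - r0| + `|a1 - a0|),
    `|Qf n A B r1 a1 - Qf n A B r0 a0 - Q1 n A B (r1 - r0) (a1 - a0) r0 a0| <= K * (`|r1 - r0| + `|a1 - a0|) ^+ 2 &
    `|Qf n A B r1 a1 - Qf n A B r0 a0 - Q1 n A B (r1 - r0) (a1 - a0) r0 a0 - Q2 n A B (r1 - r0) (a1 - a0) r0 a0 / 2|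
      <= K * (`|r1 - r0| + `|a1 - a0|) ^+ 3].
Proof.
move=> m0; have [K K0 H] := Q123_le n A B m0; exists K => // r0 r1 a0 a1 mr0 mr1.
set dr := r1 - r0; set da := a1 - a0.
pose r t := r0 + t * dr; pose a t := a0 + t * da.
have mr t : 0 <= t <= 1 -> m <= r t.
  move=> /andP[t0 t1]; rewrite /r /dr.
  have -> : r0 + t * (r1 - r0) = (1 - t) * r0 + t * r1 by ring.
  have h1 : (1 - t) * m <= (1 - t) * r0 by rewrite ler_wpM2l// subr_ge0.
  have h2 : t * m <= t * r1 by rewrite ler_wpM2l.
  by apply: le_trans (lerD h1 h2); apply: eqle; ring.
have rp t : 0 <= t <= 1 -> 0 < r0 + t * dr by move=> t01; apply: lt_le_trans (mr t t01).
have d0 n' A' B' t : 0 <= t <= 1 -> is_derive t 1 (fun t => Qf n' A' B' (r t) (a t)) (Q1 n' A' B' dr da (r t) (a t)).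
  by move=> t01; apply: Qf_path; exact: rp.
have dlin (c1 c2 : R) (f1 f2 : R -> R) (g1 g2 : R) t : is_derive t 1 f1 g1 -> is_derive t 1 f2 g2 ->
    is_derive t 1 (fun t => c1 * f1 t + c2 * f2 t) (c1 * g1 + c2 * g2).
  move=> h1 h2; exact: (is_deriveD (@is_deriveZ _ _ _ _ c1 t 1 _ h1) (@is_deriveZ _ _ _ _ c2 t 1 _ h2)).
have d1 n' A' B' t : 0 <= t <= 1 -> is_derive t 1 (fun t => Q1 n' A' B' dr da (r t) (a t)) (Q2 n' A' B' dr da (r t) (a t)).
  by move=> t01; apply: dlin; exact: d0.
have d2 n' A' B' t : 0 <= t <= 1 -> is_derive t 1 (fun t => Q2 n' A' B' dr da (r t) (a t)) (Q3 n' A' B' dr da (r t) (a t)).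
  by move=> t01; apply: dlin; exact: d1.
have e1 : Qf n A B r1 a1 = Qf n A B (r 1) (a 1) by rewrite /r /a /dr /da !mul1r !subrKC.
have er : r 0 = r0 by rewrite /r mul0r addr0.
have ea : a 0 = a0 by rewrite /a mul0r addr0.
have mm : forall t, Num.min 0 1 <= t <= Num.max 0 1 -> 0 <= t <= 1 by move=> t; rewrite min_l// max_r.
have e0 : Qf n A B r0 a0 = Qf n A B (r 0) (a 0) by rewrite er ea.
have eQ1 : Q1 n A B dr da r0 a0 = Q1 n A B dr da (r 0) (a 0) by rewrite er ea.
have eQ2 : Q2 n A B dr da r0 a0 = Q2 n A B dr da (r 0) (a 0) by rewrite er ea.
split.
- by have [] := H r0 a0 0 0 mr0.
- rewrite e1 e0.
  have := @mvt_abs R (fun t => Qf n A B (r t) (a t)) (fun t => Q1 n A B dr da (r t) (a t)) 0 1 (K * (`|dr| + `|da|)).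
  rewrite subr0 normr1 mulr1; apply=> [t /mm t01|t /mm t01].
    exact: (d0 n A B t t01).
  by have [_ h _ _] := H (r t) (a t) dr da (mr t t01).
- rewrite e1 e0 eQ1.
  apply: (@taylor2 (fun t => Qf n A B (r t) (a t)) (fun t => Q1 n A B dr da (r t) (a t)) (fun t => Q2 n A B dr da (r t) (a t))) => t t01.
  by have [_ _ + _] := H (r t) (a t) dr da (mr t t01).
- rewrite e1 e0 eQ1 eQ2.
  apply: (@taylor3 (fun t => Qf n A B (r t) (a t)) (fun t => Q1 n A B dr da (r t) (a t)) (fun t => Q2 n A B dr da (r t) (a t)) (fun t => Q3 n A B dr da (r t) (a t))) => t t01.
  by have [_ _ _ ] := H (r t) (a t) dr da (mr t t01).
Qed.


End PowerExponential.

(** * Interpolation inequalities and regularity of caloric towers *)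

Section CaloricRegularity.
Context {R : realType}.
Notation mu := (@lebesgue_measure R).
Implicit Types (h s t x y z e w M K A B T : R) (g : R -> R).

Definition Ht h (g : R -> R) x : R := \int[mu]_y (heat_kernel h (x - y) * g y).

Lemma HtE h g x : Ht h g x = Sk 0 h g x.
Proof. by apply: eq_Rintegral => y _; rewrite gk0. Qed.

Lemma Ht_le h g x M : 0 < h -> measurable_fun setT g -> (forall y, `|g y| <= M) -> `|Ht h g x| <= M.
Proof.
move=> h0 mg gM; have -> : M = \int[mu]_y (M * heat_kernel h (x - y)).
  by rewrite IntZ ?heat_Int ?mulr1//; exact: heat_itg.
apply: Int_abs_le.
- exact: itg_measurable (heat_itg_bounded x h0 mg gM).
- by apply: itgZ; exact: heat_itg.
- by move=> y; rewrite normrM (ger0_norm (heat_ge0 _ _)) mulrC ler_wpM2r ?heat_ge0.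
Qed.

Lemma HtD h (f g : R -> R) x M : 0 < h -> measurable_fun setT f -> measurable_fun setT g ->
  (forall y, `|f y| <= M) -> (forall y, `|g y| <= M) ->
  Ht h (fun y => f y + g y) x = Ht h f x + Ht h g x.
Proof.
move=> h0 mf mg fM gM; rewrite /Ht -IntD; [|exact: heat_itg_bounded fM|exact: heat_itg_bounded gM].
by apply: eq_Rintegral => y _; rewrite mulrDr.
Qed.

Lemma abs_sqr_powR e : `|e| = (e ^+ 2) `^ 2^-1.
Proof. by rewrite powR12_sqrt ?sqr_ge0// sqrtr_sqr. Qed.

Lemma powR_ge1 (a u : R) : 1 <= a -> 0 <= u -> 1 <= a `^ u.
Proof. by move=> a1 u0; rewrite -[leLHS](powRr0 a); apply: ler_powR. Qed.

(** The fine bound serves for |e| <= 1, the crude one beyond. The moduli must hold for all e because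
    they are integrated against Gaussians. *)
Lemma interp_quarter (X e A B : R) : 0 <= A -> 0 <= B -> `|X| <= A -> `|X| <= B * `|e| -> `|X| <= (A + B) * (e ^+ 2) `^ 4^-1.
Proof.
move=> A0 B0 XA XB; have p0 := powR_ge0 (e ^+ 2) 4^-1; rewrite mulrDl.
have [e1|e1] := leP (e ^+ 2) 1.
  apply: le_trans XB _; rewrite ler_wpDl ?mulr_ge0// ler_wpM2l// abs_sqr_powR.
  by apply: le_powR1; [rewrite sqr_ge0|lra|lra].
apply: le_trans XA _; rewrite ler_wpDr ?mulr_ge0// ler_peMr//.
by apply: powR_ge1; [exact: ltW|lra].
Qed.

Lemma interp_3quarter (X e A B : R) : 0 <= A -> 0 <= B -> `|X| <= A * (1 + `|e|) -> `|X| <= B * e ^+ 2 ->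
  `|X| <= (2 * A + B) * (e ^+ 2) `^ (3 / 4).
Proof.
move=> A0 B0 XA XB; have p0 := powR_ge0 (e ^+ 2) (3 / 4); rewrite mulrDl.
have [e1|e1] := leP (e ^+ 2) 1.
  apply: le_trans XB _; rewrite ler_wpDl ?mulr_ge0// ler_wpM2l// -[leLHS]powRr1 ?sqr_ge0//.
  by apply: le_powR1; [rewrite sqr_ge0|lra|lra].
apply: le_trans XA _; rewrite ler_wpDr ?mulr_ge0//.
have -> : 2 * A * (e ^+ 2) `^ (3 / 4) = A * (2 * (e ^+ 2) `^ (3 / 4)) by ring.
rewrite ler_wpM2l//.
have h1 : 1 <= (e ^+ 2) `^ (3 / 4) by apply: powR_ge1; [exact: ltW|lra].
have h2 : `|e| <= (e ^+ 2) `^ (3 / 4) by rewrite abs_sqr_powR; apply: ler_powR; [exact: ltW|lra].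
lra.
Qed.

Lemma interp_lip (X e A B : R) : 0 <= A -> 0 <= B -> `|X| <= A -> `|X| <= B * (`|e| + (e ^+ 2) `^ (3 / 4)) ->
  `|X| <= (A + 2 * B) * `|e|.
Proof.
move=> A0 B0 XA XB; rewrite mulrDl.
have [e1|e1] := leP (e ^+ 2) 1.
  apply: le_trans XB _; rewrite ler_wpDl ?mulr_ge0//.
  have h2 : (e ^+ 2) `^ (3 / 4) <= `|e| by rewrite abs_sqr_powR; apply: le_powR1; [rewrite sqr_ge0|lra|lra].
  have -> : 2 * B * `|e| = B * (`|e| + `|e|) by ring.
  by rewrite ler_wpM2l// lerD2l.
apply: le_trans XA _; rewrite ler_wpDr ?mulr_ge0// ler_peMr// abs_sqr_powR.
by apply: powR_ge1; [exact: ltW|lra].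
Qed.

(* A tower of space derivatives of a bounded caloric function of (x, w), where
   w is the backward time. *)
Definition caloric_part (S : nat -> R -> R -> R) w0 w1 M := [/\
  forall i x w, (i <= 3)%N -> w0 <= w <= w1 -> `|S i x w| <= M,
  forall i x w, w0 <= w <= w1 -> is_derive x 1 (fun x => S i x w) (S i.+1 x w),
  forall i x w, w0 <= w <= w1 -> is_derive w 1 (fun w => S i x w) (- S i.+2 x w),
  forall i w, w0 <= w <= w1 -> measurable_fun setT (fun x => S i x w) &
  forall x w h, w0 <= w <= w1 -> 0 < h -> w0 <= w - h -> Ht h (fun y => S 0%N y w) x = S 0%N x (w - h)].

Lemma mvt_set (f df : R -> R) (a b c d K : R) : c <= a <= d -> c <= b <= d ->
  (forall x, c <= x <= d -> is_derive x 1 f (df x)) -> (forall x, c <= x <= d -> `|df x| <= K) ->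
  `|f b - f a| <= K * `|b - a|.
Proof.
move=> /andP[ca ad] /andP[cb bd] H1 H2.
have mm x : Num.min a b <= x <= Num.max a b -> c <= x <= d.
  by case: (leP a b) => ab /andP[h1 h2]; apply/andP; split; lra.
by apply: (@mvt_abs R f df) => x /mm; [exact: H1|exact: H2].
Qed.

Lemma caloric_part_reg S w0 w1 M : 0 <= M -> caloric_part S w0 w1 M ->
  [/\ forall i x w v, (i <= 1)%N -> w0 <= w <= w1 -> w0 <= v <= w1 -> `|S i x w - S i x v| <= M * `|w - v|,
   forall i x e w, (i <= 1)%N -> w0 <= w <= w1 -> `|S i (x + e) w - S i x w| <= M * `|e| &
   forall x e w, w0 <= w <= w1 -> `|S 0%N (x + e) w - S 0%N x w - e * S 1%N x w| <= M * e ^+ 2].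
Proof.
move=> M0 [bd dx dw _ _].
have lip i x e w : (i <= 2)%N -> w0 <= w <= w1 -> `|S i (x + e) w - S i x w| <= M * `|e|.
  move=> i1 ww; have -> : e = x + e - x by ring.
  have -> : x + (x + e - x) = x + e by ring.
  apply: (@mvt_abs R (fun x => S i x w) (fun x => S i.+1 x w)) => z _; first exact: dx.
  by apply: bd.
split.
- move=> i x w v i1 ww vw; apply: (@mvt_set (fun w => S i x w) (fun w => - S i.+2 x w) v w w0 w1) => // u uw.
  by rewrite normrN; apply: bd => //; move: i1; clear; lia.
- by move=> i x e w i1; apply: lip; rewrite (leq_trans i1).
- move=> x e w ww.
  pose g z := S 0%N (x + z) w - z * S 1%N x w.
  have -> : S 0%N (x + e) w - S 0%N x w - e * S 1%N x w = g e - g 0 by rewrite /g addr0 mul0r subr0; ring.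
  have dg z : is_derive z 1 g (S 1%N (x + z) w - S 1%N x w).
    apply: is_deriveB; last exact: is_derive_mulr.
    have dB : is_derive z 1 (cst x + id : R -> R) (0 + 1) by apply: is_deriveD.
    rewrite add0r in dB; have := @is_derive1_comp R (fun x => S 0%N x w) (fun z => x + z) z _ _ (dx 0%N (x + z) w ww) dB.
    by rewrite mulr1.
  have := @mvt_abs R g (fun z => S 1%N (x + z) w - S 1%N x w) 0 e (M * `|e|) (fun z _ => dg z).
  rewrite subr0 -mulrA -expr2 real_normK ?num_real//; apply => z zz.
  apply: le_trans (lip 1%N x z w isT ww) _; rewrite ler_wpM2l//.
  by move: zz; case: (leP 0 e) => e0 /andP[z0 z1]; [rewrite !ger0_norm|rewrite !ler0_norm ?lerN2// ltW].
Qed.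

End CaloricRegularity.

(** * Parabolic Hölder regularity with bounded sources *)

Section ParabolicRegularity.
Context {R : realType}.
Notation mu := (@lebesgue_measure R).
Implicit Types (h s t x y z e w M K A B T : R) (g : R -> R) (f : R * R -> R).

Lemma Duh0t i (f : R * R -> R) x : Duh i f 0 x = 0.
Proof.
rewrite /Duh; apply: Int_eq0 => s; case: ifPn => // /andP[s0 /(lt_trans s0)].
by rewrite ltxx.
Qed.

Lemma measurable_Duh_slice i f t : measurable_fun setT f -> measurable_fun setT (Duh i f t).
Proof.
move=> mf; have -> : Duh i f t = (fun z : R * R => Duh i f z.1 z.2) \o (fun s : R => (t, s)) by [].
by apply: measurableT_comp; [exact: measurable_Duh|exact: measurable_pair1].
Qed.

Local Opaque Duh.

Lemma addr4 (a b c d : R) : a + b - (c + d) = (b - d) + (a - c).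
Proof. by ring. Qed.

Lemma addr6 (a b c d e u v : R) : a + b - (c + d) - e * (u + v) = (b - d - e * v) + (a - c - e * u).
Proof. by ring. Qed.

Lemma sub_chain (a b c : R) : a - c = (a - b) + (b - c).
Proof. by ring. Qed.

Lemma add_split (a b c : R) : a - b = c + (a - b - c).
Proof. by ring. Qed.

(** Space regularity comes from [Duh_mod0] and [Duh_mod1]. Regularity in time then follows through
    [Duh_step]: the increment is the effect of a short heat flow on a Hölder function plus the
    contribution of the new sources. *)
Lemma Duh_reg (f : R * R -> R) t1 M : 0 < t1 <= 1 -> measurable_fun setT f -> 0 <= M ->
  (forall s y, 0 < s < t1 -> `|f (s, y)| <= M) -> exists2 K : R, 0 < K &
  [/\ forall i t x, (i <= 1)%N -> 0 <= t <= t1 -> `|Duh i f t x| <= K,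
   forall t x e, 0 <= t <= t1 -> `|Duh 0 f t (x + e) - Duh 0 f t x| <= K * `|e| /\
     `|Duh 0 f t (x + e) - Duh 0 f t x - e * Duh 1 f t x| <= K * (e ^+ 2) `^ (3 / 4),
   forall i t x e, (i <= 1)%N -> 0 <= t <= t1 -> `|Duh i f t (x + e) - Duh i f t x| <= K * (e ^+ 2) `^ 4^-1,
   forall i t h x, (i <= 1)%N -> 0 < t -> 0 < h -> t + h <= t1 -> `|Duh i f (t + h) x - Duh i f t x| <= K * h `^ 4^-1 &
   forall t x, 0 <= t <= t1 -> `|Duh 0 f t x| <= K * t `^ 4^-1].
Proof.
move=> /andP[t10 t11] mf M0 fM.
have fMt t : t <= t1 -> forall s y, 0 < s < t -> `|f (s, y)| <= M.
  by move=> tt s y /andP[s0 st]; apply: fM; rewrite s0 (lt_le_trans st).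
have [Ca Ca0 Ha] : exists2 C : R, 0 < C & forall i, (i <= 1)%N -> (i <= 1)%N -> forall t x, 0 <= t <= t1 -> `|Duh i f t x| <= C * t `^ (1 - i%:R / 2).
  apply: ex2_uniform => [i|i C C' H CC' i1 t x tt]; last first.
    by apply: le_trans (H i1 t x tt) _; apply: wpM_le => //; exact: powR_ge0.
  have [i1|i1] := leqP i 1; last by exists 1.
  have [C C0 H] := @Duh_le R i i1; exists (C * M + 1) => [|_ t x /andP[t0 tt]].
    by rewrite ltr_wpDl// mulr_ge0// ltW.
  move: t0; rewrite le_eqVlt => /predU1P[<-|t0].
    by rewrite Duh0t normr0 mulr_ge0 ?powR_ge0// addr_ge0// mulr_ge0// ltW.
  apply: le_trans (H f t M x t0 mf M0 (fMt t tt)) _.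
  by apply: wpM_le; [rewrite lerDl|exact: powR_ge0].
have t1p u t : 0 <= u -> 0 <= t <= t1 -> t `^ u <= 1.
  move=> u0 /andP[t0 tt]; apply: (@le_trans _ _ (1 `^ u)); last by rewrite powR1.
  by apply: powR_mono => //; apply: le_trans t11.
have ha i t x : (i <= 1)%N -> 0 <= t <= t1 -> `|Duh i f t x| <= Ca.
  move=> i1 tt; apply: le_trans (Ha i i1 i1 t x tt) _; rewrite ler_piMr ?(ltW Ca0)// t1p//.
  by case: i i1 => [|[|]]// _; lra.
have [C0 C00 H0] := @Duh_mod0 R; have [C1 C10 H1] := @Duh_mod1 R.
have hb2 t x e : 0 <= t <= t1 -> `|Duh 0 f t (x + e) - Duh 0 f t x - e * Duh 1 f t x| <= C0 * M * (e ^+ 2) `^ (3 / 4).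
  move=> tt; have /andP[t0 tt1] := tt; move: t0; rewrite le_eqVlt => /predU1P[<-|t0].
    by rewrite !Duh0t mulr0 !subr0 normr0; nonneg.
  apply: le_trans (H0 f t M x e t0 mf M0 (fMt t tt1)) _; apply: wpM_le; last exact: powR_ge0.
  by rewrite ler_piMr ?mulr_ge0 ?(ltW C00)// t1p// invr_ge0.
have hd i t x e : (i <= 1)%N -> 0 <= t <= t1 -> `|Duh i f t (x + e) - Duh i f t x| <= 2 * Ca.
  move=> i1 tt; apply: le_trans (ler_normB _ _) _; apply: le_trans (lerD (ha i t _ i1 tt) (ha i t _ i1 tt)) _.
  by apply: eqle; ring.
pose B := Ca + C0 * M; have B0 : 0 <= B by rewrite /B; nonneg.
have hb1 t x e : 0 <= t <= t1 -> `|Duh 0 f t (x + e) - Duh 0 f t x| <= (2 * Ca + 2 * B) * `|e|.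
  move=> tt; apply: interp_lip => //; [by nonneg|exact: hd|].
  rewrite (add_split _ _ (e * Duh 1 f t x)).
  apply: le_trans (ler_normD _ _) _; rewrite mulrDr; apply: lerD.
    rewrite normrM mulrC; apply: wpM_le => //; apply: le_trans (ha 1%N t x isT tt) _.
    by rewrite /B lerDl mulr_ge0// ltW.
  apply: le_trans (hb2 t x e tt) _; apply: wpM_le; last exact: powR_ge0.
  by rewrite /B lerDr ltW.
pose K3 := (2 * Ca + (2 * Ca + 2 * B)) + C1 * M.
have K30 : 0 <= K3 by rewrite /K3; nonneg.
have hb3 i t x e : (i <= 1)%N -> 0 <= t <= t1 -> `|Duh i f t (x + e) - Duh i f t x| <= K3 * (e ^+ 2) `^ 4^-1.
  move=> i1 tt; case: i i1 => [|[|//]] _.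
    have A0 : 0 <= 2 * Ca by nonneg.
    have A1 : 0 <= 2 * Ca + 2 * B by nonneg.
    apply: le_trans (interp_quarter A0 A1 (hd 0%N t x e isT tt) (hb1 t x e tt)) _.
    by apply: wpM_le; [rewrite /K3 lerDl mulr_ge0// ltW|exact: powR_ge0].
  have /andP[t0 tt1] := tt; move: t0; rewrite le_eqVlt => /predU1P[<-|t0].
    by rewrite !Duh0t subr0 normr0; nonneg.
  apply: le_trans (H1 f t M x e t0 mf M0 (fMt t tt1)) _; apply: wpM_le; last exact: powR_ge0.
  apply: (@le_trans _ _ (C1 * M)); last by rewrite /K3 lerDr; nonneg.
  by rewrite ler_piMr ?mulr_ge0 ?(ltW C10)// t1p// invr_ge0.
have [Ct Ct0 Htt] : exists2 C : R, 0 < C & forall i, (i <= 1)%N -> (i <= 1)%N -> forall t h x, 0 < t -> 0 < h -> t + h <= t1 ->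
   `|\int[mu]_s Duht i f t h x s| <= C * h `^ 4^-1.
  apply: ex2_uniform => [i|i C C' H CC' i1 t h x t0 h0 th]; last first.
    by apply: le_trans (H i1 t h x t0 h0 th) _; apply: wpM_le => //; exact: powR_ge0.
  have [i1|i1] := leqP i 1; last by exists 1.
  have [C C'0 H] := @Duht_le R i i1; exists (C * M * 2 + 1) => [|_ t h x t0 h0 th].
    by rewrite ltr_wpDl// !mulr_ge0// ltW.
  apply: le_trans (H f t h M x t0 h0 mf M0 (fMt _ th)) _.
  have u01 : 4^-1 <= (1 - i%:R / 2 : R) <= 1 by case: i i1 {H} => [|[|]]// _; lra.
  have /andP[u0 u1] := u01.
  rewrite [leRHS]mulrDl mul1r ler_wpDr ?powR_ge0// -(mulrA (C * M)) ler_wpM2l ?mulr_ge0 ?(ltW C'0)//.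
  apply: le_trans (powR_2q (ltW h0) u1) _; rewrite ler_wpM2l//.
  apply: le_powR1 => //; rewrite ?invr_gt0// (ltW h0)/=; lra.
have hc i t h x : (i <= 1)%N -> 0 < t -> 0 < h -> t + h <= t1 -> `|Duh i f (t + h) x - Duh i f t x| <= (3 * K3 + Ct) * h `^ 4^-1.
  move=> i1 t0 h0 th; have tt : 0 <= t <= t1 by rewrite ltW//= (le_trans _ th)// lerDl ltW.
  rewrite (Duh_step x i1 t0 h0 mf M0 (fMt _ th)).
  have mD := measurable_Duh_slice i t mf.
  have hh := @heat_holder R h x (fun z => Duh i f t z) Ca (Duh i f t x) K3 0 h0 mD (fun z => ha i t z i1 tt) K30.
  have hx y : `|Duh i f t y - Duh i f t x| <= K3 * ((y - x) ^+ 2) `^ 4^-1 + 0.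
    by rewrite addr0; have := hb3 i t x (y - x) i1 tt; rewrite subrKC.
  have {hh} h2 := hh hx; rewrite addr0 in h2.
  rewrite addrAC mulrDl; apply: le_trans (ler_normD _ _) _; apply: lerD => //.
  exact: Htt.
exists (Ca + C0 * M + (2 * Ca + 2 * B) + K3 + (3 * K3 + Ct)).
  have : 0 <= C0 * M by nonneg.
  lra.
have p0 : 0 <= C0 * M by nonneg.
have K3t : 0 <= 3 * K3 + Ct by lra.
split.
- by move=> i t x i1 tt; apply: le_trans (ha i t x i1 tt) _; lra.
- move=> t x e tt; split.
    by apply: le_trans (hb1 t x e tt) _; apply: wpM_le => //; lra.
  by apply: le_trans (hb2 t x e tt) _; apply: wpM_le; [lra|exact: powR_ge0].
- move=> i t x e i1 tt; apply: le_trans (hb3 i t x e i1 tt) _; apply: wpM_le; [lra|exact: powR_ge0].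
- move=> i t h x i1 t0 h0 th; apply: le_trans (hc i t h x i1 t0 h0 th) _; apply: wpM_le; [lra|exact: powR_ge0].
- move=> t x tt; have := Ha 0%N isT isT t x tt; rewrite mul0r subr0 => /le_trans; apply.
  apply: ler_pM; rewrite ?(ltW Ca0) ?powR_ge0//; first lra.
  apply: le_powR1; [|by rewrite invr_gt0|lra].
  by case/andP: tt => -> tt1 /=; exact: le_trans t11.
Qed.

Definition Wf (S : nat -> R -> R -> R) (f : R * R -> R) T (i : nat) t x := S i x (T - t) + Duh i f t x.

Lemma W_reg S f T t1 MS M : 0 < t1 -> t1 < T -> T <= 1 -> 0 <= MS -> caloric_part S (T - t1) T MS ->
  measurable_fun setT f -> 0 <= M -> (forall s y, 0 < s < t1 -> `|f (s, y)| <= M) -> exists2 K : R, 0 < K &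
  [/\ forall i t x, (i <= 1)%N -> 0 <= t <= t1 -> `|Wf S f T i t x| <= K,
   forall t x e, 0 <= t <= t1 -> `|Wf S f T 0 t (x + e) - Wf S f T 0 t x| <= K * `|e| /\
     `|Wf S f T 0 t (x + e) - Wf S f T 0 t x - e * Wf S f T 1 t x| <= K * (e ^+ 2) `^ (3 / 4),
   forall i t h x e, (i <= 1)%N -> 0 < t -> 0 <= h -> t + h <= t1 ->
     `|Wf S f T i (t + h) (x + e) - Wf S f T i t x| <= K * ((e ^+ 2) `^ 4^-1 + h `^ 4^-1) &
   forall t x, 0 <= t <= t1 -> `|Wf S f T 0 t x - Wf S f T 0 0 x| <= K * t `^ 4^-1].
Proof.
move=> t10 t1T T1 MS0 HS mf M0 fM.
have t11 : 0 < t1 <= 1 by rewrite t10 (le_trans (ltW t1T)).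
have [K K0 [Ka Kb Kc Kd Ke]] := Duh_reg t11 mf M0 fM.
have [sT sX sX2] := caloric_part_reg MS0 HS.
have [sB _ _ _ _] := HS.
have ww t : 0 <= t <= t1 -> T - t1 <= T - t <= T by move=> /andP[t0 tt]; rewrite lerD2l lerN2 tt gerBl.
have t4 t : 0 <= t <= t1 -> t <= t `^ 4^-1.
  move=> /andP[t0 tt]; rewrite -[leLHS]powRr1//; apply: le_powR1; [|by rewrite invr_gt0|lra].
  by rewrite t0 (le_trans tt)//; case/andP: t11.
have N0 : 0 <= MS * 5 by rewrite mulr_ge0.
exists (K + MS * 5); first by rewrite ltr_wpDr.
have sq i t x e : (i <= 1)%N -> 0 <= t <= t1 -> `|S i (x + e) (T - t) - S i x (T - t)| <= (MS * 3) * (e ^+ 2) `^ 4^-1.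
  move=> i1 tt; have A0 : 0 <= MS * 2 by rewrite mulr_ge0.
  have -> : MS * 3 = MS * 2 + MS by ring.
  apply: interp_quarter => //; last exact: sX (ww t tt).
  apply: le_trans (ler_normB _ _) _.
  have i3 : (i <= 3)%N by rewrite (leq_trans i1).
  apply: le_trans (lerD (sB i _ _ i3 (ww t tt)) (sB i _ _ i3 (ww t tt))) _.
  by apply: eqle; ring.
split.
- move=> i t x i1 tt; apply: le_trans (ler_normD _ _) _; rewrite addrC; apply: lerD; first exact: Ka.
  apply: le_trans (sB i x _ _ (ww t tt)) _; first by rewrite (leq_trans i1).
  by rewrite ler_peMr// ler1n.
- move=> t x e tt; have [b1 b2] := Kb t x e tt; rewrite /Wf; split.
    rewrite addr4.
    apply: le_trans (ler_normD _ _) _; rewrite mulrDl; apply: lerD => //.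
    apply: le_trans (sX 0%N x e _ isT (ww t tt)) _; apply: wpM_le => //.
    by rewrite ler_peMr// ler1n.
  rewrite addr6.
  apply: le_trans (ler_normD _ _) _; rewrite mulrDl; apply: lerD => //.
  have -> : MS * 5 = 2 * (MS * 2) + MS by ring.
  apply: interp_3quarter => //; first by rewrite mulr_ge0.
    apply: le_trans (ler_normB _ _) _; rewrite normrM.
    have h1 := sX 0%N x e _ isT (ww t tt); have h2 := sB 1%N x _ isT (ww t tt).
    have h3 : `|e| * `|S 1%N x (T - t)| <= `|e| * MS by rewrite ler_wpM2l.
    apply: le_trans (lerD h1 h3) _; have := normr_ge0 e; nra.
  exact: sX2 (ww t tt).
- move=> i t h x e i1 t0 h0 th.
  have tt : 0 <= t <= t1 by rewrite ltW//= (le_trans _ th)// lerDl.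
  have tth : 0 <= t + h <= t1 by rewrite th andbT addr_ge0// ltW.
  have d1 : `|Duh i f (t + h) (x + e) - Duh i f t x| <= K * ((e ^+ 2) `^ 4^-1 + h `^ 4^-1).
    rewrite (sub_chain _ (Duh i f (t + h) x)).
    apply: le_trans (ler_normD _ _) _; rewrite mulrDr; apply: lerD; first exact: Kc.
    move: h0; rewrite le_eqVlt => /predU1P[<-|h0]; last exact: Kd.
    by rewrite addr0 subrr normr0; nonneg.
  have d2 : `|S i (x + e) (T - (t + h)) - S i x (T - t)| <= MS * 5 * ((e ^+ 2) `^ 4^-1 + h `^ 4^-1).
    rewrite (sub_chain _ (S i x (T - (t + h)))).
    apply: le_trans (ler_normD _ _) _; rewrite mulrDr; apply: lerD.
      apply: le_trans (sq i _ x e i1 tth) _; apply: wpM_le; last exact: powR_ge0.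
      by rewrite ler_wpM2l// ler_nat.
    apply: le_trans (sT i x _ _ i1 (ww _ tth) (ww _ tt)) _.
    have -> : T - (t + h) - (T - t) = - h by ring.
    rewrite normrN ger0_norm//; apply: ler_pM => //; first by rewrite ler_peMr// ler1n.
    by apply: t4; rewrite h0 (le_trans _ th)// lerDr ltW.
  rewrite /Wf addr4.
  by apply: le_trans (ler_normD _ _) _; rewrite mulrDl; apply: lerD.
- move=> t x tt; rewrite /Wf Duh0t.
  have t00 : 0 <= (0 : R) <= t1 by rewrite lexx ltW.
  rewrite addr4 subr0.
  apply: le_trans (ler_normD _ _) _; rewrite mulrDl; apply: lerD; first exact: Ke.
  apply: le_trans (sT 0%N x _ _ isT (ww _ tt) (ww _ t00)) _.
  have -> : T - t - (T - 0) = - t by ring.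
  rewrite normrN ger0_norm; last by case/andP: tt.
  apply: ler_pM => //; [by case/andP: tt|by rewrite ler_peMr// ler1n|exact: t4].
Qed.

Lemma W_heat S f T t1 MS M t h x K : 0 < t -> 0 < h -> t + h <= t1 -> t1 < T -> 0 <= MS -> caloric_part S (T - t1) T MS ->
  measurable_fun setT f -> 0 <= M -> (forall s y, 0 < s < t1 -> `|f (s, y)| <= M) -> 0 <= K ->
  (forall s y, t <= s < t + h -> `|f (s, y) - f (t, x)| <= K * ((y - x) ^+ 2) `^ 4^-1 + K * h `^ 4^-1) ->
  `|Wf S f T 0 (t + h) x - Ht h (Wf S f T 0 t) x - h * f (t, x)| <= 4 * K * h `^ 4^-1 * h.
Proof.
move=> t0 h0 th t1T MS0 [sB _ _ sM sH] mf M0 fM K0 fK.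
have fMt t' : t' <= t1 -> forall s y, 0 < s < t' -> `|f (s, y)| <= M.
  by move=> tt s y /andP[s0 st]; apply: fM; rewrite s0 (lt_le_trans st).
have tt1 : t <= t1 by apply: le_trans th; rewrite lerDl ltW.
have ww : T - t1 <= T - t <= T by apply/andP; split; lra.
have mD := measurable_Duh_slice 0 t mf.
have [C C0 HC] := @Duh_le R 0 isT.
have bD y : `|Duh 0 f t y| <= C * M * t `^ (1 - 0%:R / 2).
  exact: HC f t M y t0 mf M0 (fMt t tt1).
pose B := MS + C * M * t `^ (1 - 0%:R / 2).
have Bp : 0 <= C * M * t `^ (1 - 0%:R / 2) by nonneg.
have b1 y : `|S 0%N y (T - t)| <= B by apply: le_trans (sB 0%N y _ isT ww) _; rewrite lerDl.
have b2 y : `|Duh 0 f t y| <= B by apply: le_trans (bD y) _; rewrite lerDr.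
have -> : Ht h (Wf S f T 0 t) x = S 0%N x (T - (t + h)) + Ht h (Duh 0 f t) x.
  rewrite /Wf (HtD x h0 (sM 0%N _ ww) mD b1 b2) sH//; first by rewrite opprD addrA.
  by rewrite -addrA -opprD lerD2l lerN2.
rewrite /Wf (Duh_step x (isT : (0 <= 1)%N) t0 h0 mf M0 (fMt _ th)).
rewrite -/(Ht h (Duh 0 f t) x).
have alg (a b c d : R) : a + (b + c) - (a + b) - d = c - d by ring.
rewrite alg.
exact: (Duht_holder t0 h0 mf M0 (fMt _ th) K0 fK).
Qed.

End ParabolicRegularity.

(** * The caloric parts of [rho] and [phi] *)

Section CaloricInstances.
Context {R : realType}.
Notation mu := (@lebesgue_measure R).
Implicit Types (h s t x y z e w M K A B T c : R) (S : nat -> R -> R -> R) (g : R -> R).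

Lemma caloric_part_bounded S w0 w1 M w x : caloric_part S w0 w1 M -> w0 <= w <= w1 ->
  measurable_fun setT (fun x => S 0%N x w) /\ forall x, `|S 0%N x w| <= M.
Proof. by move=> [b _ _ m _] ww; split => [|y]; [exact: m|exact: b]. Qed.

Lemma HtZ h c g x M : 0 < h -> measurable_fun setT g -> (forall y : R, `|g y| <= M) ->
  Ht h (fun y => c * g y) x = c * Ht h g x.
Proof.
move=> h0 mg gM; rewrite /Ht -IntZ; last exact: heat_itg_bounded gM.
by apply: eq_Rintegral => y _; rewrite mulrCA.
Qed.

Lemma caloric_partZ S w0 w1 M c : caloric_part S w0 w1 M -> caloric_part (fun i x w => c * S i x w) w0 w1 (`|c| * M).
Proof.
move=> HS; have [b dx dw m H] := HS; split.
- by move=> i x w i3 ww; rewrite normrM ler_wpM2l//; exact: b.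
- by move=> i x w ww; apply: is_deriveZ; exact: dx.
- by move=> i x w ww; rewrite -mulrN; apply: is_deriveZ; exact: dw.
- by move=> i w ww; apply: measurable_funM => //; exact: m.
- move=> x w h ww h0 wh; have [mS bS] := caloric_part_bounded x HS ww.
  by rewrite (HtZ c x h0 mS bS) H.
Qed.

Lemma caloric_partD S S' w0 w1 M M' : caloric_part S w0 w1 M -> caloric_part S' w0 w1 M' ->
  caloric_part (fun i x w => S i x w + S' i x w) w0 w1 (M + M').
Proof.
move=> HS HS'; have [b dx dw m H] := HS; have [b' dx' dw' m' H'] := HS'; split.
- by move=> i x w i3 ww; apply: le_trans (ler_normD _ _) _; apply: lerD; [exact: b|exact: b'].
- by move=> i x w ww; apply: is_deriveD; [exact: dx|exact: dx'].
- by move=> i x w ww; rewrite opprD; apply: is_deriveD; [exact: dw|exact: dw'].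
- by move=> i w ww; apply: measurable_funD => //; [exact: m|exact: m'].
- move=> x w h ww h0 wh; have [mS bS] := caloric_part_bounded x HS ww.
  have [mS' bS'] := caloric_part_bounded x HS' ww.
  have M0 : 0 <= M by apply: le_trans (bS 0).
  have M0' : 0 <= M' by apply: le_trans (bS' 0).
  have c1 y : `|S 0%N y w| <= M + M' by apply: le_trans (bS y) _; rewrite lerDl.
  have c2 y : `|S' 0%N y w| <= M + M' by apply: le_trans (bS' y) _; rewrite lerDr.
  by rewrite (HtD x h0 mS mS' c1 c2) H// H'.
Qed.

Lemma caloric_part_sum (F : nat -> nat -> R -> R -> R) (c : nat -> R) w0 w1 M n :
  (forall j, (j < n)%N -> caloric_part (F j) w0 w1 M) ->
  exists2 M', 0 <= M' & caloric_part (fun i x w => \sum_(j < n) c j * F j i x w) w0 w1 M'.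
Proof.
elim: n => [|n ih] HF.
  exists 0 => //; split.
  - by move=> i x w _ _; rewrite big_ord0 normr0.
  - move=> i x w _; rewrite big_ord0; under eq_fun do rewrite big_ord0; exact: is_derive_cst.
  - move=> i x w _; rewrite big_ord0 oppr0; under eq_fun do rewrite big_ord0; exact: is_derive_cst.
  - move=> i w _; under eq_fun do rewrite big_ord0; exact: measurable_cst.
  - by move=> x w h _ _ _; rewrite big_ord0; apply: Int_eq0 => y; rewrite big_ord0 mulr0.
have [M' M0 H'] := ih (fun j jn => HF j (leqW jn)).
have HZ := caloric_partZ (c n) (HF n (ltnSn n)).
exists (M' + `| `|c n| * M |); first by rewrite addr_ge0.
have -> : (fun i x w => \sum_(j < n.+1) c j * F j i x w) = (fun i x w => \sum_(j < n) c j * F j i x w + c n * F n i x w).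
  by apply/funext => i; apply/funext => x; apply/funext => w; rewrite big_ord_recr.
have [b dx dw m H] := caloric_partD H' HZ; split => //.
move=> i x w i3 ww; apply: le_trans (b i x w i3 ww) _.
by rewrite lerD2l ler_norm.
Qed.

Lemma Ht_gk h w c a x : 0 < h -> w < a -> Ht h (fun y => gk 0 (a - w) (y - c)) x = gk 0 (a - (w - h)) (x - c).
Proof.
move=> h0 wa; have aw : 0 < a - w by rewrite subr_gt0.
by rewrite /Ht (gk_CK 0 x c h0 aw); congr (gk 0 _ _); ring.
Qed.

Lemma EE_caloric m : exists2 M : R, 0 <= M & forall j w0 w1, (j <= m)%N -> 0 <= w0 -> w1 <= 2^-1 -> caloric_part (EE m j) w0 w1 M.
Proof.
have [C C0 H] := @EE_bounded R m 3; exists C; first exact: ltW.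
move=> j w0 w1 jm w00 w12.
have ww w : w0 <= w <= w1 -> 0 <= w <= 2^-1 by move=> /andP[h1 h2]; rewrite (le_trans w00 h1) (le_trans h2 w12).
have lt1 w : w0 <= w <= w1 -> w < 1 by move=> /ww /andP[_ h]; apply: le_lt_trans h _; lra.
split.
- by move=> i x w i3 /ww; exact: H.
- by move=> i x w /lt1 w1'; exact: EE_dx.
- by move=> i x w /lt1 w1'; exact: EE_dw.
- by move=> i w _; exact: measurable_EE.
- move=> x w h wI h0 wh; rewrite /Ht /EE.
  have w1' := lt1 _ wI.
  have iG (l : nat) : itg (fun y => heat_kernel h (x - y) * gk 0 (1 - w) (y - l%:R)).
    by apply: heat_gk_itg => //; rewrite subr_gt0.
  have iG2 (l : 'I_m.+1) : itg (fun y => invmx (hmat m) l (inord j) * (heat_kernel h (x - y) * gk 0 (1 - w) (y - (l : nat)%:R))).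
    by apply: itgZ; exact: iG.
  transitivity (\int[mu]_y \sum_(l < m.+1) invmx (hmat m) l (inord j) * (heat_kernel h (x - y) * gk 0 (1 - w) (y - (l : nat)%:R))).
    by apply: eq_Rintegral => y _; rewrite mulr_sumr; apply: eq_bigr => l _; rewrite mulrCA.
  rewrite Int_sum//; apply: eq_bigr => l _; rewrite (IntZ _ (iG l)); congr (_ * _).
  exact: Ht_gk.
Qed.

Lemma Hc_caloric k : (0 < k)%N -> exists2 M : R, 0 <= M & forall w0 w1, 0 <= w0 -> w1 <= (8 * k%:R)^-1 -> caloric_part (Hc k) w0 w1 M.
Proof.
move=> k0; have [C C0 H] := @Hc_bounded R k 3 k0; exists C; first exact: ltW.
have kp : 0 < k%:R :> R by rewrite ltr0n.
move=> w0 w1 w00 w12.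
have ww w : w0 <= w <= w1 -> 0 <= w <= (8 * k%:R)^-1 by move=> /andP[h1 h2]; rewrite (le_trans w00 h1) (le_trans h2 w12).
split.
- by move=> i x w i3 /ww; exact: H.
- by move=> i x w /ww; exact: Hc_dx.
- by move=> i x w /ww; exact: Hc_dw.
- by move=> i w _; apply: measurable_Hc.
- move=> x w h wI h0 wh; have /andP[w01 w02] := ww _ wI.
  have wl (l : 'I_k) : w < (4 * l.+1%:R)^-1.
    have /andP[h1 _] := Hc_h l k0 w01 w02; rewrite -subr_gt0; apply: lt_le_trans h1.
    by rewrite invr_gt0 mulr_gt0.
  pose c (l : nat) : R := 'C(k, l.+1)%:R * (-1) ^+ l.+1 * Num.sqrt (pi / l.+1%:R).
  have iG (l : 'I_k) : itg (fun y => heat_kernel h (x - y) * gk 0 ((4 * l.+1%:R)^-1 - w) y).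
    have := @heat_gk_itg R 0 h ((4 * l.+1%:R)^-1 - w) x 0 h0.
    under eq_fun do rewrite subr0; apply; rewrite subr_gt0; exact: wl.
  have iG2 (l : 'I_k) : itg (fun y => c l * (heat_kernel h (x - y) * gk 0 ((4 * l.+1%:R)^-1 - w) y)).
    by apply: itgZ; exact: iG.
  transitivity (\int[mu]_y (heat_kernel h (x - y) + \sum_(l < k) c l * (heat_kernel h (x - y) * gk 0 ((4 * l.+1%:R)^-1 - w) y))).
    apply: eq_Rintegral => y _; rewrite /Hc mulrDr mulr1 mulr_sumr; congr (_ + _).
    by apply: eq_bigr => l _; rewrite mulrCA.
  rewrite IntD; [|exact: heat_itg|exact: itg_sum].
  rewrite heat_Int// Int_sum// /Hc; congr (_ + _); apply: eq_bigr => l _.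
  rewrite (IntZ _ (iG l)); congr (_ * _).
  have := @Ht_gk h w 0 (4 * l.+1%:R)^-1 x h0 (wl l); rewrite /Ht subr0 => <-.
  by apply: eq_Rintegral => y _; rewrite subr0.
Qed.

Lemma caloric_part_sub S w0 v0 T M : w0 <= v0 -> caloric_part S w0 T M -> caloric_part S v0 T M.
Proof.
move=> w00 [b dx dw m H].
have ww w : v0 <= w <= T -> w0 <= w <= T by move=> /andP[h1 ->]; rewrite (le_trans w00 h1).
split.
- by move=> i x w i3 /ww; exact: b.
- by move=> i x w /ww; exact: dx.
- by move=> i x w /ww; exact: dw.
- by move=> i w /ww; exact: m.
- by move=> x w h /ww wT h0 wh; apply: H => //; apply: le_trans wh.
Qed.

(** All subtracted functions and [Hc] merge into one caloric tower; (p - 1) (T - t) is kept apart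
    since it carries the constant source - (p - 1) and is not caloric. *)
Lemma rho_caloric p b0 k T f : (2 <= k)%N -> T <= 2^-1 -> T <= (8 * k%:R)^-1 ->
  exists S, exists2 M, 0 <= M & (forall w0, 0 <= w0 -> caloric_part S w0 T M) /\
    forall i t x, rho p b0 k T i f t x = (i == 0)%:R * ((p - 1) * (T - t)) + Wf S f T i t x.
Proof.
move=> k2 T2 Tk; have k0 : (0 < k)%N by rewrite (ltn_trans _ k2).
have [M1 M10 H1] := Hc_caloric k0; have [M2 M20 H2] := EE_caloric (2 * k).
have [M3 M30 H3] := @caloric_part_sum (EE (2 * k)) (fun j => - Duh j f T 0) 0 T M2 (2 * k).+1 (fun j jn => H2 j 0 T jn (lexx 0) T2).
exists (fun i x w => b0 * Hc k i x w + \sum_(j < (2 * k).+1) - Duh j f T 0 * EE (2 * k) j i x w).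
exists (`|b0| * M1 + M3); first by rewrite addr_ge0 ?mulr_ge0.
split=> [w0 w00|i t x].
  apply: (caloric_part_sub w00); apply: caloric_partD => //; apply: caloric_partZ; exact: H1.
rewrite /rho /base /LP /Wf -!addrA; congr (_ + (_ + _)); rewrite addrC; congr (_ + _).
by rewrite -sumrN; apply: eq_bigr => j _; rewrite mulNr.
Qed.

Lemma phi_caloric k T f : T <= 2^-1 ->
  exists S, exists2 M, 0 <= M & (forall w0, 0 <= w0 -> caloric_part S w0 T M) /\
    forall i t x, phi k T i f t x = Wf S f T i t x.
Proof.
move=> T2; have [M2 M20 H2] := EE_caloric (k - 1).
exists (fun i x w => \sum_(j < (k - 1).+1) - Duh j f T 0 * EE (k - 1) j i x w).
have H3 w0 : 0 <= w0 -> exists2 M', 0 <= M' & caloric_part (fun i x w => \sum_(j < (k - 1).+1) - Duh j f T 0 * EE (k - 1) j i x w) w0 T M'.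
  by move=> w00; apply: (@caloric_part_sum (EE (k - 1)) (fun j => - Duh j f T 0) w0 T M2) => j jn; exact: H2.
have [M3 M30 H] := H3 0 (lexx 0); exists M3 => //; split=> [w0 w00|i t x].
  exact: caloric_part_sub H.
rewrite /phi /LP /Wf addrC; congr (_ + _).
by rewrite -sumrN; apply: eq_bigr => j _; rewrite mulNr.
Qed.

End CaloricInstances.

(** * Second-order expansion under the heat semigroup *)

Section HeatStep.
Context {R : realType}.
Notation mu := (@lebesgue_measure R).
Implicit Types (h s t x y z e w M K A B T c m : R).

(** With b = (y - x)^2 / h, b^u <= 1 + b^2 for u <= 2, so a fourth absolute moment is enough. *)
Lemma heat_powmoment u : 0 <= u <= 2 -> exists2 C : R, 0 < C & forall h x, 0 < h ->
  itg (fun y => heat_kernel h (x - y) * ((y - x) ^+ 2) `^ u) /\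
  \int[mu]_y (heat_kernel h (x - y) * ((y - x) ^+ 2) `^ u) <= C * h `^ u.
Proof.
move=> /andP[u0 u2]; have [C C0 H] := @heat_absmoment R 4; exists (1 + C); first by rewrite addr_gt0.
move=> h x h0; have h20 : 0 < 2 * h by rewrite mulr_gt0.
pose k y := h `^ u * (heat_kernel h (x - y) + C * heat_kernel (2 * h) (x - y)).
have iC : itg (fun y => C * heat_kernel (2 * h) (x - y)) by apply: itgZ; exact: heat_itg.
have iD : itg (fun y => heat_kernel h (x - y) + C * heat_kernel (2 * h) (x - y)).
  by apply: itgD => //; exact: heat_itg.
have iK : itg k by exact: itgZ.
have mF : measurable_fun setT (fun y => heat_kernel h (x - y) * ((y - x) ^+ 2) `^ u).
  apply: measurable_funM; first by apply: measurable_heat => //; exact: measurable_funB.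
  apply: (@measurableT_comp _ _ _ _ _ _ (fun z : R => z `^ u)); first exact: measurable_powR.
  by apply: measurable_funX; exact: measurable_funB.
have le y : `|heat_kernel h (x - y) * ((y - x) ^+ 2) `^ u| <= k y.
  rewrite ger0_norm ?mulr_ge0 ?heat_ge0 ?powR_ge0// /k.
  pose b := (y - x) ^+ 2 / h; have b0 : 0 <= b by rewrite divr_ge0 ?sqr_ge0// ltW.
  have -> : (y - x) ^+ 2 = h * b by rewrite /b mulrCA divff ?mulr1// gt_eqF.
  rewrite powRM ?(ltW h0)// mulrCA ler_wpM2l ?powR_ge0//.
  have bu : b `^ u <= 1 + b ^+ 2.
    have [b1|b1] := leP b 1.
      apply: (@le_trans _ _ 1); last by rewrite lerDl sqr_ge0.
      by apply: le_trans (powR_mono b0 b1 u0) _; rewrite powR1.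
    rewrite ler_wpDl// -powR_mulrn//; apply: ler_powR => //; exact: ltW.
  apply: le_trans (ler_wpM2l (heat_ge0 _ _) bu) _; rewrite mulrDr mulr1 lerD2l.
  have := H h (x - y) h0; have -> : Num.sqrt h ^+ 4 = h ^+ 2.
    by rewrite -[4%N]/((2 * 2)%N) exprM sqr_sqrtr// ltW.
  rewrite distrC; have -> : `|y - x| ^+ 4 = (h * b) ^+ 2.
    by rewrite /b mulrCA divff ?gt_eqF// mulr1 -[LHS]/(`|y - x| ^+ (2 * 2)) exprM real_normK ?num_real.
  rewrite exprMn => hh; rewrite -(ler_pM2l (exprn_gt0 2 h0)); apply: le_trans (le_trans _ hh) _; apply: eqle; ring.
split; first exact: itg_le mF iK le.
have := Int_le (itg_le mF iK le) iK (fun y => le_trans (ler_norm _) (le y)) => /le_trans; apply.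
rewrite (IntZ _ iD) IntD//; last exact: heat_itg.
rewrite heat_Int// (IntZ _ (heat_itg x h20)) heat_Int// mulr1.
by apply: eqle; ring.
Qed.

Lemma mul_diff_le (u v u' v' K d : R) : `|u| <= K -> `|v| <= K -> `|u'| <= K -> `|v'| <= K -> `|u - u'| <= d -> `|v - v'| <= d ->
  `|u * v - u' * v'| <= 2 * K * d.
Proof.
move=> uK vK uK' vK' ud vd.
have -> : u * v - u' * v' = (u - u') * v + u' * (v - v') by ring.
apply: le_trans (ler_normD _ _) _; rewrite !normrM.
have h1 : `|u - u'| * `|v| <= d * K by apply: ler_pM.
have h2 : `|u'| * `|v - v'| <= K * d by apply: ler_pM.
apply: le_trans (lerD h1 h2) _; apply: eqle; ring.
Qed.

Context (al be : R) (al0 : 0 < al).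
Notation Qf := (Qf al be). Notation Q1 := (Q1 al be). Notation Q2 := (Q2 al be).

(** [Q2] is a quadratic form in the direction (dr, da) whose coefficients are bounded on r >= m. *)
Lemma Q2_diff m n A B : 0 < m -> exists2 L : R, 0 < L & forall r0 a0 dr da dr' da' K d : R, m <= r0 ->
  `|dr| <= K -> `|da| <= K -> `|dr'| <= K -> `|da'| <= K -> `|dr - dr'| <= d -> `|da - da'| <= d ->
  `|Q2 n A B dr da r0 a0 - Q2 n A B dr' da' r0 a0| <= L * (K * d).
Proof.
move=> m0.
have b0 n' A' B' : exists2 K : R, 0 < K & forall r a, m <= r -> `|Qf n' A' B' r a| <= K.
  by have [K K0 H] := Q123_le be al0 n' A' B' m0; exists K => // r a mr; have [] := H r a 0 0 mr.
pose A' := RA al be n A B; pose B' := RB al be n A B.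
have [K1 K10 H1] := b0 n.+2 (RA al be n.+1 A' B') (RB al be n.+1 A' B').
have [K2 K20 H2] := b0 n.+1 B' (- A').
have [K3 K30 H3] := b0 n.+1 (RA al be n B (- A)) (RB al be n B (- A)).
have [K4 K40 H4] := b0 n (- A) (- B).
exists (2 * (K1 + K2 + K3 + K4)); first by rewrite mulr_gt0 ?addr_gt0.
move=> r0 a0 dr da dr' da' K d mr h1 h2 h3 h4 h5 h6.
have p11 := mul_diff_le h1 h1 h3 h3 h5 h5; have p12 := mul_diff_le h1 h2 h3 h4 h5 h6.
have p21 := mul_diff_le h2 h1 h4 h3 h6 h5; have p22 := mul_diff_le h2 h2 h4 h4 h6 h6.
move: (H1 r0 a0 mr) (H2 r0 a0 mr) (H3 r0 a0 mr) (H4 r0 a0 mr).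
rewrite /Q2 /Q1 -/A' -/B'.
set X1 := Qf _ _ _ _ _; set X2 := Qf _ _ _ _ _; set X3 := Qf _ _ _ _ _; set X4 := Qf _ _ _ _ _.
move=> b1 b2 b3 b4.
have -> : dr * (dr * X1 + da * X2) + da * (dr * X3 + da * X4) - (dr' * (dr' * X1 + da' * X2) + da' * (dr' * X3 + da' * X4)) =
  (dr * dr - dr' * dr') * X1 + (dr * da - dr' * da') * X2 + (da * dr - da' * dr') * X3 + (da * da - da' * da') * X4 by ring.
have m1 : `|(dr * dr - dr' * dr') * X1| <= 2 * K * d * K1 by rewrite normrM; apply: ler_pM.
have m2 : `|(dr * da - dr' * da') * X2| <= 2 * K * d * K2 by rewrite normrM; apply: ler_pM.
have m3 : `|(da * dr - da' * dr') * X3| <= 2 * K * d * K3 by rewrite normrM; apply: ler_pM.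
have m4 : `|(da * da - da' * da') * X4| <= 2 * K * d * K4 by rewrite normrM; apply: ler_pM.
apply: le_trans (le_trans (ler_normD _ _) (lerD (le_trans (ler_normD _ _) (lerD (le_trans (ler_normD _ _) (lerD m1 m2)) m3)) m4)) _.
by apply: eqle; ring.
Qed.

Lemma Q2_scale n A B (c dr da r0 a0 : R) : Q2 n A B (c * dr) (c * da) r0 a0 = c ^+ 2 * Q2 n A B dr da r0 a0.
Proof. by rewrite /Q2 /Q1; ring. Qed.

Lemma abs_pow3 e : `|e| ^+ 3 = (e ^+ 2) `^ (3 / 2).
Proof.
rewrite -(@powR_mulrn _ `|e| 3)// abs_sqr_powR -powRrM; congr (_ `^ _); lra.
Qed.

Lemma abs_pow_mul e : `|e| * (e ^+ 2) `^ (3 / 4) = (e ^+ 2) `^ (5 / 4).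
Proof.
have [->|e0] := eqVneq e 0.
  by rewrite normr0 mul0r expr0n/= powR0// gt_eqF//; lra.
rewrite abs_sqr_powR -powRDp; last by rewrite exprn_even_gt0.
by congr (_ `^ _); lra.
Qed.

(** The linear term integrates to 0 because the first moment of the kernel vanishes; only the
    3/4-power remainder is left. *)
Lemma Ht_center h x (g : R -> R) M (g1 : R) K C : 0 < h -> measurable_fun setT g -> (forall y, `|g y| <= M) ->
  (forall h x, 0 < h -> itg (fun y => heat_kernel h (x - y) * ((y - x) ^+ 2) `^ (3 / 4)) /\
  \int[mu]_y (heat_kernel h (x - y) * ((y - x) ^+ 2) `^ (3 / 4)) <= C * h `^ (3 / 4)) -> 0 <= K ->
  (forall e, `|g (x + e) - g x - e * g1| <= K * (e ^+ 2) `^ (3 / 4)) -> `|Ht h g x - g x| <= K * (C * h `^ (3 / 4)).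
Proof.
move=> h0 mg gM HC K0 gK; have [i1 I1] := HC h x h0; have [i2 I2] := heat_moment1 x h0.
have iG := heat_itg_bounded x h0 mg gM.
have e1 : Ht h g x - g x = \int[mu]_y (heat_kernel h (x - y) * g y + - g x * heat_kernel h (x - y) + - g1 * ((y - x) * heat_kernel h (x - y))).
  have iA : itg (fun y => - g x * heat_kernel h (x - y)) by apply: itgZ; exact: heat_itg.
  have iB : itg (fun y => - g1 * ((y - x) * heat_kernel h (x - y))) by exact: itgZ.
  rewrite IntD//; last exact: itgD.
  by rewrite IntD// (IntZ _ (heat_itg x h0)) (IntZ _ i2) I2 heat_Int// mulr0 addr0 mulr1.
rewrite e1; apply: (@le_trans _ _ (\int[mu]_y (K * (heat_kernel h (x - y) * ((y - x) ^+ 2) `^ (3 / 4))))); last first.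
  by rewrite (IntZ _ i1) ler_wpM2l.
apply: Int_abs_le; [|exact: itgZ|].
  apply: measurable_funD; [apply: measurable_funD|]; [exact: itg_measurable iG| |].
    by apply: measurable_funM => //; exact: itg_measurable (heat_itg x h0).
  by apply: measurable_funM => //; exact: itg_measurable i2.
move=> y; have -> : heat_kernel h (x - y) * g y + - g x * heat_kernel h (x - y) + - g1 * ((y - x) * heat_kernel h (x - y)) =
   heat_kernel h (x - y) * (g y - g x - (y - x) * g1) by ring.
rewrite normrM (ger0_norm (heat_ge0 _ _)) mulrCA ler_wpM2l ?heat_ge0//.
by have := gK (y - x); rewrite subrKC.
Qed.

Lemma pow_small h u : 0 < h <= 1 -> 5 / 4 <= u -> h `^ u <= h `^ (5 / 4).
Proof. by move=> /andP[h0 h1] uu; apply: le_powR1; [rewrite (ltW h0)|lra|]. Qed.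

Lemma pow_small32 h : 0 < h <= 1 -> h `^ (3 / 2) <= h `^ (5 / 4).
Proof. by move=> h01; apply: pow_small => //; lra. Qed.

Lemma pow_small34 h : 0 < h <= 1 ->
  [/\ h `^ (5 / 4) <= h `^ (3 / 4), h <= h `^ (3 / 4) & (h `^ (3 / 4)) ^+ 2 <= h `^ (5 / 4)].
Proof.
move=> h01; have /andP[h0 h1] := h01; split.
- by apply: le_powR1; [rewrite (ltW h0)|lra|lra].
- by rewrite -[leLHS]powRr1 ?(ltW h0)//; apply: le_powR1; [rewrite (ltW h0)|lra|lra].
- by rewrite -powR_mulrn ?powR_ge0// -powRrM; apply: pow_small => //; lra.
Qed.

(** An Itô-type formula: the heat flow of Q(r, a) exceeds Q of the flows by h times [Q2] along the
    gradient (second moment 2 h, Taylor factor 1/2). Errors are the mixed term |e|^(5/2), the cubic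
    term |e|^3 and squared increments h^(3/2), all integrating to O(h^(5/4)). *)
Lemma heat_step m K n A B : 0 < m -> 0 <= K -> exists2 C : R, 0 < C &
  forall (r a : R -> R) (x h r1 a1 g1 g2 r' a' : R), measurable_fun setT r -> measurable_fun setT a -> 0 < h <= 1 ->
  (forall y, m <= r y) -> m <= r' -> (forall y, `|r y| <= K) -> (forall y, `|a y| <= K) ->
  (forall e, `|r (x + e) - r x| <= K * `|e|) -> (forall e, `|a (x + e) - a x| <= K * `|e|) ->
  (forall e, `|r (x + e) - r x - e * r1| <= K * (e ^+ 2) `^ (3 / 4)) ->
  (forall e, `|a (x + e) - a x - e * a1| <= K * (e ^+ 2) `^ (3 / 4)) ->
  `|r1| <= K -> `|a1| <= K -> `|g1| <= K -> `|g2| <= K ->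
  `|r' - Ht h r x - h * g1| <= K * h `^ (5 / 4) -> `|a' - Ht h a x - h * g2| <= K * h `^ (5 / 4) ->
  `|Qf n A B r' a' - Ht h (fun y => Qf n A B (r y) (a y)) x -
     h * (Q1 n A B g1 g2 (r x) (a x) - Q2 n A B r1 a1 (r x) (a x))| <= C * h `^ (5 / 4).
Proof.
move=> m0 K0.
have [L L0 HL] := Qf_taylor be al0 n A B m0.
have [L2 L20 HL2] := Q2_diff n A B m0.
have [X X0 HX] := Q123_le be al0 n.+1 (RA al be n A B) (RB al be n A B) m0.
have [Y Y0 HY] := Q123_le be al0 n B (- A) m0.
have u34 : 0 <= (3 / 4 : R) <= 2 by lra.
have u54 : 0 <= (5 / 4 : R) <= 2 by lra.
have u32 : 0 <= (3 / 2 : R) <= 2 by lra.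
have [M3 M30 H3] := heat_powmoment u34.
have [M5 M50 H5] := heat_powmoment u54.
have [M6 M60 H6] := heat_powmoment u32.
pose c1 := L2 * (K * K) / 2; pose c2 := L * (2 * K) ^+ 3.
pose d := K * M3 + 2 * K.
have c10 : 0 <= c1 by rewrite /c1; nonneg.
have c20 : 0 <= c2 by rewrite /c2; nonneg.
have d0 : 0 <= d by rewrite /d; nonneg.
exists (L * (2 * d) ^+ 2 + X * K + Y * K + (c1 * M5 + c2 * M6) + 1).
  by apply: ltr_wpDl => //; nonneg.
move=> r a x h r1 a1 g1 g2 r' a' mr ma /andP[h0 h1] rm rm' rK aK rl al' rt at' r1K a1K g1K g2K hr ha.
set r0 := r x; set a0 := a x.
set Xv := Qf n.+1 (RA al be n A B) (RB al be n A B) r0 a0; set Yv := Qf n B (- A) r0 a0.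
have bX : `|Xv| <= X by have [] := HX r0 a0 0 0 (rm x).
have bY : `|Yv| <= Y by have [] := HY r0 a0 0 0 (rm x).
set q := Q2 n A B r1 a1 r0 a0.
pose U y := Qf n A B (r y) (a y).
have mU : measurable_fun setT U.
  have mln : measurable_fun setT (fun y => ln (r y)) by apply: (measurableT_comp (@measurable_ln R)).
  apply: measurable_funM.
    by apply: (measurableT_comp (@measurable_expR R)); apply: measurable_funM.
  have mth : measurable_fun setT (fun y => a y - be * ln (r y)) by apply: measurable_funB => //; exact: measurable_funM.
  apply: measurable_funD; apply: measurable_funM => //.
    by apply: measurableT_comp mth; apply: continuous_measurable_fun; exact: continuous_cos.
  by apply: measurableT_comp mth; apply: continuous_measurable_fun; exact: continuous_sin.
have bU y : `|U y| <= L by have [] := HL (r y) (r y) (a y) (a y) (rm y) (rm y).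
have iG := heat_itg x h0.
have iU := heat_itg_bounded x h0 mU bU; have ir := heat_itg_bounded x h0 mr rK; have ia := heat_itg_bounded x h0 ma aK.
have [i2 I2] := heat_moment2 x h0.
(* The second-order expansion error, with the quadratic term evaluated on the tangent direction (y -
   x) (r1, a1) instead of the true increment; this makes its heat average an explicit second
   moment. *)
pose E y := U y - Qf n A B r0 a0 - Q1 n A B (r y - r0) (a y - a0) r0 a0 - (y - x) ^+ 2 / 2 * q.
have EE y : heat_kernel h (x - y) * E y = heat_kernel h (x - y) * U y + (- Xv * (heat_kernel h (x - y) * r y) + (- Yv * (heat_kernel h (x - y) * a y) +
    ((Xv * r0 + Yv * a0 - Qf n A B r0 a0) * heat_kernel h (x - y) + - (q / 2) * ((y - x) ^+ 2 * heat_kernel h (x - y))))).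
  by rewrite /E /Q1 -/Xv -/Yv; field.
have iX : itg (fun y => - Xv * (heat_kernel h (x - y) * r y)) by exact: itgZ.
have iY : itg (fun y => - Yv * (heat_kernel h (x - y) * a y)) by exact: itgZ.
have ic : itg (fun y => (Xv * r0 + Yv * a0 - Qf n A B r0 a0) * heat_kernel h (x - y)) by exact: itgZ.
have iq : itg (fun y => - (q / 2) * ((y - x) ^+ 2 * heat_kernel h (x - y))) by exact: itgZ.
have icq := itgD ic iq; have iYc := itgD iY icq; have iXc := itgD iX iYc.
have HE : Ht h E x = Ht h U x - Qf n A B r0 a0 - (Xv * (Ht h r x - r0) + Yv * (Ht h a x - a0)) - h * q.
  rewrite /Ht; under eq_Rintegral do rewrite EE.
  rewrite (IntD iU iXc) (IntD iX iYc) (IntD iY icq) (IntD ic iq).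
  rewrite (IntZ _ ir) (IntZ _ ia) (IntZ _ iG) (IntZ _ i2) I2 heat_Int//.
  by field.
have Ele y : `|E y| <= c1 * ((y - x) ^+ 2) `^ (5 / 4) + c2 * ((y - x) ^+ 2) `^ (3 / 2).
  set e := y - x; have yE : y = x + e by rewrite /e subrKC.
  have l1 := rl e; have l2 := al' e; have t1 := rt e; have t2 := at' e; rewrite -yE in l1 l2 t1 t2.
  have [_ _ _ h4] := HL r0 (r y) a0 (a y) (rm x) (rm y).
  have s1 : `|e * r1| <= K * `|e| by rewrite normrM mulrC; apply: wpM_le.
  have s2 : `|e * a1| <= K * `|e| by rewrite normrM mulrC; apply: wpM_le.
  have h5 := HL2 r0 a0 (r y - r0) (a y - a0) (e * r1) (e * a1) (K * `|e|) _ (rm x) l1 l2 s1 s2 t1 t2.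
  rewrite Q2_scale -/q in h5.
  have -> : E y = (U y - Qf n A B r0 a0 - Q1 n A B (r y - r0) (a y - a0) r0 a0 - Q2 n A B (r y - r0) (a y - a0) r0 a0 / 2) +
     (Q2 n A B (r y - r0) (a y - a0) r0 a0 - e ^+ 2 * q) / 2 by rewrite /E -/e; move: (Q1 _ _ _ _ _ _ _) (Q2 _ _ _ _ _ _ _) (U y) => u1 u2 u3; field.
  apply: le_trans (ler_normD _ _) _; rewrite addrC; apply: lerD.
    rewrite normrM (ger0_norm (_ : 0 <= 2^-1)) ?invr_ge0// ler_pdivrMr//; apply: le_trans h5 _.
    by rewrite -abs_pow_mul; apply: eqle; rewrite /c1; field.
  apply: le_trans h4 _; rewrite -abs_pow3 /c2 -mulrA ler_wpM2l ?(ltW L0)// -exprMn.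
  rewrite lerXn2r ?nnegrE ?addr_ge0 ?mulr_ge0//.
  by apply: le_trans (lerD l1 l2) _; apply: eqle; ring.
have [i5 I5] := H5 h x h0; have [i6 I6] := H6 h x h0.
have h01 : 0 < h <= 1 by rewrite h0.
have HtE : `|Ht h E x| <= (c1 * M5 + c2 * M6) * h `^ (5 / 4).
  have i56 : itg (fun y => c1 * (heat_kernel h (x - y) * ((y - x) ^+ 2) `^ (5 / 4)) + c2 * (heat_kernel h (x - y) * ((y - x) ^+ 2) `^ (3 / 2))).
    by apply: itgD; exact: itgZ.
  apply: (@le_trans _ _ (\int[mu]_y (c1 * (heat_kernel h (x - y) * ((y - x) ^+ 2) `^ (5 / 4)) + c2 * (heat_kernel h (x - y) * ((y - x) ^+ 2) `^ (3 / 2))))).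
    apply: Int_abs_le => //.
      have -> : (fun y => heat_kernel h (x - y) * E y) = (fun y => heat_kernel h (x - y) * U y + (- Xv * (heat_kernel h (x - y) * r y) + (- Yv * (heat_kernel h (x - y) * a y) +
    ((Xv * r0 + Yv * a0 - Qf n A B r0 a0) * heat_kernel h (x - y) + - (q / 2) * ((y - x) ^+ 2 * heat_kernel h (x - y)))))).
        by apply/funext => y; exact: EE.
      by apply: itg_measurable; exact: itgD.
    move=> y; rewrite normrM (ger0_norm (heat_ge0 _ _)).
    have -> : c1 * (heat_kernel h (x - y) * ((y - x) ^+ 2) `^ (5 / 4)) + c2 * (heat_kernel h (x - y) * ((y - x) ^+ 2) `^ (3 / 2)) =
      heat_kernel h (x - y) * (c1 * ((y - x) ^+ 2) `^ (5 / 4) + c2 * ((y - x) ^+ 2) `^ (3 / 2)) by ring.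
    by rewrite ler_wpM2l ?heat_ge0.
  rewrite IntD; [|exact: itgZ|exact: itgZ]; rewrite (IntZ _ i5) (IntZ _ i6) [leRHS]mulrDl.
  apply: lerD; rewrite -[leRHS]mulrA; apply: ler_wpM2l => //.
  by apply: le_trans I6 _; rewrite ler_wpM2l ?(ltW M60)//; exact: pow_small32.
have cr := Ht_center h0 mr rK H3 K0 rt; have ca := Ht_center h0 ma aK H3 K0 at'.
have [h34 h134 hsq] := pow_small34 h01.
have dl (v v0 w g : R) : `|v - w - h * g| <= K * h `^ (5 / 4) -> `|w - v0| <= K * (M3 * h `^ (3 / 4)) -> `|g| <= K -> `|v - v0| <= d * h `^ (3 / 4).
  move=> b1 b2 b3; have -> : v - v0 = (w - v0) + (h * g + (v - w - h * g)) by ring.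
  have b4 : `|h * g| <= K * h `^ (3 / 4) by rewrite normrM (ger0_norm (ltW h0)) mulrC; apply: ler_pM => //; exact: ltW.
  have b5 : K * h `^ (5 / 4) <= K * h `^ (3 / 4) by rewrite ler_wpM2l.
  apply: le_trans (ler_normD _ _) _; apply: le_trans (lerD b2 (le_trans (ler_normD _ _) (lerD b4 (le_trans b1 b5)))) _.
  by rewrite /d; apply: eqle; ring.
have dr := dl r' r0 (Ht h r x) g1 hr cr g1K; have da := dl a' a0 (Ht h a x) g2 ha ca g2K.
have [_ _ t2 _] := HL r0 r' a0 a' (rm x) rm'.
have t2' : `|Qf n A B r' a' - Qf n A B r0 a0 - Q1 n A B (r' - r0) (a' - a0) r0 a0| <= L * (2 * d) ^+ 2 * h `^ (5 / 4).
  apply: le_trans t2 _; rewrite -mulrA ler_wpM2l ?(ltW L0)//.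
  apply: (@le_trans _ _ ((2 * d * h `^ (3 / 4)) ^+ 2)).
    rewrite lerXn2r ?nnegrE ?addr_ge0 ?mulr_ge0 ?powR_ge0//.
    by apply: le_trans (lerD dr da) _; apply: eqle; ring.
  by rewrite exprMn ler_wpM2l ?sqr_ge0.
have final : Qf n A B r' a' - Ht h U x - h * (Q1 n A B g1 g2 r0 a0 - q) =
  (Qf n A B r' a' - Qf n A B r0 a0 - Q1 n A B (r' - r0) (a' - a0) r0 a0) + (Xv * (r' - Ht h r x - h * g1) + (Yv * (a' - Ht h a x - h * g2) - Ht h E x)).
  rewrite HE /Q1 -/Xv -/Yv; move: (Ht h r x) (Ht h a x) (Ht h U x) (Qf n A B r' a') (Qf n A B r0 a0) => u1 u2 u3 u4 u5; ring.
rewrite final.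
have bx : `|Xv * (r' - Ht h r x - h * g1)| <= X * K * h `^ (5 / 4) by rewrite normrM -mulrA; apply: ler_pM.
have by' : `|Yv * (a' - Ht h a x - h * g2)| <= Y * K * h `^ (5 / 4) by rewrite normrM -mulrA; apply: ler_pM.
apply: le_trans (ler_normD _ _) _; apply: le_trans (lerD t2' (le_trans (ler_normD _ _) (lerD bx (le_trans (ler_normB _ _) (lerD by' HtE))))) _.
have p54 := powR_ge0 h (5 / 4).
have sum5 (a1' a2' a3' a4' P : R) : 0 <= P -> a1' * P + (a2' * P + (a3' * P + a4' * P)) <= (a1' + a2' + a3' + a4' + 1) * P.
  by move=> P0; rewrite !mulrDl -!addrA !lerD2l mul1r lerDl.
exact: sum5.
Qed.

End HeatStep.

(** * Regularity and heat step for functions with linear, caloric and Duhamel parts *)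

Section SolutionRegularity.
Context {R : realType}.
Notation mu := (@lebesgue_measure R).
Implicit Types (h s t x y z e w M K A B T c m : R) (V : nat -> R -> R -> R) (f : R * R -> R).

Lemma Ht_cst h c x : 0 < h -> Ht h (fun=> c) x = c.
Proof.
move=> h0; have -> : Ht h (fun=> c) x = \int[mu]_y (c * heat_kernel h (x - y)).
  by apply: eq_Rintegral => y _; rewrite mulrC.
by rewrite IntZ ?heat_Int ?mulr1//; exact: heat_itg.
Qed.

Lemma h_quarter h : 0 <= h <= 1 -> h <= h `^ 4^-1.
Proof.
move=> h01; have /andP[h0 h1] := h01; rewrite -[leLHS]powRr1//.
by apply: le_powR1 => //; lra.
Qed.

Lemma h_54 h : 0 < h -> h `^ 4^-1 * h = h `^ (5 / 4).
Proof.
move=> h0; rewrite -{2}(powRr1 (ltW h0)) -powRDp//; congr (_ `^ _); lra.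
Qed.

(** Parabolic Hölder regularity of exponent 1/2, with [V 1] as space derivative of [V 0]. Joint
    increments start at positive times, so closeness to the initial value is recorded separately. *)
Definition reg V t1 K := [/\ 
   forall i t x, (i <= 1)%N -> 0 <= t <= t1 -> `|V i t x| <= K,
   forall t x e, 0 <= t <= t1 -> `|V 0%N t (x + e) - V 0%N t x| <= K * `|e| /\
     `|V 0%N t (x + e) - V 0%N t x - e * V 1%N t x| <= K * (e ^+ 2) `^ (3 / 4),
   forall i t h x e, (i <= 1)%N -> 0 < t -> 0 <= h -> t + h <= t1 ->
     `|V i (t + h) (x + e) - V i t x| <= K * ((e ^+ 2) `^ 4^-1 + h `^ 4^-1) &
   forall t x, 0 <= t <= t1 -> `|V 0%N t x - V 0%N 0 x| <= K * t `^ 4^-1].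

Lemma regW V t1 K K' : reg V t1 K -> K <= K' -> reg V t1 K'.
Proof.
move=> [r1 r2 r3 r4] KK; split.
- by move=> i t x i1 tt; apply: le_trans (r1 i t x i1 tt) KK.
- move=> t x e tt; have [h1 h2] := r2 t x e tt; split.
    by apply: le_trans h1 _; apply: wpM_le.
  by apply: le_trans h2 _; apply: wpM_le => //; exact: powR_ge0.
- move=> i t h x e i1 t0 h0 th; apply: le_trans (r3 i t h x e i1 t0 h0 th) _.
  by apply: wpM_le => //; rewrite addr_ge0 ?powR_ge0.
- by move=> t x tt; apply: le_trans (r4 t x tt) _; apply: wpM_le => //; exact: powR_ge0.
Qed.

Lemma V_reg V S f T t1 MS M c : 0 < t1 -> t1 < T -> T <= 1 -> 0 <= MS -> caloric_part S (T - t1) T MS ->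
  measurable_fun setT f -> 0 <= M -> (forall s y, 0 < s < t1 -> `|f (s, y)| <= M) ->
  (forall i t x, V i t x = (i == 0)%:R * (c * (T - t)) + Wf S f T i t x) ->
  exists2 K : R, 0 < K & reg V t1 K.
Proof.
move=> t10 t1T T1 MS0 HS mf M0 fM VE.
have [K K0 [r1 r2 r3 r4]] := W_reg t10 t1T T1 MS0 HS mf M0 fM.
exists (K + `|c|); first by rewrite ltr_wpDr.
have c0 := normr_ge0 c.
split.
- move=> i t x i1 tt; rewrite VE addrC; apply: le_trans (ler_normD _ _) _; apply: lerD; first exact: r1.
  case: (i == 0)%N; last by rewrite mul0r normr0.
  rewrite mul1r normrM ler_piMr//; have /andP[t0 tt1] := tt.
  by rewrite ger0_norm ?subr_ge0//; lra.
- move=> t x e tt; have [h1 h2] := r2 t x e tt; rewrite !VE /= !mul1r mul0r add0r.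
  have a1 (u v w : R) : u + v - (u + w) = v - w by ring.
  rewrite a1; split.
    by apply: le_trans h1 _; apply: wpM_le => //; rewrite lerDl.
  by apply: le_trans h2 _; apply: wpM_le; [rewrite lerDl|exact: powR_ge0].
- move=> i t h x e i1 t0 h0 th; rewrite !VE addr4 [leRHS]mulrDl; apply: le_trans (ler_normD _ _) _.
  apply: lerD; first exact: r3.
  have h4 := powR_ge0 h 4^-1; have e4 := powR_ge0 (e ^+ 2) 4^-1.
  case: (i == 0)%N; last by rewrite !mul0r subr0 normr0 mulr_ge0// addr_ge0.
  have -> : 1 * (c * (T - (t + h))) - 1 * (c * (T - t)) = - (c * h) by ring.
  rewrite normrN normrM ler_wpM2l// (ger0_norm h0) ler_wpDl//.
  by apply: h_quarter; rewrite h0/=; lra.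
- move=> t x tt; rewrite !VE addr4 [leRHS]mulrDl; apply: le_trans (ler_normD _ _) _.
  apply: lerD; first exact: r4.
  rewrite eqxx !mul1r.
  have -> : c * (T - t) - c * (T - 0) = - (c * t) by ring.
  have /andP[t0 tt1] := tt.
  by rewrite normrN normrM ler_wpM2l// ger0_norm//; apply: h_quarter; rewrite t0/=; lra.
Qed.

Lemma V_heat V S f T t1 MS M c t h x K : 0 < t -> 0 < h -> t + h <= t1 -> t1 < T -> T <= 1 -> 0 <= MS -> caloric_part S (T - t1) T MS ->
  measurable_fun setT f -> 0 <= M -> (forall s y, 0 < s < t1 -> `|f (s, y)| <= M) ->
  (forall i t x, V i t x = (i == 0)%:R * (c * (T - t)) + Wf S f T i t x) -> 0 <= K ->
  (forall s y, t <= s < t + h -> `|f (s, y) - f (t, x)| <= K * ((y - x) ^+ 2) `^ 4^-1 + K * h `^ 4^-1) ->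
  `|V 0%N (t + h) x - Ht h (V 0%N t) x - h * (- c + f (t, x))| <= 4 * K * h `^ (5 / 4).
Proof.
move=> t0 h0 th t1T T1 MS0 HS mf M0 fM VE K0 fK.
have WH := W_heat t0 h0 th t1T MS0 HS mf M0 fM K0 fK.
rewrite -mulrA (h_54 h0) in WH.
have t10 : 0 < t1 by apply: lt_le_trans th; exact: addr_gt0.
have [L L0 [r1 _ _ _]] := W_reg t10 t1T T1 MS0 HS mf M0 fM.
have tt : 0 <= t <= t1 by rewrite ltW//= (le_trans _ th)// lerDl ltW.
have mW : measurable_fun setT (Wf S f T 0 t).
  have [_ _ _ mS _] := HS; apply: measurable_funD; last exact: measurable_Duh_slice.
  by apply: mS; apply/andP; split; lra.
have -> : V 0%N t = (fun y => c * (T - t) + Wf S f T 0 t y) by apply/funext => y; rewrite VE mul1r.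
have b1 (y : R) : `|c * (T - t)| <= `|c * (T - t)| + L by rewrite lerDl ltW.
have b2 y : `|Wf S f T 0 t y| <= `|c * (T - t)| + L by apply: le_trans (r1 0%N t y isT tt) _; rewrite lerDr.
rewrite (@HtD R h (fun=> c * (T - t)) (Wf S f T 0 t) x _ h0 _ mW b1 b2) ?Ht_cst//.
rewrite VE mul1r; move: WH.
move: (Wf S f T 0 (t + h) x) (Ht h (Wf S f T 0 t) x) (f (t, x)) => u v w.
have -> : c * (T - (t + h)) + u - (c * (T - t) + v) - h * (- c + w) = u - v - h * w by ring.
by [].
Qed.

End SolutionRegularity.

(** * Regularity of the fixed point on compact time intervals before T *)

Section MildIdentity.
Context {R : realType}.
Notation mu := (@lebesgue_measure R).
Implicit Types (h s t x y z e w M K A B c m : R).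
Context (p b0 de : R) (k : nat) (p1 : 1 < p) (b00 : 0 < b0) (k2 : (2 <= k)%N).
Context (T Af c0 C0 : R) (f1 f2 : R * R -> R).

Definition is_solution := [/\ 0 < T, T <= 2^-1 & T <= (8 * k%:R)^-1] /\ [/\ 0 <= Af, 0 < c0 & 0 < C0] /\
  [/\ measurable_fun setT f1, measurable_fun setT f2,
    wbound (2 * k) (nu k) T Af f1, wbound (k - 1) (ze k) T Af f2 &
    (forall t x, 0 <= t < T -> [/\ c0 * DD k x (T - t) <= rho p b0 k T 0 f1 t x <= C0 * DD k x (T - t),
      `|rho p b0 k T 1 f1 t x| <= C0 * (DD k x (T - t) * GG k x (T - t)) &
      `|phi k T 1 f2 t x| <= C0 * GG k x (T - t)]) /\
    (forall z : R * R, f1 z = src1 p b0 de k T f1 f2 z /\ f2 z = src2 p b0 de k T f1 f2 z)].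

Context (sol : is_solution).

Let r i t x := rho p b0 k T i f1 t x.
Let a i t x := phi k T i f2 t x.

Lemma sol_bounded t1 : 0 < t1 < T -> exists2 M : R, 0 <= M & forall s y, 0 < s <= t1 -> `|f1 (s, y)| <= M /\ `|f2 (s, y)| <= M.
Proof.
move=> /andP[t10 t1T]; have [[T0 T2 Tk] [[A0 c00 C00] [mf1 mf2 w1 w2 _]]] := sol.
have w0 : 0 < T - t1 by rewrite subr_gt0.
have [[/andP[n0 n1] _ _ _] [[/andP[z0 z1] _ _ _] _]] := @exponents R k k2.
exists (Af * (T - t1) `^ (- nu k) + Af * (T - t1) `^ (- ze k)); first by rewrite addr_ge0// mulr_ge0 ?powR_ge0.
move=> s y /andP[s0 st]; have sT : 0 < s < T by rewrite s0 (le_lt_trans st).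
have h1 := wbound_bounded A0 w1 sT y; have h2 := wbound_bounded A0 w2 sT y.
have le1 : T - t1 <= T - s by lra.
split.
  apply: le_trans h1 _; rewrite ler_wpDr ?mulr_ge0 ?powR_ge0// ler_wpM2l//.
  by apply: powR_anti => //; exact: ltW.
apply: le_trans h2 _; rewrite ler_wpDl ?mulr_ge0 ?powR_ge0// ler_wpM2l//.
by apply: powR_anti => //; exact: ltW.
Qed.

Lemma sol_lower t1 t x : 0 <= t <= t1 -> t1 < T -> c0 * (T - t1) <= r 0 t x.
Proof.
move=> /andP[t0 tt] t1T; have [[T0 T2 Tk] [[A0 c00 C00] [_ _ _ _ [bnd _]]]] := sol.
have tT : 0 <= t < T by rewrite t0 (le_lt_trans tt).
have [/andP[h _] _ _] := bnd t x tT; apply: le_trans h; rewrite ler_wpM2l ?(ltW c00)//.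
rewrite /DD; apply: (@le_trans _ _ (T - t)); first by lra.
by rewrite lerDl exprn_ge0// qd_ge0.
Qed.

(** A bootstrap: bounded sources give Hölder [rho], [phi] and first derivatives; the fixed point
    equations make the sources Hölder in turn, and this upgrades the step error to h^(5/4). *)
Lemma sol_reg t1 : 0 < t1 < T -> exists2 K : R, 0 < K & 
  [/\ reg r t1 K, reg a t1 K,
   forall t h x e, 0 < t -> 0 <= h -> t + h <= t1 ->
     `|f1 (t + h, x + e) - f1 (t, x)| <= K * ((e ^+ 2) `^ 4^-1 + h `^ 4^-1) /\
     `|f2 (t + h, x + e) - f2 (t, x)| <= K * ((e ^+ 2) `^ 4^-1 + h `^ 4^-1),
   forall t x, 0 < t <= t1 -> `|f1 (t, x)| <= K /\ `|f2 (t, x)| <= K &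
   forall t h x, 0 < t -> 0 < h -> t + h <= t1 ->
     `|r 0 (t + h) x - Ht h (r 0 t) x - h * (- (p - 1) + f1 (t, x))| <= K * h `^ (5 / 4) /\
     `|a 0 (t + h) x - Ht h (a 0 t) x - h * f2 (t, x)| <= K * h `^ (5 / 4)].
Proof.
move=> t1T'; have /andP[t10 t1T] := t1T'.
have [[T0 T2 Tk] [[A0 c00 C00] [mf1 mf2 w1 w2 [bnd eqs]]]] := sol.
have T1 : T <= 1 by lra.
have [M M0 fM] := sol_bounded t1T'.
have fM1 s y : 0 < s < t1 -> `|f1 (s, y)| <= M.
  by move=> /andP[s0 st]; have [|//] := fM s y; rewrite s0 ltW.
have fM2 s y : 0 < s < t1 -> `|f2 (s, y)| <= M.
  by move=> /andP[s0 st]; have [|//] := fM s y; rewrite s0 ltW.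
have [S1 [M1 M10 [HS1 rE]]] := @rho_caloric R p b0 k T f1 k2 T2 Tk.
have [S2 [M2 M20 [HS2 aE]]] := @phi_caloric R k T f2 T2.
have w00 : 0 <= T - t1 by rewrite subr_ge0 ltW.
have aE' i t x : a i t x = (i == 0)%:R * (0 * (T - t)) + Wf S2 f2 T i t x by rewrite mul0r mulr0 add0r -aE.
have [K1 K10 R1] := V_reg t10 t1T T1 M10 (HS1 _ w00) mf1 M0 fM1 rE.
have [K2 K20 R2] := V_reg t10 t1T T1 M20 (HS2 _ w00) mf2 M0 fM2 aE'.
pose m := c0 * (T - t1); have m0 : 0 < m by rewrite /m mulr_gt0// subr_gt0.
pose L := K1 + K2; have L0 : 0 < L by exact: addr_gt0.
have R1' : reg r t1 L by apply: regW R1 _; rewrite lerDl ltW.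
have R2' : reg a t1 L by apply: regW R2 _; rewrite lerDr ltW.
(* On [0, t1] the function [rho] is bounded below by [m], so the homogeneous estimate is used at the
   trivial scale D = G = 1. *)
have [N N0 HN] := nonlin_le p de m0 L0.
have [b1 l1 hr tr] := R1'; have [b2 l2 ha ta] := R2'.
have tt t h : 0 < t -> 0 <= h -> t + h <= t1 -> [/\ 0 <= t <= t1, 0 <= t + h <= t1, 0 < t < T & 0 < t + h < T].
  by move=> t0 h0 th; split; apply/andP; split; lra.
have Hf t h x e : 0 < t -> 0 <= h -> t + h <= t1 ->
     `|f1 (t + h, x + e) - f1 (t, x)| <= N * L * ((e ^+ 2) `^ 4^-1 + h `^ 4^-1) /\
     `|f2 (t + h, x + e) - f2 (t, x)| <= N * L * ((e ^+ 2) `^ 4^-1 + h `^ 4^-1).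
  move=> t0 h0 th; have [t01 th1 tT thT] := tt t h t0 h0 th.
  have [-> ->] := eqs (t + h, x + e); have [-> ->] := eqs (t, x).
  rewrite /src1 /src2 /= tT thT.
  set d := _ `^ _ + _ `^ _; have d0 : 0 <= d by rewrite addr_ge0 ?powR_ge0.
  have rb t' x' : 0 <= t' <= t1 -> m * 1 <= r 0 t' x' <= L * 1.
    move=> tt'; rewrite !mulr1 sol_lower//=; apply: le_trans (ler_norm _) _; exact: b1.
  have rb1 t' x' : 0 <= t' <= t1 -> `|r 1 t' x'| <= L * (1 * 1) by move=> tt'; rewrite !mulr1; exact: b1.
  have ab1 t' x' : 0 <= t' <= t1 -> `|a 1 t' x'| <= L * 1 by move=> tt'; rewrite mulr1; exact: b2.
  have e1 : `|r 0 (t + h) (x + e) - r 0 t x| <= L * d * 1 by rewrite mulr1; exact: hr.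
  have e2 : `|r 1 (t + h) (x + e) - r 1 t x| <= L * d * (1 * 1) by rewrite !mulr1; exact: hr.
  have e3 : `|a 1 (t + h) (x + e) - a 1 t x| <= L * d * 1 by rewrite mulr1; exact: ha.
  have Ld : 0 <= L * d by rewrite mulr_ge0// ltW.
  have [_ _ n1 n2] := HN 1 1 (L * d) _ _ _ _ _ _ ltr01 ler01 Ld (rb _ _ th1) (rb _ _ t01) (rb1 _ _ th1) (rb1 _ _ t01) (ab1 _ _ th1) (ab1 _ _ t01) e1 e2 e3.
  by split; [apply: le_trans n1 _|apply: le_trans n2 _]; rewrite expr1n !mulr1 mulrA.
pose K3 := N * L; have K30 : 0 <= K3 by rewrite /K3 mulr_ge0// ltW.
exists (L + M + 4 * K3); first by rewrite -addrA ltr_wpDr// addr_ge0// mulr_ge0.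
have le1 : L <= L + M + 4 * K3 by rewrite -addrA lerDl addr_ge0// mulr_ge0.
have le2 : M <= L + M + 4 * K3 by rewrite addrAC lerDr addr_ge0// ?mulr_ge0// ltW.
have le3 : K3 <= L + M + 4 * K3.
  apply: (@le_trans _ _ (4 * K3)); first by rewrite ler_peMl// ler1n.
  by rewrite lerDr addr_ge0// ltW.
have le4 : 4 * K3 <= L + M + 4 * K3 by rewrite lerDr addr_ge0// ltW.
split.
- exact: regW R1' le1.
- exact: regW R2' le1.
- move=> t h x e t0 h0 th; have [h1 h2] := Hf t h x e t0 h0 th.
  have p0 : 0 <= (e ^+ 2) `^ 4^-1 + h `^ 4^-1 by rewrite addr_ge0 ?powR_ge0.
  by split; [apply: le_trans h1 _|apply: le_trans h2 _]; apply: wpM_le.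
- by move=> t x t01; have [h1 h2] := fM t x t01; split; [apply: le_trans h1 _|apply: le_trans h2 _].
- move=> t h x t0 h0 th.
  have fK (f : R * R -> R) : (forall t h x e, 0 < t -> 0 <= h -> t + h <= t1 -> `|f (t + h, x + e) - f (t, x)| <= N * L * ((e ^+ 2) `^ 4^-1 + h `^ 4^-1)) ->
     forall s y, t <= s < t + h -> `|f (s, y) - f (t, x)| <= K3 * ((y - x) ^+ 2) `^ 4^-1 + K3 * h `^ 4^-1.
    move=> Hff s y /andP[ts sth]; have st0 : 0 <= s - t by rewrite subr_ge0.
    have sth' : t + (s - t) <= t1 by rewrite subrKC (le_trans (ltW sth)).
    have := Hff t (s - t) x (y - x) t0 st0 sth'; rewrite !subrKC => /le_trans; apply.
    rewrite mulrDr lerD2l ler_wpM2l//; apply: powR_mono; rewrite ?invr_ge0//.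
    by rewrite lerBlDl ltW.
  have F1 := fK f1 (fun t h x e p1 p2 p3 => (Hf t h x e p1 p2 p3).1).
  have F2 := fK f2 (fun t h x e p1 p2 p3 => (Hf t h x e p1 p2 p3).2).
  have h1 := V_heat t0 h0 th t1T T1 M10 (HS1 _ w00) mf1 M0 fM1 rE K30 F1.
  have h2 := V_heat t0 h0 th t1T T1 M20 (HS2 _ w00) mf2 M0 fM2 aE' K30 F2.
  rewrite oppr0 add0r in h2.
  split; [apply: le_trans h1 _|apply: le_trans h2 _]; apply: wpM_le => //; exact: powR_ge0.
Qed.

End MildIdentity.

(** * Approximate heat steps with superlinear error force exactness *)

Section Vanishing.
Context {R : realType}.
Notation mu := (@lebesgue_measure R).
Implicit Types (h s t x y z e w M K C A B : R).

Lemma le_quarter_zero (a M t : R) : 0 <= a -> 0 < t -> (forall n : nat, a <= M * (t / n.+1%:R) `^ 4^-1) -> a = 0.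
Proof.
move=> a0 t0 H; apply/eqP; rewrite eq_le a0 andbT leNgt; apply/negP => ap.
have M0 : 0 < M.
  have := H 0%N; rewrite divr1 => h; have := lt_le_trans ap h; rewrite pmulr_lgt0//; exact: powR_gt0.
pose n := Num.truncn (M ^+ 4 * t / a ^+ 4).
have a4 : 0 < a ^+ 4 by exact: exprn_gt0.
have nn : M ^+ 4 * t / a ^+ 4 < n.+1%:R by apply: truncnS_gt.
have tn : 0 < t / n.+1%:R by rewrite divr_gt0// ltr0n.
have : a ^+ 4 <= (M * (t / n.+1%:R) `^ 4^-1) ^+ 4.
  by rewrite lerXn2r ?nnegrE ?mulr_ge0 ?powR_ge0// ltW.
rewrite exprMn -(powR_mulrn _ (powR_ge0 _ _)) -powRrM mulVf// powRr1 ?(ltW tn)//.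
by rewrite mulrA ler_pdivlMr ?ltr0n// leNgt -ltr_pdivrMl// mulrC nn.
Qed.

(* Telescoping over n steps of length t / n gives a bound O(n^(- 1 / 4)). *)
Lemma vanishing (D : R -> R -> R) t1 K C : 0 <= K -> 0 <= C -> 
  (forall t, measurable_fun setT (D t)) ->
  (forall t x, 0 < t <= t1 -> `|D t x| <= K * t `^ 4^-1) ->
  (forall t h x, 0 < t -> 0 < h -> t + h <= t1 -> `|D (t + h) x - Ht h (D t) x| <= C * h `^ (5 / 4)) ->
  forall t x, 0 < t <= t1 -> D t x = 0.
Proof.
move=> K0 C0 mD DK DC t x /andP[t0 tt].
apply/eqP; rewrite -normr_eq0; apply/eqP.
apply: (@le_quarter_zero _ (K + C * t) t) => // n.
set h := t / n.+1%:R; have h0 : 0 < h by rewrite divr_gt0.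
have nh : h * n.+1%:R = t by rewrite /h divfK.
(* The walk starts at time h, not 0: steps are available from positive times only, and the first
   value is small by Hölder continuity at 0. *)
have ind j y : (j <= n)%N -> `|D (h * j.+1%:R) y| <= K * h `^ 4^-1 + j%:R * (C * h `^ (5 / 4)).
  elim: j y => [|j IH] y jn.
    rewrite mul0r addr0 mulr1; apply: DK; rewrite h0/= (le_trans _ tt)// -nh ler_peMr ?ler1n ?(ltW h0)//.
  have hj : 0 < h * j.+1%:R by rewrite mulr_gt0// ltr0n.
  have sj : h * j.+2%:R = h * j.+1%:R + h by rewrite (natrD _ 1 j.+1) mulrDr mulr1 addrC.
  have jt : h * j.+1%:R + h <= t1.
    by rewrite -sj (le_trans _ tt)// -nh ler_wpM2l ?(ltW h0)// ler_nat.
  have := DC _ _ y hj h0 jt; rewrite -sj => h1.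
  have h2 := Ht_le y h0 (mD _) (fun z => IH z (ltnW jn)).
  have -> : D (h * j.+2%:R) y = (D (h * j.+2%:R) y - Ht h (D (h * j.+1%:R)) y) + Ht h (D (h * j.+1%:R)) y by rewrite subrK.
  apply: le_trans (ler_normD _ _) _; apply: le_trans (lerD h1 h2) _.
  rewrite -(natr1 j); move: (C * _) (K * _) => u v; nra.
have := ind n x (leqnn n); rewrite nh => /le_trans; apply.
rewrite -h_54// [leRHS]mulrDl lerD2l -nh.
rewrite (_ : n%:R * (C * (h `^ 4^-1 * h)) = C * (h * n%:R) * h `^ 4^-1); last by ring.
rewrite ler_wpM2r ?powR_ge0// ler_wpM2l// ler_wpM2l ?(ltW h0)// ler_nat.
exact: leqnSn.
Qed.

Lemma max5 (a b c d e : R) : 0 < a -> 0 < b -> 0 < c -> 0 < d -> 0 < e -> exists2 W : R, [/\ 0 < W, a <= W, b <= W, c <= W & d <= W] & e <= W.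
Proof. by move=> a0 b0 c0 d0 e0; exists (a + b + c + d + e); [split|]; lra. Qed.

Lemma subitv t h t1 : 0 < t -> 0 <= h -> t + h <= t1 -> 0 <= t <= t1 /\ 0 <= t + h <= t1.
Proof. by move=> t0 h0 th; split; apply/andP; split; lra. Qed.

Lemma subitvT t h t1 T : 0 < t -> 0 < h -> t + h <= t1 -> t1 < T -> T <= 2^-1 -> [/\ 0 <= t <= t1, 0 <= t + h <= t1, 0 < h <= 1 & 0 < t < T].
Proof. by move=> t0 h0 th tT T2; split; apply/andP; split; lra. Qed.

Lemma measurable_Ht h (g : R -> R) : measurable_fun setT g -> measurable_fun setT (Ht h g).
Proof.
move=> mg; rewrite /Ht.
apply: (@measurable_Rintegral _ _ _ (fun w : R * R => heat_kernel h (w.1 - w.2) * g w.2)).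
apply: measurable_funM; first by apply: measurable_heat => //; exact: measurable_funB.
by apply: measurableT_comp.
Qed.

End Vanishing.

(** * The step expansion for the real and imaginary parts of u *)

Section DuhamelIdentity.
Context {R : realType}.
Notation mu := (@lebesgue_measure R).
Implicit Types (h s t x y z e w M K C A B : R).

Lemma measurable_Qf (al be : R) n (A B : R) d (X : measurableType d) (r a : X -> R) : measurable_fun setT r -> measurable_fun setT a ->
  measurable_fun setT (fun z : X => Qf al be n A B (r z) (a z)).
Proof.
move=> mr ma; rewrite /Qf.
have ml : measurable_fun setT (fun z : X => ln (r z)).
  by apply: (measurableT_comp (@measurable_ln R)).
have mb : measurable_fun setT (fun z : X => a z - be * ln (r z)).
  by apply: measurable_funB => //; apply: measurable_funM.
apply: measurable_funM.
  by apply: measurableT_comp => //; apply: measurable_funM.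
apply: measurable_funD; apply: measurable_funM => //.
  by apply: measurableT_comp mb; apply: continuous_measurable_fun; exact: continuous_cos.
by apply: measurableT_comp mb; apply: continuous_measurable_fun; exact: continuous_sin.
Qed.

(* The equations for [rho] and [phi] are chosen so that this holds: the nonlinear terms [N1], [N2]
   cancel the quadratic part of the second derivative of [r ^ (- c) * exp (i * a)]. *)
Lemma Qf_equation (p de A B r a r1 a1 : R) : 1 < p -> 0 < r ->
  let al := (p - 1)^-1 in let be := de * al in
  Q1 al be 0 A B (- (p - 1) + N1 p de r r1 a1) (N2 p de r r1 a1) r a - Q2 al be 0 A B r1 a1 r a =
  Qf al be 1 (A + de * B) (- de * A + B) r a.
Proof.
move=> p1 r0 al be; have r00 : r != 0 by rewrite gt_eqF.
have p00 : p - 1 != 0 by rewrite gt_eqF// subr_gt0.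
rewrite /Q2 /Q1 !Qf_shift// /Qf /RA /RB /N1 /N2 /ReZ /ImZ /quad.
set E := expR _; set c := cos _; set s := sin _.
rewrite /be /al; field; rewrite ?r00 ?p00//.
Qed.

Context (p b0 de : R) (k : nat) (p1 : 1 < p) (b00 : 0 < b0) (k2 : (2 <= k)%N).
Context (T Af c0 C0 : R) (f1 f2 : R * R -> R) (sol : is_solution p b0 de k T Af c0 C0 f1 f2).

(** (A, B) = (1, 0) and (0, 1) give the real and imaginary parts of u; [Ff] with the same (A, B)
    gives those of the nonlinearity, the coefficients encoding multiplication by 1 + i de and n = 1
    the factor 1 / rho. *)
Definition Uf A B t x := Qf (p - 1)^-1 (de * (p - 1)^-1) 0 A B (rho p b0 k T 0 f1 t x) (phi k T 0 f2 t x).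
Definition Ff A B (z : R * R) := Qf (p - 1)^-1 (de * (p - 1)^-1) 1 (A + de * B) (- de * A + B) (rho p b0 k T 0 f1 z.1 z.2) (phi k T 0 f2 z.1 z.2).

Lemma measurable_Uf A B : measurable_fun setT (fun z : R * R => Uf A B z.1 z.2).
Proof.
have [_ [_ [m1 m2 _ _ _]]] := sol.
by apply: measurable_Qf; [exact: measurable_rho|exact: measurable_phi].
Qed.

Lemma measurable_Uf_slice A B t : measurable_fun setT (Uf A B t).
Proof.
have -> : Uf A B t = (fun z : R * R => Uf A B z.1 z.2) \o (fun s : R => (t, s)) by [].
by apply: measurableT_comp; [exact: measurable_Uf|exact: measurable_pair1].
Qed.

Lemma measurable_Ff A B : measurable_fun setT (Ff A B).
Proof.
have [_ [_ [m1 m2 _ _ _]]] := sol.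
by apply: measurable_Qf; [exact: measurable_rho|exact: measurable_phi].
Qed.

Lemma Uf_reg A B t1 : 0 < t1 < T -> exists2 K : R, 0 < K & [/\
  forall t x, 0 <= t <= t1 -> `|Uf A B t x| <= K /\ `|Ff A B (t, x)| <= K,
  forall t x e, 0 <= t <= t1 -> `|Uf A B t (x + e) - Uf A B t x| <= K * `|e|,
  forall t x, 0 <= t <= t1 -> `|Uf A B t x - Uf A B 0 x| <= K * t `^ 4^-1,
  forall t h x e, 0 < t -> 0 <= h -> t + h <= t1 ->
     `|Ff A B (t + h, x + e) - Ff A B (t, x)| <= K * ((e ^+ 2) `^ 4^-1 + h `^ 4^-1) &
  forall t h x, 0 < t -> 0 < h -> t + h <= t1 ->
    `|Uf A B (t + h) x - Ht h (Uf A B t) x - h * Ff A B (t, x)| <= K * h `^ (5 / 4)].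
Proof.
move=> t1T'; have /andP[t10 t1T] := t1T'.
have [K K0 [[r1 r2 r3 r4] [a1 a2 a3 a4] fH fB st]] := sol_reg k2 sol t1T'.
have [[T0 T2 _] [[A0 c00 C00] [mf1 mf2 _ _ [_ eqs]]]] := sol.
pose m := c0 * (T - t1); have m0 : 0 < m by rewrite /m mulr_gt0// subr_gt0.
have mr t x : 0 <= t <= t1 -> m <= rho p b0 k T 0 f1 t x.
  by move=> tt; exact: (sol_lower sol).
have al0 : 0 < (p - 1)^-1 by rewrite invr_gt0 subr_gt0.
have [L L0 HL] := @Qf_taylor R _ (de * (p - 1)^-1) al0 m 0 A B m0.
have [N N0 HN] := @Qf_taylor R _ (de * (p - 1)^-1) al0 m 1 (A + de * B) (- de * A + B) m0.
(* [heat_step] takes one bound for everything, including the drift - (p - 1) + f1 of [rho]. *)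
pose K' := p - 1 + 2 * K.
have KK : K <= K' by rewrite /K' ler_wpDl ?subr_ge0 ?(ltW p1)// ler_peMl ?ler1n// ltW.
have K'0 : 0 <= K' by exact: le_trans (ltW K0) KK.
have [S S0 HS] := @heat_step R _ (de * (p - 1)^-1) al0 m K' 0 A B m0 K'0.
have combo (Q X Y c d : R) : 0 <= Q -> `|X| <= c * d -> `|Y| <= c * d -> Q * (`|X| + `|Y|) <= Q * (c + c) * d.
  by move=> Q0 hX hY; rewrite -mulrA ler_wpM2l// mulrDl lerD.
pose E := L * (K + K); pose G := N * (K + K).
have E0 : 0 < E by rewrite mulr_gt0// addr_gt0.
have G0 : 0 < G by rewrite mulr_gt0// addr_gt0.
have [W [W0 wL wN wE wG] wS] := @max5 _ L N E G S L0 N0 E0 G0 S0.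
exists W => //; split.
- move=> t x tt; split.
    by have [h _ _ _] := HL _ _ (phi k T 0 f2 t x) 0 (mr t x tt) (mr t x tt); exact: le_trans h wL.
  by have [h _ _ _] := HN _ _ (phi k T 0 f2 t x) 0 (mr t x tt) (mr t x tt); exact: le_trans h wN.
- move=> t x e tt; have [_ h _ _] := HL _ _ (phi k T 0 f2 t x) (phi k T 0 f2 t (x + e)) (mr t x tt) (mr t (x + e) tt).
  apply: le_trans h _; have [x1 _] := r2 t x e tt; have [y1 _] := a2 t x e tt.
  apply: le_trans (combo _ _ _ _ _ (ltW L0) x1 y1) _; exact: wpM_le.
- move=> t x tt; have tt0 : 0 <= (0 : R) <= t1 by rewrite lexx ltW.
  have [_ h _ _] := HL _ _ (phi k T 0 f2 0 x) (phi k T 0 f2 t x) (mr 0 x tt0) (mr t x tt).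
  apply: le_trans h _; have x1 := r4 t x tt; have y1 := a4 t x tt.
  apply: le_trans (combo _ _ _ _ _ (ltW L0) x1 y1) _; apply: wpM_le => //; exact: powR_ge0.
- move=> t h x e t0 h0 th.
  have [tt tth] := subitv t0 h0 th.
  have [_ hh _ _] := HN _ _ (phi k T 0 f2 t x) (phi k T 0 f2 (t + h) (x + e)) (mr t x tt) (mr (t + h) (x + e) tth).
  apply: le_trans hh _; have x1 := r3 0%N t h x e isT t0 h0 th; have y1 := a3 0%N t h x e isT t0 h0 th.
  apply: le_trans (combo _ _ _ _ _ (ltW N0) x1 y1) _; apply: wpM_le => //; rewrite addr_ge0 ?powR_ge0//.
- move=> t h x t0 h0 th.
  have [tt tth h1 tT] := subitvT t0 h0 th t1T T2.
  have [s1 s2] := st t h x t0 h0 th.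
  have [b1 b2] : `|f1 (t, x)| <= K /\ `|f2 (t, x)| <= K by apply: fB; rewrite t0/=; case/andP: tt.
  have pK (u v : R) : `|u| <= K * v -> 0 <= v -> `|u| <= K' * v.
    by move=> hu v0; apply: le_trans hu _; exact: wpM_le.
  have p10 : 0 <= p - 1 by rewrite subr_ge0 ltW.
  have mrho : measurable_fun setT (rho p b0 k T 0 f1 t).
    have -> : rho p b0 k T 0 f1 t = (fun z : R * R => rho p b0 k T 0 f1 z.1 z.2) \o (fun s : R => (t, s)) by [].
    by apply: measurableT_comp; [exact: measurable_rho|exact: measurable_pair1].
  have mphi : measurable_fun setT (phi k T 0 f2 t).
    have -> : phi k T 0 f2 t = (fun z : R * R => phi k T 0 f2 z.1 z.2) \o (fun s : R => (t, s)) by [].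
    by apply: measurableT_comp; [exact: measurable_phi|exact: measurable_pair1].
  have b1' : `|- (p - 1) + f1 (t, x)| <= K'.
    apply: le_trans (ler_normD _ _) _; rewrite normrN (ger0_norm p10) /K' lerD2l.
    by apply: le_trans b1 _; rewrite ler_peMl ?ler1n// ltW.
  have b2' : `|f2 (t, x)| <= K' by exact: le_trans KK.
  have E4 e : 0 <= (e ^+ 2) `^ (3 / 4) by exact: powR_ge0.
  have H4 : 0 <= h `^ (5 / 4) by exact: powR_ge0.
  have := HS (rho p b0 k T 0 f1 t) (phi k T 0 f2 t) x h (rho p b0 k T 1 f1 t x) (phi k T 1 f2 t x)
    (- (p - 1) + f1 (t, x)) (f2 (t, x)) (rho p b0 k T 0 f1 (t + h) x) (phi k T 0 f2 (t + h) x)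
    mrho mphi h1 (fun y => mr t y tt) (mr (t + h) x tth)
    (fun y => le_trans (r1 0%N t y isT tt) KK) (fun y => le_trans (a1 0%N t y isT tt) KK)
    (fun e => pK _ _ (r2 t x e tt).1 (normr_ge0 e)) (fun e => pK _ _ (a2 t x e tt).1 (normr_ge0 e))
    (fun e => pK _ _ (r2 t x e tt).2 (E4 e)) (fun e => pK _ _ (a2 t x e tt).2 (E4 e))
    (le_trans (r1 1%N t x isT tt) KK) (le_trans (a1 1%N t x isT tt) KK) b1' b2'
    (pK _ _ s1 H4) (pK _ _ s2 H4).
  have [-> ->] := eqs (t, x); rewrite /src1 /src2 /= tT Qf_equation//; last exact: lt_le_trans m0 (mr t x tt).
  by move=> /le_trans; apply; exact: wpM_le.
Qed.

End DuhamelIdentity.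

Section DuhamelFromSteps.
Context {R : realType}.
Notation mu := (@lebesgue_measure R).
Implicit Types (h s t x y z e w M K C A B : R).

Lemma HtB h (f g : R -> R) x M : 0 < h -> measurable_fun setT f -> measurable_fun setT g ->
  (forall y, `|f y| <= M) -> (forall y, `|g y| <= M) ->
  Ht h (fun y => f y - g y) x = Ht h f x - Ht h g x.
Proof.
move=> h0 mf mg fM gM; rewrite /Ht -IntB; [|exact: heat_itg_bounded fM|exact: heat_itg_bounded gM].
by apply: eq_Rintegral => y _; rewrite mulrBr.
Qed.

Lemma Ht_Ht h t (g : R -> R) x M : 0 < h -> 0 < t -> measurable_fun setT g -> (forall y, `|g y| <= M) ->
  Ht h (Ht t g) x = Ht (h + t) g x.
Proof.
move=> h0 t0 mg gM; rewrite [RHS]HtE -(Sk_CK _ _ h0 t0 mg gM); apply: eq_Rintegral => y _.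
by rewrite -HtE.
Qed.

Lemma regroup (u v a b c d : R) : u - a - (b + c) - (v - a - b) = u - v - d - (c - d).
Proof. by ring. Qed.

Lemma duhamel_of_steps (U : R -> R -> R) (F : R * R -> R) t1 K : 0 < K -> t1 <= 1 ->
  (forall t, measurable_fun setT (U t)) -> measurable_fun setT F ->
  (forall t x, 0 <= t <= t1 -> `|U t x| <= K /\ `|F (t, x)| <= K) ->
  (forall t x e, 0 <= t <= t1 -> `|U t (x + e) - U t x| <= K * `|e|) ->
  (forall t x, 0 <= t <= t1 -> `|U t x - U 0 x| <= K * t `^ 4^-1) ->
  (forall t h x e, 0 < t -> 0 <= h -> t + h <= t1 ->
     `|F (t + h, x + e) - F (t, x)| <= K * ((e ^+ 2) `^ 4^-1 + h `^ 4^-1)) ->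
  (forall t h x, 0 < t -> 0 < h -> t + h <= t1 ->
    `|U (t + h) x - Ht h (U t) x - h * F (t, x)| <= K * h `^ (5 / 4)) ->
  forall t x, 0 < t <= t1 -> U t x = Ht t (U 0) x + Duh 0 F t x.
Proof.
move=> K0 t11 mU mF bd lip tm Fh st t x tt; have [c c0 Hc] := @Duh_le R 0 isT.
have KK : 0 <= K by exact: ltW.
have t10 : 0 < t1 by case/andP: tt; exact: lt_le_trans.
have tt0 : 0 <= (0 : R) <= t1 by rewrite lexx ltW.
have FM s y : 0 <= s <= t1 -> `|F (s, y)| <= K by move=> ss; have [] := bd s y ss.
have FMt s y t' : t' <= t1 -> 0 < s < t' -> `|F (s, y)| <= K.
  by move=> tt1 /andP[s0 st']; apply: FM; rewrite ltW//= (le_trans (ltW st')).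
have UM y : `|U 0 y| <= K by have [] := bd 0 y tt0.
pose D t x := U t x - Ht t (U 0) x - Duh 0 F t x.
suff : D t x = 0 by rewrite /D => /eqP; rewrite subr_eq0 subr_eq => /eqP ->; rewrite addrC.
apply: (@vanishing _ D t1 (K + (3 * (K + K + K) + 0) + c * K) (K + 4 * K)) => //.
- by rewrite !addr_ge0 ?mulr_ge0 ?addr_ge0 ?(ltW c0).
- by rewrite addr_ge0 ?mulr_ge0.
- move=> s; apply: measurable_funB; last exact: measurable_Duh_slice.
  by apply: measurable_funB => //; apply: measurable_Ht.
- move=> s y /andP[s0 s1].
  have sq : s <= s `^ 4^-1 by apply: h_quarter; rewrite ltW//= (le_trans s1).
  rewrite /D.
  have -> : U s y - Ht s (U 0) y - Duh 0 F s y = (U s y - U 0 y) - (Ht s (U 0) y - U 0 y) - Duh 0 F s y.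
    by move: (Duh 0 F s y) (Ht s _ y) => u v; ring.
  apply: le_trans (ler_normB _ _) _; rewrite [leRHS]mulrDl; apply: lerD.
    apply: le_trans (ler_normB _ _) _; rewrite [leRHS]mulrDl; apply: lerD.
      by apply: tm; rewrite ltW.
    rewrite [leRHS]mulrDl mul0r; apply: (@heat_holder _ s y (U 0) K (U 0 y)) => // [|z].
      by rewrite !addr_ge0.
    rewrite addr0; apply: interp_quarter; rewrite ?addr_ge0//.
      by apply: le_trans (ler_normB _ _) _; rewrite lerD.
    by have := lip 0 y (z - y) tt0; rewrite subrKC.
  apply: le_trans (Hc F s K y s0 mF KK (fun u v => FMt u v s s1)) _.
  by rewrite mul0r subr0 powRr1 ?(ltW s0)// ler_wpM2l// mulr_ge0 ?(ltW c0).
- move=> s h y s0 h0 sh; rewrite /D.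
  have ss : 0 <= s <= t1 by rewrite ltW//= (le_trans _ sh)// lerDl ltW.
  have HM z : `|Ht s (U 0) z| <= K by exact: Ht_le.
  have DM z : `|Duh 0 F s z| <= c * K * s `^ (1 - 0%:R / 2).
    by apply: Hc => // u v; apply: FMt; case/andP: ss.
  have mH : measurable_fun setT (Ht s (U 0)) by exact: measurable_Ht.
  set M := c * K * s `^ _ in DM.
  have M0 : 0 <= M by apply: le_trans (normr_ge0 _) (DM 0).
  have b1 z : `|U s z - Ht s (U 0) z| <= K + K + M.
    apply: le_trans (ler_normB _ _) _; apply: ler_wpDr => //; apply: lerD => //.
    by have [] := bd s z ss.
  have b2 z : `|Duh 0 F s z| <= K + K + M by apply: le_trans (DM z) _; rewrite lerDr addr_ge0.
  have b3 z : `|U s z| <= K + K by apply: (@le_trans _ _ K); [have [] := bd s z ss|rewrite lerDl].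
  have b4 z : `|Ht s (U 0) z| <= K + K by apply: (@le_trans _ _ K) => //; rewrite lerDl.
  rewrite (@HtB h (fun z => U s z - Ht s (U 0) z) (Duh 0 F s) y _ h0 _ (measurable_Duh_slice 0 s mF) b1 b2); last exact: measurable_funB.
  rewrite (@HtB h (U s) (Ht s (U 0)) y _ h0 (mU s) mH b3 b4).
  rewrite (Ht_Ht y h0 s0 (mU 0) UM) [h + s]addrC.
  rewrite (Duh_step y (isT : (0 <= 1)%N) s0 h0 mF KK (fun u v => FMt u v _ sh)).
  rewrite -/(Ht h (Duh 0 F s) y).
  have FK u v : s <= u < s + h -> `|F (u, v) - F (s, y)| <= K * ((v - y) ^+ 2) `^ 4^-1 + K * h `^ 4^-1.
    move=> /andP[su uh]; have us : 0 <= u - s by rewrite subr_ge0.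
    have sth' : s + (u - s) <= t1 by rewrite subrKC (le_trans (ltW uh)).
    have := Fh s (u - s) y (v - y) s0 us sth'; rewrite !subrKC => /le_trans; apply.
    rewrite mulrDr lerD2l ler_wpM2l//; apply: powR_mono; rewrite ?invr_ge0//.
    by rewrite lerBlDl ltW.
  have h2 := Duht_holder s0 h0 mF KK (fun u v => FMt u v _ sh) KK FK.
  rewrite -mulrA (h_54 h0) in h2.
  have h1 := st s h y s0 h0 sh.
  rewrite (regroup _ _ _ _ _ (h * F (s, y))).
  rewrite [leRHS]mulrDl; apply: le_trans (ler_normB _ _) _; apply: lerD; first exact: h1.
  exact: h2.
Qed.

End DuhamelFromSteps.

Section UfDuhamel.
Context {R : realType}.
Implicit Types (t x y A B : R).
Context (p b0 de : R) (k : nat) (p1 : 1 < p) (b00 : 0 < b0) (k2 : (2 <= k)%N).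
Context (T Af c0 C0 : R) (f1 f2 : R * R -> R) (sol : is_solution p b0 de k T Af c0 C0 f1 f2).

Lemma Uf_duhamel A B t x : 0 < t < T ->
  Uf p b0 de k T f1 f2 A B t x = Ht t (Uf p b0 de k T f1 f2 A B 0) x + Duh 0 (Ff p b0 de k T f1 f2 A B) t x.
Proof.
move=> tT; have [K K0 [r1 r2 r3 r4 r5]] := Uf_reg p1 k2 sol A B tT.
have [[_ T2 _] _] := sol; have /andP[t0 tT'] := tT.
have t1 : t <= 1 by lra.
apply: (duhamel_of_steps K0 t1 _ _ r1 r2 r3 r4 r5).
- by move=> s; exact: (measurable_Uf_slice sol).
- exact: (measurable_Ff sol).
- by rewrite t0 lexx.
Qed.

End UfDuhamel.

(** * Mild solutions and uniqueness *)

Section ComplexComponents.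
Context {R : realType}.
Notation mu := (@lebesgue_measure R).
Notation normc := ComplexField.Normc.normc.
Implicit Types (h s t x y w M K C : R) (z : R[i]).

Lemma normc_le_add (a b : R[i]) : normc (a + b) <= normc a + normc b.
Proof. exact: (@le_normcD R a b). Qed.

Lemma normc_opp (a : R[i]) : normc (- a) = normc a.
Proof. exact: (@normcN R a). Qed.

Lemma normc_ge0 (a : R[i]) : 0 <= normc a.
Proof. by case: a => a b; exact: sqrtr_ge0. Qed.

Lemma Re_le_normc (a : R[i]) : `|complex.Re a| <= normc a.
Proof. by case: a => a b /=; rewrite -sqrtr_sqr ler_wsqrtr// lerDl sqr_ge0. Qed.

Lemma Im_le_normc (a : R[i]) : `|complex.Im a| <= normc a.
Proof. by case: a => a b /=; rewrite -sqrtr_sqr ler_wsqrtr// lerDr sqr_ge0. Qed.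

Lemma normc_real (a : R) : normc a%:C = `|a|.
Proof. by rewrite /= expr0n addr0 sqrtr_sqr. Qed.

Lemma normc_le_ReIm (a : R[i]) : normc a <= `|complex.Re a| + `|complex.Im a|.
Proof.
case: a => a b /=; have h : 0 <= `|a| + `|b| by rewrite addr_ge0.
rewrite -[leRHS](ger0_norm h) -sqrtr_sqr ler_wsqrtr// sqrrD !real_normK ?num_real//.
by rewrite lerD2r lerDl mulrn_wge0// mulr_ge0.
Qed.

Lemma heat_semigroupE t (f : R -> R[i]) x :
  heat_semigroup t f x = Ht t (fun y => complex.Re (f y)) x +i* Ht t (fun y => complex.Im (f y)) x.
Proof.
by congr (_ +i* _); apply: eq_Rintegral => y _; case: (f y) => a b /=; rewrite mul0r ?subr0 ?addr0.
Qed.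

Lemma Rintegral_ifitv t (g : R -> R) :
  \int[mu]_(s in `]0, t[) g s = \int[mu]_s (if 0 < s < t then g s else 0).
Proof.
rewrite Rintegral_mkcond; apply: eq_Rintegral => s _.
by rewrite patchE mem_setE in_itv.
Qed.

Lemma duhamel_termE t (f : R -> R -> R[i]) x :
  cintegral `]0, t[ (fun s => heat_semigroup (t - s) (f s) x) =
  Duh 0 (fun z : R * R => complex.Re (f z.1 z.2)) t x +i* Duh 0 (fun z : R * R => complex.Im (f z.1 z.2)) t x.
Proof.
rewrite /cintegral /Duh; set a := Rintegral _ _ _; set b := Rintegral _ _ _.
have -> : a = \int[mu]_s (if 0 < s < t then Sk 0 (t - s) (fun y => complex.Re (f s y)) x else 0).
  rewrite /a Rintegral_ifitv; apply: eq_Rintegral => s _.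
  by rewrite heat_semigroupE [complex.Re _]/= HtE.
have -> // : b = \int[mu]_s (if 0 < s < t then Sk 0 (t - s) (fun y => complex.Im (f s y)) x else 0).
rewrite /b Rintegral_ifitv; apply: eq_Rintegral => s _.
by rewrite heat_semigroupE [complex.Im _]/= HtE.
Qed.

Lemma eq_Duh i (f g : R * R -> R) t x : (forall s y, 0 < s < t -> f (s, y) = g (s, y)) -> Duh i f t x = Duh i g t x.
Proof.
move=> fg; apply: eq_Rintegral => s _; case: ifP => // st.
by apply: eq_Rintegral => y _; rewrite fg.
Qed.

Lemma eq_complex_parts (a b : R[i]) : complex.Re a = complex.Re b -> complex.Im a = complex.Im b -> a = b.
Proof. by case: a b => [a b] [c d] /= -> ->. Qed.

Lemma lebesgue_setT_gt0 : (0 < mu [set: R])%E.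
Proof.
apply: (@lt_le_trans _ _ (mu `]0, 1[%classic)).
  by rewrite lebesgue_measure_itv/= lte_fin ltr01 oppr0 adde0 lte_fin.
by apply: le_measure; rewrite ?inE//; exact: measurable_itv.
Qed.

Lemma Linfty_normE (f : R -> R[i]) : Linfty_norm f = ess_sup mu (fun x => (normc (f x))%:E).
Proof.
rewrite /Linfty_norm unlock lebesgue_setT_gt0; congr ess_sup.
by apply/funext => x /=; rewrite ger0_norm// normc_ge0.
Qed.

Lemma Linfty_norm_le (f : R -> R[i]) M : (forall x, normc (f x) <= M) -> (Linfty_norm f <= M%:E)%E.
Proof. by move=> fM; rewrite Linfty_normE; apply/ess_supP; apply: nearW => x; rewrite lee_fin. Qed.

Lemma Linfty_norm_ae (f : R -> R[i]) M : (Linfty_norm f <= M%:E)%E -> \forall x \ae mu, normc (f x) <= M.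
Proof. by rewrite Linfty_normE => /ess_supP; apply: filterS => x; rewrite lee_fin. Qed.

(** Pointwise largeness is seen by the essential norm only on a set of positive measure, whence a
    lower bound on an interval. *)
Lemma Linfty_norm_ge (f : R -> R[i]) (a b c : R) : a < b -> (forall x, a < x < b -> c <= normc (f x)) ->
  (c%:E <= Linfty_norm f)%E.
Proof.
move=> ab fc; rewrite leNgt; apply/negP => fl.
have [e ee] : exists e : R, (Linfty_norm f <= e%:E)%E /\ e < c.
  have : (Linfty_norm f \is a fin_num).
    rewrite fin_numE (lt_eqF (lt_trans fl (ltry _))) andbT; apply/negP => /eqP h.
    (* An essential supremum equal to -oo would give |f| <= -1 almost everywhere on a line of
       positive measure. *)
    have : (Linfty_norm f <= (-1)%:E)%E by rewrite h leNye.
    move=> /Linfty_norm_ae [N [mN N0 sN]].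
    have : (mu [set: R] <= mu N)%E.
      apply: le_measure; rewrite ?inE// => x _; apply: sN => /= hx.
      by have := le_trans (normc_ge0 (f x)) hx; rewrite ler0N1.
    by rewrite N0 leNgt lebesgue_setT_gt0.
  move=> fin; exists (fine (Linfty_norm f)); rewrite fineK//; split => //.
  by rewrite -lte_fin fineK.
case: ee => /Linfty_norm_ae [N [mN N0 sN]] ec.
have : (mu `]a, b[%classic <= mu N)%E.
  apply: le_measure; rewrite ?inE// => x; rewrite /= in_itv/= => xab; apply: sN => /= hx.
  by have := lt_le_trans ec (le_trans (fc x xab) hx); rewrite ltxx.
by rewrite N0 lebesgue_measure_itv/= lte_fin ab -EFinB lee_fin leNgt subr_gt0 ab.
Qed.

End ComplexComponents.

(** * Local Lipschitz continuity of the nonlinearity *)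

Section ComplexNonlinearity.
Context {R : realType}.
Notation normc := ComplexField.Normc.normc.
Context (delta p : R) (p1 : 1 < p).

Lemma bernoulli_le (x : R) n : 0 <= x <= 1 -> 1 - x ^+ n <= n%:R * (1 - x).
Proof.
move=> /andP[x0 x1]; elim: n => [|n IH]; first by rewrite expr0 subrr mul0r.
have -> : 1 - x ^+ n.+1 = 1 - x + x * (1 - x ^+ n) by rewrite exprS; ring.
rewrite -natr1 mulrDl mul1r addrC lerD2r.
apply: le_trans IH; rewrite -[leRHS]mul1r; apply: ler_wpM2r => //.
by rewrite subr_ge0 exprn_ile1.
Qed.

(** For q < 1 the power alone is not Lipschitz at 0; the factor r' repairs this. With x = r' / r in
    [0, 1] and an integer n >= q one has x^n <= x^q, and Bernoulli gives 1 - x^n <= n (1 - x). *)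
Lemma powR_sub_le (q : R) : 0 < q -> exists2 n : R, 0 <= n & forall r r' : R, 0 <= r' -> r' <= r ->
  (r `^ q - r' `^ q) * r' <= n * r `^ q * (r - r').
Proof.
move=> q0; pose m := Num.truncn q; exists m.+1%:R => // r r' r0' r'r.
have [r00|rn] := eqVneq r 0.
  have -> : r' = 0 by apply/eqP; rewrite eq_le r0' -r00 r'r.
  by rewrite r00 subrr !mulr0.
have r0 : 0 < r by rewrite lt_neqAle eq_sym rn (le_trans r0').
pose x := r' / r; have x01 : 0 <= x <= 1 by rewrite divr_ge0 ?(ltW r0)//= ler_pdivrMr// mul1r.
have r'E : r' = x * r by rewrite divfK.
have [x0 x1] := andP x01.
have h1 : x ^+ m.+1 <= x `^ q.
  by rewrite -powR_mulrn//; apply: le_powR1 => //; apply: ltW; exact: truncnS_gt.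
have h2 := bernoulli_le m.+1 x01.
rewrite r'E powRM ?(ltW r0)//.
have -> : (r `^ q - x `^ q * r `^ q) * (x * r) = r `^ q * r * (x * (1 - x `^ q)) by ring.
have -> : m.+1%:R * r `^ q * (r - x * r) = r `^ q * r * (m.+1%:R * (1 - x)) by ring.
rewrite ler_wpM2l ?mulr_ge0 ?powR_ge0 ?(ltW r0)//.
apply: (@le_trans _ _ (1 - x `^ q)).
  rewrite -[leRHS]mul1r ler_wpM2r// subr_ge0.
  by have := powR_mono x0 x1 (ltW q0); rewrite powR1.
by apply: le_trans h2; rewrite lerD2l lerN2.
Qed.

(** By symmetry the larger modulus belongs to z; the difference is then |z|^(p-1) (z - z') plus the
    difference of powers times z', to which [powR_sub_le] applies. *)
Lemma nonlinearity_lipschitz M : 0 <= M -> exists2 L : R, 0 < L & forall z z' : R[i], normc z <= M -> normc z' <= M ->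
  normc (nonlinearity delta p z - nonlinearity delta p z') <= L * normc (z - z').
Proof.
move=> M0; have q0 : 0 < p - 1 by rewrite subr_gt0.
have [n n0 Hn] := powR_sub_le q0.
pose l := (1 + n) * M `^ (p - 1).
have l0 : 0 <= l by rewrite mulr_ge0 ?powR_ge0// addr_ge0.
have key (z z' : R[i]) : normc z <= M -> normc z' <= normc z ->
    normc ((normc z `^ (p - 1))%:C * z - (normc z' `^ (p - 1))%:C * z') <= l * normc (z - z').
  move=> zM z'z; set a := normc z `^ _; set b := normc z' `^ _.
  have aM : a <= M `^ (p - 1) by apply: powR_mono; rewrite ?(ltW q0)// normc_ge0.
  have ba : b <= a by apply: powR_mono; rewrite ?(ltW q0)// normc_ge0.
  have -> : a%:C * z - b%:C * z' = a%:C * (z - z') + (a - b)%:C * z'.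
    by rewrite rmorphB/= mulrBr mulrBl addrA subrK.
  apply: le_trans (normc_le_add _ _) _; rewrite !ComplexField.Normc.normcM !normc_real.
  rewrite (ger0_norm (powR_ge0 _ _)) (ger0_norm _) ?subr_ge0//.
  rewrite /l [(1 + n) * _]mulrDl mul1r [leRHS]mulrDl; apply: lerD; first by rewrite ler_wpM2r// normc_ge0.
  apply: le_trans (Hn _ _ (normc_ge0 z') z'z) _.
  have tri : normc z - normc z' <= normc (z - z').
    by rewrite lerBlDr; apply: le_trans (normc_le_add _ _); rewrite subrK.
  by apply: ler_pM => //; rewrite ?subr_ge0// ?mulr_ge0 ?powR_ge0// ler_wpM2l.
exists (normc (1 +i* delta) * l + 1); first by rewrite ltr_wpDl// mulr_ge0// normc_ge0.
move=> z z' zM z'M; rewrite /nonlinearity -!mulrA -mulrBr ComplexField.Normc.normcM.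
rewrite mulrDl mul1r ler_wpDr ?normc_ge0// -mulrA ler_wpM2l ?normc_ge0//.
have [zz|zz] := leP (normc z') (normc z); first exact: key.
rewrite -normc_opp opprB -[in leRHS]normc_opp opprB; apply: key => //; exact: ltW.
Qed.

Lemma normc_nonlinearity_le M z : normc z <= M ->
  normc (nonlinearity delta p z) <= normc (1 +i* delta) * (M `^ (p - 1) * M).
Proof.
move=> zM; rewrite /nonlinearity -mulrA !ComplexField.Normc.normcM normc_real ler_wpM2l ?normc_ge0//.
rewrite ger0_norm ?powR_ge0//; apply: ler_pM; rewrite ?powR_ge0 ?normc_ge0//.
by apply: powR_mono; rewrite ?normc_ge0// subr_ge0 ltW.
Qed.

End ComplexNonlinearity.

Section Gronwall.
Context {R : realType}.
Notation mu := (@lebesgue_measure R).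
Implicit Types (h s t x y b B L : R).

Lemma halving_zero (a K : R) : 0 <= a -> (forall n, a <= K / 2 ^+ n) -> a = 0.
Proof.
move=> a0 H; apply/eqP; rewrite eq_le a0 andbT; apply: (@half_pow_le _ a 0 K) => n.
by rewrite add0r exprVn; exact: H.
Qed.

Lemma small_step (u v : R) : 0 <= u -> 0 <= v -> exists2 h : R, 0 < h & u * h <= 2^-1 /\ v * (2 * h) <= 2^-1.
Proof.
move=> u0 v0; have den : 0 < 2 * u + 4 * v + 1 by lra.
exists (2 * u + 4 * v + 1)^-1; first by rewrite invr_gt0.
by split; rewrite ?mulrA ler_pdivrMr//; lra.
Qed.

(* On a short time step, any bound on [w] can be halved. *)
Lemma gronwall_zero (w : bool -> R -> R -> R) (g : bool -> R * R -> R) t1 B L :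
  0 <= B -> 0 <= L -> (forall i, measurable_fun setT (g i)) ->
  (forall i s y, 0 < s < t1 -> `|g i (s, y)| <= B) ->
  (forall i t x, 0 < t <= t1 -> w i t x = Duh 0 (g i) t x) ->
  (forall i s y b, 0 < s <= t1 -> (forall j, `|w j s y| <= b) -> `|g i (s, y)| <= L * b) ->
  forall i t x, 0 < t <= t1 -> w i t x = 0.
Proof.
move=> B0 L0 mg gB wE gw.
have [c c0 Hc] := @Duh_le R 0 isT; have [d d0 Hd] := @Duht_le R 0 isT.
have e1 : 1 - 0%:R / 2 = 1 :> R by rewrite mul0r subr0.
have {}Hc (f : R * R -> R) t (M : R) x : 0 < t -> measurable_fun setT f -> 0 <= M -> (forall s y, 0 < s < t -> `|f (s, y)| <= M) ->
    `|Duh 0 f t x| <= c * M * t.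
  by move=> t0 mf M0 fM; have := Hc f t M x t0 mf M0 fM; rewrite e1 powRr1 ?(ltW t0).
have {}Hd (f : R * R -> R) t h (M : R) x : 0 < t -> 0 < h -> measurable_fun setT f -> 0 <= M ->
    (forall s y, 0 < s < t + h -> `|f (s, y)| <= M) -> `|\int[mu]_s Duht 0 f t h x s| <= d * M * (2 * h).
  by move=> t0 h0 mf M0 fM; have := Hd f t h M x t0 h0 mf M0 fM; rewrite e1 powRr1 ?mulr_ge0 ?(ltW h0).
have cL : 0 <= c * L by rewrite mulr_ge0 ?(ltW c0).
have dL : 0 <= d * L by rewrite mulr_ge0 ?(ltW d0).
have [h h0 [h1 h2]] := small_step cL dL.
(* Vanishing is propagated over intervals of fixed length h, chosen by [small_step] so that both the
   first interval and each later one halve the bound. *)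
have ind j i t x : 0 < t <= t1 -> t <= h * j%:R -> w i t x = 0.
  elim: j i t x => [|j IH] i t x tt tj.
    by have /andP[t0 _] := tt; have := lt_le_trans t0 tj; rewrite mulr0 ltxx.
  have half b : 0 <= b -> (forall i t x, 0 < t <= t1 -> t <= h * j.+1%:R -> `|w i t x| <= b) ->
      forall i t x, 0 < t <= t1 -> t <= h * j.+1%:R -> `|w i t x| <= b / 2.
    move=> b0 Hb i' t' x' tt' tj'; have /andP[t0' t1'] := tt'.
    have gb s y : 0 < s < t' -> `|g i' (s, y)| <= L * b.
      move=> /andP[s0 st]; apply: gw; first by rewrite s0 (le_trans (ltW st)).
      by move=> i2; apply: Hb; [rewrite s0 (le_trans (ltW st))|exact: le_trans (ltW st) tj'].
    have Lb : 0 <= L * b by rewrite mulr_ge0.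
    have [tle|tgt] := leP t' (h * j%:R); first by rewrite IH// normr0 divr_ge0.
    have [j0|j0] := posnP j.
      rewrite wE//; apply: le_trans (Hc (g i') t' _ x' t0' (mg i') Lb gb) _.
      rewrite j0 mulr1 in tj';
      have -> : c * (L * b) * t' = b * (c * L * t') by ring.
      rewrite ler_wpM2l//; apply: le_trans h1.
      by rewrite ler_wpM2l.
    set s := h * j%:R; have s0 : 0 < s by rewrite mulr_gt0// ltr0n.
    set e := t' - s; have e0 : 0 < e by rewrite subr_gt0.
    have te : t' = s + e by rewrite /e subrKC.
    have eh : e <= h by rewrite /e lerBlDl; apply: le_trans tj' _; rewrite /s -natr1 mulrDr mulr1.
    rewrite wE// te; rewrite te in gb.
    rewrite (Duh_step x' (isT : (0 <= 1)%N) s0 e0 (mg i') Lb gb).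
    have -> : \int[mu]_z (heat_kernel e (x' - z) * Duh 0 (g i') s z) = 0.
      have st1 : 0 < s <= t1 by rewrite s0 (le_trans (ltW tgt)).
      by rewrite -[RHS](Ht_cst 0 x' e0); apply: eq_Rintegral => z _; rewrite -wE// IH.
    rewrite add0r; apply: le_trans (Hd (g i') s e _ x' s0 e0 (mg i') Lb gb) _.
    have -> : d * (L * b) * (2 * e) = b * (d * L * (2 * e)) by ring.
    rewrite ler_wpM2l//; apply: le_trans h2; rewrite ler_wpM2l// ler_wpM2l//.
  have K0 : 0 <= c * B * t1.
    by rewrite !mulr_ge0 ?(ltW c0)//; case/andP: tt => /ltW /le_trans h3 /h3.
  have all n i' t' x' : 0 < t' <= t1 -> t' <= h * j.+1%:R -> `|w i' t' x'| <= c * B * t1 / 2 ^+ n.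
    elim: n i' t' x' => [|n IHn] i' t' x' tt' tj'.
      have /andP[t0' t1'] := tt'; rewrite expr0 divr1 wE//.
      have gB' s y : 0 < s < t' -> `|g i' (s, y)| <= B.
        by move=> /andP[s0 st]; apply: gB; rewrite s0 (lt_le_trans st).
      apply: le_trans (Hc (g i') t' B x' t0' (mg i') B0 gB') _.
      by rewrite ler_wpM2l// mulr_ge0// ltW.
    by rewrite exprSr invfM mulrA; apply: half => //; rewrite divr_ge0// exprn_ge0.
  by apply/eqP; rewrite -normr_eq0; apply/eqP; apply: halving_zero => // n; apply: all.
move=> i t x tt; apply: (ind (Num.truncn (t / h)).+1 i t x tt).
by rewrite mulrC -ler_pdivrMr// ltW// truncnS_gt.
Qed.

End Gronwall.

(** * Uniqueness of mild solutions *)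

Section Uniqueness.
Context {R : realType}.
Notation mu := (@lebesgue_measure R).
Notation normc := ComplexField.Normc.normc.
Implicit Types (h s t x y M K C : R).

Definition part (i : bool) (z : R[i]) : R := if i then complex.Re z else complex.Im z.

Lemma partB i (a b : R[i]) : part i (a - b) = part i a - part i b.
Proof. by case: i; case: a b => [a b] [c d]. Qed.

Lemma part_le i (a : R[i]) : `|part i a| <= normc a.
Proof. by case: i; [exact: Re_le_normc|exact: Im_le_normc]. Qed.

Lemma normc_le_parts (a : R[i]) : normc a <= `|part true a| + `|part false a|.
Proof. exact: normc_le_ReIm. Qed.

Lemma normcE (a : R[i]) : normc a = Num.sqrt (part true a ^+ 2 + part false a ^+ 2).
Proof. by case: a. Qed.

Lemma part_nonlinearity de p (z : R[i]) i : part i (nonlinearity de p z) =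
  normc z `^ (p - 1) * (if i then complex.Re z - de * complex.Im z else complex.Im z + de * complex.Re z).
Proof.
rewrite /nonlinearity; move: (_ `^ _) => w; case: i; case: z => a b /=; ring.
Qed.

Lemma measurable_normc d (X : measurableType d) (D : set X) (f : X -> R[i]) : cmeasurable D f -> measurable_fun D (fun x : X => normc (f x)).
Proof.
move=> [m1 m2]; under eq_fun do rewrite normcE -powR12_sqrt ?addr_ge0 ?sqr_ge0//.
by apply: (measurableT_comp (measurable_powR _)); apply: measurable_funD; apply: measurable_funX.
Qed.

Lemma measurable_part_nonlinearity de p d (X : measurableType d) (D : set X) (f : X -> R[i]) i : cmeasurable D f ->
  measurable_fun D (fun x : X => part i (nonlinearity de p (f x))).
Proof.
move=> mf; have [m1 m2] := mf; under eq_fun do rewrite part_nonlinearity.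
apply: measurable_funM.
  by apply: (measurableT_comp (measurable_powR _)); exact: measurable_normc.
by case: i; [apply: measurable_funB|apply: measurable_funD] => //; apply: measurable_funM.
Qed.

Lemma measurable_strip (f : R * R -> R) (T : \bar R) t1 :
  measurable_fun [set z : R * R | 0 <= z.1 /\ (z.1%:E < T)%E] f -> (t1%:E <= T)%E ->
  measurable_fun setT (fun z : R * R => if 0 < z.1 < t1 then f z else 0).
Proof.
move=> mf tT; pose D := [set z : R * R | 0 < z.1 < t1].
have mD : measurable D.
  rewrite (_ : D = setT `&` (fun z : R * R => (0 < z.1) && (z.1 < t1)) @^-1` [set true]).
    have m1 : measurable_fun setT (fun z : R * R => z.1) by exact: measurable_fst.
    by apply: (measurable_and (measurable_fun_ltr _ m1) (measurable_fun_ltr m1 _)).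
  by rewrite setTI; apply/seteqP; split.
rewrite (_ : (fun z => _) = f \_ D); last first.
  apply/funext => z; rewrite patchE; case: ifP => h.
    by rewrite mem_set.
  by rewrite memNset// /D/= h.
apply/(measurable_restrictT _ mD).
apply: (measurable_funS _ _ mf); last first.
  move=> z /= /andP[z0 z1]; split; first exact: ltW.
  by apply: lt_le_trans tT; rewrite lte_fin.
rewrite (_ : [set z : R * R | _] = (fun z : R * R => z.1) @^-1` [set t | 0 <= t /\ (t%:E < T)%E])//.
rewrite -[X in measurable X]setTI; apply: measurable_fst => //.
case: T {tT mf} => [T| |].
- rewrite (_ : [set t | _] = `[0, T[%classic); first exact: measurable_itv.
  by apply/seteqP; split => t /=; rewrite in_itv/= lte_fin; [case=> -> ->|move=> /andP[]].
- rewrite (_ : [set t | _] = `[0, +oo[%classic); first exact: measurable_itv.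
  by apply/seteqP; split => t /=; rewrite in_itv/= andbT ltry; [case|].
- rewrite (_ : [set t | _] = set0); first exact: measurable0.
  by apply/seteqP; split => t //= [_]; rewrite ltNge leNye.
Qed.

Lemma ae_mono2 (P Q S : R -> Prop) : (forall y, P y -> Q y -> S y) ->
  (\forall y \ae mu, P y) -> (\forall y \ae mu, Q y) -> \forall y \ae mu, S y.
Proof.
move=> PQS aP aQ; apply: (negligibleS _ (negligibleU aP aQ)) => y /= nS.
by have [Py|nP] := pselect (P y); [right => Qy; apply/nS/PQS|left].
Qed.

Lemma eq_Sk_ae h (f g : R -> R) x : 0 < h -> measurable_fun setT f -> measurable_fun setT g ->
  (\forall y \ae mu, f y = g y) -> Sk 0 h f x = Sk 0 h g x.
Proof.
move=> h0 mf mg fg; rewrite /Sk /Rintegral; congr fine.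
have mG : measurable_fun setT (fun y => gk 0 h (x - y)).
  by apply: measurable_gk => //; exact: measurable_funB.
apply: ae_eq_integral => //; try by apply/measurable_EFinP; apply: measurable_funM.
case: fg => N [mN N0 sN]; exists N; split => // y /= nE; apply: sN => /= E; apply: nE => _; by rewrite E.
Qed.

(** A mild solution is only essentially bounded at each time; this permits changing the source on a
    null set of every time slice. *)
Lemma eq_Duh_ae (f g : R * R -> R) t x : measurable_fun setT f -> measurable_fun setT g ->
  (forall s, 0 < s < t -> \forall y \ae mu, f (s, y) = g (s, y)) -> Duh 0 f t x = Duh 0 g t x.
Proof.
move=> mf mg fg; apply: eq_Rintegral => s _; case: ifP => // st; have /andP[s0 s1] := st.
by apply: eq_Sk_ae; rewrite ?subr_gt0//; [exact: measurable_slice|exact: measurable_slice|exact: fg].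
Qed.

Lemma DuhB (f g : R * R -> R) t x M : 0 < t -> 0 <= M -> measurable_fun setT f -> measurable_fun setT g ->
  (forall s y, 0 < s < t -> `|f (s, y)| <= M) -> (forall s y, 0 < s < t -> `|g (s, y)| <= M) ->
  Duh 0 (fun z => f z - g z) t x = Duh 0 f t x - Duh 0 g t x.
Proof.
move=> t0 M0 mf mg fM gM; rewrite !DuhE -IntB; last 2 first.
- exact: (Duhk_itg x (isT : (0 <= 1)%N) t0 mf (lexx 0) M0 fM).
- exact: (Duhk_itg x (isT : (0 <= 1)%N) t0 mg (lexx 0) M0 gM).
apply: eq_Rintegral => s _; rewrite /Duhk; case: ifP => [st|_]; last by rewrite subr0.
have /andP[s0 s1] := st; rewrite addr0.
rewrite (SkB _ _ _ (measurable_slice s mf) (measurable_slice s mg) (fM s ^~ st) (gM s ^~ st))//.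
by rewrite subr_gt0.
Qed.

Lemma part_duhamel de p (u0 : R -> R[i]) (Tm : \bar R) (u : R -> R -> R[i]) i t x : mild_solution de p u0 Tm u ->
  0 < t -> (t%:E < Tm)%E -> part i (u t x) = part i (heat_semigroup t u0 x) +
     Duh 0 (fun z => part i (nonlinearity de p (u z.1 z.2))) t x.
Proof.
move=> [_ _ _ _ E] t0 tT; rewrite E// duhamel_termE.
by case: i; case: (heat_semigroup _ _ _).
Qed.

(* The nonlinearities are set to 0 on the null sets where [u] or [v] exceeds its
   essential bound. *)
Lemma mild_unique de p (u0 : R -> R[i]) (T1 T2 : \bar R) (u v : R -> R -> R[i]) : 1 < p ->
  mild_solution de p u0 T1 u -> mild_solution de p u0 T2 v ->
  forall t x, 0 <= t -> (t%:E < T1)%E -> (t%:E < T2)%E -> v t x = u t x.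
Proof.
move=> p1 su sv t1 x; rewrite le_eqVlt => /predU1P[<-|t10] tT1 tT2.
  by have [_ _ _ -> _] := su; have [_ _ _ -> _] := sv.
have [_ [mu1 mu2] bu _ _] := su; have [_ [mv1 mv2] bv _ _] := sv.
have [M1 HM1] := bu t1 (ltW t10) tT1; have [M2 HM2] := bv t1 (ltW t10) tT2.
pose M := `|M1| + `|M2|; have M0 : 0 <= M by rewrite addr_ge0.
have M1M : M1 <= M by apply: le_trans (ler_norm _) _; rewrite lerDl.
have M2M : M2 <= M by apply: le_trans (ler_norm _) _; rewrite lerDr.
(* Extension by 0 outside ]0, t1[: mild solutions are measurable on their strip, whereas the Duhamel
   estimates ask for sources measurable on the whole plane. *)
pose uu (z : R * R) : R[i] := (if 0 < z.1 < t1 then complex.Re (u z.1 z.2) else 0) +i* (if 0 < z.1 < t1 then complex.Im (u z.1 z.2) else 0).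
pose vv (z : R * R) : R[i] := (if 0 < z.1 < t1 then complex.Re (v z.1 z.2) else 0) +i* (if 0 < z.1 < t1 then complex.Im (v z.1 z.2) else 0).
have uE s y : 0 < s < t1 -> uu (s, y) = u s y by move=> st; rewrite /uu /= st; case: (u s y).
have vE s y : 0 < s < t1 -> vv (s, y) = v s y by move=> st; rewrite /vv /= st; case: (v s y).
have mU : cmeasurable setT uu by split; apply: (measurable_strip _ (ltW tT1)).
have mV : cmeasurable setT vv by split; apply: (measurable_strip _ (ltW tT2)).
pose good z := (normc (uu z) <= M) && (normc (vv z) <= M).
have mgood : measurable_fun setT good.
  by apply: measurable_and; apply: measurable_fun_ler => //; exact: measurable_normc.
pose gu i z := if good z then part i (nonlinearity de p (uu z)) else 0.
pose gv i z := if good z then part i (nonlinearity de p (vv z)) else 0.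
have mgu i : measurable_fun setT (gu i).
  by apply: measurable_fun_ifT => //; exact: measurable_part_nonlinearity.
have mgv i : measurable_fun setT (gv i).
  by apply: measurable_fun_ifT => //; exact: measurable_part_nonlinearity.
pose B := normc (1 +i* de) * (M `^ (p - 1) * M).
have B0 : 0 <= B by rewrite mulr_ge0 ?normc_ge0// mulr_ge0 ?powR_ge0.
have guB i z : `|gu i z| <= B.
  rewrite /gu; case: ifP => [/andP[h _]|_]; last by rewrite normr0.
  by apply: le_trans (part_le _ _) _; exact: normc_nonlinearity_le.
have gvB i z : `|gv i z| <= B.
  rewrite /gv; case: ifP => [/andP[_ h]|_]; last by rewrite normr0.
  by apply: le_trans (part_le _ _) _; exact: normc_nonlinearity_le.
have aegood s : 0 < s < t1 -> \forall y \ae mu, good (s, y).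
  move=> st; have st' : 0 <= s <= t1 by case/andP: st => /ltW -> /ltW ->.
  have [_ h1] := HM1 s st'; have [_ h2] := HM2 s st'.
  have a1 := Linfty_norm_ae (le_trans h1 (_ : (M1%:E <= M%:E)%E)).
  have a2 := Linfty_norm_ae (le_trans h2 (_ : (M2%:E <= M%:E)%E)).
  apply: ae_mono2 (a1 M1M) (a2 M2M) => y b1 b2.
  by rewrite /good uE// vE// b1 b2.
have DU i t y : 0 < t <= t1 -> Duh 0 (fun z => part i (nonlinearity de p (u z.1 z.2))) t y = Duh 0 (gu i) t y.
  move=> /andP[t0 tt].
  have stt s : 0 < s < t -> 0 < s < t1 by move=> /andP[-> h]; rewrite (lt_le_trans h).
  rewrite (@eq_Duh _ _ _ (fun z => part i (nonlinearity de p (uu z)))); last first.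
    by move=> s y' st; rewrite uE//; exact: stt.
  apply: eq_Duh_ae => //; first exact: measurable_part_nonlinearity.
  by move=> s st; apply: ae_mono2 (aegood s (stt s st)) (aegood s (stt s st)) => y' gd _; rewrite /gu gd.
have DV i t y : 0 < t <= t1 -> Duh 0 (fun z => part i (nonlinearity de p (v z.1 z.2))) t y = Duh 0 (gv i) t y.
  move=> /andP[t0 tt].
  have stt s : 0 < s < t -> 0 < s < t1 by move=> /andP[-> h]; rewrite (lt_le_trans h).
  rewrite (@eq_Duh _ _ _ (fun z => part i (nonlinearity de p (vv z)))); last first.
    by move=> s y' st; rewrite vE//; exact: stt.
  apply: eq_Duh_ae => //; first exact: measurable_part_nonlinearity.
  by move=> s st; apply: ae_mono2 (aegood s (stt s st)) (aegood s (stt s st)) => y' gd _; rewrite /gv gd.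
have [L L0 HL] := nonlinearity_lipschitz de p1 M0.
pose w i t y := part i (u t y - v t y).
have key i t y : 0 < t <= t1 -> w i t y = 0.
  apply: (@gronwall_zero _ w (fun i z => gu i z - gv i z) t1 (B + B) (L * 2)).
  - by rewrite addr_ge0.
  - by rewrite mulr_ge0// ltW.
  - by move=> j; apply: measurable_funB.
  - by move=> j s z _; apply: le_trans (ler_normB _ _) _; rewrite lerD.
  - move=> j s z st; have /andP[s0 st1] := st.
    have sT1 : (s%:E < T1)%E by apply: le_lt_trans tT1; rewrite lee_fin.
    have sT2 : (s%:E < T2)%E by apply: le_lt_trans tT2; rewrite lee_fin.
    rewrite (@DuhB (gu j) (gv j) s z B)//.
    rewrite /w partB (part_duhamel _ _ su)// (part_duhamel _ _ sv)// DU// DV//.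
    by rewrite opprD addrACA subrr add0r.
  - move=> j s z b /andP[s0 st1] Hb; have b0 : 0 <= b by exact: le_trans (normr_ge0 _) (Hb true).
    have Lb : 0 <= L * 2 * b by rewrite mulr_ge0// mulr_ge0// ltW.
    rewrite /gu /gv; case: ifP => [/andP[h1 h2]|_]; last by rewrite subrr normr0.
    move: st1; rewrite le_eqVlt => /predU1P[st1|st1].
      by rewrite /uu /vv /= st1 ltxx andbF subrr normr0.
    rewrite -partB; apply: le_trans (part_le _ _) _; apply: le_trans (HL _ _ h1 h2) _.
    rewrite -mulrA ler_wpM2l ?(ltW L0)// uE ?s0// vE ?s0//.
    apply: le_trans (normc_le_parts _) _; rewrite mulr_natl mulr2n; apply: lerD; [exact: (Hb true)|exact: (Hb false)].
have t11 : 0 < t1 <= t1 by rewrite t10 lexx.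
have k1 := key true t1 x t11; have k2 := key false t1 x t11.
apply/esym/eqP; rewrite -subr_eq0; apply/eqP; exact: eq_complex_parts.
Qed.

End Uniqueness.

(** * Blow-up and profile *)

Section ComplexSolution.
Context {R : realType}.
Notation normc := ComplexField.Normc.normc.
Implicit Types (h s t x y M K C : R).
Context (p b0 de : R) (k : nat) (p1 : 1 < p) (b00 : 0 < b0) (k2 : (2 <= k)%N).
Context (T Af c0 C0 : R) (f1 f2 : R * R -> R) (sol : is_solution p b0 de k T Af c0 C0 f1 f2).

Definition solution t x : R[i] := Uf p b0 de k T f1 f2 1 0 t x +i* Uf p b0 de k T f1 f2 0 1 t x.

Let al := (p - 1)^-1.
Let r t x := rho p b0 k T 0 f1 t x.
Let a t x := phi k T 0 f2 t x.

Lemma al_gt0 : 0 < al. Proof. by rewrite invr_gt0 subr_gt0. Qed.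

Lemma normc_solution t x : normc (solution t x) = expR (- al * ln (r t x)).
Proof.
rewrite /solution /Uf /Qf /= !mul1r !mul0r add0r addr0 add0r -/(r t x) -/(a t x) -/al !exprMn -mulrDr cos2Dsin2 mulr1.
by rewrite sqrtr_sqr ger0_norm// expR_ge0.
Qed.

Lemma rho_bounds t x : 0 <= t < T -> c0 * DD k x (T - t) <= r t x <= C0 * DD k x (T - t).
Proof. by move=> tT; have [_ [_ [_ _ _ _ [bnd _]]]] := sol; have [] := bnd t x tT. Qed.

Lemma rho_gt0 t x : 0 <= t < T -> 0 < r t x.
Proof.
move=> tT; have /andP[h _] := rho_bounds x tT; apply: lt_le_trans h.
have [_ [[_ c00 _] _]] := sol; rewrite mulr_gt0// DD_gt0// subr_gt0.
by case/andP: tT.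
Qed.

(** |u|^(p-1) = 1 / rho: with real exponent - 1 / (p - 1), the nonlinearity just raises n from 0 to
    1 and multiplies by 1 + i de. *)
Lemma solution_nonlinearity t x : 0 <= t < T ->
  nonlinearity de p (solution t x) = Ff p b0 de k T f1 f2 1 0 (t, x) +i* Ff p b0 de k T f1 f2 0 1 (t, x).
Proof.
move=> tT; have r0 := rho_gt0 x tT.
have w : normc (solution t x) `^ (p - 1) = (r t x)^-1.
  rewrite normc_solution /powR gt_eqF ?expR_gt0// expRK mulrA mulrN mulfV ?gt_eqF ?subr_gt0//.
  by rewrite mulN1r expRN lnK.
have E i := part_nonlinearity de p (solution t x) i; rewrite w in E.
apply: eq_complex_parts; [have := E true|have := E false]; rewrite /part => ->;
  rewrite /solution /Ff /Uf /= Qf_shift -/(r t x)//; congr (_ * _); rewrite /Qf; ring.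
Qed.

Lemma solution_bounded t1 : t1 < T -> exists M : R, forall t x, 0 <= t <= t1 -> normc (solution t x) <= M.
Proof.
move=> t1T; have [[T0 _ _] [[_ c00 _] _]] := sol.
have m0 : 0 < c0 * (T - t1) by rewrite mulr_gt0// subr_gt0.
exists (expR (- al * ln (c0 * (T - t1)))) => t x tt.
have h := sol_lower sol x tt t1T.
rewrite normc_solution ler_expR !mulNr lerN2 ler_wpM2l ?(ltW al_gt0)//.
by rewrite ler_ln ?posrE//; exact: lt_le_trans h.
Qed.

Lemma cmeasurable_solution t : cmeasurable setT (solution t).
Proof. by split; exact: (measurable_Uf_slice sol). Qed.

Lemma solution_in_Linfty t : 0 <= t < T -> in_Linfty (solution t).
Proof.
move=> /andP[t0 tT]; split; first exact: cmeasurable_solution.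
have [M HM] := solution_bounded tT.
apply: le_lt_trans (ltry M); apply: Linfty_norm_le => x; apply: HM.
by rewrite t0 lexx.
Qed.

Lemma add_complexE (u v w z : R) : (u +i* v) + (w +i* z) = (u + w) +i* (v + z) :> R[i].
Proof. by []. Qed.

Lemma solution_mild : mild_solution de p (solution 0) T%:E solution.
Proof.
have [[T0 _ _] _] := sol; split => //.
- by split; apply: measurable_funTS; exact: (measurable_Uf sol).
- move=> t1 t10 t1T; rewrite lte_fin in t1T; have [M HM] := solution_bounded t1T.
  exists M => t tt; split; last by apply: Linfty_norm_le => x; exact: HM.
  by apply: solution_in_Linfty; case/andP: tt => -> h; exact: le_lt_trans t1T.
- move=> t x t0; rewrite lte_fin => tT; have tt : 0 < t < T by rewrite t0.
  have st s : 0 < s < t -> 0 <= s < T by move=> /andP[s0 st]; rewrite (ltW s0)/= (lt_trans st).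
  rewrite heat_semigroupE duhamel_termE.
  rewrite (@eq_Duh _ 0 _ (Ff p b0 de k T f1 f2 1 0)); last by move=> s y /st sT; rewrite solution_nonlinearity.
  rewrite [X in _ + (_ +i* X)](@eq_Duh _ 0 _ (Ff p b0 de k T f1 f2 0 1)); last by move=> s y /st sT; rewrite solution_nonlinearity.
  rewrite add_complexE {1}/solution.
  by rewrite (Uf_duhamel p1 k2 sol 1 0 x tt) (Uf_duhamel p1 k2 sol 0 1 x tt).
Qed.

Lemma DD_le_sqrt x w : (0 < k)%N -> 0 < w <= 1 -> `|x| <= Num.sqrt w -> DD k x w <= 3 * Num.sqrt w.
Proof.
move=> k0 /andP[w0 w1] xw; rewrite /DD.
have s0 : 0 <= Num.sqrt w by exact: sqrtr_ge0.
have ws : w <= Num.sqrt w.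
  rewrite -[leLHS]sqr_sqrtr ?(ltW w0)// expr2 ler_piMl// -[leRHS]sqrtr1 ler_wsqrtr//.
have q : qd x w ^+ (2 * k) <= qd x w.
  by rewrite -[leRHS]expr1 ler_wiXn2l ?qd_ge0 ?qd_le1// muln_gt0.
have q2 : qd x w <= 2 * Num.sqrt w.
  by rewrite /qd ge_min; apply/orP; left; rewrite mulr_natl mulr2n lerD2r.
by apply: le_trans (lerD ws (le_trans q q2)) _; lra.
Qed.

(** On the parabola |x| <= sqrt (T - t) one has D <= 3 sqrt (T - t), so [rho] is uniformly small
    there. A whole interval of x is needed for the essential norm, and x = 0 for the blow-up
    point. *)
Lemma solution_large A : exists2 e : R, 0 < e & forall t x, 0 <= t < T -> T - t < e -> `|x| <= Num.sqrt (T - t) ->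
  A <= normc (solution t x).
Proof.
have [[T0 T2 _] [[_ c00 C00] _]] := sol.
(* [m] is chosen so that C0 times 3 m equals B^(- (p - 1)), the value of [rho] at which |u| = B; the
   maximum with 1 makes the logarithm meaningful. *)
pose B := Num.max A 1; have B0 : 0 < B by rewrite lt_max ltr01 orbT.
pose m := expR (- (p - 1) * ln B) / (3 * C0); have m0 : 0 < m by rewrite divr_gt0 ?expR_gt0 ?mulr_gt0.
exists (m ^+ 2) => [|t x tT te xt]; first exact: exprn_gt0.
apply: (@le_trans _ _ B); first by rewrite le_max lexx.
have /andP[t0 tT'] := tT.
have w1 : 0 < T - t <= 1 by rewrite subr_gt0 tT'/=; lra.
have /andP[_ h] := rho_bounds x tT.
have sm : Num.sqrt (T - t) <= m.
  by rewrite -[leRHS](ger0_norm (ltW m0)) -sqrtr_sqr ler_wsqrtr// ltW.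
have hr : r t x <= expR (- (p - 1) * ln B).
  apply: le_trans h _; apply: (@le_trans _ _ (C0 * (3 * m))).
    rewrite ler_wpM2l ?(ltW C00)//; apply: le_trans (DD_le_sqrt _ w1 xt) _; first exact: ltnW.
    by rewrite ler_wpM2l.
  by rewrite /m mulrCA mulrA mulrCA divff ?mulr1// gt_eqF// mulr_gt0.
rewrite normc_solution -[leLHS]lnK ?posrE// ler_expR mulNr lerNr.
have := @ler_wpM2l _ al (ltW al_gt0) (ln (r t x)) (- (p - 1) * ln B).
rewrite -[X in ln _ <= X](expRK) ler_ln ?posrE ?expR_gt0 ?rho_gt0// => /(_ hr) /le_trans; apply.
by rewrite mulNr mulrN mulrA mulVf ?mul1r// gt_eqF// subr_gt0.
Qed.

(** At distance at least |y| / 2 from the origin the term q^(2k) keeps [rho] away from 0, uniformly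
    up to T. *)
Lemma solution_away y : y != 0 -> exists B : R, forall t x, 0 <= t < T -> `|y - x| < `|y| / 2 -> normc (solution t x) <= B.
Proof.
move=> y0; have [[T0 T2 _] [[_ c00 C00] _]] := sol.
have yp : 0 < `|y| / 2 by rewrite divr_gt0// normr_gt0.
pose q := Num.min (`|y| / 2) 1; have q0 : 0 < q by rewrite lt_min yp ltr01.
pose m := c0 * q ^+ (2 * k); have m0 : 0 < m by rewrite mulr_gt0// exprn_gt0.
exists (expR (- al * ln m)) => t x tT yx.
have /andP[h _] := rho_bounds x tT; have /andP[t0 tT'] := tT.
rewrite normc_solution ler_expR !mulNr lerN2 ler_wpM2l ?(ltW al_gt0)//.
rewrite ler_ln ?posrE ?rho_gt0//; apply: le_trans h; rewrite ler_wpM2l ?(ltW c00)//.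
rewrite /DD ler_wpDl ?subr_ge0 ?(ltW tT')//.
rewrite lerXn2r ?nnegrE ?qd_ge0 ?(ltW q0)//.
rewrite /q /qd le_min !ge_min lexx orbT andbT.
apply/orP; left; apply: ler_wpDr; first exact: sqrtr_ge0.
have := ler_distD x y 0; rewrite !subr0 => hh.
move: yx hh; move: `|y| `|x| `|y - x| => u v w; lra.
Qed.

Lemma solution_blows_up : blows_up_at_time de p (solution 0) T solution.
Proof.
have [[T0 T2 _] _] := sol.
have cv : Linfty_norm (solution t) @[t --> T^'-] --> +oo%E.
  apply/cvgeyPge => A; have [e e0 H] := solution_large A.
  near=> t.
  have t0 : 0 < t by near: t; exact: nbhs_left_gt.
  have tT : t < T by near: t; exact: nbhs_left_lt.
  have te : T - e < t by near: t; apply: nbhs_left_gt; rewrite ltrBlDr ltrDl.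
  have s0 : 0 < Num.sqrt (T - t) by rewrite sqrtr_gt0 subr_gt0.
  apply: (@Linfty_norm_ge _ _ 0 (Num.sqrt (T - t))) => // x /andP[x0 xs].
  apply: H; rewrite ?(ltW t0)//; first by rewrite ltrBlDr addrC -ltrBlDr.
  by rewrite ger0_norm ?ltW.
split=> //; split; first exact: solution_mild.
move=> T' v mv; have uq := mild_unique p1 solution_mild mv.
have T'T : (T' <= T%:E)%E.
  rewrite leNgt; apply/negP => TT'.
  have [_ _ bv _ _] := mv; have [M HM] := bv T (ltW T0) TT'.
  have [e e0 H] := solution_large (M + 1).
  pose t := Num.max (T / 2) (T - e / 2).
  have tT : t < T.
    by rewrite gt_max ltr_pdivrMr// mulr2n mulrDr mulr1 ltrDl T0/= ltrBlDr ltrDl divr_gt0.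
  have t0 : 0 < t by rewrite lt_max divr_gt0.
  have te : T - t < e.
    have : T - e / 2 <= t by rewrite le_max lexx orbT.
    by move=> h; rewrite ltrBlDr -ltrBlDl; apply: lt_le_trans h; rewrite ltrD2l ltrN2 ltr_pdivrMr// mulr2n mulrDr mulr1 ltrDl.
  have s0 : 0 < Num.sqrt (T - t) by rewrite sqrtr_gt0 subr_gt0.
  have tT' : 0 <= t < T by rewrite ltW.
  have tTT : 0 <= t <= T by rewrite !ltW.
  have [_ h] := HM t tTT.
  have h1 : ((M + 1)%:E <= Linfty_norm (v t))%E.
    apply: (@Linfty_norm_ge _ _ 0 (Num.sqrt (T - t))) => // x /andP[x0 xs].
    rewrite uq ?(ltW t0)//; last by apply: lt_trans TT'; rewrite lte_fin.
    by apply: H => //; rewrite ger0_norm ?ltW.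
  by have := le_trans h1 h; rewrite lee_fin gerDl ler10.
split=> // t x t0 tT'; apply: uq => //; exact: lt_le_trans T'T.
Unshelve. all: by end_near.
Qed.

Lemma solution_blowup_point x0 : blowup_point T solution x0 <-> x0 = 0.
Proof.
have [[T0 T2 _] _] := sol; split.
  move=> [xs [ts [tsT xsx tsc blow]]]; apply/eqP; apply: contraT => x00.
  have [B HB] := solution_away x00.
  have yp : 0 < `|x0| / 2 by rewrite divr_gt0// normr_gt0.
  have h1 : \forall j \near \oo, `|x0 - xs j| < `|x0| / 2 by exact: (@cvgr_dist_lt _ _ _ _ _ _ _ xsx _ yp).
  have h2 : \forall j \near \oo, B + 1 <= normc (solution (ts j) (xs j)) by move/cvgryPge : blow; apply.
  near \oo => j.
  have a1 : `|x0 - xs j| < `|x0| / 2 by near: j.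
  have a2 : B + 1 <= normc (solution (ts j) (xs j)) by near: j.
  by have := le_trans a2 (HB _ _ (tsT j) a1); rewrite gerDl ler10.
(* [harmonic j] is 1 / (j + 1), so the times start at 0 and stay strictly below T. *)
move=> ->; exists (fun=> 0), (fun j => T - T * harmonic j).
have hc : T - T * harmonic j @[j --> \oo] --> T.
  rewrite -[X in _ --> X]subr0 -[X in _ --> _ - X](mulr0 T).
  by apply: cvgB; [exact: cvg_cst|apply: cvgMr; exact: cvg_harmonic].
have tsT j : 0 <= T - T * harmonic j < T.
  have j0 : 0 < (j.+1%:R : R) by rewrite ltr0n.
  rewrite subr_ge0 ltrBlDr ltrDl /= mulr_gt0 ?invr_gt0// andbT.
  by rewrite ler_piMr ?(ltW T0)// invf_le1// ler1n.
split => //; first exact: cvg_cst.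
apply/cvgryPge => A; have [e e0 H] := solution_large A.
have h1 : \forall j \near \oo, `|T - (T - T * harmonic j)| < e by exact: (@cvgr_dist_lt _ _ _ _ _ _ _ hc _ e0).
near=> j; apply: H => //; last by rewrite normr0 sqrtr_ge0.
by apply: le_lt_trans (ler_norm _) _; near: j.
Unshelve. all: by end_near.
Qed.

End ComplexSolution.

Section ComplexExponential.
Context {R : realType}.
Notation normc := ComplexField.Normc.normc.
Implicit Types (x y z w : R).

Lemma cexpE x y : cexp (x +i* y) = (expR x * cos y) +i* (expR x * sin y) :> R[i].
Proof. by rewrite /cexp /=; apply: eq_complex_parts => /=; rewrite mul0r ?subr0 ?addr0. Qed.

Lemma cexpM x y z w : cexp (x +i* y) * cexp (z +i* w) = cexp ((x + z) +i* (y + w)) :> R[i].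
Proof.
rewrite !cexpE expRD cosD sinD; apply: eq_complex_parts => /=; ring.
Qed.

Lemma normc_cexp x y : normc (cexp (x +i* y) : R[i]) = expR x.
Proof.
by rewrite cexpE /= !exprMn -mulrDr cos2Dsin2 mulr1 sqrtr_sqr ger0_norm// expR_ge0.
Qed.

Lemma cpowE (r x y : R) : cpow r (x +i* y) = cexp ((x * ln r) +i* (y * ln r)).
Proof. by rewrite /cpow; congr cexp; apply: eq_complex_parts => /=; rewrite mulr0 ?subr0 ?add0r. Qed.

Lemma exponentE (de p : R) : (1 +i* de) / (p - 1)%:C = (p - 1)^-1 +i* (de * (p - 1)^-1) :> R[i].
Proof.
by rewrite -fmorphV; apply: eq_complex_parts => /=; rewrite mulr0 ?subr0 ?add0r ?mul1r.
Qed.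

End ComplexExponential.

(** * Distance from [rho] and [phi] to their leading terms *)

Section ProfileEstimate.
Context {R : realType}.
Notation normc := ComplexField.Normc.normc.
Implicit Types (h s t x y w M K C : R).

(** With y = x^2 and z = 1 - exp (- y), the ratio z / y lies between 1 - y and 1, and Bernoulli
    bounds 1 - (z / y)^k by k y. *)
Lemma Hc0_near k x : (0 < k)%N -> `|x| <= 1 -> `|Hc k 0 x 0 - x ^+ (2 * k)| <= k%:R * (`|x| ^+ (2 * k) * `|x| ^+ 2).
Proof.
move=> k0 x1; rewrite Hc0E exprM.
have y0 : 0 <= x ^+ 2 by exact: sqr_ge0.
have y1 : x ^+ 2 <= 1 by rewrite -real_normK ?num_real// exprn_ile1.
rewrite exprM real_normK ?num_real//; move: (x ^+ 2) y0 y1 => y y0 y1.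
have h1 := one_expR_ge y0; have h2 := one_expR_le y.
set z := 1 - expR (- y) in h1 h2 *.
have z0 : 0 <= z by rewrite /z subr_ge0 -[leRHS]expR0 ler_expR oppr_le0.
have [y00|yn] := eqVneq y 0.
  have -> : z = 0 by apply/eqP; rewrite eq_le z0 -y00 h2.
  by rewrite y00 subrr normr0 mulr0 mulr0.
have yp : 0 < y by rewrite lt_neqAle eq_sym yn.
have h3 : 1 - z / y <= y.
  have h : y - y ^+ 2 <= y / (1 + y).
    rewrite ler_pdivlMr ?ltr_pwDl//.
    have -> : (y - y ^+ 2) * (1 + y) = y - y ^+ 3 by ring.
    by rewrite gerBl exprn_ge0.
  rewrite lerBlDr -lerBlDl ler_pdivlMr// mulrBl mul1r -expr2.
  exact: le_trans h h1.
have t01 : 0 <= z / y <= 1 by rewrite divr_ge0//= ler_pdivrMr// mul1r.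
have zE : z = z / y * y by rewrite divfK.
have zk : z ^+ k <= y ^+ k by rewrite lerXn2r ?nnegrE.
rewrite ler0_norm ?subr_le0// opprB zE exprMn.
have -> : y ^+ k - (z / y) ^+ k * y ^+ k = y ^+ k * (1 - (z / y) ^+ k) by ring.
rewrite mulrCA ler_wpM2l ?exprn_ge0//; apply: le_trans (bernoulli_le k t01) _.
by rewrite ler_wpM2l.
Qed.

(** The leading term of [rho] is itself comparable from below to [DD]; the constant 2^(2k) splits
    the power of |x| + sqrt w. *)
Lemma DD_le_flat (c d x w : R) k : (0 < k)%N -> 0 < c -> 0 < d -> 0 <= w <= 1 ->
  Num.min c d / (1 + 2 ^+ (2 * k)) * DD k x w <= c * w + d * x ^+ (2 * k).
Proof.
move=> k0 c0 d0 /andP[w0 w1]; have q4 : 0 <= (2 : R) ^+ (2 * k) by rewrite exprn_ge0.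
have m0 : 0 <= Num.min c d by rewrite le_min !ltW.
have x0 : 0 <= x ^+ (2 * k) by rewrite exprM exprn_ge0// sqr_ge0.
apply: (@le_trans _ _ (Num.min c d * (w + x ^+ (2 * k)))).
  rewrite -mulrA ler_wpM2l// mulrC ler_pdivrMr ?ltr_pwDl//.
  apply: (@le_trans _ _ (w + 2 ^+ (2 * k) * (x ^+ (2 * k) + w))).
    rewrite /DD lerD2l; apply: (@le_trans _ _ ((`|x| + Num.sqrt w) ^+ (2 * k))).
      by rewrite lerXn2r ?nnegrE ?qd_ge0 ?addr_ge0 ?sqrtr_ge0// /qd ge_min lexx.
    apply: le_trans (exprD_le (2 * k) (normr_ge0 x) (sqrtr_ge0 w)) _; rewrite ler_wpM2l// [X in X + _]exprM [X in _ + X]exprM sqr_sqrtr//.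
    by rewrite real_normK ?num_real// -exprM lerD2l -[leRHS]expr1 ler_wiXn2l.
  move: q4 x0; move: (2 ^+ (2 * k)) (x ^+ (2 * k)) => u v; nra.
by rewrite mulrDr lerD// ler_wpM2r// ge_min lexx ?orbT.
Qed.

Context (p b0 de : R) (k : nat) (p1 : 1 < p) (b00 : 0 < b0) (k2 : (2 <= k)%N).

(** Relative to the size D of [rho], every error is O(q^(1 - nu)): from the caloric function since 1
    - nu <= 1, from the correction by [LP_bounds]. Bounding T^et by 1 makes the constant independent
    of T. *)
Lemma ansatz_profile Af : 0 <= Af -> exists2 C : R, 0 < C & forall T c0 C0 f1 f2 t x,
  is_solution p b0 de k T Af c0 C0 f1 f2 -> 0 <= t < T -> `|x| <= 1 ->
  `|rho p b0 k T 0 f1 t x - ((p - 1) * (T - t) + b0 * x ^+ (2 * k))| <= C * (DD k x (T - t) * qd x (T - t) `^ (1 - nu k)) /\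
  `|phi k T 0 f2 t x| <= C * qd x (T - t) `^ (1 - nu k).
Proof.
move=> A0; have k0 : (0 < k)%N by exact: ltnW.
have [C1 C10 H1] := @Hc_time R k k0; have [C2 C20 H2] := @LP_bounds R k k2.
have [[/andP[n0 n1] _ _ _] [[/andP[z0 z1] _ _ _] [e0 _ _ _ _]]] := @exponents R k k2.
have C2A : 0 <= C2 * Af by rewrite mulr_ge0// ltW.
pose C := b0 * (C1 + k%:R) + C2 * Af.
exists C => [|T c0 C0 f1 f2 t x sol tT x1].
  by rewrite /C ltr_wpDr// mulr_gt0// addr_gt0// ltr0n.
have [[T0 T2 T8] [_ [mf1 mf2 w1 w2 _]]] := sol; have /andP[t0 tT'] := tT.
set w := T - t; have wp : 0 < w by rewrite subr_gt0.
have wT : w <= T by rewrite /w gerBl.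
have w8 : 0 <= w <= (8 * k%:R)^-1 by rewrite ltW//= (le_trans wT).
have T1 : T <= 1 by apply: le_trans T2 _; rewrite invf_le1// ler1n.
have Tet : T `^ et k <= 1.
  by have := powR_mono (ltW T0) T1 (ltW e0); rewrite powR1.
have T02 : 0 < T <= 2^-1 by rewrite T0.
have [h1 _ h2 _] := H2 T Af f1 f2 t x T02 A0 mf1 mf2 w1 w2 tT; rewrite -/w in h1 h2.
set q := qd x w in h1 h2 *; have q0 : 0 <= q by exact: qd_ge0.
have q1 : q <= 1 by exact: qd_le1.
set Q := q `^ (1 - nu k); have Q0 : 0 <= Q by exact: powR_ge0.
have qQ : q <= Q.
  by rewrite -[leLHS](powRr1 q0) le_powR1 ?q0//; lra.
have D0 := DD_gt0 k x wp; have D00 := ltW D0.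
have qD : q ^+ (2 * k) <= DD k x w by rewrite /DD lerDr ltW.
have wD : w <= DD k x w by rewrite /DD lerDl exprn_ge0.
have c1T u : 0 <= u -> C2 * Af * T `^ et k * u <= C2 * Af * u.
  by move=> u0; rewrite ler_wpM2r// ler_piMr.
have bC : C2 * Af <= C by rewrite /C lerDr mulr_ge0 ?(ltW b00)// addr_ge0// ltW.
split.
- rewrite /rho /base eqxx mul1r.
  have -> : (p - 1) * (T - t) + b0 * Hc k 0 x (T - t) + LP (2 * k) T 0 f1 t x - ((p - 1) * w + b0 * x ^+ (2 * k)) =
    b0 * ((Hc k 0 x w - Hc k 0 x 0) + (Hc k 0 x 0 - x ^+ (2 * k))) + LP (2 * k) T 0 f1 t x.
    by rewrite -/w; move: (LP _ _ _ _ _ _) (Hc k 0 x w) (Hc k 0 x 0) => u v u'; ring.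
  apply: le_trans (ler_normD _ _) _; rewrite /C [leRHS]mulrDl; apply: lerD.
    rewrite normrM (ger0_norm (ltW b00)) -mulrA ler_wpM2l ?(ltW b00)// mulrDl.
    apply: le_trans (ler_normD _ _) _; apply: lerD.
      apply: le_trans (H1 x w w8) _; rewrite -mulrA ler_wpM2l ?(ltW C10)//.
      apply: ler_pM => //; rewrite ?(ltW wp) ?exprn_ge0//.
      apply: le_trans qQ; rewrite -[leRHS]expr1 ler_wiXn2l//; move: k2; clear; lia.
    apply: le_trans (Hc0_near k0 x1) _; rewrite ler_wpM2l//.
    have xq : `|x| <= q by rewrite /q /qd le_min x1 andbT lerDl sqrtr_ge0.
    apply: ler_pM; rewrite ?exprn_ge0//.
      by apply: le_trans qD; rewrite lerXn2r ?nnegrE.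
    apply: le_trans qQ; apply: le_trans xq; rewrite -[leRHS]expr1 ler_wiXn2l//.
  apply: le_trans h1 _; apply: le_trans (c1T _ _) _; first by rewrite mulr_ge0 ?exprn_ge0.
  by rewrite ler_wpM2l// ler_wpM2r.
- apply: le_trans h2 _; apply: le_trans (c1T _ _) _; first by rewrite mulr_ge0 ?exprn_ge0 ?powR_ge0.
  apply: ler_pM => //; first by rewrite mulr_ge0 ?exprn_ge0 ?powR_ge0.
  have z00 : 0 <= 1 - ze k :> R by lra.
  have h3 := qpow_le1 x w z00.
  apply: le_trans qQ; rewrite -[leRHS]mulr1; apply: ler_pM => //; rewrite ?exprn_ge0 ?powR_ge0//.
  by rewrite -[leRHS]expr1 ler_wiXn2l//; move: k2; clear; lia.
Qed.

Let al := (p - 1)^-1.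
Let be := de * al.

(** After scaling, the base of the power is P / w with P = (p - 1) w + b0 x^(2k), the leading term
    of [rho]. *)
Lemma profileE w x : 0 < w -> profile de p k b0 (`|x| / w `^ ((2 * k)%:R^-1)) =
  cexp ((- al * (ln ((p - 1) * w + b0 * x ^+ (2 * k)) - ln w)) +i* (- be * (ln ((p - 1) * w + b0 * x ^+ (2 * k)) - ln w))).
Proof.
move=> w0; have k20 : (0 < 2 * k)%N by move: k2; clear; lia.
rewrite /profile exponentE.
have -> : p - 1 + b0 * `| `|x| / w `^ (2 * k)%:R^-1| ^+ (2 * k) = ((p - 1) * w + b0 * x ^+ (2 * k)) / w.
  rewrite normrM normr_id exprMn normfV exprVn (ger0_norm (powR_ge0 _ _)).
  rewrite -(powR_mulrn _ (powR_ge0 w _)) -powRrM mulVf ?pnatr_eq0 -?lt0n// powRr1 ?(ltW w0)//.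
  rewrite exprM real_normK ?num_real// -exprM mulrDl mulfK ?gt_eqF// mulrA//.
have P0 : 0 < (p - 1) * w + b0 * x ^+ (2 * k).
  by rewrite ltr_pwDl ?mulr_gt0 ?subr_gt0// mulr_ge0 ?(ltW b00)// exprM exprn_ge0// sqr_ge0.
have -> : - ((p - 1)^-1 +i* (de * (p - 1)^-1)) = (- al) +i* (- be) :> R[i] by [].
by rewrite cpowE ln_div.
Qed.

End ProfileEstimate.

(** * Convergence to the profile *)

Section ProfileConvergence.
Context {R : realType}.
Notation normc := ComplexField.Normc.normc.
Implicit Types (h s t x y w M K C : R).

Lemma Qf_cexp (al be r a : R) : cexp ((- al * ln r) +i* (a - be * ln r)) = Qf al be 0 1 0 r a +i* Qf al be 0 0 1 r a.
Proof. by rewrite cexpE /Qf add0r !mul1r !mul0r addr0 add0r. Qed.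

Lemma eq_cexp (a b c d : R) : a = c -> b = d -> cexp (a +i* b) = cexp (c +i* d).
Proof. by move=> -> ->. Qed.

(** Both the rescaled solution and the profile contain the factor (w / D)^c; once it is removed, the
    arguments r / D and P / D are bounded below, where [Qf] is uniformly Lipschitz. *)
Lemma cexp_factor (al be lw lr a lD : R) :
  cexp ((al * lw) +i* (be * lw)) * cexp ((- al * lr) +i* (a - be * lr)) =
  cexp ((- al * (lD - lw)) +i* (- be * (lD - lw))) * cexp ((- al * (lr - lD)) +i* (a - be * (lr - lD))).
Proof. by rewrite !cexpM; apply: eq_cexp; ring. Qed.

Lemma cexp_factor0 (al be lw lP lD : R) :
  cexp ((- al * (lP - lw)) +i* (- be * (lP - lw))) =
  cexp ((- al * (lD - lw)) +i* (- be * (lD - lw))) * cexp ((- al * (lP - lD)) +i* (0 - be * (lP - lD))).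
Proof. by rewrite !cexpM; apply: eq_cexp; ring. Qed.

Lemma expR_ln_div (al v w : R) : 0 < v -> 0 < w -> expR (- al * (ln v - ln w)) = (w / v) `^ al.
Proof.
move=> v0 w0; rewrite /powR gt_eqF ?divr_gt0// ln_div//; congr expR; ring.
Qed.

(** Since w / D <= 1, its exponent may be lowered to th; since q^n <= D, the power of q is at most
    D^th, and D cancels. *)
Lemma powR_interp (D q w al th e : R) n : 0 <= q <= 1 -> 0 < w -> w <= D -> q ^+ n <= D -> 0 < th -> th <= al -> (0 < n)%N ->
  n%:R * th <= e -> (w / D) `^ al * q `^ e <= w `^ th.
Proof.
move=> /andP[q0 q1] w0 wD qD th0 tal n0 ne; have D0 : 0 < D by exact: lt_le_trans wD.
have wD1 : 0 <= w / D <= 1 by rewrite divr_ge0 ?(ltW w0) ?(ltW D0)//= ler_pdivrMr// mul1r.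
have h1 : (w / D) `^ al <= (w / D) `^ th by exact: le_powR1.
have h2 : q `^ e <= D `^ th.
  apply: (@le_trans _ _ (q `^ (n%:R * th))).
    by apply: le_powR1; rewrite ?q0// mulr_gt0// ltr0n.
  by rewrite powRrM powR_mulrn//; apply: powR_mono; rewrite ?exprn_ge0// ltW.
apply: (@le_trans _ _ ((w / D) `^ th * D `^ th)); first by apply: ler_pM; rewrite ?powR_ge0.
by rewrite -powRM ?divfK ?gt_eqF//; [case/andP: wD1|exact: ltW].
Qed.

Context (p b0 de : R) (k : nat) (p1 : 1 < p) (b00 : 0 < b0) (k2 : (2 <= k)%N).

Let al := (p - 1)^-1.
Let be := de * al.

(** The rate of convergence: 1 / (p - 1) is the decay away from the origin, (1 - nu) / (2 k) is the
    relative error q^(1 - nu) converted by q^(2k) <= D. *)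
Definition theta : R := Num.min al ((1 - nu k) / (2 * k)%:R).

Lemma theta_gt0 : 0 < theta.
Proof.
have [[/andP[n0 n1] _ _ _] _] := @exponents R k k2.
rewrite lt_min invr_gt0 subr_gt0 p1/= divr_gt0 ?subr_gt0// ltr0n.
by move: k2; clear; lia.
Qed.

Lemma solution_cexp T f1 f2 t x : solution p b0 de k T f1 f2 t x =
  cexp ((- al * ln (rho p b0 k T 0 f1 t x)) +i* (phi k T 0 f2 t x - be * ln (rho p b0 k T 0 f1 t x))).
Proof. by rewrite Qf_cexp. Qed.

Lemma profile_near Af c0 : 0 <= Af -> 0 < c0 -> exists2 C : R, 0 < C & forall T C0 f1 f2 t x,
  is_solution p b0 de k T Af c0 C0 f1 f2 -> 0 <= t < T -> `|x| <= 1 ->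
  normc (cpow (T - t) ((1 +i* de) / (p - 1)%:C) * solution p b0 de k T f1 f2 t x -
     profile de p k b0 (`|x| / (T - t) `^ ((2 * k)%:R^-1))) <= C * (T - t) `^ theta.
Proof.
move=> A0 c00; have k0 : (0 < k)%N by exact: ltnW.
have al0 : 0 < al by rewrite invr_gt0 subr_gt0.
have p10 : 0 < p - 1 by rewrite subr_gt0.
have [C1 C10 H1] := @ansatz_profile R p b0 de k b00 k2 Af A0.
pose m' := Num.min (p - 1) b0 / (1 + 2 ^+ (2 * k)).
have m'0 : 0 < m' by rewrite divr_gt0 ?lt_min ?p10 ?b00// ltr_pwDl// exprn_ge0.
pose m := Num.min c0 m'; have m0 : 0 < m by rewrite lt_min c00.
have [K1 K10 HK1] := @Qf_taylor R al be al0 m 0 1 0 m0.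
have [K2 K20 HK2] := @Qf_taylor R al be al0 m 0 0 1 m0.
exists ((K1 + K2) * (C1 + C1)) => [|T C0 f1 f2 t x sol tT x1]; first by rewrite mulr_gt0// addr_gt0.
have [h1 h2] := H1 T c0 C0 f1 f2 t x sol tT x1.
have /andP[hr _] := rho_bounds sol x tT; have r0 := rho_gt0 sol x tT.
have [[T0 T2 _] _] := sol; have /andP[t0 tT'] := tT.
rewrite solution_cexp.
set w := T - t in h1 h2 hr *; have w0 : 0 < w by rewrite subr_gt0.
have w1 : 0 <= w <= 1 by rewrite ltW//= /w; lra.
have DP := DD_le_flat x k0 p10 b00 w1; rewrite -/m' in DP.
have D0 := DD_gt0 k x w0.
rewrite (profileE de p1 b00 k2 x w0) exponentE cpowE -/al -/be.
set r := rho _ _ _ _ _ _ _ _ in h1 hr r0 *; set a := phi _ _ _ _ _ _ in h2 *.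
set P := _ * w + _ in h1 DP *; set D := DD k x w in h1 hr DP D0 *.
have P0 : 0 < P by apply: lt_le_trans DP; rewrite mulr_gt0.
have rD0 : 0 < r / D by rewrite divr_gt0.
(* Normalization by D, the common size of [rho] and of its leading term, isolates a factor of
   modulus (w / D)^al. *)
rewrite (cexp_factor _ _ _ _ _ (ln D)) (cexp_factor0 al be (ln w) (ln P) (ln D)) -[ln r - ln D]ln_div// -[ln P - ln D]ln_div//.
rewrite -mulrBr ComplexField.Normc.normcM normc_cexp expR_ln_div// !Qf_cexp.
have mr : m <= r / D by rewrite ler_pdivlMr// (le_trans _ hr)// ler_wpM2r ?(ltW D0)// ge_min lexx.
have mP : m <= P / D by rewrite ler_pdivlMr// (le_trans _ DP)// ler_wpM2r ?(ltW D0)// ge_min lexx orbT.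
have [_ g1 _ _] := HK1 (P / D) (r / D) 0 a mP mr.
have [_ g2 _ _] := HK2 (P / D) (r / D) 0 a mP mr.
set Q := qd x w `^ (1 - nu k) in h1 h2.
have d : `|r / D - P / D| + `|a - 0| <= (C1 + C1) * Q.
  rewrite subr0 [leRHS]mulrDl; apply: lerD => //.
  by rewrite -mulrBl normrM normfV (ger0_norm (ltW D0)) ler_pdivrMr// -mulrA [Q * D]mulrC.
have g : normc (Qf al be 0 1 0 (r / D) a +i* Qf al be 0 0 1 (r / D) a - Qf al be 0 1 0 (P / D) 0 +i* Qf al be 0 0 1 (P / D) 0) <=
    (K1 + K2) * (C1 + C1) * Q.
  have -> : (K1 + K2) * (C1 + C1) * Q = K1 * ((C1 + C1) * Q) + K2 * ((C1 + C1) * Q) by ring.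
  apply: le_trans (normc_le_ReIm _) _; apply: lerD.
    by apply: le_trans g1 _; rewrite ler_wpM2l ?(ltW K10).
  by apply: le_trans g2 _; rewrite ler_wpM2l ?(ltW K20).
apply: (@le_trans _ _ ((w / D) `^ al * ((K1 + K2) * (C1 + C1) * Q))).
  by rewrite ler_wpM2l ?powR_ge0.
rewrite mulrCA ler_wpM2l ?mulr_ge0 ?addr_ge0 ?(ltW K10) ?(ltW K20) ?(ltW C10)//.
apply: (@powR_interp _ _ _ _ _ _ (2 * k)%N) => //.
- by rewrite qd_ge0 qd_le1.
- by rewrite /D /DD lerDl exprn_ge0 ?qd_ge0.
- by rewrite /D /DD lerDr ltW.
- exact: theta_gt0.
- by rewrite /theta ge_min lexx.
- by move: k0; clear; lia.
- rewrite mulrC -ler_pdivlMr ?ltr0n; last by move: k0; clear; lia.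
  by rewrite /theta ge_min lexx orbT.
Qed.

(** For |x| >= 1 no comparison is made: [rho] and P are bounded below, so the two terms are each
    O(w^(1 / (p - 1))). *)
Lemma profile_far Af c0 : 0 < c0 -> exists2 C : R, 0 < C & forall T C0 f1 f2 t x,
  is_solution p b0 de k T Af c0 C0 f1 f2 -> 0 <= t < T -> 1 <= `|x| ->
  normc (cpow (T - t) ((1 +i* de) / (p - 1)%:C) * solution p b0 de k T f1 f2 t x -
     profile de p k b0 (`|x| / (T - t) `^ ((2 * k)%:R^-1))) <= C * (T - t) `^ theta.
Proof.
move=> c00; have al0 : 0 < al by rewrite invr_gt0 subr_gt0.
have p10 : 0 < p - 1 by rewrite subr_gt0.
exists (c0^-1 `^ al + b0^-1 `^ al) => [|T C0 f1 f2 t x sol tT x1]; first by rewrite addr_gt0 ?powR_gt0 ?invr_gt0.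
have /andP[hr _] := rho_bounds sol x tT; have r0 := rho_gt0 sol x tT.
have [[T0 T2 _] _] := sol; have /andP[t0 tT'] := tT.
rewrite solution_cexp.
set w := T - t in hr *; have w0 : 0 < w by rewrite subr_gt0.
have w1 : w <= 1 by rewrite /w; lra.
rewrite (profileE de p1 b00 k2 x w0) exponentE cpowE -/al -/be cexpM.
set r := rho _ _ _ _ _ _ _ _ in hr r0 *; set P := _ * w + _.
have bP : b0 <= P.
  rewrite /P -[leLHS]add0r; apply: lerD; first by rewrite mulr_ge0 ?ltW.
  by rewrite ler_peMr ?(ltW b00)// exprM -real_normK ?num_real// -exprM exprn_ege1.
have P0 : 0 < P by exact: lt_le_trans bP.
have cr : c0 <= r.
  apply: le_trans hr; rewrite ler_peMr ?(ltW c00)// /DD /qd min_r ?expr1n ?lerDr ?(ltW w0)//.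
  by rewrite ler_wpDr ?sqrtr_ge0.
have wt : w `^ al <= w `^ theta.
  by apply: le_powR1; [rewrite (ltW w0)|exact: theta_gt0|rewrite /theta ge_min lexx].
have b (v c : R) : 0 < c -> c <= v -> (w / v) `^ al <= c^-1 `^ al * w `^ theta.
  move=> c0' cv; have v0 : 0 < v by exact: lt_le_trans cv.
  rewrite mulrC powRM ?(ltW w0) ?invr_ge0 ?(ltW v0)//; apply: ler_pM; rewrite ?powR_ge0//.
  by apply: powR_mono; [rewrite invr_ge0 ltW|rewrite lef_pV2|exact: ltW].
apply: le_trans (normc_le_add _ _) _; rewrite normc_opp !normc_cexp [leRHS]mulrDl; apply: lerD.
  rewrite (_ : al * ln w + - al * ln r = - al * (ln r - ln w)); last by ring.
  by rewrite expR_ln_div// b.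
by rewrite expR_ln_div// b.
Qed.

End ProfileConvergence.

Theorem theorem1 (R : realType) (delta p : R) (k : nat) (b0 : R)
    (hp : 1 < p) (hk : (2 <= k)%N) (hb0 : 0 < b0) :
  exists gamma0 T0 C : R,
    [/\ 0 < gamma0, 0 < T0, 0 < C
      & forall T : R, 0 < T < T0 ->
        exists u0 : R -> R[i], in_Linfty u0 /\
        exists u : R -> R -> R[i],
          [/\ blows_up_at_time delta p u0 T u,
              forall x0 : R, blowup_point T u x0 <-> x0 = 0
            & exists bstar : R,
              [/\ 0 < bstar,
                  forall t : R, 0 <= t < T ->
                    (Linfty_norm (fun x : R =>
                       (cpow (T - t) ((1 +i* delta) / (p - 1)%:C) * u t x
                       - profile delta p k bstar
                           (`|x| / (T - t) `^ ((2 * k)%:R^-1)))%R)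
                     <= (C * (T - t) `^ (gamma0 / 2 * (1 - k%:R^-1)))%:E)%E
                & `|bstar - b0| <= C * T `^ (gamma0 / 2 * (1 - k%:R^-1))]]].
Proof.
have [c0 [C0 [A [T0 [c00 C00 A0 /andP[T00 T02] H]]]]] := @fixed_point R p b0 delta k hp hb0 hk.
have [C1 C10 near] := profile_near delta hp hb0 hk (ltW A0) c00.
have [C2 C20 far] := profile_far delta hp hb0 hk A c00.
have /andP[e0 e1] := @invk_bounds R k hk.
have d0 : 0 < 1 - (k%:R^-1 : R) by lra.
have th0 := theta_gt0 hp hk.
pose th := theta p k.
have gE : 2 * th / (1 - k%:R^-1) / 2 * (1 - k%:R^-1) = th.
  by rewrite mulrAC divfK ?gt_eqF// mulrC mulKf.
have k80 : 0 < (8 * k%:R)^-1 :> R by rewrite invr_gt0 mulr_gt0// ltr0n ltnW.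
(* gamma0 solves gamma0 / 2 (1 - 1/k) = theta; the bound 1 / (8 k) on T is the time range of
   [Hc]. *)
exists (2 * th / (1 - k%:R^-1)), (Num.min T0 (8 * k%:R)^-1), (C1 + C2); rewrite gE.
split; rewrite ?lt_min ?T00 ?k80 ?addr_gt0//; first by rewrite divr_gt0// mulr_gt0.
move=> T; rewrite lt_min => /and3P[Tp TT0 T8].
have TT : 0 < T < T0 by rewrite Tp.
have [f1 [f2 [mf1 mf2 w1 w2 [bnd eqs]]]] := H T TT.
have sol : is_solution p b0 delta k T A c0 C0 f1 f2.
  split; first by split => //; [exact: le_trans (ltW TT0) T02|exact: ltW].
  by split; [split => //; exact: ltW|split].
exists (solution p b0 delta k T f1 f2 0); split.
  by apply: (solution_in_Linfty hp sol); rewrite lexx.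
exists (solution p b0 delta k T f1 f2); split.
- exact: (solution_blows_up hp hk sol).
- exact: (solution_blowup_point hp hk sol).
- exists b0; split => //.
  + move=> t tT; apply: Linfty_norm_le => x; rewrite mulrDl.
    have [x1|x1] := leP `|x| 1.
      by apply: ler_wpDr; [rewrite mulr_ge0 ?powR_ge0// ltW|exact: (near T C0 f1 f2 t x sol tT x1)].
    by apply: ler_wpDl; [rewrite mulr_ge0 ?powR_ge0// ltW|exact: (far T C0 f1 f2 t x sol tT (ltW x1))].
  + by rewrite subrr normr0 mulr_ge0 ?powR_ge0// addr_ge0// ltW.
Qed.
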